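(* Let $\theta(q,x)=\sum_{j=0}^{\infty}q^{j(j+1)/2}x^j$ and let $\bar q_k\in(-1,0)$, $\bar y_k\in\mathbb{R}$ ($k=1,2,\ldots$) be the spectral values and the corresponding double real zeros defined in the context. (1) For $k$ odd, one has $\bar y_k<0$, $\theta(\bar q_k,\cdot)$ has a local minimum at $\bar y_k$, and $\bar y_k$ is the rightmost of the negative real zeros of $\theta(\bar q_k,\cdot)$. For $k$ even, one has $\bar y_k>0$, $\theta(\bar q_k,\cdot)$ has a local maximum at $\bar y_k$, and $\bar y_k$ is the leftmost but one (second from the left) of the positive real zeros of $\theta(\bar q_k,\cdot)$. (2) For every $k\geq1$ one has $-1<\bar q_{k+1}<\bar q_k<0$. (3) For every $k\geq 1$ and every $q\in(\bar q_{k+1},\bar q_k)$, the function $\theta(q,\cdot)$ has exactly $k$ complex conjugate pairs of (non-real) zeros counted with multiplicity.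
   Context: For $q\in(-1,0)$ with $|q|$ small, all zeros of the entire function $\theta(q,\cdot)$ are real and simple; they are denoted $x_j=x_j(q)$, $j=1,2,\ldots$, where $x_j(q)$ is asymptotically equivalent to $-q^{-j}$ as $q\to0^-$ (so odd-indexed zeros are positive and even-indexed ones negative). They are followed continuously as $q$ decreases from $0$ to $-1$, as long as they have not coalesced. Known facts: $x_1$ remains a simple real zero for all $q\in(-1,0)$; real zeros coalesce only in the pairs $\{x_{4m+2},x_{4m+4}\}$ or $\{x_{4m+3},x_{4m+5}\}$, $m\geq0$, each pair then forming a complex conjugate pair as $q$ decreases further; complex zeros never coalesce to give birth to real zeros. For $\ell\geq1$, $\bar q_{2\ell-1}$ denotes the value of $q\in(-1,0)$ at which $x_{4\ell-2}$ and $x_{4\ell}$ coalesce, and $\bar q_{2\ell}$ the value at which $x_{4\ell-1}$ and $x_{4\ell+1}$ coalesce. The values $\bar q_k$ are exactly the $q\in(-1,0)$ for which $\theta(q,\cdot)$ has a multiple real zero; $\bar y_k$ denotes the double real zero of $\theta(\bar q_k,\cdot)$, all other real zeros of $\theta(\bar q_k,\cdot)$ being simple. One has $\bar q_k\to-1$ and $\bar q_1=-0.72713332\ldots$, $\bar q_2=-0.78374209\ldots$, $\bar q_3=-0.84160192\ldots$. *)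

(* Defs.v *)
From Stdlib Require Export Reals Arith List.
From Coquelicot Require Export Coquelicot.
Export ListNotations.
Open Scope R_scope.

Definition theta_coeff (q : R) (j : nat) : R := q ^ (j * (j + 1) / 2).

Definition theta (q x : R) : R := PSeries (theta_coeff q) x.

(* Coquelicot has no total sum operator for complex series, so the real and
   imaginary parts are summed separately. *)
Definition Ctheta (q : R) (z : C) : C :=
  (Series (fun j => Re (RtoC (theta_coeff q j) * z ^ j)%C),
   Series (fun j => Im (RtoC (theta_coeff q j) * z ^ j)%C)).

(* Order 0 means that the function does not vanish at the point. *)
Definition zero_of_order (f : R -> R) (x : R) (m : nat) : Prop :=
  (forall i, (i < m)%nat -> Derive_n f i x = 0) /\ Derive_n f m x <> 0.

Definition C_zero_of_order (f : C -> C) (z : C) (m : nat) : Prop :=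
  (forall i, (i < m)%nat -> Nat.iter i C_derive f z = RtoC 0) /\
  Nat.iter m C_derive f z <> RtoC 0.

(* [f] is the zero x_j, normalised by x_j(q) ~ -q^{-j} as q -> 0-, followed
   continuously as q decreases from 0 to [a]. Simplicity of the zero on the
   whole of (a, 0) says that x_j has not coalesced before [a]; it also makes
   the continuation unique. *)
Definition zero_branch (j : nat) (a : R) (f : R -> R) : Prop :=
  (forall q, a < q < 0 ->
     continuous f q /\ zero_of_order (theta q) (f q) 1) /\
  filterlim (fun q : R => f q / (- / q ^ j)) (at_left 0) (locally 1).

(* The zeros x_i and x_j stay simple for q in (a, 0) and merge, for q = a, into
   the double real zero [y]. *)
Definition coalesce (i j : nat) (a y : R) : Prop :=
  -1 < a < 0 /\
  zero_of_order (theta a) y 2 /\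
  exists f g : R -> R,
    zero_branch i a f /\ zero_branch j a g /\
    filterlim f (at_right a) (locally y) /\
    filterlim g (at_right a) (locally y).

(* Indices start at 1; the values at index 0 are irrelevant. *)
Definition spectral_data (qbar ybar : nat -> R) : Prop :=
  forall l : nat, (1 <= l)%nat ->
    coalesce (4 * l - 2) (4 * l) (qbar (2 * l - 1)%nat) (ybar (2 * l - 1)%nat) /\
    coalesce (4 * l - 1) (4 * l + 1) (qbar (2 * l)%nat) (ybar (2 * l)%nat).

Definition local_min (f : R -> R) (y : R) : Prop :=
  locally y (fun x => f y <= f x).

Definition local_max (f : R -> R) (y : R) : Prop :=
  locally y (fun x => f x <= f y).

Definition rightmost_negative_zero (f : R -> R) (y : R) : Prop :=
  y < 0 /\ f y = 0 /\ forall x, x < 0 -> f x = 0 -> x <= y.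

Definition second_leftmost_positive_zero (f : R -> R) (y : R) : Prop :=
  0 < y /\ f y = 0 /\ exists! x, 0 < x < y /\ f x = 0.

(* [zs] lists the zeros in the upper half-plane, repeated according to
   multiplicity. *)
Definition has_conjugate_zero_pairs (f : C -> C) (k : nat) : Prop :=
  exists zs : list C,
    length zs = k /\
    List.Forall (fun z : C => 0 < Im z) zs /\
    forall z : C, Im z <> 0 ->
      C_zero_of_order f z (count_occ Ceq_dec (zs ++ map Cconj zs) z).

(* Main.v *)
Require Import Defs.
From Stdlib Require Import Lra Lia Psatz Classical IndefiniteDescription.

(** Write [q = - v]. Apart from one zero in [(1, 1/v)], the real zeros of theta lie in zones
    [k = 1, 2, ...] of alternating sign, found by comparing theta with the two-sided theta series
    (Jacobi's triple product). If theta vanishes in zone [k], its normalisation [w] is positive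
    somewhere in zone [k + 1], by the functional equation.

    theta solves the heat equation [2 v theta_v = x^2 theta_xx + 2 x theta_x]. By the maximum principle
    a zone can only lose zeros as [v] grows: it shows the signs -, +, - between its two zeros until they
    merge into a maximum of [w], and is empty afterwards. Since a zero in zone [k] makes zone [k + 1]
    positive somewhere, the zones are emptied in the order of their indices, which gives (2) and,
    with it, (1).

    For (3), let exactly the zones up to [k] be empty. Dividing theta by the canonical product over its
    real zeros leaves an entire function, which by estimates on the circles
    [|z| = kap / v ^ (4 L + 1)] is a polynomial of degree [2 k]; it has no real root because
    the real zeros of theta are simple. For small [v] no zone is empty and the polynomial is constant,
    which provides the initial sign pattern of the zones. *)

(** The zones come from the two-sided series [St]: its zeros are exactly the points [- q ^ n] for
    integers [n], and [n = - j] is the asymptotic position of [x_j]. Theta at [y] equals [St] minus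
    theta(1/y)/y, and for |y| >= 1 the last term has the sign of [y], because theta is positive on
    [-1, 1]. Hence theta vanishes there only where the normalised [St] is positive. The positivity
    itself rests on the concavity of [x * th v x] on [0, 1], which the heat equation translates into
    monotonicity of theta in [v]. Passing from an odd zone to the next even one is immediate from
    the functional equation. Passing from an even zone to an odd one needs [v * x + v ^ 3 < x ^ 2]
    at points where theta is nonnegative; this is [golden], the source of the numerical constants.
    [spectral_data] describes two branches per zone. That no other real zero shares the zone has to
    be obtained by counting, and the counting is done without contour integrals: Cauchy's estimate
    for the quotient by the product over known zeros bounds a degree from above, and values on the
    imaginary axis bound it from below. *)

(** Coquelicot states equalities in the carrier of a module, where [ring] and [field] fail. *)
Ltac Req := match goal with |- @eq _ ?a ?b => change (@eq R a b) end.

(** * Weighted theta series *)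

Definition tri (j : nat) : nat := (j * (j + 1) / 2)%nat.

Lemma tri_S (j : nat) : tri (S j) = (tri j + S j)%nat.
Proof.
  unfold tri.
  replace (S j * (S j + 1))%nat with (j * (j + 1) + S j * 2)%nat by nia.
  now rewrite Nat.div_add by lia.
Qed.

Lemma tri_0 : tri 0 = 0%nat.
Proof. reflexivity. Qed.

Lemma tri_add (n j : nat) : tri (n + j) = (tri n + n * j + tri j)%nat.
Proof.
  induction j as [|j IH].
  - rewrite Nat.add_0_r, tri_0. lia.
  - rewrite Nat.add_succ_r, !tri_S, IH. nia.
Qed.

Lemma INR_tri (j : nat) : INR (tri j) = INR j * (INR j + 1) / 2.
Proof.
  induction j as [|j IH].
  - rewrite tri_0. simpl. lra.
  - rewrite tri_S, plus_INR, IH, !S_INR. lra.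
Qed.

Lemma pow_le_one (x : R) (n : nat) : 0 <= x <= 1 -> x ^ n <= 1.
Proof.
  intros Hx. rewrite <- (pow1 n). apply pow_incr. lra.
Qed.

Lemma pow_le_anti (x : R) (m n : nat) : 0 <= x <= 1 -> (m <= n)%nat -> x ^ n <= x ^ m.
Proof.
  intros Hx Hmn. replace n with (m + (n - m))%nat by lia.
  rewrite pow_add. rewrite <- (Rmult_1_r (x ^ m)) at 2.
  apply Rmult_le_compat_l; [apply pow_le; lra | apply pow_le_one; lra].
Qed.

Lemma pow_small (r eps : R) : 0 <= r < 1 -> 0 < eps -> exists N, forall n, (N <= n)%nat -> r ^ n < eps.
Proof.
  intros Hr Heps.
  destruct (pow_lt_1_zero r) with (y := eps) as [N HN]; [rewrite Rabs_pos_eq; lra | lra |].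
  exists N. intros n Hn. specialize (HN n Hn).
  rewrite Rabs_pos_eq in HN; [lra | apply pow_le; lra].
Qed.

(** The ratio of consecutive terms, [r ^ S j * B], is at most 1 from the index [J] on, and below [J]
    the crude bound [(B + 1) ^ j] suffices. This makes all the series below entire in [x], whatever
    geometric growth the weights have. *)
Lemma tri_pow_bounded (r B : R) : 0 <= r < 1 -> 0 <= B ->
  exists M, 0 < M /\ forall j, r ^ tri j * B ^ j <= M.
Proof.
  intros Hr HB.
  destruct (pow_small r (/ (B + 1))) as [J HJ]; [lra | apply Rinv_0_lt_compat; lra |].
  assert (HJ' : forall j, (J <= j)%nat -> r ^ j * B <= 1).
  { intros j Hj. specialize (HJ j Hj).
    assert (r ^ j * (B + 1) < 1).
    { apply Rmult_lt_reg_r with (/ (B + 1)); [apply Rinv_0_lt_compat; lra|].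
      rewrite Rmult_assoc, Rinv_r by lra. lra. }
    assert (0 <= r ^ j) by (apply pow_le; lra). nra. }
  assert (Hnn : forall j, 0 <= r ^ tri j * B ^ j).
  { intros j. apply Rmult_le_pos; apply pow_le; lra. }
  assert (H1 : forall j, r ^ tri j * B ^ j <= (B + 1) ^ j).
  { intros j. rewrite <- (Rmult_1_l ((B + 1) ^ j)).
    apply Rmult_le_compat; try (apply pow_le; lra).
    - apply pow_le_one; lra.
    - apply pow_incr; lra. }
  exists ((B + 1) ^ J). split; [apply pow_lt; lra|].
  assert (H2 : forall k, r ^ tri (J + k) * B ^ (J + k) <= (B + 1) ^ J).
  { induction k as [|k IH].
    - rewrite Nat.add_0_r. apply H1.
    - rewrite Nat.add_succ_r, tri_S, pow_add. simpl pow at 3.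
      replace (r ^ tri (J + k) * r ^ S (J + k) * (B * B ^ (J + k)))
        with (r ^ tri (J + k) * B ^ (J + k) * (r ^ S (J + k) * B)) by ring.
      specialize (HJ' (S (J + k)) ltac:(lia)). specialize (Hnn (J + k)%nat).
      assert (0 <= r ^ S (J + k) * B) by (apply Rmult_le_pos; [apply pow_le|]; lra).
      nra. }
  intros j. destruct (le_lt_dec J j) as [Hj|Hj].
  - replace j with (J + (j - J))%nat by lia. apply H2.
  - apply Rle_trans with ((B + 1) ^ j); [apply H1|].
    apply Rle_pow; [lra | lia].
Qed.

Lemma ex_series_half (M : R) : ex_series (fun j => M * (/ 2) ^ j).
Proof.
  apply (ex_series_scal_l (V := R_NormedModule) M).
  apply ex_series_geom. rewrite Rabs_pos_eq; lra.
Qed.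

Lemma ex_series_tri (r B : R) : 0 <= r < 1 -> 0 <= B -> ex_series (fun j => r ^ tri j * B ^ j).
Proof.
  intros Hr HB. destruct (tri_pow_bounded r (2 * B)) as [M [HM HMj]]; [lra..|].
  apply (ex_series_le (V := R_CompleteNormedModule)) with (2 := ex_series_half M).
  intros j. change (norm (r ^ tri j * B ^ j)) with (Rabs (r ^ tri j * B ^ j)).
  rewrite Rabs_pos_eq by (apply Rmult_le_pos; apply pow_le; lra).
  specialize (HMj j). rewrite Rpow_mult_distr in HMj.
  rewrite pow_inv.
  apply Rmult_le_reg_r with (2 ^ j); [apply pow_lt; lra|].
  rewrite (Rmult_assoc M), Rinv_l by (apply pow_nonzero; lra). lra.
Qed.

(** This growth condition is stable under multiplication by [INR j] and by [INR (tri j)], which is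
    what differentiation in [x] and in [v] does to the weights, and the powers [v ^ tri j] beat it
    for every [B]. *)
Definition geom_bounded (c : nat -> R) : Prop := exists K B, 0 <= K /\ 0 <= B /\ forall j, Rabs (c j) <= K * B ^ j.

(** theta(-v, x) with weights [c]; the class is closed under [d/dx], up to rescaling [x], and [v d/dv]. *)
Definition U (c : nat -> R) (v x : R) : R := Series (fun j => c j * (- v) ^ tri j * x ^ j).

Definition one_w (j : nat) : R := 1.
Definition shift_w (c : nat -> R) (j : nat) : R := INR (S j) * c (S j).
Definition tri_w (c : nat -> R) (j : nat) : R := INR (tri j) * c j.

Lemma theta_U (v x : R) : theta (- v) x = U one_w v x.
Proof.
  unfold theta, U, PSeries. apply Series_ext. intros j. unfold theta_coeff, one_w.
  fold (tri j). ring.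
Qed.

Lemma geom_bounded_one : geom_bounded one_w.
Proof.
  exists 1, 1. repeat split; try lra. intros j. unfold one_w.
  rewrite Rabs_R1, pow1. lra.
Qed.

Lemma INR_le_pow2 (j : nat) : INR j <= 2 ^ j.
Proof.
  induction j as [|j IH]; [simpl; lra|].
  rewrite S_INR. simpl. assert (1 <= 2 ^ j) by (apply pow_R1_Rle; lra). lra.
Qed.

Lemma INR_tri_le_pow (j : nat) : INR (tri j) <= 4 ^ j.
Proof.
  rewrite INR_tri.
  induction j as [|j IH]; [simpl; lra|].
  rewrite S_INR. pose proof (pos_INR j).
  simpl pow. assert (INR j + 1 <= 4 ^ j).
  { clear. induction j as [|j IH]; [simpl; lra|]. rewrite S_INR. simpl pow.
    pose proof (pos_INR j). lra. }
  nra.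
Qed.

Lemma geom_bounded_scale (c : nat -> R) (B : R) (f : nat -> R) :
  0 <= B -> (forall j, 0 <= f j <= B ^ j) -> geom_bounded c -> geom_bounded (fun j => f j * c j).
Proof.
  intros HB Hf [K [D [HK [HD Hc]]]]. exists K, (B * D). repeat split; try nra.
  intros j. rewrite Rabs_mult, Rpow_mult_distr, Rabs_pos_eq by apply Hf.
  specialize (Hf j). specialize (Hc j). pose proof (Rabs_pos (c j)). nra.
Qed.

Lemma geom_bounded_tri (c : nat -> R) : geom_bounded c -> geom_bounded (tri_w c).
Proof.
  intros Hc. apply (geom_bounded_scale c 4); auto; try lra.
  intros j. split; [apply pos_INR | apply INR_tri_le_pow].
Qed.

Lemma geom_bounded_shift (c : nat -> R) : geom_bounded c -> geom_bounded (shift_w c).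
Proof.
  intros Hc.
  assert (H : geom_bounded (fun j => INR j * c j)).
  { apply (geom_bounded_scale c 2); auto; try lra. intros j; split; [apply pos_INR | apply INR_le_pow2]. }
  destruct H as [K [B [HK [HB H]]]].
  exists (K * B), B. repeat split; try nra.
  intros j. unfold shift_w. specialize (H (S j)). simpl pow in H. rewrite Rmult_assoc. exact H.
Qed.

Lemma geom_bounded_scal (c : nat -> R) (k : R) : geom_bounded c -> geom_bounded (fun j => k * c j).
Proof.
  intros [K [B [HK [HB H]]]]. exists (Rabs k * K), B. pose proof (Rabs_pos k).
  repeat split; try nra. intros j. rewrite Rabs_mult. specialize (H j).
  rewrite Rmult_assoc. apply Rmult_le_compat_l; lra.
Qed.

Lemma U_term_bound (c : nat -> R) (r X : R) : geom_bounded c -> 0 <= r < 1 -> 0 <= X ->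
  exists M, ex_series M /\ (forall j, 0 <= M j) /\
    forall v x j, Rabs v <= r -> Rabs x <= X -> Rabs (c j * (- v) ^ tri j * x ^ j) <= M j.
Proof.
  intros [K [B [HK [HB Hc]]]] Hr HX.
  exists (fun j => K * (r ^ tri j * (B * X) ^ j)). split; [|split].
  - apply (ex_series_scal_l (V := R_NormedModule) K). apply ex_series_tri; [lra|nra].
  - intros j. apply Rmult_le_pos; [lra|]. apply Rmult_le_pos; apply pow_le; nra.
  - intros v x j Hv Hx. rewrite !Rabs_mult, <- !RPow_abs, Rabs_Ropp, Rpow_mult_distr.
    specialize (Hc j).
    assert (0 <= Rabs v ^ tri j <= r ^ tri j).
    { split; [apply pow_le; apply Rabs_pos | apply pow_incr; split; [apply Rabs_pos | lra]]. }
    assert (0 <= Rabs x ^ j <= X ^ j).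
    { split; [apply pow_le; apply Rabs_pos | apply pow_incr; split; [apply Rabs_pos | lra]]. }
    pose proof (Rabs_pos (c j)).
    replace (K * (r ^ tri j * (B ^ j * X ^ j))) with ((K * B ^ j) * r ^ tri j * X ^ j) by ring.
    apply Rmult_le_compat; try lra; [apply Rmult_le_pos; lra|].
    apply Rmult_le_compat; lra.
Qed.

Lemma ex_series_abs_le (a M : nat -> R) : ex_series M -> (forall j, Rabs (a j) <= M j) ->
  ex_series (fun j => Rabs (a j)).
Proof.
  intros HM H. apply (ex_series_le (V := R_CompleteNormedModule)) with (2 := HM).
  intros j. change (norm (Rabs (a j))) with (Rabs (Rabs (a j))). rewrite Rabs_Rabsolu. auto.
Qed.

Lemma U_abs_ex (c : nat -> R) (v x : R) : geom_bounded c -> Rabs v < 1 ->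
  ex_series (fun j => Rabs (c j * (- v) ^ tri j * x ^ j)).
Proof.
  intros Hc Hv. destruct (U_term_bound c (Rabs v) (Rabs x) Hc) as [M [HM [_ H]]];
    [split; [apply Rabs_pos | auto] | apply Rabs_pos |].
  apply ex_series_abs_le with M; auto. intros j. apply H; lra.
Qed.

Lemma U_ex (c : nat -> R) (v x : R) : geom_bounded c -> Rabs v < 1 ->
  ex_series (fun j => c j * (- v) ^ tri j * x ^ j).
Proof. intros Hc Hv. apply ex_series_Rabs, U_abs_ex; auto. Qed.

Lemma Series_abs_le (a M : nat -> R) : ex_series M -> (forall j, Rabs (a j) <= M j) ->
  Rabs (Series a) <= Series M.
Proof.
  intros HM H. apply Rle_trans with (Series (fun j => Rabs (a j))).
  - apply Series_Rabs. apply ex_series_abs_le with M; auto.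
  - apply Series_le; auto. intros j. split; [apply Rabs_pos | auto].
Qed.

Lemma U_bound (c : nat -> R) (r X : R) : geom_bounded c -> 0 <= r < 1 -> 0 <= X ->
  exists M, 0 < M /\ forall v x, Rabs v <= r -> Rabs x <= X -> Rabs (U c v x) <= M.
Proof.
  intros Hc Hr HX. destruct (U_term_bound c r X Hc Hr HX) as [M [HM [H0 H]]].
  exists (Series M + 1).
  assert (0 <= Series M).
  { rewrite <- (Rmult_0_l (Series M)), <- Series_scal_l. apply Series_le; auto.
    intros j. specialize (H0 j). lra. }
  split; [lra|]. intros v x Hv Hx.
  apply Rle_trans with (Series M); [|lra]. apply Series_abs_le; auto.
Qed.

Lemma U_scal (c : nat -> R) (k v x : R) : U (fun j => k * c j) v x = k * U c v x.
Proof.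
  unfold U. rewrite <- Series_scal_l. apply Series_ext. intros j. ring.
Qed.

(** ** Derivatives *)

(** By induction: the remainder for [S n] is [t] times the remainder for [n] plus
    [INR n * t0 ^ pred n * (t - t0) ^ 2]. The factor [INR n ^ 2] is absorbed into the weights, once
    with [n = j] for the derivative in [x] and once with [n = tri j] for the derivative in [v]. *)
Lemma pow_taylor_bound (t t0 r : R) (n : nat) : 0 < r -> Rabs t <= r -> Rabs t0 <= r ->
  Rabs (t ^ n - t0 ^ n - INR n * t0 ^ pred n * (t - t0)) <= INR n ^ 2 * r ^ n / r ^ 2 * (t - t0) ^ 2.
Proof.
  intros Hr Ht Ht0. induction n as [|n IH].
  - simpl. replace (1 - 1 - 0 * 1 * (t - t0)) with 0 by ring. rewrite Rabs_R0. nra.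
  - set (h := t - t0) in *.
    assert (E : t ^ S n - t0 ^ S n - INR (S n) * t0 ^ pred (S n) * h
      = t * (t ^ n - t0 ^ n - INR n * t0 ^ pred n * h) + INR n * t0 ^ pred n * h ^ 2).
    { destruct n as [|n].
      - simpl. unfold h. ring.
      - rewrite S_INR. simpl pred. simpl pow. unfold h. ring. }
    rewrite E. eapply Rle_trans; [apply Rabs_triang|]. rewrite !Rabs_mult.
    assert (H1 : INR n * Rabs t0 ^ pred n * r <= INR n * r ^ n).
    { destruct n as [|n]; [simpl; lra|]. simpl pred. simpl (r ^ S n).
      rewrite (Rmult_comm r), Rmult_assoc. apply Rmult_le_compat_l; [apply pos_INR|].
      apply Rmult_le_compat_r; [lra|]. apply pow_incr. split; [apply Rabs_pos | auto]. }
    rewrite (Rabs_pos_eq (INR n)) by apply pos_INR. rewrite (Rabs_pos_eq (h ^ 2)) by nra.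
    rewrite <- RPow_abs.
    set (W := Rabs (t ^ n - t0 ^ n - INR n * t0 ^ pred n * h)) in *.
    assert (0 <= W) by apply Rabs_pos.
    assert (0 < r ^ n) by (apply pow_lt; auto).
    assert (H2 : Rabs t * W <= INR n ^ 2 * (r ^ n / r) * h ^ 2).
    { apply Rle_trans with (r * W); [apply Rmult_le_compat_r; auto|].
      apply Rle_trans with (r * (INR n ^ 2 * r ^ n / r ^ 2 * h ^ 2)); [apply Rmult_le_compat_l; lra|].
      right. field. lra. }
    assert (H3 : INR n * Rabs t0 ^ pred n <= INR n * (r ^ n / r)).
    { apply Rmult_le_reg_r with r; auto. eapply Rle_trans; [apply H1|]. right. field. lra. }
    rewrite S_INR. pose proof (pos_INR n).
    assert (0 < r ^ n / r) by (apply Rdiv_lt_0_compat; auto).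
    replace ((INR n + 1) ^ 2 * r ^ S n / r ^ 2) with ((INR n + 1) ^ 2 * (r ^ n / r)) by (simpl; field; lra).
    assert (0 <= h ^ 2) by nra.
    assert (INR n * Rabs t0 ^ pred n * h ^ 2 <= INR n * (r ^ n / r) * h ^ 2)
      by (apply Rmult_le_compat_r; auto).
    assert (0 <= (r ^ n / r) * h ^ 2) by (apply Rmult_le_pos; lra).
    nra.
Qed.

(** Quadratic remainders with summable constants [M j] add up to [Series M * (t - t0) ^ 2], so that
    uniform convergence of the derivatives does not have to be discussed. *)
Lemma series_is_derive (g : nat -> R -> R) (g' M : nat -> R) (t0 d : R) :
  0 < d -> ex_series M -> ex_series g' ->
  (forall t, Rabs (t - t0) < d -> ex_series (fun j => g j t)) ->
  (forall j t, Rabs (t - t0) < d ->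
     Rabs (g j t - g j t0 - g' j * (t - t0)) <= M j * (t - t0) ^ 2) ->
  is_derive (fun t => Series (fun j => g j t)) t0 (Series g').
Proof.
  intros Hd HM Hg' Hg H.
  apply is_derive_Reals. intros eps Heps.
  set (S0 := Series M).
  assert (HS0 : 0 <= S0).
  { unfold S0. rewrite <- (Rmult_0_l (Series M)), <- Series_scal_l. apply Series_le; auto.
    intros j. specialize (H j (t0 + d / 2)).
    replace (t0 + d / 2 - t0) with (d / 2) in H by ring.
    assert (Rabs (d / 2) < d) by (rewrite Rabs_pos_eq; lra). specialize (H H0).
    pose proof (Rabs_pos (g j (t0 + d / 2) - g j t0 - g' j * (d / 2))).
    assert (0 < (d / 2) ^ 2) by (apply pow_lt; lra).
    assert (0 <= M j).
    { apply Rmult_le_reg_r with ((d / 2) ^ 2); lra. }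
    lra. }
  assert (Hdel : 0 < Rmin d (eps / (S0 + 1))).
  { apply Rmin_pos; auto. apply Rdiv_lt_0_compat; lra. }
  exists (mkposreal _ Hdel). simpl. intros h Hh0 Hh.
  assert (Hh1 : Rabs h < d) by (eapply Rlt_le_trans; [apply Hh | apply Rmin_l]).
  assert (Hh2 : Rabs h < eps / (S0 + 1)) by (eapply Rlt_le_trans; [apply Hh | apply Rmin_r]).
  assert (Et : t0 + h - t0 = h) by ring.
  assert (B : Rabs (Series (fun j => g j (t0 + h)) - Series (fun j => g j t0) - Series g' * h)
              <= S0 * h ^ 2).
  { rewrite <- Series_minus, <- Series_scal_r, <- Series_minus; try apply Hg.
    - unfold S0. rewrite <- Series_scal_r. apply Series_abs_le.
      + apply (ex_series_scal_r (h ^ 2) M); auto.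
      + intros j. specialize (H j (t0 + h)). rewrite Et in H. apply H; auto.
    - apply (ex_series_minus (V := R_NormedModule)); apply Hg; rewrite ?Et; auto.
      replace (t0 - t0) with 0 by ring. rewrite Rabs_R0; lra.
    - apply (ex_series_scal_r h g'); auto.
    - rewrite Et; auto.
    - replace (t0 - t0) with 0 by ring. rewrite Rabs_R0; lra. }
  assert (Hpos : 0 < Rabs h) by (apply Rabs_pos_lt; auto).
  replace ((Series (fun j => g j (t0 + h)) - Series (fun j => g j t0)) / h - Series g')
    with ((Series (fun j => g j (t0 + h)) - Series (fun j => g j t0) - Series g' * h) / h)
    by (field; auto).
  unfold Rdiv. rewrite Rabs_mult, Rabs_inv.
  apply Rmult_lt_reg_r with (Rabs h); auto.
  rewrite Rmult_assoc, Rinv_l, Rmult_1_r by lra.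
  eapply Rle_lt_trans; [apply B|].
  assert (E2 : h ^ 2 = Rabs h * Rabs h) by (rewrite <- Rabs_mult, Rabs_pos_eq by (apply Rle_0_sqr); ring).
  rewrite E2.
  assert (Rabs h * (S0 + 1) < eps).
  { apply Rmult_lt_reg_r with (/ (S0 + 1)); [apply Rinv_0_lt_compat; lra|].
    rewrite Rmult_assoc, Rinv_r by lra. lra. }
  nra.
Qed.

(** Shifting the index turns [(- v) ^ tri (S j)] into [(- v) ^ tri j * (- v) ^ S j], so the
    [x]-derivative is again a weighted series, taken at [- v * x]. A second derivative leads to the
    argument [v ^ 2 * x] and the factor [- v ^ 3]. *)
Definition Ux (c : nat -> R) (v x : R) : R := - v * U (shift_w c) v (- v * x).
Definition Uxx (c : nat -> R) (v x : R) : R := - v ^ 3 * U (shift_w (shift_w c)) v (v ^ 2 * x).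

Lemma is_derive_U_x (c : nat -> R) (v x : R) : geom_bounded c -> Rabs v < 1 ->
  is_derive (U c v) x (Ux c v x).
Proof.
  intros Hc Hv.
  set (X := Rabs x + 1). assert (HX : 0 < X) by (unfold X; pose proof (Rabs_pos x); lra).
  assert (Hn : geom_bounded (fun j => INR j ^ 2 * c j)).
  { apply (geom_bounded_scale c 4); auto; try lra. intros j. split; [apply pow2_ge_0|].
    pose proof (INR_le_pow2 j). pose proof (pos_INR j).
    replace 4 with (2 * 2) by ring. rewrite Rpow_mult_distr. nra. }
  destruct (U_term_bound _ (Rabs v) X Hn) as [M [HM [HM0 HMj]]];
    [split; [apply Rabs_pos | auto] | lra |].
  assert (E : Ux c v x = Series (fun j => c j * (- v) ^ tri j * (INR j * x ^ pred j))).
  { rewrite Series_incr_1_aux.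
    - unfold Ux, U. rewrite <- Series_scal_l. apply Series_ext. intros j.
      rewrite tri_S, pow_add. simpl pred. unfold shift_w. rewrite Rpow_mult_distr. simpl ((-v) ^ S j). ring.
    - simpl. ring. }
  rewrite E.
  apply (series_is_derive (fun j t => c j * (- v) ^ tri j * t ^ j) _ (fun j => M j / X ^ 2) x 1); try lra.
  - apply (ex_series_scal_r (/ X ^ 2) M); auto.
  - apply ex_series_incr_1.
    assert (E2 : ex_series (fun j => - v * (shift_w c j * (- v) ^ tri j * (- v * x) ^ j))).
    { apply (ex_series_scal_l (V := R_NormedModule) (- v)). apply U_ex; auto. apply geom_bounded_shift; auto. }
    apply (ex_series_ext (V := R_NormedModule)) with (2 := E2). intros j. Req.
    rewrite tri_S, pow_add. simpl pred. unfold shift_w. rewrite Rpow_mult_distr. simpl ((-v) ^ S j). ring.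
  - intros t Ht. apply U_ex; auto.
  - intros j t Ht.
    replace (c j * (- v) ^ tri j * t ^ j - c j * (- v) ^ tri j * x ^ j
      - c j * (- v) ^ tri j * (INR j * x ^ pred j) * (t - x))
      with (c j * (- v) ^ tri j * (t ^ j - x ^ j - INR j * x ^ pred j * (t - x))) by ring.
    rewrite Rabs_mult.
    assert (Hb : Rabs (t ^ j - x ^ j - INR j * x ^ pred j * (t - x))
                 <= INR j ^ 2 * X ^ j / X ^ 2 * (t - x) ^ 2).
    { apply pow_taylor_bound; auto; unfold X; [|lra].
      replace t with (x + (t - x)) by ring. eapply Rle_trans; [apply Rabs_triang|]. lra. }
    specialize (HMj v X j ltac:(lra)).
    rewrite (Rabs_pos_eq X) in HMj by lra. specialize (HMj ltac:(lra)).
    rewrite !Rabs_mult in HMj. rewrite (Rabs_pos_eq (INR j ^ 2)) in HMj by apply pow2_ge_0.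
    rewrite (Rabs_pos_eq (X ^ j)) in HMj by (apply pow_le; lra).
    rewrite Rabs_mult.
    eapply Rle_trans; [apply Rmult_le_compat_l; [|apply Hb]|].
    + apply Rmult_le_pos; apply Rabs_pos.
    + replace (Rabs (c j) * Rabs ((- v) ^ tri j) * (INR j ^ 2 * X ^ j / X ^ 2 * (t - x) ^ 2))
        with ((INR j ^ 2 * Rabs (c j) * Rabs ((- v) ^ tri j) * X ^ j) * ((t - x) ^ 2 / X ^ 2))
        by (field; lra).
      replace (M j / X ^ 2 * (t - x) ^ 2) with (M j * ((t - x) ^ 2 / X ^ 2)) by (field; lra).
      apply Rmult_le_compat_r; auto.
      apply Rmult_le_pos; [apply pow2_ge_0|]. apply Rlt_le, Rinv_0_lt_compat, pow_lt; lra.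
Qed.

Lemma is_derive_Ux_x (c : nat -> R) (v x : R) : geom_bounded c -> Rabs v < 1 ->
  is_derive (Ux c v) x (Uxx c v x).
Proof.
  intros Hc Hv.
  assert (H := is_derive_U_x (shift_w c) v (- v * x) (geom_bounded_shift c Hc) Hv).
  unfold Ux at 1, Uxx.
  replace (- v ^ 3 * U (shift_w (shift_w c)) v (v ^ 2 * x))
    with (- v * (- v * Ux (shift_w c) v (- v * x))).
  2: { unfold Ux. replace (- v * (- v * x)) with (v ^ 2 * x) by ring. ring. }
  apply (is_derive_scal (fun x => U (shift_w c) v (- v * x)) x (- v)).
  apply (is_derive_comp (U (shift_w c) v) (fun x => - v * x) x); [exact H|].
  auto_derive; auto. ring.
Qed.

Lemma is_derive_U_v (c : nat -> R) (v x : R) : geom_bounded c -> 0 < v < 1 ->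
  is_derive (fun v => U c v x) v (U (tri_w c) v x / v).
Proof.
  intros Hc Hv.
  set (r := (v + 1) / 2). assert (Hr : v < r < 1) by (unfold r; lra).
  assert (Hn : geom_bounded (fun j => INR (tri j) ^ 2 * c j)).
  { apply (geom_bounded_scale c 16); auto; try lra. intros j. split; [apply pow2_ge_0|].
    pose proof (INR_tri_le_pow j). pose proof (pos_INR (tri j)).
    replace 16 with (4 * 4) by ring. rewrite Rpow_mult_distr. nra. }
  destruct (U_term_bound _ r (Rabs x) Hn) as [M [HM [HM0 HMj]]]; [lra | apply Rabs_pos |].
  assert (E : U (tri_w c) v x / v
    = Series (fun j => - (c j * (INR (tri j) * (- v) ^ pred (tri j)) * x ^ j))).
  { unfold U, Rdiv. rewrite <- Series_scal_r. apply Series_ext. intros j. unfold tri_w.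
    destruct (tri j) as [|n]; [simpl; ring|]. simpl pred. simpl pow. field. lra. }
  rewrite E.
  apply (series_is_derive (fun j t => c j * (- t) ^ tri j * x ^ j) _ (fun j => M j / r ^ 2) v (r - v)); try lra.
  - apply (ex_series_scal_r (/ r ^ 2) M); auto.
  - assert (E2 : ex_series (fun j => tri_w c j * (- v) ^ tri j * x ^ j * / v)).
    { apply (ex_series_scal_r (/ v)). apply U_ex; [apply geom_bounded_tri; auto | rewrite Rabs_pos_eq; lra]. }
    apply (ex_series_ext (V := R_NormedModule)) with (2 := E2). intros j. Req. unfold tri_w.
    destruct (tri j) as [|n]; [simpl; ring|]. simpl pred. simpl pow. field. lra.
  - intros t Ht. apply U_ex; auto. apply Rabs_def2 in Ht. apply Rabs_def1; lra.
  - intros j t Ht. apply Rabs_def2 in Ht.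
    replace (c j * (- t) ^ tri j * x ^ j - c j * (- v) ^ tri j * x ^ j
      - - (c j * (INR (tri j) * (- v) ^ pred (tri j)) * x ^ j) * (t - v))
      with (c j * ((- t) ^ tri j - (- v) ^ tri j - INR (tri j) * (- v) ^ pred (tri j) * (- t - - v)) * x ^ j)
      by ring.
    assert (Hb := pow_taylor_bound (- t) (- v) r (tri j) ltac:(lra)
      ltac:(rewrite Rabs_Ropp; apply Rabs_le; lra) ltac:(rewrite Rabs_Ropp; apply Rabs_le; lra)).
    specialize (HMj (- r) x j ltac:(rewrite Rabs_Ropp, Rabs_pos_eq; lra) ltac:(lra)).
    rewrite !Rabs_mult in HMj. rewrite (Rabs_pos_eq (INR (tri j) ^ 2)) in HMj by apply pow2_ge_0.
    rewrite Ropp_involutive in HMj. rewrite (Rabs_pos_eq (r ^ tri j)) in HMj by (apply pow_le; lra).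
    rewrite !Rabs_mult.
    set (W := Rabs _) in Hb. fold W.
    assert (0 <= W) by apply Rabs_pos.
    replace ((- t - - v) ^ 2) with ((t - v) ^ 2) in Hb by ring.
    pose proof (Rabs_pos (c j)). pose proof (Rabs_pos (x ^ j)).
    apply Rle_trans with (Rabs (c j) * (INR (tri j) ^ 2 * r ^ tri j / r ^ 2 * (t - v) ^ 2) * Rabs (x ^ j)).
    + apply Rmult_le_compat_r; auto. apply Rmult_le_compat_l; auto.
    + replace (Rabs (c j) * (INR (tri j) ^ 2 * r ^ tri j / r ^ 2 * (t - v) ^ 2) * Rabs (x ^ j))
        with ((INR (tri j) ^ 2 * Rabs (c j) * r ^ tri j * Rabs (x ^ j)) * ((t - v) ^ 2 / r ^ 2))
        by (field; lra).
      replace (M j / r ^ 2 * (t - v) ^ 2) with (M j * ((t - v) ^ 2 / r ^ 2)) by (field; lra).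
      apply Rmult_le_compat_r; auto.
      apply Rmult_le_pos; [apply pow2_ge_0|]. apply Rlt_le, Rinv_0_lt_compat, pow_lt; lra.
Qed.

(** [2 tri j = j (j - 1) + 2 j] turns [v d/dv] into a second-order operator in [x]. *)
Lemma U_heat (c : nat -> R) (v x : R) : geom_bounded c -> Rabs v < 1 ->
  2 * U (tri_w c) v x = x ^ 2 * Uxx c v x + 2 * x * Ux c v x.
Proof.
  intros Hc Hv.
  assert (H1 : x * Ux c v x = Series (fun j => INR j * c j * (- v) ^ tri j * x ^ j)).
  { rewrite Series_incr_1_aux by (simpl; ring).
    unfold Ux, U. rewrite <- Series_scal_l, <- Series_scal_l. apply Series_ext. intros j.
    rewrite tri_S, pow_add. unfold shift_w. rewrite Rpow_mult_distr. simpl ((-v) ^ S j). simpl (x ^ S j). ring. }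
  assert (H2 : x ^ 2 * Uxx c v x = Series (fun j => INR j * (INR j - 1) * c j * (- v) ^ tri j * x ^ j)).
  { rewrite Series_incr_1_aux by (simpl; ring). rewrite Series_incr_1_aux by (simpl; ring).
    unfold Uxx, U. rewrite <- Series_scal_l, <- Series_scal_l. apply Series_ext. intros j.
    rewrite !tri_S, !pow_add. unfold shift_w. rewrite Rpow_mult_distr.
    replace ((v ^ 2) ^ j) with ((- v) ^ j * (- v) ^ j).
    2: { rewrite <- Rpow_mult_distr. f_equal. ring. }
    rewrite !S_INR. simpl pow. ring. }
  rewrite H2. replace (2 * x * Ux c v x) with (2 * (x * Ux c v x)) by ring. rewrite H1.
  unfold U. rewrite <- !Series_scal_l.
  assert (W : forall f B, 0 <= B -> (forall j, 0 <= f j <= B ^ j) ->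
    ex_series (fun j => f j * c j * (- v) ^ tri j * x ^ j)).
  { intros f B HB Hf. apply (U_ex (fun j => f j * c j)); auto. apply geom_bounded_scale with B; auto. }
  rewrite <- Series_plus.
  - apply Series_ext. intros j. unfold tri_w. rewrite INR_tri. field.
  - apply (W (fun j => INR j * (INR j - 1)) 4); [lra|]. intros j.
    pose proof (INR_le_pow2 j). pose proof (pos_INR j).
    replace 4 with (2 * 2) by ring. rewrite Rpow_mult_distr.
    destruct j as [|j]; [simpl; lra|]. rewrite S_INR in *. pose proof (pos_INR j). split; nra.
  - apply (ex_series_scal_l (V := R_NormedModule) 2 (fun j => INR j * c j * (- v) ^ tri j * x ^ j)).
    apply (W INR 2); [lra|]. intros j. split; [apply pos_INR | apply INR_le_pow2].
Qed.

Lemma ex_derive_cont (f : R -> R) (x l : R) : is_derive f x l -> continuity_pt f x.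
Proof.
  intros H. apply derivable_continuous_pt. exists l. apply is_derive_Reals, H.
Qed.

Lemma U_cont_x (c : nat -> R) (v x : R) : geom_bounded c -> Rabs v < 1 -> continuity_pt (U c v) x.
Proof. intros Hc Hv. eapply ex_derive_cont, is_derive_U_x; auto. Qed.

Lemma Ux_bound (c : nat -> R) (r X : R) : geom_bounded c -> 0 <= r < 1 -> 0 <= X ->
  exists M, 0 < M /\ forall v x, Rabs v <= r -> Rabs x <= X -> Rabs (Ux c v x) <= M.
Proof.
  intros Hc Hr HX. destruct (U_bound (shift_w c) r X (geom_bounded_shift c Hc) Hr HX) as [M [HM H]].
  exists M. split; auto. intros v x Hv Hx. unfold Ux. rewrite Rabs_mult, Rabs_Ropp.
  pose proof (Rabs_pos v). pose proof (Rabs_pos x).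
  specialize (H v (- v * x) Hv).
  rewrite Rabs_mult, Rabs_Ropp in H. specialize (H ltac:(nra)).
  pose proof (Rabs_pos (U (shift_w c) v (- v * x))). nra.
Qed.

Lemma U_lip_x (c : nat -> R) (r X : R) : geom_bounded c -> 0 <= r < 1 -> 0 <= X ->
  exists C, 0 < C /\ forall v x x', Rabs v <= r -> Rabs x <= X -> Rabs x' <= X ->
    Rabs (U c v x - U c v x') <= C * Rabs (x - x').
Proof.
  intros Hc Hr HX. destruct (Ux_bound c r X Hc Hr HX) as [M [HM H]].
  exists M. split; auto. intros v x x' Hv Hx Hx'.
  destruct (MVT_gen (U c v) x' x (Ux c v)) as [t [Ht E]].
  - intros y _. apply is_derive_U_x; auto. lra.
  - intros y _. apply U_cont_x; auto. lra.
  - rewrite E, Rabs_mult. apply Rmult_le_compat_r; [apply Rabs_pos|]. apply H; auto.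
    apply Rabs_le_between in Hx. apply Rabs_le_between in Hx'. apply Rabs_le.
    unfold Rmin, Rmax in Ht. destruct (Rle_dec x' x); lra.
Qed.

Lemma U_lip_v (c : nat -> R) (a b X : R) : geom_bounded c -> 0 < a -> a <= b < 1 -> 0 <= X ->
  exists C, 0 < C /\ forall v v' x, a <= v <= b -> a <= v' <= b -> Rabs x <= X ->
    Rabs (U c v x - U c v' x) <= C * Rabs (v - v').
Proof.
  intros Hc Ha Hb HX. destruct (U_bound (tri_w c) b X (geom_bounded_tri c Hc) ltac:(lra) HX) as [M [HM H]].
  exists (M / a). split; [apply Rdiv_lt_0_compat; auto|]. intros v v' x Hv Hv' Hx.
  destruct (MVT_gen (fun v => U c v x) v' v (fun v => U (tri_w c) v x / v)) as [t [Ht E]].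
  - intros y Hy. apply is_derive_U_v; auto.
    unfold Rmin, Rmax in Hy. destruct (Rle_dec v' v); lra.
  - intros y Hy. eapply ex_derive_cont, is_derive_U_v; auto.
    unfold Rmin, Rmax in Hy. destruct (Rle_dec v' v); lra.
  - rewrite E, Rabs_mult. apply Rmult_le_compat_r; [apply Rabs_pos|].
    assert (Ht2 : a <= t <= b) by (unfold Rmin, Rmax in Ht; destruct (Rle_dec v' v); lra).
    unfold Rdiv. rewrite Rabs_mult, Rabs_inv, (Rabs_pos_eq t) by lra.
    apply Rmult_le_compat; [apply Rabs_pos | apply Rlt_le, Rinv_0_lt_compat; lra | |].
    + apply H; auto. rewrite Rabs_pos_eq; lra.
    + apply Rinv_le_contravar; lra.
Qed.

Lemma U_cont2 (c : nat -> R) (v0 x0 eps : R) : geom_bounded c -> 0 < v0 < 1 -> 0 < eps ->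
  exists d, 0 < d /\ forall v x, Rabs (v - v0) < d -> Rabs (x - x0) < d ->
    Rabs (U c v x - U c v0 x0) < eps.
Proof.
  intros Hc Hv0 Heps.
  set (a := v0 / 2). set (b := (v0 + 1) / 2). set (X := Rabs x0 + 1).
  assert (HX : 0 <= X) by (unfold X; pose proof (Rabs_pos x0); lra).
  assert (Hab : 0 < a /\ a < v0 /\ v0 < b /\ b < 1) by (unfold a, b; lra).
  destruct (U_lip_x c b X Hc ltac:(lra) HX) as [C1 [HC1 H1]].
  destruct (U_lip_v c a b X Hc ltac:(lra) ltac:(lra) HX) as [C2 [HC2 H2]].
  set (d := Rmin (Rmin 1 (v0 - a)) (Rmin (b - v0) (eps / (C1 + C2)))).
  assert (Hd : 0 < d).
  { unfold d. repeat apply Rmin_pos; try lra. apply Rdiv_lt_0_compat; lra. }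
  assert (Hd1 : d <= 1) by (unfold d; eapply Rle_trans; [apply Rmin_l | apply Rmin_l]).
  assert (Hd2 : d <= v0 - a) by (unfold d; eapply Rle_trans; [apply Rmin_l | apply Rmin_r]).
  assert (Hd3 : d <= b - v0) by (unfold d; eapply Rle_trans; [apply Rmin_r | apply Rmin_l]).
  assert (Hd4 : d <= eps / (C1 + C2)) by (unfold d; eapply Rle_trans; [apply Rmin_r | apply Rmin_r]).
  exists d. split; auto. intros v x Hv Hx.
  assert (Hv' := Rabs_def2 _ _ Hv).
  assert (Hxx : Rabs x <= X).
  { unfold X. replace x with (x0 + (x - x0)) by ring. eapply Rle_trans; [apply Rabs_triang|]. lra. }
  assert (Hx0 : Rabs x0 <= X) by (unfold X; lra).
  replace (U c v x - U c v0 x0) with ((U c v x - U c v x0) + (U c v x0 - U c v0 x0)) by ring.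
  eapply Rle_lt_trans; [apply Rabs_triang|].
  specialize (H1 v x x0 ltac:(rewrite Rabs_pos_eq; lra) Hxx Hx0).
  specialize (H2 v v0 x0 ltac:(lra) ltac:(lra) Hx0).
  assert (d * (C1 + C2) <= eps).
  { apply Rmult_le_reg_r with (/ (C1 + C2)); [apply Rinv_0_lt_compat; lra|].
    rewrite Rmult_assoc, Rinv_r by lra. lra. }
  nra.
Qed.

Lemma U_neg_near (c : nat -> R) (v0 x0 : R) : geom_bounded c -> 0 < v0 < 1 -> U c v0 x0 < 0 ->
  exists d, 0 < d /\ forall v x, Rabs (v - v0) < d -> Rabs (x - x0) < d -> U c v x < 0.
Proof.
  intros Hc Hv0 HU. destruct (U_cont2 c v0 x0 (- U c v0 x0) Hc Hv0 ltac:(lra)) as [d [Hd H]].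
  exists d. split; auto. intros v x Hv Hx. specialize (H v x Hv Hx). apply Rabs_def2 in H. lra.
Qed.

(** * Real induction and the maximum principle *)

Lemma real_induction (P : R -> Prop) (a b : R) : a <= b -> P a ->
  (forall s, a <= s < b -> P s -> exists d, 0 < d /\ forall v, s < v < s + d -> v <= b -> P v) ->
  (forall s, a < s <= b -> (forall v, a <= v < s -> P v) -> P s) ->
  forall v, a <= v <= b -> P v.
Proof.
  intros Hab Ha Hr Hl.
  set (E := fun v => a <= v <= b /\ forall u, a <= u <= v -> P u).
  assert (Ea : E a) by (split; [lra|]; intros u Hu; replace u with a by lra; auto).
  destruct (completeness E) as [s [Hs1 Hs2]].
  - exists b. intros v [Hv _]. lra.
  - exists a. auto.
  - assert (Has : a <= s) by (apply Hs1; auto).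
    assert (Hsb : s <= b) by (apply Hs2; intros v [Hv _]; lra).
    assert (Hlt : forall u, a <= u < s -> P u).
    { intros u Hu. destruct (classic (exists v, E v /\ u <= v)) as [[v [[_ Hv] Huv]]|Hn].
      - apply Hv. lra.
      - exfalso. assert (s <= u); [|lra]. apply Hs2. intros v Hv.
        destruct (Rle_dec v u); auto. exfalso. apply Hn. exists v. split; auto. lra. }
    assert (Ps : P s).
    { destruct (Req_dec a s) as [->|Hne]; auto. apply Hl; auto. lra. }
    assert (Hes : s = b).
    { destruct (Rle_lt_dec b s) as [H|H]; [lra|]. exfalso.
      destruct (Hr s ltac:(lra) Ps) as [d [Hd Hd']].
      set (t := Rmin (s + d / 2) b).
      assert (Ht : s < t) by (unfold t; apply Rmin_glb_lt; lra).
      assert (Ht2 : t <= s + d / 2) by apply Rmin_l. assert (Ht3 : t <= b) by apply Rmin_r.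
      assert (E t).
      { split; [lra|]. intros u Hu. destruct (Rlt_le_dec u s); [apply Hlt; lra|].
        destruct (Req_dec u s) as [->|]; auto. apply Hd'; lra. }
      apply Hs1 in H0. lra. }
    intros v Hv. destruct (Req_dec v s) as [->|]; auto. apply Hlt. lra.
Qed.

(** The local step concerns pairs [v <= v'] on either side of [s], so one hypothesis covers both
    leaving [s] to the right and reaching [s] from the left. It is the form in which sign patterns
    are carried forward in [v]. *)
Lemma local_propagation (P : R -> Prop) (a b : R) : a <= b -> P a ->
  (forall s, a <= s <= b -> exists d, 0 < d /\ forall v v', s - d < v -> v <= v' -> v' < s + d ->
     a <= v -> v' <= b -> P v -> P v') -> P b.
Proof.
  intros Hab Ha H. apply (real_induction P a b); auto; [| |lra].
  - intros s Hs Ps. destruct (H s ltac:(lra)) as [d [Hd Hd']]. exists d. split; auto.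
    intros v Hv Hvb. apply (Hd' s v); auto; lra.
  - intros s Hs Hv. destruct (H s ltac:(lra)) as [d [Hd Hd']].
    set (u := Rmax a (s - d / 2)).
    assert (a <= u) by apply Rmax_l. assert (s - d / 2 <= u) by apply Rmax_r.
    assert (u < s) by (unfold u; apply Rmax_lub_lt; lra).
    apply (Hd' u s); try lra. apply Hv. lra.
Qed.

Lemma interval_max_neg (f : R -> R) (a b : R) : a <= b ->
  (forall x, a <= x <= b -> continuity_pt f x) -> (forall x, a <= x <= b -> f x < 0) ->
  exists m, 0 < m /\ forall x, a <= x <= b -> f x <= - m.
Proof.
  intros Hab Hc Hf. destruct (continuity_ab_maj f a b Hab Hc) as [M [HM1 HM2]].
  exists (- f M). split; [specialize (Hf M HM2); lra|]. intros x Hx. specialize (HM1 x Hx). lra.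
Qed.

Lemma local_max_derivs (f f' : R -> R) (f2 a b x : R) : a < x < b ->
  (forall y, is_derive f y (f' y)) -> is_derive f' x f2 ->
  (forall y, a <= y <= b -> f y <= f x) -> f' x = 0 /\ f2 <= 0.
Proof.
  intros Hx Hf Hf' Hmax.
  assert (H0 : f' x = 0).
  { assert (pr : derivable_pt f x) by (exists (f' x); apply is_derive_Reals, Hf).
    assert (E := deriv_maximum f a b x pr ltac:(lra) ltac:(lra)).
    rewrite <- E; [|intros y Hy1 Hy2; apply Hmax; lra].
    symmetry. apply derive_pt_eq_0. apply is_derive_Reals, Hf. }
  split; auto.
  destruct (Rle_lt_dec f2 0) as [H|H]; auto. exfalso.
  apply is_derive_Reals in Hf'. destruct (Hf' (f2 / 2) ltac:(lra)) as [d Hd].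
  assert (Hpos : forall h, 0 < h < d -> 0 < f' (x + h)).
  { intros h Hh. specialize (Hd h ltac:(lra) ltac:(rewrite Rabs_pos_eq; lra)).
    apply Rabs_def2 in Hd. rewrite H0 in Hd.
    assert (0 < (f' (x + h) - 0) / h) by lra.
    apply Rmult_lt_reg_r with (/ h); [apply Rinv_0_lt_compat; lra|]. unfold Rdiv in *. lra. }
  set (h := Rmin (d / 2) (b - x)).
  assert (Hdp := cond_pos d).
  assert (Hh : 0 < h) by (unfold h; apply Rmin_pos; lra).
  assert (h <= d / 2) by apply Rmin_l. assert (h <= b - x) by apply Rmin_r.
  destruct (MVT_cor2 f f' x (x + h) ltac:(lra)) as [t [E Ht]].
  - intros y _. apply is_derive_Reals, Hf.
  - specialize (Hmax (x + h) ltac:(lra)).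
    assert (0 < f' t) by (replace t with (x + (t - x)) by ring; apply Hpos; lra). nra.
Qed.

Lemma is_derive_nonneg_left (f : R -> R) (t l : R) (d : R) : 0 < d -> is_derive f t l ->
  (forall u, t - d < u < t -> f u <= f t) -> 0 <= l.
Proof.
  intros Hd Hl H. apply is_derive_Reals in Hl.
  destruct (Rle_lt_dec 0 l) as [|Hn]; auto. exfalso.
  destruct (Hl (- l / 2) ltac:(lra)) as [e He]. pose proof (cond_pos e).
  set (h := Rmin (d / 2) (e / 2)).
  assert (0 < h) by (unfold h; apply Rmin_pos; lra).
  assert (h <= d / 2) by apply Rmin_l. assert (h <= e / 2) by apply Rmin_r.
  specialize (He (- h) ltac:(lra) ltac:(rewrite Rabs_Ropp, Rabs_pos_eq; lra)).
  apply Rabs_def2 in He.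
  specialize (H (t + - h) ltac:(lra)).
  assert (0 <= (f (t + - h) - f t) / - h); [|lra].
  replace ((f (t + - h) - f t) / - h) with ((f t - f (t + - h)) / h) by (field; lra).
  apply Rmult_le_pos; [lra | apply Rlt_le, Rinv_0_lt_compat; lra].
Qed.

Lemma continuity_pt_le_left (f : R -> R) (s d M : R) : 0 < d -> continuity_pt f s ->
  (forall u, s - d < u < s -> f u <= M) -> f s <= M.
Proof.
  intros Hd Hc H. destruct (Rle_lt_dec (f s) M) as [|Hn]; auto. exfalso.
  destruct (Hc (f s - M) ltac:(lra)) as [e [He He']].
  set (h := Rmin (d / 2) (e / 2)).
  assert (0 < h) by (unfold h; apply Rmin_pos; lra).
  assert (h <= d / 2) by apply Rmin_l. assert (h <= e / 2) by apply Rmin_r.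
  specialize (H (s - h) ltac:(lra)).
  assert (Hx := He' (s - h)). simpl in Hx. unfold R_dist in Hx.
  assert (Hy : Rabs (f (s - h) - f s) < f s - M).
  { apply Hx. split; [split; [exact I | lra]|].
    replace (s - h - s) with (- h) by ring. rewrite Rabs_Ropp, Rabs_pos_eq; lra. }
  apply Rabs_def2 in Hy. lra.
Qed.

(** Consider the first [s] at which the tilted function [w] reaches 0, at an interior point [x1].
    There [Ux] vanishes and [Uxx <= 0], so by the heat equation the [v]-derivative of [U] is at most
    0 and that of [w] at most [- k]; but [w] was negative before [s], so its [v]-derivative is at
    least 0. *)
Lemma max_principle (c : nat -> R) (a b al be : R) : geom_bounded c -> 0 < a -> a <= b < 1 -> al <= be ->
  (forall x, al <= x <= be -> U c a x < 0) ->
  (forall v, a <= v <= b -> U c v al < 0) ->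
  (forall v, a <= v <= b -> U c v be < 0) ->
  forall v x, a <= v <= b -> al <= x <= be -> U c v x < 0.
Proof.
  intros Hc Ha Hb Hal H0 H1 H2.
  assert (Hcv : forall x v, a <= v <= b -> continuity_pt (fun v => U c v x) v).
  { intros x v Hv. eapply ex_derive_cont, is_derive_U_v; auto. lra. }
  destruct (interval_max_neg (U c a) al be Hal) as [m0 [Hm0 Hi0]]; auto.
  { intros x _. apply U_cont_x; auto. rewrite Rabs_pos_eq; lra. }
  destruct (interval_max_neg (fun v => U c v al) a b ltac:(lra)) as [m1 [Hm1 Hi1]]; auto.
  destruct (interval_max_neg (fun v => U c v be) a b ltac:(lra)) as [m2 [Hm2 Hi2]]; auto.
  set (k := Rmin m0 (Rmin m1 m2) / 2).
  assert (Hk : 0 < k) by (unfold k; assert (0 < Rmin m0 (Rmin m1 m2)) by (repeat apply Rmin_pos; lra); lra).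
  assert (Hk0 : 2 * k <= m0) by (unfold k; pose proof (Rmin_l m0 (Rmin m1 m2)); lra).
  assert (Hk1 : 2 * k <= m1) by (unfold k; pose proof (Rmin_r m0 (Rmin m1 m2)); pose proof (Rmin_l m1 m2); lra).
  assert (Hk2 : 2 * k <= m2) by (unfold k; pose proof (Rmin_r m0 (Rmin m1 m2)); pose proof (Rmin_r m1 m2); lra).
  (* The tilt in [v] makes the contradiction at first contact strict. Since the values on the
     initial segment and on the two sides are at most [- 2 * k], [w] is negative there; at the end
     [w < 0] gives [U < 0] because [v - a < 1]. *)
  set (w := fun v x => U c v x - k * (v - a) + k).
  set (X := Rmax (Rabs al) (Rabs be)).
  assert (HX : 0 <= X) by (unfold X; eapply Rle_trans; [apply Rabs_pos | apply Rmax_l]).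
  assert (HX2 : forall x, al <= x <= be -> Rabs x <= X).
  { intros x Hx. unfold X. apply RmaxAbs; lra. }
  assert (Main : forall v, a <= v <= b -> forall x, al <= x <= be -> w v x < 0).
  { apply (real_induction (fun v => forall x, al <= x <= be -> w v x < 0)); [lra| | |].
    - intros x Hx. unfold w. specialize (Hi0 x Hx). lra.
    - intros s Hs Ps.
      destruct (interval_max_neg (w s) al be Hal) as [m [Hm Him]]; auto.
      { intros x _. unfold w.
        apply (continuity_pt_plus (fun x => U c s x - k * (s - a)) (fun _ => k));
          [|apply continuity_pt_const; intros ? ?; reflexivity].
        apply (continuity_pt_minus (U c s) (fun _ => k * (s - a)));
          [|apply continuity_pt_const; intros ? ?; reflexivity].
        apply U_cont_x; auto. rewrite Rabs_pos_eq; lra. }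
      destruct (U_lip_v c a b X Hc Ha Hb HX) as [C [HC HL]].
      exists (m / C). split; [apply Rdiv_lt_0_compat; auto|].
      intros v Hv Hvb x Hx. specialize (Him x Hx).
      specialize (HL v s x ltac:(lra) ltac:(lra) (HX2 x Hx)).
      apply Rabs_le_between in HL. rewrite Rabs_pos_eq in HL by lra.
      assert (C * (v - s) < m).
      { apply Rmult_lt_reg_r with (/ C); [apply Rinv_0_lt_compat; auto|].
        replace (C * (v - s) * / C) with (v - s) by (field; lra). unfold Rdiv in Hv. lra. }
      unfold w in *. nra.
    - intros s Hs Hlt x1 Hx1.
      destruct (Rlt_le_dec (w s x1) 0) as [|Hge]; auto. exfalso.
      assert (Hle : forall x, al <= x <= be -> w s x <= 0).
      { intros x Hx. apply (continuity_pt_le_left (fun v => w v x) s (s - a) 0); [lra| |].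
        - unfold w. apply (continuity_pt_plus (fun v => U c v x - k * (v - a)) (fun _ => k));
          [|apply continuity_pt_const; intros ? ?; reflexivity].
          apply (continuity_pt_minus (fun v => U c v x)); [apply Hcv; lra|]. reg.
        - intros u Hu. left. apply Hlt; auto. lra. }
      assert (E1 : w s x1 = 0) by (specialize (Hle x1 Hx1); lra).
      assert (Hin : al < x1 < be).
      { assert (x1 <> al).
        { intros ->. specialize (Hi1 s ltac:(lra)). simpl in Hi1. unfold w in E1. nra. }
        assert (x1 <> be).
        { intros ->. specialize (Hi2 s ltac:(lra)). simpl in Hi2. unfold w in E1. nra. }
        lra. }
      assert (Hs1 : Rabs s < 1) by (rewrite Rabs_pos_eq; lra).
      destruct (local_max_derivs (U c s) (Ux c s) (Uxx c s x1) al be x1 Hin) as [D1 D2].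
      + intros y. apply is_derive_U_x; auto.
      + apply is_derive_Ux_x; auto.
      + intros y Hy. specialize (Hle y Hy). unfold w in *. lra.
      + assert (Hv0 : 0 <= U (tri_w c) s x1 / s - k).
        { apply (is_derive_nonneg_left (fun v => w v x1) s _ (s - a)); [lra| |].
          - apply (is_derive_ext (fun v => plus (U c v x1) (- k * v + (k * a + k)))).
            { intros t. unfold w, plus; simpl. ring. }
            apply (is_derive_plus (V := R_NormedModule) (fun v => U c v x1) (fun v => - k * v + (k * a + k))).
            + apply is_derive_U_v; auto. lra.
            + auto_derive; auto. ring.
          - intros u Hu. rewrite E1. left. apply Hlt; auto. lra. }
        assert (Hh := U_heat c s x1 Hc Hs1). rewrite D1 in Hh.
        assert (U (tri_w c) s x1 <= 0) by (assert (0 <= x1 ^ 2) by apply pow2_ge_0; nra).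
        assert (U (tri_w c) s x1 / s <= 0).
        { unfold Rdiv. assert (0 < / s) by (apply Rinv_0_lt_compat; lra). nra. }
        lra. }
  intros v x Hv Hx. specialize (Main v Hv x Hx). unfold w in Main. nra.
Qed.

(** * Finite and infinite products *)

Fixpoint prodf (f : nat -> R) (n : nat) : R :=
  match n with O => 1 | S n => prodf f n * f n end.

Lemma prodf_ext (f g : nat -> R) (n : nat) :
  (forall i, (i < n)%nat -> f i = g i) -> prodf f n = prodf g n.
Proof.
  induction n as [|n IH]; intros H; simpl; auto. rewrite IH by auto. rewrite H by lia. auto.
Qed.

Lemma prodf_mult (f g : nat -> R) (n : nat) :
  prodf (fun i => f i * g i) n = prodf f n * prodf g n.
Proof. induction n as [|n IH]; simpl; [ring|]. rewrite IH. ring. Qed.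

Lemma prodf_front (f : nat -> R) (n : nat) : prodf f (S n) = f O * prodf (fun i => f (S i)) n.
Proof.
  induction n as [|n IH]; [simpl; ring|].
  change (prodf f (S (S n))) with (prodf f (S n) * f (S n)). rewrite IH. simpl. ring.
Qed.

Lemma prodf_split (f : nat -> R) (m n : nat) :
  prodf f (m + n) = prodf f m * prodf (fun i => f (m + i)%nat) n.
Proof.
  induction n as [|n IH]; [rewrite Nat.add_0_r; simpl; ring|].
  rewrite Nat.add_succ_r. simpl. rewrite IH. ring.
Qed.

Lemma prodf_rev (f : nat -> R) (n : nat) : prodf f n = prodf (fun i => f (n - 1 - i)%nat) n.
Proof.
  revert f. induction n as [|n IH]; intros f; auto. rewrite prodf_front, IH, Rmult_comm. simpl prodf. f_equal.
  - apply prodf_ext. intros i Hi. f_equal. lia.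
  - f_equal. lia.
Qed.

Lemma prodf_const (k : R) (n : nat) : prodf (fun _ => k) n = k ^ n.
Proof. induction n as [|n IH]; simpl; [|rewrite IH]; ring. Qed.

Lemma prodf_abs (f : nat -> R) (n : nat) : Rabs (prodf f n) = prodf (fun i => Rabs (f i)) n.
Proof. induction n as [|n IH]; simpl; [apply Rabs_R1|]. rewrite Rabs_mult, IH. auto. Qed.

Lemma prodf_nonneg (f : nat -> R) (n : nat) : (forall i, (i < n)%nat -> 0 <= f i) -> 0 <= prodf f n.
Proof.
  induction n as [|n IH]; intros H; simpl; [lra|]. apply Rmult_le_pos; auto.
Qed.

Lemma prodf_pos (f : nat -> R) (n : nat) : (forall i, (i < n)%nat -> 0 < f i) -> 0 < prodf f n.
Proof.
  induction n as [|n IH]; intros H; simpl; [lra|]. apply Rmult_lt_0_compat; auto.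
Qed.

Lemma prodf_le (f g : nat -> R) (n : nat) :
  (forall i, (i < n)%nat -> 0 <= f i <= g i) -> prodf f n <= prodf g n.
Proof.
  induction n as [|n IH]; intros H; simpl; [lra|].
  apply Rmult_le_compat; auto; [apply prodf_nonneg|..]; try (intros; apply H; lia).
Qed.

Lemma exp_le (x y : R) : x <= y -> exp x <= exp y.
Proof. intros [H | ->]; [left; apply exp_increasing; auto | lra]. Qed.

(** The inequality [1 + y <= exp y] at [y = a / (1 - a)], where [1 + y = / (1 - a)]. It bounds
    infinite products from below by sums. *)
Lemma one_minus_ge_exp (a r : R) : 0 <= a <= r -> r < 1 -> exp (- (a / (1 - r))) <= 1 - a.
Proof.
  intros Ha Hr.
  apply Rle_trans with (exp (- (a / (1 - a)))).
  { apply exp_le. apply Ropp_le_contravar. apply Rmult_le_compat_l; [lra|].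
    apply Rinv_le_contravar; lra. }
  rewrite exp_Ropp.
  replace (1 - a) with (/ (1 + a / (1 - a))) at 2 by (field; lra).
  assert (0 <= a / (1 - a)) by (apply Rmult_le_pos; [lra | apply Rlt_le, Rinv_0_lt_compat; lra]).
  apply Rinv_le_contravar; [lra|].
  apply exp_ineq1_le.
Qed.

Fixpoint sumf (f : nat -> R) (n : nat) : R :=
  match n with O => 0 | S n => sumf f n + f n end.

Lemma sumf_ext (f g : nat -> R) (n : nat) :
  (forall i, (i < n)%nat -> f i = g i) -> sumf f n = sumf g n.
Proof.
  induction n as [|n IH]; intros H; simpl; auto. rewrite IH by auto. rewrite H by lia. auto.
Qed.

Lemma sumf_plus (f g : nat -> R) (n : nat) : sumf (fun i => f i + g i) n = sumf f n + sumf g n.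
Proof. induction n as [|n IH]; simpl; [ring|]. rewrite IH. ring. Qed.

Lemma sumf_scal (k : R) (f : nat -> R) (n : nat) : sumf (fun i => k * f i) n = k * sumf f n.
Proof. induction n as [|n IH]; simpl; [ring|]. rewrite IH. ring. Qed.

Lemma sumf_split (f : nat -> R) (m n : nat) :
  sumf f (m + n) = sumf f m + sumf (fun i => f (m + i)%nat) n.
Proof.
  induction n as [|n IH]; [rewrite Nat.add_0_r; simpl; ring|].
  rewrite Nat.add_succ_r. simpl. rewrite IH. ring.
Qed.

Lemma sumf_front (f : nat -> R) (n : nat) : sumf f (S n) = f O + sumf (fun i => f (S i)) n.
Proof. change (S n) with (1 + n)%nat. rewrite sumf_split. simpl. ring. Qed.

Lemma sumf_rev (f : nat -> R) (n : nat) : sumf f n = sumf (fun i => f (n - 1 - i)%nat) n.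
Proof.
  revert f. induction n as [|n IH]; intros f; auto. rewrite sumf_front, IH, Rplus_comm. simpl sumf. f_equal.
  - apply sumf_ext. intros i Hi. f_equal. lia.
  - f_equal. lia.
Qed.

Lemma sumf_le (f g : nat -> R) (n : nat) :
  (forall i, (i < n)%nat -> f i <= g i) -> sumf f n <= sumf g n.
Proof.
  induction n as [|n IH]; intros H; simpl; [lra|]. apply Rplus_le_compat; auto.
Qed.

Lemma sumf_nonneg (f : nat -> R) (n : nat) : (forall i, (i < n)%nat -> 0 <= f i) -> 0 <= sumf f n.
Proof.
  induction n as [|n IH]; intros H; simpl; [lra|]. apply Rplus_le_le_0_compat; auto.
Qed.

Lemma sumf_sum_n (f : nat -> R) (n : nat) : sumf f (S n) = sum_n f n.
Proof.
  induction n as [|n IH].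
  - rewrite sum_O. simpl. ring.
  - rewrite sum_Sn, <- IH. reflexivity.
Qed.

Lemma is_series_sumf (f : nat -> R) (l : R) : is_series f l <-> is_lim_seq (sumf f) l.
Proof.
  split; intros H.
  - apply is_lim_seq_incr_1. apply (is_lim_seq_ext (sum_n f)); [|exact H].
    intros n. symmetry. apply sumf_sum_n.
  - apply is_lim_seq_incr_1 in H. change (is_lim_seq (sum_n f) l).
    apply (is_lim_seq_ext (fun n => sumf f (S n))); [|exact H]. intros n. apply sumf_sum_n.
Qed.

Lemma sumf_lim (f : nat -> R) : ex_series f -> is_lim_seq (sumf f) (Series f).
Proof. intros H. apply is_series_sumf, Series_correct, H. Qed.

Lemma sumf_le_series (f : nat -> R) (n : nat) : (forall i, 0 <= f i) -> ex_series f -> sumf f n <= Series f.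
Proof.
  intros Hf Hs. apply (is_lim_seq_incr_compare (sumf f)); [apply sumf_lim; auto|].
  intros m. simpl. specialize (Hf m). lra.
Qed.

Lemma prodf_one_minus (a : nat -> R) (r S : R) (n : nat) : r < 1 ->
  (forall i, (i < n)%nat -> 0 <= a i <= r) -> sumf a n <= S ->
  exp (- (S / (1 - r))) <= prodf (fun i => 1 - a i) n.
Proof.
  intros Hr Ha HS.
  apply Rle_trans with (exp (- (sumf a n / (1 - r)))).
  { apply exp_le, Ropp_le_contravar, Rmult_le_compat_r; auto.
    apply Rlt_le, Rinv_0_lt_compat; lra. }
  clear HS. induction n as [|n IH].
  - simpl. unfold Rdiv. rewrite Rmult_0_l, Ropp_0, exp_0. lra.
  - simpl. replace (- ((sumf a n + a n) / (1 - r))) with (- (sumf a n / (1 - r)) + - (a n / (1 - r)))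
      by (field; lra).
    rewrite exp_plus. apply Rmult_le_compat; try (apply Rlt_le, exp_pos).
    + apply IH. auto.
    + apply one_minus_ge_exp; auto.
Qed.

Lemma prodf_one_plus (a : nat -> R) (S : R) (n : nat) :
  (forall i, (i < n)%nat -> 0 <= a i) -> sumf a n <= S -> prodf (fun i => 1 + a i) n <= exp S.
Proof.
  intros Ha HS. apply Rle_trans with (exp (sumf a n)); [|apply exp_le; auto].
  clear HS. induction n as [|n IH]; simpl; [rewrite exp_0; lra|].
  rewrite exp_plus. apply Rmult_le_compat; auto.
  - apply prodf_nonneg. intros i Hi. specialize (Ha i ltac:(lia)). lra.
  - specialize (Ha n ltac:(lia)). lra.
  - apply exp_ineq1_le.
Qed.

Lemma sumf_geom (r : R) (n : nat) : 0 <= r < 1 -> sumf (fun i => r ^ i) n <= / (1 - r).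
Proof.
  intros Hr. apply Rle_trans with ((1 - r ^ n) / (1 - r)).
  - right. induction n as [|n IH]; simpl; [field; lra|]. rewrite IH. field. lra.
  - unfold Rdiv. rewrite <- (Rmult_1_l (/ (1 - r))) at 2. apply Rmult_le_compat_r.
    + apply Rlt_le, Rinv_0_lt_compat; lra.
    + pose proof (pow_le r n). lra.
Qed.

Lemma seq_cv_of_summable (u a : nat -> R) : ex_series a ->
  (forall n, Rabs (u (S n) - u n) <= a n) -> exists l : R, is_lim_seq u l.
Proof.
  intros Ha H.
  assert (Hs : ex_series (fun n => u (S n) - u n)).
  { apply ex_series_Rabs. apply ex_series_abs_le with a; auto. }
  exists (u O + Series (fun n => u (S n) - u n)).
  apply (is_lim_seq_ext (fun n => u O + sumf (fun n => u (S n) - u n) n)).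
  - intros n. induction n as [|n IH]; simpl; [ring|]. lra.
  - apply (is_lim_seq_plus' (fun _ => u O)); [apply is_lim_seq_const | apply sumf_lim; auto].
Qed.

Lemma tannery (a : nat -> nat -> R) (l t : nat -> R) :
  ex_series t ->
  (forall n j, Rabs (a n j) <= t j) -> (forall j, is_lim_seq (fun n => a n j) (l j)) ->
  is_lim_seq (fun n => Series (a n)) (Series l).
Proof.
  intros Ht Ha Hl.
  assert (Ht0 : forall j, 0 <= t j) by (intros j; eapply Rle_trans; [apply Rabs_pos | apply (Ha O j)]).
  assert (Hlt : forall j, Rabs (l j) <= t j).
  { intros j. assert (H := is_lim_seq_le (fun n => Rabs (a n j)) (fun _ => t j) (Rabs (l j)) (t j)).
    apply H; auto; [|apply is_lim_seq_const].
    apply (is_lim_seq_abs (fun n => a n j) (l j)); auto. }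
  assert (Ea : forall n, ex_series (a n)) by (intros n; apply ex_series_Rabs, (ex_series_abs_le _ t); auto).
  assert (El : ex_series l) by (apply ex_series_Rabs, (ex_series_abs_le _ t); auto).
  apply is_lim_seq_spec. intros eps.
  assert (Hlim := sumf_lim t Ht). apply is_lim_seq_spec in Hlim.
  (* One quarter goes to the head of the sum and twice a quarter to the tail, where the difference
     is at most [2 * t j]. *)
  assert (He4 : 0 < eps / 4) by (pose proof (cond_pos eps); lra).
  destruct (Hlim (mkposreal _ He4)) as [J HJ]. specialize (HJ J (le_n _)). simpl in HJ.
  assert (Hfin : is_lim_seq (fun n => sumf (fun j => Rabs (a n j - l j)) J) 0).
  { clear HJ. induction J as [|J IH]; simpl; [apply is_lim_seq_const|].
    replace (Finite 0) with (Finite (0 + 0)) by (f_equal; ring).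
    apply (is_lim_seq_plus' (fun n => sumf (fun j => Rabs (a n j - l j)) J)); auto.
    rewrite <- Rabs_R0. apply (is_lim_seq_abs (fun n => a n J - l J) 0).
    replace 0 with (l J - l J) by ring.
    apply (is_lim_seq_minus' (fun n => a n J) (fun _ => l J)); auto. apply is_lim_seq_const. }
  apply is_lim_seq_spec in Hfin. destruct (Hfin (mkposreal _ He4)) as [N HN].
  exists N. intros n Hn. specialize (HN n Hn). simpl in HN.
  rewrite <- Series_minus by auto.
  assert (Ed : ex_series (fun j => a n j - l j)) by (apply (ex_series_minus (V := R_NormedModule)); auto).
  assert (E2t : ex_series (fun j => 2 * t j)) by (apply (ex_series_scal_l (V := R_NormedModule) 2 t); auto).
  assert (Hd : forall j, Rabs (a n j - l j) <= 2 * t j).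
  { intros j. specialize (Ha n j). specialize (Hlt j).
    eapply Rle_trans; [apply Rabs_triang|]. rewrite Rabs_Ropp. lra. }
  assert (Eda : ex_series (fun j => Rabs (a n j - l j))) by (apply (ex_series_abs_le _ _ E2t); auto).
  eapply Rle_lt_trans; [apply Series_Rabs; auto|].
  assert (T : forall m, (J <= m)%nat -> sumf (fun j => Rabs (a n j - l j)) m
     <= sumf (fun j => Rabs (a n j - l j)) J + 2 * (Series t - sumf t J)).
  { intros m Hm. replace m with (J + (m - J))%nat by lia. rewrite sumf_split.
    apply Rplus_le_compat_l.
    apply Rle_trans with (sumf (fun i => 2 * t (J + i)%nat) (m - J)); [apply sumf_le; auto|].
    rewrite sumf_scal. apply Rmult_le_compat_l; [lra|].
    assert (Hs := sumf_le_series t (J + (m - J)) Ht0 Ht). rewrite sumf_split in Hs. lra. }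
  assert (Series (fun j => Rabs (a n j - l j)) <= sumf (fun j => Rabs (a n j - l j)) J + 2 * (Series t - sumf t J)).
  { assert (H := is_lim_seq_le_loc (sumf (fun j => Rabs (a n j - l j)))
      (fun _ => sumf (fun j => Rabs (a n j - l j)) J + 2 * (Series t - sumf t J))
      (Series (fun j => Rabs (a n j - l j))) (sumf (fun j => Rabs (a n j - l j)) J + 2 * (Series t - sumf t J))).
    apply H; [exists J; auto | apply sumf_lim; auto | apply is_lim_seq_const]. }
  rewrite Rminus_0_r in HN. apply Rabs_def2 in HN. apply Rabs_def2 in HJ. lra.
Qed.

Lemma Series_finite (f : nat -> R) (n : nat) : (forall j, (n <= j)%nat -> f j = 0) ->
  Series f = sumf f n.
Proof.
  intros H. apply is_series_unique. apply is_series_sumf.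
  apply (is_lim_seq_ext_loc (fun _ => sumf f n)); [|apply is_lim_seq_const].
  exists n. intros m Hm. replace m with (n + (m - n))%nat by lia. rewrite sumf_split.
  assert (E : sumf (fun i => f (n + i)%nat) (m - n) = 0).
  { induction (m - n)%nat as [|k IH]; simpl; auto. rewrite IH, H by lia. ring. }
  lra.
Qed.

(** * Gaussian binomials and the triple product *)

(** The q-Pascal rule serves as definition, so no division occurs; the quotient of q-factorials is
    recovered in [gauss_binom_qfac]. *)
Fixpoint gauss_binom (q : R) (N k : nat) : R :=
  match N, k with
  | O, O => 1
  | O, S _ => 0
  | S _, O => 1
  | S N, S k => q ^ S k * gauss_binom q N (S k) + gauss_binom q N k
  end.

Lemma gauss_binom_gt (q : R) (N k : nat) : (N < k)%nat -> gauss_binom q N k = 0.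
Proof.
  revert k. induction N as [|N IH]; intros [|k] H; try lia; auto.
  simpl. rewrite !IH by lia. ring.
Qed.

Lemma gauss_binom_0 (q : R) (N : nat) : gauss_binom q N 0 = 1.
Proof. destruct N; auto. Qed.

Definition qfac (q : R) (n : nat) : R := prodf (fun i => 1 - q ^ S i) n.

Lemma gauss_binom_qfac (q : R) (N k : nat) : (k <= N)%nat ->
  gauss_binom q N k * (qfac q k * qfac q (N - k)) = qfac q N.
Proof.
  revert k. induction N as [|N IH]; intros [|k] H; try lia.
  - unfold qfac. simpl. ring.
  - rewrite gauss_binom_0, Nat.sub_0_r. unfold qfac. simpl. ring.
  - simpl gauss_binom. rewrite Nat.sub_succ.
    assert (H2 := IH k ltac:(lia)).
    change (qfac q (S k)) with (qfac q k * (1 - q ^ S k)).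
    change (qfac q (S N)) with (qfac q N * (1 - q ^ S N)).
    destruct (Nat.eq_dec k N) as [->|Hne].
    + rewrite (gauss_binom_gt q N (S N)) by lia.
      transitivity (gauss_binom q N N * (qfac q N * qfac q (N - N)) * (1 - q ^ S N)); [simpl pow; ring|].
      rewrite H2. ring.
    + assert (H1 := IH (S k) ltac:(lia)).
      change (qfac q (S k)) with (qfac q k * (1 - q ^ S k)) in H1.
      replace (N - k)%nat with (S (N - S k)) in * by lia.
      change (qfac q (S (N - S k))) with (qfac q (N - S k) * (1 - q ^ S (N - S k))) in *.
      assert (Ep : q ^ S N = q ^ S k * q ^ S (N - S k)) by (rewrite <- pow_add; f_equal; lia).
      rewrite Ep.
      transitivity (q ^ S k * (1 - q ^ S (N - S k)) * (gauss_binom q N (S k) * (qfac q k * (1 - q ^ S k) * qfac q (N - S k)))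
         + (1 - q ^ S k) * (gauss_binom q N k * (qfac q k * (qfac q (N - S k) * (1 - q ^ S (N - S k)))))).
      { simpl pow. ring. }
      rewrite H1, H2. ring.
Qed.

(** Cauchy's q-binomial theorem, with [tri (pred k)] standing for k(k-1)/2. Splitting off the first
    factor rescales [z] to [q * z] in the others, and the q-Pascal rule recombines the two sums. *)
Lemma qbinomial (q z : R) (N : nat) :
  prodf (fun i => 1 + q ^ i * z) N = sumf (fun k => gauss_binom q N k * q ^ tri (pred k) * z ^ k) (S N).
Proof.
  revert z. induction N as [|N IH]; intros z.
  - simpl. ring.
  - rewrite prodf_front.
    rewrite (prodf_ext _ (fun i => 1 + q ^ i * (q * z))) by (intros; simpl; ring).
    rewrite IH. rewrite (sumf_front _ (S N)).
    rewrite (sumf_ext (fun i => gauss_binom q (S N) (S i) * q ^ tri (pred (S i)) * z ^ S i)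
      (fun i => gauss_binom q N (S i) * q ^ tri i * (q * z) ^ S i
                + z * (gauss_binom q N i * q ^ tri (pred i) * (q * z) ^ i))).
    2: { intros i _. simpl gauss_binom. simpl pred. rewrite !Rpow_mult_distr.
         destruct i as [|i]; [rewrite tri_0; simpl; ring|].
         simpl pred. rewrite tri_S, pow_add. simpl pow. ring. }
    rewrite sumf_plus, sumf_scal.
    rewrite (sumf_front (fun k => gauss_binom q N k * q ^ tri (pred k) * (q * z) ^ k) N) at 1.
    rewrite (sumf_front (fun k => gauss_binom q N k * q ^ tri (pred k) * (q * z) ^ k) N).
    simpl sumf at 2. rewrite (gauss_binom_gt q N (S N)) by lia. rewrite !gauss_binom_0. simpl pred. rewrite tri_0. simpl. ring.
Qed.

Lemma prodf_pow_tri (q : R) (n : nat) : prodf (fun i => q ^ i) n = q ^ tri (pred n).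
Proof.
  induction n as [|n IH]; auto. simpl prodf. rewrite IH, <- pow_add. f_equal.
  destruct n as [|n]; auto. simpl pred. rewrite tri_S. lia.
Qed.

Lemma tri_double (k : nat) : (tri k + tri k = k * S k)%nat.
Proof. induction k as [|k IH]; [reflexivity|]. rewrite tri_S. nia. Qed.

Lemma tri_sum_pred (k j : nat) : (tri (k + j) + tri (pred k) = tri j + (k + j) * k)%nat.
Proof.
  destruct k as [|k]; [change (tri j + 0 = tri j + j * 0)%nat; lia|]. change (pred (S k)) with k. rewrite (tri_add (S k) j), (tri_S k).
  pose proof (tri_double k). generalize dependent (tri k). intros t Ht. nia.
Qed.

Lemma tri_sum_add (k j : nat) : (tri k + tri (k + j) = tri j + k * (S k + j))%nat.
Proof. rewrite tri_add. pose proof (tri_double k). nia. Qed.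

(** The q-binomial theorem for [2 n] factors at [z = y / q ^ (n - 1)]. The upper half of the factors
    becomes [1 + q ^ S j * y]; the lower half, read backwards, becomes [1 + q ^ j / y] up to
    monomials, and the product of these monomials moves the centre of the sum to the index [n]. *)
Lemma triple_finite (q y : R) (n : nat) : q <> 0 -> y <> 0 ->
  prodf (fun j => (1 + q ^ S j * y) * (1 + q ^ j / y)) n =
  sumf (fun j => gauss_binom q (n + n) (n + j) * (q ^ tri j * y ^ j)) (S n) +
  / y * sumf (fun j => gauss_binom q (n + n) (n - 1 - j) * (q ^ tri j * (/ y) ^ j)) n.
Proof.
  intros Hq Hy. destruct n as [|m].
  { simpl. simpl. ring. }
  set (n := S m).
  set (z := y / q ^ m).
  assert (Hqm : q ^ m <> 0) by (apply pow_nonzero; auto).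
  assert (Hyn : y ^ n <> 0) by (apply pow_nonzero; auto).
  assert (Hz : forall k, q ^ (m * k) * z ^ k = y ^ k).
  { intros k. rewrite pow_mult, <- Rpow_mult_distr. unfold z. f_equal. field. auto. }
  apply Rmult_eq_reg_l with (y ^ n); auto.
  assert (L : y ^ n * prodf (fun j => (1 + q ^ S j * y) * (1 + q ^ j / y)) n
     = q ^ tri m * prodf (fun i => 1 + q ^ i * z) (n + n)).
  { rewrite prodf_mult, prodf_split.
    rewrite (prodf_ext (fun i => 1 + q ^ (n + i) * z) (fun j => 1 + q ^ S j * y)).
    2: { intros i _. f_equal. unfold n, z. rewrite <- (Rmult_1_r y) at 2.
         replace (S m + i)%nat with (S i + m)%nat by lia. rewrite pow_add. field. auto. }
    rewrite (prodf_rev (fun i => 1 + q ^ i * z) n).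
    replace (tri m) with (tri (pred n)) by reflexivity.
    rewrite <- prodf_pow_tri, <- (prodf_const y n).
    transitivity (prodf (fun j => 1 + q ^ S j * y) n *
       prodf (fun i => y * (1 + q ^ i / y)) n); [rewrite (prodf_mult (fun _ => y)); ring|].
    transitivity (prodf (fun j => 1 + q ^ S j * y) n *
       prodf (fun i => q ^ i * (1 + q ^ (n - 1 - i) * z)) n);
      [f_equal | rewrite (prodf_mult (fun i => q ^ i)); ring].
    apply prodf_ext. intros i Hi. unfold z.
    replace (q ^ m) with (q ^ i * q ^ (n - 1 - i)) by (rewrite <- pow_add; f_equal; unfold n in *; lia).
    field. repeat split; auto; apply pow_nonzero; auto. }
  rewrite L, qbinomial.
  replace (S (n + n)) with (n + S n)%nat by lia. rewrite sumf_split.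
  match goal with |- ?t * (?a + ?b) = ?w * (?c + ?d) =>
    assert (E1 : t * a = w * d); [|assert (E2 : t * b = w * c); [|lra]] end.
  - rewrite (sumf_rev _ n). rewrite <- !sumf_scal. apply sumf_ext. intros j Hj.
    replace (q ^ tri m * (gauss_binom q (n + n) (n - 1 - j) * q ^ tri (pred (n - 1 - j)) * z ^ (n - 1 - j)))
      with (gauss_binom q (n + n) (n - 1 - j) * (q ^ (tri m + tri (pred (n - 1 - j))) * z ^ (n - 1 - j)))
      by (rewrite pow_add; ring).
    replace (tri m + tri (pred (n - 1 - j)))%nat with (tri j + m * (n - 1 - j))%nat.
    2: { unfold n in *. replace (S m - 1 - j)%nat with (m - j)%nat by lia.
         replace m with ((m - j) + j)%nat at 1 3 by lia. symmetry. apply tri_sum_pred. }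
    rewrite pow_add, (Rmult_assoc (q ^ tri j)), Hz.
    rewrite pow_inv. replace (y ^ n) with (y ^ (n - 1 - j) * y ^ j * y).
    2: { unfold n in *. rewrite <- pow_add, Rmult_comm.
         change (y * y ^ (S m - 1 - j + j)) with (y ^ S (S m - 1 - j + j)). f_equal. lia. }
    field. split; auto. apply pow_nonzero; auto.
  - clear E1. rewrite <- !sumf_scal. apply sumf_ext. intros j Hj.
    replace (q ^ tri m * (gauss_binom q (n + n) (n + j) * q ^ tri (pred (n + j)) * z ^ (n + j)))
      with (gauss_binom q (n + n) (n + j) * (q ^ (tri m + tri (pred (n + j))) * z ^ (n + j)))
      by (rewrite pow_add; ring).
    replace (tri m + tri (pred (n + j)))%nat with (tri j + m * (n + j))%nat.
    2: { unfold n. simpl pred. symmetry. apply tri_sum_add. }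
    rewrite pow_add, (Rmult_assoc (q ^ tri j)), Hz, pow_add. ring.
Qed.

Lemma is_lim_seq_comp (u : nat -> R) (phi : nat -> nat) (l : R) :
  is_lim_seq u l -> (forall N, exists M, forall n, (M <= n)%nat -> (N <= phi n)%nat) ->
  is_lim_seq (fun n => u (phi n)) l.
Proof.
  intros Hu Hphi. apply (is_lim_seq_subseq u l phi); auto.
  intros P [N HN]. destruct (Hphi N) as [M HM]. exists M. intros n Hn. apply HN, HM, Hn.
Qed.

Lemma sumf_pow_S (v : R) (n : nat) : 0 <= v < 1 -> sumf (fun i => v ^ S i) n <= v / (1 - v).
Proof.
  intros Hv. rewrite (sumf_ext _ (fun i => v * v ^ i)) by (intros; simpl; ring).
  rewrite sumf_scal. apply Rmult_le_compat_l; [lra|]. apply sumf_geom; auto.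
Qed.

Lemma pow_S_bounds (v : R) (i : nat) : 0 < v < 1 -> 0 < v ^ S i <= v.
Proof.
  intros Hv. split; [apply pow_lt; lra|]. simpl. pose proof (pow_le_one v i ltac:(lra)).
  pose proof (pow_lt v i ltac:(lra)). nra.
Qed.

Lemma prod_one_minus_pow (v : R) : 0 < v < 1 ->
  exists e, 0 < e /\ forall n, e <= prodf (fun i => 1 - v ^ S i) n.
Proof.
  intros Hv. exists (exp (- (v / (1 - v) / (1 - v)))). split; [apply exp_pos|].
  intros n. apply prodf_one_minus; [lra| |apply sumf_pow_S; lra].
  intros i _. pose proof (pow_S_bounds v i Hv). lra.
Qed.

Lemma qfac_bounds (v : R) : 0 < v < 1 ->
  exists c C, 0 < c /\ 0 < C /\ forall n, c <= qfac (- v) n <= C.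
Proof.
  intros Hv. destruct (prod_one_minus_pow v Hv) as [e [He Hen]].
  exists e, (exp (v / (1 - v))). repeat split; auto using exp_pos.
  - eapply Rle_trans; [apply Hen|]. apply prodf_le. intros i _.
    pose proof (pow_S_bounds v i Hv).
    assert (Rabs ((- v) ^ S i) <= v ^ S i) by (rewrite <- RPow_abs, Rabs_Ropp, Rabs_pos_eq; lra).
    apply Rabs_le_between in H0. lra.
  - eapply Rle_trans; [|apply (prodf_one_plus (fun i => v ^ S i) (v / (1 - v)) n)].
    + apply prodf_le. intros i _.
      pose proof (pow_S_bounds v i Hv).
      assert (Rabs ((- v) ^ S i) <= v ^ S i) by (rewrite <- RPow_abs, Rabs_Ropp, Rabs_pos_eq; lra).
      apply Rabs_le_between in H0. lra.
    + intros i _. pose proof (pow_S_bounds v i Hv). lra.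
    + apply sumf_pow_S; lra.
Qed.

Lemma qfac_lim (v : R) : 0 < v < 1 -> exists L, L <> 0 /\ is_lim_seq (qfac (- v)) L.
Proof.
  intros Hv. destruct (qfac_bounds v Hv) as [c [C [Hc [HC H]]]].
  destruct (seq_cv_of_summable (qfac (- v)) (fun n => C * v ^ n)) as [L HL].
  - apply (ex_series_scal_l (V := R_NormedModule) C). apply ex_series_geom. rewrite Rabs_pos_eq; lra.
  - intros n. change (qfac (- v) (S n)) with (qfac (- v) n * (1 - (- v) ^ S n)).
    replace (qfac (- v) n * (1 - (- v) ^ S n) - qfac (- v) n) with (- (qfac (- v) n * (- v) ^ S n)) by ring.
    rewrite Rabs_Ropp, Rabs_mult. specialize (H n).
    rewrite Rabs_pos_eq by lra. apply Rmult_le_compat; [lra | apply Rabs_pos | lra|].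
    rewrite <- RPow_abs, Rabs_Ropp, Rabs_pos_eq by lra.
    apply pow_le_anti; [lra|lia].
  - exists L. split; auto. intros ->.
    assert (Hle := is_lim_seq_le (fun _ => c) (qfac (- v)) c 0).
    assert (c <= 0); [|lra]. apply Hle; auto; [intros n; apply H | apply is_lim_seq_const].
Qed.

Definition th (v x : R) : R := U one_w v x.

(** The two-sided series, summing [q ^ (j (j + 1) / 2) * y ^ j] over all integers [j], for [q = - v]. *)
Definition St (v y : R) : R := th v y + th v (/ y) / y.

Definition tf (v y : R) (j : nat) : R :=
  (1 - (- v) ^ S j) * ((1 + (- v) ^ S j * y) * (1 + (- v) ^ j / y)).

(** Jacobi's identity is the limit of [triple_finite] multiplied by [qfac q n]. For fixed [j] the
    coefficient [qfac q n * gauss_binom q (n + n) (n + j)] tends to 1, and all of them are bounded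
    by [C * C / (c * c)], so [tannery] applies to each of the two one-sided sums. *)
Lemma triple_product (v y : R) : 0 < v < 1 -> y <> 0 -> is_lim_seq (prodf (tf v y)) (St v y).
Proof.
  intros Hv Hy.
  destruct (qfac_bounds v Hv) as [c [C [Hc [HC Hb]]]].
  destruct (qfac_lim v Hv) as [L [HL0 HL]].
  set (q := - v) in *.
  set (B := C * C / (c * c)).
  assert (HB : 0 < B) by (unfold B; apply Rdiv_lt_0_compat; nra).
  assert (Hg : forall n k, (k <= n + n)%nat ->
     qfac q n * gauss_binom q (n + n) k = qfac q n * qfac q (n + n) / (qfac q k * qfac q (n + n - k))).
  { intros n k Hk. rewrite <- (gauss_binom_qfac q (n + n) k Hk). pose proof (Hb k). pose proof (Hb (n + n - k)%nat).
    field. lra. }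
  assert (HgB : forall n k, Rabs (qfac q n * gauss_binom q (n + n) k) <= B).
  { intros n k. destruct (le_lt_dec k (n + n)) as [Hk|Hk].
    - rewrite Hg by auto. pose proof (Hb n). pose proof (Hb (n + n)%nat). pose proof (Hb k).
      pose proof (Hb (n + n - k)%nat).
      assert (c * c <= qfac q k * qfac q (n + n - k)) by (apply Rmult_le_compat; lra).
      rewrite Rabs_pos_eq.
      + unfold B, Rdiv. apply Rmult_le_compat.
        * apply Rmult_le_pos; lra.
        * apply Rlt_le, Rinv_0_lt_compat. nra.
        * apply Rmult_le_compat; lra.
        * apply Rinv_le_contravar; nra.
      + apply Rmult_le_pos; [nra|]. apply Rlt_le, Rinv_0_lt_compat. nra.
    - rewrite gauss_binom_gt by auto. rewrite Rmult_0_r, Rabs_R0. lra. }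
  assert (Hlim : forall phi : nat -> nat, (forall N, exists M, forall n, (M <= n)%nat -> (N <= phi n)%nat) ->
     (forall N, exists M, forall n, (M <= n)%nat -> (N <= n + n - phi n)%nat /\ (phi n <= n + n)%nat) ->
     is_lim_seq (fun n => qfac q n * gauss_binom q (n + n) (phi n)) 1).
  { intros phi H1 H2.
    apply (is_lim_seq_ext_loc (fun n => qfac q n * qfac q (n + n) / (qfac q (phi n) * qfac q (n + n - phi n)))).
    { destruct (H2 O) as [M HM]. exists M. intros n Hn. symmetry. apply Hg. apply HM, Hn. }
    replace (Finite 1) with (Finite (L * L / (L * L))) by (f_equal; field; auto).
    apply is_lim_seq_div'.
    - apply is_lim_seq_mult'; auto. apply (is_lim_seq_comp (qfac q) (fun n => (n + n)%nat)); auto.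
      intros N. exists N. intros; lia.
    - apply is_lim_seq_mult'; [apply is_lim_seq_comp; auto|].
      apply (is_lim_seq_comp (qfac q) (fun n => (n + n - phi n)%nat)); auto.
      intros N. destruct (H2 N) as [M HM]. exists M. intros n Hn. apply HM, Hn.
    - nra. }
  assert (Hex : forall x, ex_series (fun j => B * Rabs (q ^ tri j * x ^ j))).
  { intros x. apply (ex_series_scal_l (V := R_NormedModule) B).
    apply (ex_series_ext (fun j => Rabs (one_w j * (- v) ^ tri j * x ^ j))).
    - intros j. unfold one_w, q. f_equal. Req. ring.
    - apply U_abs_ex; [apply geom_bounded_one | rewrite Rabs_pos_eq; lra]. }
  set (t := fun j => q ^ tri j * y ^ j). set (s := fun j => q ^ tri j * (/ y) ^ j).
  assert (Et : Series t = th v y).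
  { unfold th, U. apply Series_ext. intros j. unfold one_w, t, q. ring. }
  assert (Es : Series s = th v (/ y)).
  { unfold th, U. apply Series_ext. intros j. unfold one_w, s, q. ring. }
  set (a1 := fun n j => if le_lt_dec j n then qfac q n * gauss_binom q (n + n) (n + j) * t j else 0).
  set (a2 := fun n j => if le_lt_dec n j then 0 else qfac q n * gauss_binom q (n + n) (n - 1 - j) * s j).
  assert (L1 : is_lim_seq (fun n => Series (a1 n)) (Series t)).
  { apply (tannery a1 t (fun j => B * Rabs (t j))).
    - apply Hex.
    - intros n j. unfold a1. destruct (le_lt_dec j n) as [Hj|Hj].
      + rewrite Rabs_mult. apply Rmult_le_compat_r; [apply Rabs_pos | apply HgB].
      + rewrite Rabs_R0. apply Rmult_le_pos; [lra | apply Rabs_pos].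
    - intros j. apply (is_lim_seq_ext_loc (fun n => qfac q n * gauss_binom q (n + n) (n + j) * t j)).
      + exists j. intros n Hn. unfold a1. destruct (le_lt_dec j n); [auto | lia].
      + replace (Finite (t j)) with (Finite (1 * t j)) by (f_equal; ring).
        apply is_lim_seq_mult'; [|apply is_lim_seq_const]. apply Hlim.
        * intros N. exists N. intros; lia.
        * intros N. exists (N + j)%nat. intros; lia. }
  assert (L2 : is_lim_seq (fun n => Series (a2 n)) (Series s)).
  { apply (tannery a2 s (fun j => B * Rabs (s j))).
    - apply Hex.
    - intros n j. unfold a2. destruct (le_lt_dec n j) as [Hj|Hj].
      + rewrite Rabs_R0. apply Rmult_le_pos; [lra | apply Rabs_pos].
      + rewrite Rabs_mult. apply Rmult_le_compat_r; [apply Rabs_pos | apply HgB].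
    - intros j. apply (is_lim_seq_ext_loc (fun n => qfac q n * gauss_binom q (n + n) (n - 1 - j) * s j)).
      + exists (S j). intros n Hn. unfold a2. destruct (le_lt_dec n j); [lia | auto].
      + replace (Finite (s j)) with (Finite (1 * s j)) by (f_equal; ring).
        apply is_lim_seq_mult'; [|apply is_lim_seq_const].
        apply (Hlim (fun n => (n - 1 - j)%nat)).
        * intros N. exists (N + 1 + j)%nat. intros; lia.
        * intros N. exists N. intros; lia. }
  apply (is_lim_seq_ext (fun n => Series (a1 n) + / y * Series (a2 n))).
  - intros n. rewrite (Series_finite (a1 n) (S n)).
    2: { intros j Hj. unfold a1. destruct (le_lt_dec j n); [lia | auto]. }
    rewrite (Series_finite (a2 n) n).
    2: { intros j Hj. unfold a2. destruct (le_lt_dec n j); [auto | lia]. }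
    rewrite (sumf_ext (a1 n) (fun j => qfac q n * (gauss_binom q (n + n) (n + j) * t j))).
    2: { intros j Hj. unfold a1. destruct (le_lt_dec j n); [ring | lia]. }
    rewrite (sumf_ext (a2 n) (fun j => qfac q n * (gauss_binom q (n + n) (n - 1 - j) * s j))).
    2: { intros j Hj. unfold a2. destruct (le_lt_dec n j); [lia | ring]. }
    rewrite !sumf_scal. unfold tf. rewrite prodf_mult. fold q. fold (qfac q n).
    rewrite triple_finite; [|unfold q; lra | auto]. unfold t, s. ring.
  - unfold St. rewrite <- Et, <- Es. unfold Rdiv. rewrite (Rmult_comm (Series s)).
    apply is_lim_seq_plus'; auto. apply is_lim_seq_mult'; auto. apply is_lim_seq_const.
Qed.

(** * Functional equations *)

Lemma th_fe (v x : R) : Rabs v < 1 -> th v x = 1 - v * x * th v (- v * x).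
Proof.
  intros Hv. unfold th, U. rewrite Series_incr_1 by (apply U_ex; [apply geom_bounded_one | auto]).
  rewrite <- Series_scal_l.
  assert (E : Series (fun k => one_w (S k) * (- v) ^ tri (S k) * x ^ S k)
    = - Series (fun n => v * x * (one_w n * (- v) ^ tri n * (- v * x) ^ n))).
  { rewrite <- Series_opp. apply Series_ext. intros j. unfold one_w.
    rewrite tri_S, pow_add, Rpow_mult_distr. simpl pow. ring. }
  rewrite E. unfold one_w. rewrite tri_0. simpl. ring.
Qed.

Lemma th_fe2 (v x : R) : Rabs v < 1 -> th v x = 1 - v * x - v ^ 3 * x ^ 2 * th v (v ^ 2 * x).
Proof.
  intros Hv. rewrite (th_fe v x Hv), (th_fe v (- v * x) Hv).
  replace (- v * (- v * x)) with (v ^ 2 * x) by ring. ring.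
Qed.

Lemma th_0 (v : R) : Rabs v < 1 -> th v 0 = 1.
Proof. intros Hv. rewrite th_fe by auto. ring. Qed.

Lemma St_fe (v y : R) : 0 < v < 1 -> y <> 0 -> St v y = - v * y * St v (- v * y).
Proof.
  intros Hv Hy. assert (Hv1 : Rabs v < 1) by (rewrite Rabs_pos_eq; lra).
  unfold St. rewrite (th_fe v y Hv1). rewrite (th_fe v (/ (- v * y)) Hv1).
  replace (- v * / (- v * y)) with (/ y) by (field; lra). field. lra.
Qed.

Lemma St_neg (v w : R) : 0 < v < 1 -> w <> 0 -> St v (- w) = v * w * St v (v * w).
Proof.
  intros Hv Hw. rewrite St_fe by lra. replace (- v * - w) with (v * w) by ring. ring.
Qed.

Lemma St_fe2 (v y : R) : 0 < v < 1 -> y <> 0 -> St v y = - v ^ 3 * y ^ 2 * St v (v ^ 2 * y).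
Proof.
  intros Hv Hy. rewrite St_fe by auto. replace (- v * y) with (- (v * y)) at 2 by ring.
  rewrite St_neg by nra. replace (v * (v * y)) with (v ^ 2 * y) by ring. ring.
Qed.

Lemma St_scale (v t : R) (m : nat) : 0 < v < 1 -> t <> 0 ->
  St v (t / v ^ (2 * m)) = (-1) ^ m * (t ^ (2 * m) / v ^ (m * (2 * m - 1))) * St v t.
Proof.
  intros Hv Ht. induction m as [|m IH].
  - simpl. replace (t / 1) with t by field. field.
  - assert (Hvn : forall k, v ^ k <> 0) by (intros k; apply pow_nonzero; lra).
    rewrite St_fe2; [|auto|].
    2: { unfold Rdiv. apply Rmult_integral_contrapositive_currified; auto.
         apply Rinv_neq_0_compat; auto. }
    replace (2 * S m)%nat with (2 * m + 2)%nat by lia.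
    replace (v ^ 2 * (t / v ^ (2 * m + 2))) with (t / v ^ (2 * m)).
    2: { rewrite pow_add. field. split; [lra | auto]. }
    rewrite IH.
    replace (S m * (2 * m + 2 - 1))%nat with (m * (2 * m - 1) + 2 * m + 2 * m + 1)%nat.
    2: { destruct m as [|m]; [reflexivity|]. nia. }
    rewrite !pow_add. simpl ((-1) ^ S m). field. repeat split; auto; lra.
Qed.

(** In the triple product at [q = - v] only the factors [1 - v * t] and [1 - v / t], from the
    indices 0 and 1, vanish at the ends of the interval. The rest of these two indices contributes
    at least [1 - v ^ 2], and each later index at least [(1 - v ^ S i) ^ 3], whence [e ^ 3]. *)
Lemma St_lower (v : R) : 0 < v < 1 ->
  exists c, 0 < c /\ forall t, v <= t <= / v -> c * ((1 - v * t) * (1 - v / t)) <= St v t.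
Proof.
  intros Hv. destruct (prod_one_minus_pow v Hv) as [e [He Hen]].
  exists ((1 - v ^ 2) * e ^ 3). split.
  { apply Rmult_lt_0_compat; [nra | apply pow_lt; auto]. }
  intros t Ht.
  assert (Hvt : 0 <= 1 - v * t).
  { assert (v * t <= v * / v) by (apply Rmult_le_compat_l; lra). rewrite Rinv_r in H by lra. lra. }
  assert (Hit : 0 < / t <= / v).
  { split; [apply Rinv_0_lt_compat; lra | apply Rinv_le_contravar; lra]. }
  assert (Hvt2 : 0 <= 1 - v / t).
  { assert (v * / t <= v * / v) by (apply Rmult_le_compat_l; lra). rewrite Rinv_r in H by lra.
    unfold Rdiv. lra. }
  assert (Hlim := triple_product v t Hv ltac:(lra)).
  assert (H := is_lim_seq_le_loc (fun _ => (1 - v ^ 2) * e ^ 3 * ((1 - v * t) * (1 - v / t)))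
    (prodf (tf v t)) ((1 - v ^ 2) * e ^ 3 * ((1 - v * t) * (1 - v / t))) (St v t)).
  apply H; auto; [|apply is_lim_seq_const]. exists 2%nat. intros n Hn.
  replace n with (2 + (n - 2))%nat by lia. rewrite prodf_split.
  assert (F1 : (1 - v ^ 2) * ((1 - v * t) * (1 - v / t)) <= prodf (tf v t) 2).
  { unfold prodf, tf. simpl pow.
    replace (1 * ((1 - - v * 1) * ((1 + - v * 1 * t) * (1 + 1 / t))) *
       ((1 - - v * (- v * 1)) * ((1 + - v * (- v * 1) * t) * (1 + - v * 1 / t))))
      with ((1 - v * (v * 1)) * ((1 - v * t) * (1 - v / t)) * ((1 + v) * (1 + / t) * (1 + v * v * t)))
      by (field; lra).
    rewrite <- (Rmult_1_r ((1 - v * (v * 1)) * ((1 - v * t) * (1 - v / t)))) at 1.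
    apply Rmult_le_compat_l.
    - apply Rmult_le_pos; [nra|]. apply Rmult_le_pos; auto.
    - assert (0 <= v * v * t) by (apply Rmult_le_pos; nra).
      assert (1 <= (1 + v) * (1 + / t)) by nra. nra. }
  assert (F2 : e ^ 3 <= prodf (fun i => tf v t (2 + i)) (n - 2)).
  { apply Rle_trans with (prodf (fun i => (1 - v ^ S i) * ((1 - v ^ S i) * (1 - v ^ S i))) (n - 2)).
    - rewrite !prodf_mult. replace (e ^ 3) with (e * (e * e)) by ring.
      specialize (Hen (n - 2)%nat). apply Rmult_le_compat; try nra.
    - apply prodf_le. intros i _. unfold tf.
      assert (Hp : 0 < v ^ S i <= v) by (apply pow_S_bounds; auto).
      assert (Ab : forall k, (S i <= k)%nat -> Rabs ((- v) ^ k) <= v ^ S i).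
      { intros k Hk. rewrite <- RPow_abs, Rabs_Ropp, Rabs_pos_eq by lra. apply pow_le_anti; [lra | auto]. }
      assert (A1 := Ab (S (2 + i)) ltac:(lia)). apply Rabs_le_between in A1.
      assert (A2 : - v ^ S i <= (- v) ^ S (2 + i) * t).
      { assert (X := Ab (S (S i)) ltac:(lia)).
        assert (Rabs ((- v) ^ S (2 + i) * t) <= v ^ S i).
        { replace ((- v) ^ S (2 + i) * t) with ((- v) ^ S (S i) * (- (v * t))) by (simpl; ring).
          rewrite Rabs_mult, Rabs_Ropp, (Rabs_pos_eq (v * t)) by nra.
          pose proof (Rabs_pos ((- v) ^ S (S i))). nra. }
        apply Rabs_le_between in H0. lra. }
      assert (A3 : - v ^ S i <= (- v) ^ (2 + i) / t).
      { assert (X := Ab (S i) ltac:(lia)).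
        assert (Rabs ((- v) ^ (2 + i) / t) <= v ^ S i).
        { replace ((- v) ^ (2 + i) / t) with ((- v) ^ S i * (- (v / t))) by (simpl; field; lra).
          assert (0 <= v / t <= 1) by (split; [apply Rmult_le_pos; lra | lra]).
          rewrite Rabs_mult, Rabs_Ropp, (Rabs_pos_eq (v / t)) by lra.
          pose proof (Rabs_pos ((- v) ^ S i)). nra. }
        apply Rabs_le_between in H0. lra. }
      split; [apply Rmult_le_pos; [lra|]; apply Rmult_le_pos; lra|].
      apply Rmult_le_compat; try lra; [apply Rmult_le_pos; lra|].
      apply Rmult_le_compat; lra. }
  assert (0 <= (1 - v ^ 2) * ((1 - v * t) * (1 - v / t))).
  { apply Rmult_le_pos; [nra|]. apply Rmult_le_pos; auto. }
  replace ((1 - v ^ 2) * e ^ 3 * ((1 - v * t) * (1 - v / t)))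
    with ((1 - v ^ 2) * ((1 - v * t) * (1 - v / t)) * e ^ 3) by ring.
  apply Rmult_le_compat; auto. apply pow_le; lra.
Qed.

(** * The unit interval *)

Lemma prodf_pairs (f : nat -> R) (m : nat) :
  prodf f (2 * m) = prodf (fun i => f (2 * i)%nat * f (2 * i + 1)%nat) m.
Proof.
  induction m as [|m IH]; auto. replace (2 * S m)%nat with (S (S (2 * m))) by lia.
  simpl prodf. simpl prodf in IH. rewrite IH, Rmult_assoc. do 3 f_equal; lia.
Qed.

Lemma bernoulli (v : R) (n : nat) : 0 <= v -> 1 + INR n * (v - 1) <= v ^ n.
Proof.
  intros Hv. induction n as [|n IH]; [simpl; lra|]. rewrite S_INR. simpl pow.
  pose proof (pos_INR n). assert (v * (1 + INR n * (v - 1)) <= v * v ^ n) by (apply Rmult_le_compat_l; auto).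
  assert (0 <= INR n * (v - 1) ^ 2) by (apply Rmult_le_pos; [auto | apply pow2_ge_0]). nra.
Qed.

Lemma nonincr_of_derive (f f' : R -> R) (a b : R) : a <= b ->
  (forall x, a <= x <= b -> is_derive f x (f' x)) -> (forall x, a < x < b -> f' x <= 0) -> f b <= f a.
Proof.
  intros [Hab | ->] Hf Hf'; [|lra].
  destruct (MVT_cor2 f f' a b Hab) as [t [E Ht]].
  - intros c Hc. apply is_derive_Reals, Hf, Hc.
  - specialize (Hf' t Ht). nra.
Qed.

(** Bernoulli's inequality in the form [(n + 1) * v - n <= v ^ (n + 1)] makes the derivative
    nonpositive. *)
Lemma pair_factor_nonincr (n : nat) (u v : R) : (1 <= n)%nat -> 0 < u -> u <= v -> v < 1 ->
  (1 - v ^ n) * (1 + v ^ S n) <= (1 - u ^ n) * (1 + u ^ S n).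
Proof.
  intros Hn Hu Huv Hv.
  apply (nonincr_of_derive (fun v => (1 - v ^ n) * (1 + v ^ S n))
    (fun v => v ^ pred n * (INR (S n) * v - INR n - (2 * INR n + 1) * v ^ S n))); auto.
  - intros x Hx. destruct n as [|n]; [lia|]. auto_derive; auto.
    rewrite !S_INR. simpl pred. destruct n as [|n]; simpl; rewrite ?S_INR; simpl; ring.
  - intros x Hx. assert (B := bernoulli x (S n) ltac:(lra)). rewrite S_INR in *.
    assert (0 <= x ^ pred n) by (apply pow_le; lra).
    assert (0 <= x ^ S n) by (apply pow_le; lra). pose proof (pos_INR n).
    assert (0 <= 2 * INR n * x ^ S n) by (apply Rmult_le_pos; nra).
    nra.
Qed.

Lemma St_1 (v : R) : St v 1 = 2 * th v 1.
Proof. unfold St. rewrite Rinv_1. field. Qed.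

(** At [y = 1] the first two parts of a factor combine to [1 - (v ^ S j) ^ 2], and [1 + (- v) ^ j]
    remains. The index 0 gives the 2, and an odd index is grouped with the following even one;
    therefore the number of factors is odd. *)
Lemma tf_1_odd (v : R) (m : nat) : 0 < v < 1 ->
  prodf (tf v 1) (S (2 * m)) = 2 * prodf (fun j => 1 - (v ^ S j) ^ 2) (S (2 * m)) *
    prodf (fun i => (1 - v ^ (2 * i + 1)) * (1 + v ^ S (2 * i + 1))) m.
Proof.
  intros Hv.
  rewrite (prodf_ext (tf v 1) (fun j => (1 - (v ^ S j) ^ 2) * (1 + (- v) ^ j))).
  2: { intros j _. unfold tf. replace ((v ^ S j) ^ 2) with (((- v) ^ S j) ^ 2); [simpl; field|].
       rewrite <- !pow_mult, !(Nat.mul_comm _ 2), !pow_mult. f_equal. ring. }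
  rewrite prodf_mult, (prodf_front (fun j => 1 + (- v) ^ j)), prodf_pairs.
  rewrite (prodf_ext (fun i => (1 + (- v) ^ S (2 * i)) * (1 + (- v) ^ S (2 * i + 1)))
    (fun i => (1 - v ^ (2 * i + 1)) * (1 + v ^ S (2 * i + 1)))); [simpl; ring|].
  intros i _. assert (E : (- v) ^ (2 * i) = v ^ (2 * i)).
  { rewrite !pow_mult. f_equal. ring. }
  replace (S (2 * i + 1)) with (2 * i + 2)%nat by lia.
  replace (S (2 * i)) with (2 * i + 1)%nat by lia. rewrite !pow_add, E. ring.
Qed.

(** At [x = 1] the two halves of the two-sided series coincide, so twice theta is a product. In the
    grouping of [tf_1_odd] every factor is nonnegative and nonincreasing in [v]. *)
Lemma th_1_nonincr (u v : R) : 0 < u -> u <= v -> v < 1 -> th v 1 <= th u 1.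
Proof.
  intros Hu Huv Hv.
  assert (L : forall w, 0 < w < 1 -> is_lim_seq (fun m => prodf (tf w 1) (S (2 * m))) (St w 1)).
  { intros w Hw. apply (is_lim_seq_comp (prodf (tf w 1)) (fun m => S (2 * m))).
    - apply triple_product; auto.
    - intros N. exists N. intros; lia. }
  enough (K : forall m, prodf (tf v 1) (S (2 * m)) <= prodf (tf u 1) (S (2 * m))).
  { assert (H := is_lim_seq_le _ _ (St v 1) (St u 1) K (L v ltac:(lra)) (L u ltac:(lra))).
    simpl in H. rewrite !St_1 in H. lra. }
  intros m. rewrite !tf_1_odd by lra.
  assert (P : forall w i, 0 < w < 1 -> 0 < w ^ S i <= w) by (intros; apply pow_S_bounds; auto).
  apply Rmult_le_compat.
  - apply Rmult_le_pos; [lra|]. apply prodf_nonneg. intros i _. specialize (P v i ltac:(lra)).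
    assert ((v ^ S i) ^ 2 <= 1) by (apply pow_le_one; lra). lra.
  - apply prodf_nonneg. intros i _. rewrite Nat.add_1_r.
    pose proof (P v (2 * i)%nat ltac:(lra)). pose proof (P v (S (2 * i)) ltac:(lra)).
    apply Rmult_le_pos; lra.
  - apply Rmult_le_compat_l; [lra|]. apply prodf_le. intros i _.
    pose proof (P v i ltac:(lra)). pose proof (P u i ltac:(lra)).
    assert (u ^ S i <= v ^ S i) by (apply pow_incr; lra).
    assert ((v ^ S i) ^ 2 <= 1) by (apply pow_le_one; lra).
    assert ((u ^ S i) ^ 2 <= (v ^ S i) ^ 2) by (apply pow_incr; lra). lra.
  - apply prodf_le. intros i _. split.
    + rewrite Nat.add_1_r. pose proof (P v (2 * i)%nat ltac:(lra)). pose proof (P v (S (2 * i)) ltac:(lra)).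
    apply Rmult_le_pos; lra.
    + apply pair_factor_nonincr; auto. lia.
Qed.

Lemma th_1_pos (v : R) : 0 < v < 1 -> 0 < th v 1.
Proof.
  intros Hv. destruct (St_lower v Hv) as [c [Hc H]].
  assert (1 <= / v) by (rewrite <- Rinv_1; apply Rinv_le_contravar; lra).
  specialize (H 1 ltac:(lra)). rewrite St_1 in H.
  assert (0 < c * ((1 - v * 1) * (1 - v / 1))).
  { apply Rmult_lt_0_compat; auto. unfold Rdiv. rewrite Rinv_1. nra. }
  lra.
Qed.

(** The series with weights [tri j] is [v] times the [v]-derivative of theta and satisfies the same
    heat equation. It vanishes at [x = 0], is nonpositive at [x = 1] by [th_1_nonincr], and is small
    for small [v]; the maximum principle carries this into the rectangle. *)
Lemma zeta_nonpos (v x : R) : 0 < v < 1 -> 0 <= x <= 1 -> U (tri_w one_w) v x <= 0.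
Proof.
  intros Hv Hx.
  assert (Hb1 : geom_bounded (tri_w one_w)) by (apply geom_bounded_tri, geom_bounded_one).
  destruct (Rle_lt_dec (U (tri_w one_w) v x) 0) as [|Hpos]; auto. exfalso.
  set (e := U (tri_w one_w) v x) in *.
  (* Subtracting the supposed positive value [e] from the weight of index 0 subtracts the constant
     [e] from the series, because [tri 0 = 0]; the difference is still of the form [U c]. It would
     then be negative at a point where it is 0. *)
  set (c := fun j => tri_w one_w j - (if Nat.eq_dec j 0 then e else 0)).
  assert (Hc : geom_bounded c).
  { destruct Hb1 as [K [B [HK [HB H]]]]. exists (K + e), (B + 1). repeat split; try lra.
    intros j. unfold c. destruct (Nat.eq_dec j 0) as [->|Hj].
    - simpl. unfold tri_w, one_w. rewrite tri_0. simpl.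
      replace (0 * 1 - e) with (- e) by ring. rewrite Rabs_Ropp, Rabs_pos_eq; lra.
    - rewrite Rminus_0_r. eapply Rle_trans; [apply H|].
      apply Rmult_le_compat; try lra; [apply pow_le; lra | apply pow_incr; lra]. }
  assert (EU : forall u y, Rabs u < 1 -> U c u y = U (tri_w one_w) u y - e).
  { intros u y Hu. unfold U.
    replace e with (Series (fun j => (if Nat.eq_dec j 0 then e else 0))).
    2: { rewrite (Series_finite _ 1); [simpl; ring|]. intros j Hj. destruct (Nat.eq_dec j 0); [lia|auto]. }
    rewrite <- Series_minus; [|apply U_ex; auto|].
    - apply Series_ext. intros j. unfold c. destruct (Nat.eq_dec j 0) as [->|Hj]; [|ring].
      rewrite tri_0. simpl. ring.
    - exists e. apply is_series_sumf. apply (is_lim_seq_ext_loc (fun _ => e)); [|apply is_lim_seq_const].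
      exists 1%nat. intros n Hn. destruct n as [|n]; [lia|]. rewrite sumf_front. simpl.
      rewrite (sumf_ext _ (fun _ => 0 * 0)) by (intros; ring). rewrite sumf_scal. ring. }
  assert (Hone : geom_bounded one_w) by apply geom_bounded_one.
  destruct (U_bound (shift_w one_w) (1 / 2) 1) as [M1 [HM1 B1]]; [apply geom_bounded_shift; auto | lra | lra |].
  destruct (U_bound (shift_w (shift_w one_w)) (1 / 2) 1) as [M2 [HM2 B2]];
    [apply geom_bounded_shift, geom_bounded_shift; auto | lra | lra |].
  (* By the heat equation the series is [a] times a quantity bounded by [M1 + M2] on [0, 1]; this
     choice makes it smaller than [e] at the initial parameter [a]. *)
  set (a := Rmin (Rmin v (1 / 2)) (e / (M1 + M2 + 1))).
  assert (Ha : 0 < a).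
  { unfold a. repeat apply Rmin_pos; try lra. apply Rdiv_lt_0_compat; lra. }
  assert (Hav : a <= v) by (unfold a; eapply Rle_trans; [apply Rmin_l | apply Rmin_l]).
  assert (Ha2 : a <= 1 / 2) by (unfold a; eapply Rle_trans; [apply Rmin_l | apply Rmin_r]).
  assert (Hae : a * (M1 + M2) < e).
  { assert (a <= e / (M1 + M2 + 1)) by apply Rmin_r.
    assert (a * (M1 + M2 + 1) <= e).
    { apply Rmult_le_reg_r with (/ (M1 + M2 + 1)); [apply Rinv_0_lt_compat; lra|].
      rewrite Rmult_assoc, Rinv_r by lra. lra. }
    lra. }
  assert (Habs : forall u, a <= u <= v -> Rabs u < 1) by (intros; rewrite Rabs_pos_eq; lra).
  assert (F : U c v x < 0).
  { apply (max_principle c a v 0 1); auto; try lra.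
    - intros y Hy. rewrite EU by (apply Habs; lra).
      assert (Hh := U_heat one_w a y Hone ltac:(apply Habs; lra)).
      unfold Ux, Uxx in Hh.
      assert (X1 : Rabs (U (shift_w one_w) a (- a * y)) <= M1).
      { apply B1; [rewrite Rabs_pos_eq; lra|]. rewrite Rabs_mult, Rabs_Ropp, !Rabs_pos_eq; nra. }
      assert (X2 : Rabs (U (shift_w (shift_w one_w)) a (a ^ 2 * y)) <= M2).
      { apply B2; [rewrite Rabs_pos_eq; lra|]. rewrite Rabs_pos_eq; [nra|]. apply Rmult_le_pos; nra. }
      apply Rabs_le_between in X1. apply Rabs_le_between in X2.
      set (u1 := U (shift_w one_w) a (- a * y)) in *.
      set (u2 := U (shift_w (shift_w one_w)) a (a ^ 2 * y)) in *.
      assert (E1 : U (tri_w one_w) a y = a * (- (y * u1) + - (a ^ 2 * y ^ 2 / 2 * u2))) by lra.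
      assert (- (y * u1) <= M1) by nra.
      assert (0 <= a ^ 2 * y ^ 2 / 2 <= 1) by (assert (0 <= a ^ 2 <= 1) by nra; assert (0 <= y ^ 2 <= 1) by nra; nra).
      assert (- (a ^ 2 * y ^ 2 / 2 * u2) <= M2) by nra.
      assert (U (tri_w one_w) a y <= a * (M1 + M2)) by (rewrite E1; apply Rmult_le_compat_l; lra).
      lra.
    - intros u Hu. rewrite EU by auto.
      assert (U (tri_w one_w) u 0 = 0); [|lra].
      assert (Hh := U_heat one_w u 0 Hone ltac:(auto)). nra.
    - intros u Hu. rewrite EU by auto.
      assert (D := is_derive_U_v one_w u 1 Hone ltac:(lra)).
      apply (is_derive_opp (V := R_NormedModule) (fun v => U one_w v 1)) in D.
      apply (is_derive_nonneg_left _ u _ (u / 2)) in D; [|lra|].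
      + unfold opp in D; simpl in D. unfold Rdiv in D.
        assert (0 < / u) by (apply Rinv_0_lt_compat; lra).
        assert (U (tri_w one_w) u 1 <= 0) by nra. lra.
      + intros w Hw. unfold opp; simpl. apply Ropp_le_contravar. apply th_1_nonincr; lra. }
  rewrite EU in F by (rewrite Rabs_pos_eq; lra). fold e in F. lra.
Qed.

(** The [x]-derivative of [x * th v x]. The heat equation reads [2 v theta_v = x (x theta)''], so
    [zeta_nonpos] says that [x * th v x] is concave on [0, 1], that is, that [chi] is
    nonincreasing. *)
Definition chi (v x : R) : R := th v x + x * Ux one_w v x.

Lemma is_derive_th (v x : R) : 0 < v < 1 -> is_derive (th v) x (Ux one_w v x).
Proof. intros Hv. apply is_derive_U_x; [apply geom_bounded_one | rewrite Rabs_pos_eq; lra]. Qed.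

Lemma is_derive_xth (v x : R) : 0 < v < 1 -> is_derive (fun x => x * th v x) x (chi v x).
Proof.
  intros Hv. unfold chi.
  replace (th v x + x * Ux one_w v x) with (plus (mult 1 (th v x)) (mult x (Ux one_w v x)))
    by (unfold plus, mult; simpl; ring).
  apply (is_derive_mult (fun x : R => x) (th v)).
  - apply (is_derive_id (K := R_AbsRing)).
  - apply is_derive_th; auto.
  - intros; apply Rmult_comm.
Qed.

Lemma is_derive_chi (v x : R) : 0 < v < 1 ->
  is_derive (chi v) x (2 * Ux one_w v x + x * Uxx one_w v x).
Proof.
  intros Hv. unfold chi.
  replace (2 * Ux one_w v x + x * Uxx one_w v x)
    with (plus (Ux one_w v x) (plus (mult 1 (Ux one_w v x)) (mult x (Uxx one_w v x))))
    by (unfold plus, mult; simpl; ring).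
  apply (is_derive_plus (V := R_NormedModule) (th v) (fun x => x * Ux one_w v x)).
  - apply is_derive_th; auto.
  - apply (is_derive_mult (fun x : R => x) (Ux one_w v)).
    + apply (is_derive_id (K := R_AbsRing)).
    + apply is_derive_Ux_x; [apply geom_bounded_one | rewrite Rabs_pos_eq; lra].
    + intros; apply Rmult_comm.
Qed.

Lemma chi_derive_nonpos (v x : R) : 0 < v < 1 -> 0 < x <= 1 -> 2 * Ux one_w v x + x * Uxx one_w v x <= 0.
Proof.
  intros Hv Hx. assert (Z := zeta_nonpos v x Hv ltac:(lra)).
  assert (H := U_heat one_w v x geom_bounded_one ltac:(rewrite Rabs_pos_eq; lra)).
  apply Rmult_le_reg_l with x; lra || nra.
Qed.

Lemma chi_nonincr (v x y : R) : 0 < v < 1 -> 0 <= x -> x <= y -> y <= 1 -> chi v y <= chi v x.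
Proof.
  intros Hv Hx Hxy Hy.
  apply (nonincr_of_derive (chi v) (fun x => 2 * Ux one_w v x + x * Uxx one_w v x)); auto.
  - intros z _. apply is_derive_chi; auto.
  - intros z Hz. apply chi_derive_nonpos; auto. lra.
Qed.

(** For the concave function [x * th v x] the chord from 0 to [x] has slope [th v x], and this is at
    least the slope [th v x + x * Ux one_w v x] of the tangent at [x]. *)
Lemma th_derive_nonpos (v x : R) : 0 < v < 1 -> 0 < x <= 1 -> Ux one_w v x <= 0.
Proof.
  intros Hv Hx.
  destruct (MVT_cor2 (fun x => x * th v x) (chi v) 0 x ltac:(lra)) as [t [E Ht]].
  { intros c _. apply is_derive_Reals, is_derive_xth; auto. }
  assert (H := chi_nonincr v t x Hv ltac:(lra) ltac:(lra) ltac:(lra)). unfold chi at 1 in H.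
  assert (x * Ux one_w v x <= 0) by nra.
  apply Rmult_le_reg_l with x; lra.
Qed.

Lemma th_nonincr (v x y : R) : 0 < v < 1 -> 0 <= x -> x <= y -> y <= 1 -> th v y <= th v x.
Proof.
  intros Hv Hx Hxy Hy. apply (nonincr_of_derive (th v) (Ux one_w v)); auto.
  - intros z _. apply is_derive_th; auto.
  - intros z Hz. apply th_derive_nonpos; auto. lra.
Qed.

(** On [0, 1] by monotonicity and the value at 1. For negative [x] the functional equation adds to 1
    a nonnegative multiple of the value at [- v * x], which lies in [0, 1]. *)
Lemma th_pos_unit (v x : R) : 0 < v < 1 -> -1 <= x <= 1 -> 0 < th v x.
Proof.
  intros Hv Hx.
  assert (P : forall y, 0 <= y <= 1 -> 0 < th v y).
  { intros y Hy. pose proof (th_1_pos v Hv). pose proof (th_nonincr v y 1 Hv ltac:(lra) ltac:(lra) ltac:(lra)). lra. }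
  destruct (Rle_lt_dec 0 x) as [H|H]; [apply P; lra|].
  rewrite th_fe by (rewrite Rabs_pos_eq; lra).
  specialize (P (- v * x) ltac:(nra)).
  assert (0 <= - v * x * th v (- v * x)) by (apply Rmult_le_pos; [nra | lra]). lra.
Qed.

Lemma pow2_unit (v : R) : 0 < v < 1 -> 0 < v ^ 2 < v.
Proof. intros Hv. simpl. rewrite Rmult_1_r. split; nra. Qed.

(** Replace theta at [v ^ 2 * s] in the two-step functional equation by the smaller value at [s] and
    solve for it. *)
Lemma th_upper (v s : R) : 0 < v < 1 -> 0 <= s <= 1 -> th v s <= (1 - v * s) / (1 + v ^ 3 * s ^ 2).
Proof.
  intros Hv Hs. assert (E := th_fe2 v s ltac:(rewrite Rabs_pos_eq; lra)).
  pose proof (pow2_unit v Hv) as V2.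
  assert (M := th_nonincr v (v ^ 2 * s) s Hv ltac:(apply Rmult_le_pos; lra) ltac:(nra) ltac:(lra)).
  assert (P : 0 <= v ^ 3 * s ^ 2) by (apply Rmult_le_pos; apply pow_le; lra).
  apply Rmult_le_reg_r with (1 + v ^ 3 * s ^ 2); [lra|].
  unfold Rdiv. rewrite Rmult_assoc, Rinv_l by lra. nra.
Qed.

(** The chord of [x * th v x] over [[v, 1]] has slope at most [chi v v] by concavity, and the value
    at 1 is positive; hence [chi v v * (1 - v) > - v * th v v]. It remains to see
    [v ^ 2 * th v v < 1 - v], which follows from [th_upper] and [v ^ 2 * (1 + v) < 1 + v ^ 5]. *)
Lemma chi_lower (v : R) : 0 < v < 1 -> -1 < v * chi v v.
Proof.
  intros Hv.
  destruct (MVT_cor2 (fun x => x * th v x) (chi v) v 1 ltac:(lra)) as [t [E Ht]].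
  { intros c _. apply is_derive_Reals, is_derive_xth; auto. }
  assert (H := chi_nonincr v v t Hv ltac:(lra) ltac:(lra) ltac:(lra)).
  pose proof (th_1_pos v Hv). assert (B := th_upper v v Hv ltac:(lra)).
  assert (P : 0 < v ^ 3 * v ^ 2) by (apply Rmult_lt_0_compat; apply pow_lt; lra).
  pose proof (pow2_unit v Hv) as V2.
  assert (B2 : th v v * (1 + v ^ 5) <= (1 - v * v)).
  { apply Rmult_le_compat_r with (r := 1 + v ^ 3 * v ^ 2) in B; [|lra].
    unfold Rdiv in B. rewrite Rmult_assoc, Rinv_l in B by lra.
    replace (v ^ 5) with (v ^ 3 * v ^ 2) by ring. lra. }
  assert (K : - (v * th v v) < chi v v * (1 - v)) by nra.
  assert (V3 : 0 < v ^ 3 < 1) by (replace (v ^ 3) with (v * v ^ 2) by ring; nra).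
  assert (Q0 : 0 < (1 - v ^ 2) * (1 - v ^ 3)) by (apply Rmult_lt_0_compat; lra).
  assert (V5 : 0 < v ^ 5) by (apply pow_lt; lra).
  assert (Q : v ^ 2 * (1 + v) < 1 + v ^ 5).
  { replace (v ^ 5) with (v ^ 2 * v ^ 3) by ring. replace (v ^ 2 * (1 + v)) with (v ^ 2 + v ^ 3) by ring. lra. }
  assert (v ^ 2 * th v v < 1 - v).
  { apply Rmult_lt_reg_r with (1 + v ^ 5); [lra|].
    apply Rle_lt_trans with (v ^ 2 * (1 - v * v)).
    - rewrite Rmult_assoc. apply Rmult_le_compat_l; lra.
    - replace (v ^ 2 * (1 - v * v)) with (v ^ 2 * (1 + v) * (1 - v)) by ring.
      rewrite (Rmult_comm (1 - v)). apply Rmult_lt_compat_r; lra. }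
  assert (- (1 - v) < v * chi v v * (1 - v)) by nra. nra.
Qed.

Lemma chi_lower_le (v s : R) : 0 < v < 1 -> 0 <= s <= v -> -1 < v * chi v s.
Proof.
  intros Hv Hs. pose proof (chi_lower v Hv).
  pose proof (chi_nonincr v s v Hv ltac:(lra) ltac:(lra) ltac:(lra)). nra.
Qed.

(** By the two-step functional equation [th v z / z] is [/ z - v] minus [v] times [x * th v x] taken
    at [v ^ 2 * z]. Up to [/ v] the first term falls at rate at least [v ^ 2], and by [chi_lower_le]
    the last one cannot make up for it, since its argument stays in [[0, v]]. *)
Lemma th_over_x_decr (v x y : R) : 0 < v < 1 -> 0 < x -> x < y -> y <= / v -> th v y / y < th v x / x.
Proof.
  intros Hv Hx Hxy Hy.
  assert (Hvy : v * y <= 1).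
  { apply Rmult_le_reg_l with (/ v); [apply Rinv_0_lt_compat; lra|]. rewrite <- Rmult_assoc, Rinv_l by lra. lra. }
  assert (E : forall z, 0 < z -> th v z / z = / z - v - v * (v ^ 2 * z * th v (v ^ 2 * z))).
  { intros z Hz. rewrite (th_fe2 v z) at 1 by (rewrite Rabs_pos_eq; lra). field. lra. }
  rewrite !E by lra.
  destruct (MVT_cor2 (fun x => x * th v x) (chi v) (v ^ 2 * x) (v ^ 2 * y)) as [t [Et Ht]].
  { apply Rmult_lt_compat_l; nra. }
  { intros c _. apply is_derive_Reals, is_derive_xth; auto. }
  assert (C := chi_lower_le v t Hv ltac:(split; nra)).
  assert (I : / x - / y >= v ^ 2 * (y - x)).
  { replace (/ x - / y) with ((y - x) * / (x * y)) by (field; lra).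
    assert (v ^ 2 <= / (x * y)); [|nra].
    replace (v ^ 2) with (/ (/ v * / v)) by (field; lra).
    apply Rinv_le_contravar; [nra|]. apply Rmult_le_compat; lra. }
  assert (v * (v ^ 2 * y * th v (v ^ 2 * y)) - v * (v ^ 2 * x * th v (v ^ 2 * x)) > - (v ^ 2 * (y - x))).
  { replace (v * (v ^ 2 * y * th v (v ^ 2 * y)) - v * (v ^ 2 * x * th v (v ^ 2 * x)))
      with (v * (chi v t * (v ^ 2 * y - v ^ 2 * x))) by (rewrite <- Et; ring).
    replace (v * (chi v t * (v ^ 2 * y - v ^ 2 * x))) with (v * chi v t * (v ^ 2 * (y - x))) by ring.
    assert (0 < v ^ 2 * (y - x)) by (apply Rmult_lt_0_compat; nra). nra. }
  lra.
Qed.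

Lemma th_inv_v (v : R) : 0 < v < 1 -> th v (/ v) < 0.
Proof.
  intros Hv. rewrite th_fe2 by (rewrite Rabs_pos_eq; lra).
  replace (v ^ 2 * / v) with v by (field; lra). rewrite Rinv_r by lra.
  pose proof (th_pos_unit v v Hv ltac:(lra)).
  assert (0 < v ^ 3 * / v ^ 2) by (apply Rmult_lt_0_compat; [apply pow_lt; lra | apply Rinv_0_lt_compat, pow_lt; lra]).
  rewrite pow_inv. nra.
Qed.

Lemma inv_v_gt1 (v : R) : 0 < v < 1 -> 1 < / v.
Proof. intros Hv. rewrite <- Rinv_1. apply Rinv_lt_contravar; lra. Qed.

(** Existence is the intermediate value theorem; uniqueness and the signs follow from the strict
    decrease of [th v x / x]. For simplicity the two-step functional equation is differentiated: a
    double zero would force [x1 ^ 2 * v ^ 2 * (v * chi v (v ^ 2 * x1)) = -1], although [v * x1 < 1]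
    and the bracket exceeds -1. *)
Lemma first_zero (v : R) : 0 < v < 1 ->
  exists x1, 1 < x1 < / v /\ th v x1 = 0 /\ Ux one_w v x1 <> 0 /\
    (forall x, -1 <= x < x1 -> 0 < th v x) /\ (forall x, x1 < x <= / v -> th v x < 0).
Proof.
  intros Hv. pose proof (inv_v_gt1 v Hv).
  pose proof (th_pos_unit v 1 Hv ltac:(lra)). pose proof (th_inv_v v Hv).
  destruct (IVT (fun x => - th v x) 1 (/ v)) as [x1 [Hx1 E]]; try lra.
  { intros x. apply (continuity_pt_opp (th v)). apply U_cont_x; [apply geom_bounded_one | rewrite Rabs_pos_eq; lra]. }
  assert (E' : th v x1 = 0) by lra. clear E.
  assert (x1 <> 1) by (intros ->; lra). assert (x1 <> / v) by (intros ->; lra).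
  exists x1. split; [lra|]. split; auto. split; [|split].
  - assert (D : is_derive (th v) x1 (- v - v * (v ^ 2 * x1 * th v (v ^ 2 * x1)) - v * x1 * (v ^ 2 * chi v (v ^ 2 * x1)))).
    { apply (is_derive_ext (fun x => 1 - v * x - v * x * (v ^ 2 * x * th v (v ^ 2 * x)))).
      { intros t. rewrite (th_fe2 v t) by (rewrite Rabs_pos_eq; lra). Req. ring. }
      assert (Dm : is_derive (fun x => v ^ 2 * x * th v (v ^ 2 * x)) x1 (v ^ 2 * chi v (v ^ 2 * x1))).
      { apply (is_derive_comp (fun x => x * th v x) (fun x => v ^ 2 * x)).
        - apply is_derive_xth; auto.
        - auto_derive; auto. ring. }
      set (mm := fun x => v ^ 2 * x * th v (v ^ 2 * x)) in *.
      change (is_derive (fun x => 1 - v * x - v * x * mm x) x1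
        (- v - v * mm x1 - v * x1 * (v ^ 2 * chi v (v ^ 2 * x1)))).
      set (l := v ^ 2 * chi v (v ^ 2 * x1)) in *.
      apply (is_derive_ext (fun x => plus (1 - v * x) (opp (mult (v * x) (mm x)))));
        [intros t; unfold plus, opp, mult; simpl; Req; ring|].
      replace (- v - v * mm x1 - v * x1 * l)
        with (plus (- v) (opp (plus (mult v (mm x1)) (mult (v * x1) l))))
        by (unfold plus, opp, mult; simpl; ring).
      apply (is_derive_plus (V := R_NormedModule) (fun x => 1 - v * x)); [auto_derive; auto; ring|].
      apply (is_derive_opp (V := R_NormedModule)).
      apply (is_derive_mult (fun x => v * x) mm); auto; [auto_derive; auto; ring | intros; apply Rmult_comm]. }
    assert (Ev : Ux one_w v x1 = - v - v * (v ^ 2 * x1 * th v (v ^ 2 * x1)) - v * x1 * (v ^ 2 * chi v (v ^ 2 * x1))).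
    { rewrite <- (is_derive_unique _ _ _ D). symmetry. apply is_derive_unique, is_derive_th; auto. }
    rewrite Ev. assert (F := th_fe2 v x1 ltac:(rewrite Rabs_pos_eq; lra)). rewrite E' in F.
    assert (Hvx : v * x1 < 1).
    { apply Rmult_lt_reg_l with (/ v); [apply Rinv_0_lt_compat; lra|]. rewrite <- Rmult_assoc, Rinv_l by lra. lra. }
    assert (C := chi_lower_le v (v ^ 2 * x1) Hv ltac:(split; nra)).
    intros Z. assert (Z2 : x1 * (- v - v * (v ^ 2 * x1 * th v (v ^ 2 * x1)) - v * x1 * (v ^ 2 * chi v (v ^ 2 * x1))) = 0)
      by (rewrite Z; ring).
    assert (x1 ^ 2 * v ^ 2 * (v * chi v (v ^ 2 * x1)) = -1) by nra.
    assert (0 < x1 ^ 2 * v ^ 2 < 1).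
    { replace (x1 ^ 2 * v ^ 2) with ((v * x1) * (v * x1)) by ring. assert (0 < v * x1) by nra. nra. }
    nra.
  - intros x Hx. destruct (Rle_lt_dec x 1); [apply th_pos_unit; auto; lra|].
    assert (D := th_over_x_decr v x x1 Hv ltac:(lra) ltac:(lra) ltac:(lra)).
    rewrite E' in D. unfold Rdiv in D. rewrite Rmult_0_l in D.
    apply Rmult_lt_reg_r with (/ x); [apply Rinv_0_lt_compat; lra | lra].
  - intros x Hx. assert (D := th_over_x_decr v x1 x Hv ltac:(lra) ltac:(lra) ltac:(lra)).
    rewrite E' in D. unfold Rdiv in D. rewrite Rmult_0_l in D.
    apply Rmult_lt_reg_r with (/ x); [apply Rinv_0_lt_compat; lra | lra].
Qed.

(** * Zones *)

(** All real zeros except [x_1] lie in the zones [k >= 1]: zone [k] is the interval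
    [v ^ (1 - cz k) < x < v ^ (- 1 - cz k)] of the half-line of sign [sg k]. It houses the two zeros
    that coalesce for the [k]-th spectral value, and [w v k] is theta with its signs normalised so
    that it is negative at both ends of the zone. *)
Definition cz (k : nat) : nat := if Nat.even k then (2 * k)%nat else (2 * k + 1)%nat.
Definition sg (k : nat) : R := (-1) ^ k.
Definition w (v : R) (k : nat) (x : R) : R := sg k * th v (sg k * x).
Definition inz (v : R) (k : nat) (x : R) : Prop := v < v ^ cz k * x < / v.

Lemma even_cases (k : nat) : (exists l, k = (2 * l)%nat /\ cz k = (2 * (2 * l))%nat /\ sg k = 1) \/
  (exists l, k = (2 * l + 1)%nat /\ cz k = (2 * (2 * l + 1) + 1)%nat /\ sg k = -1).
Proof.
  destruct (Nat.even k) eqn:E.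
  - left. apply Nat.even_spec in E as [l ->]. exists l. repeat split; auto.
    + unfold cz. rewrite (proj2 (Nat.even_spec (2 * l))); auto. exists l; auto.
    + unfold sg. rewrite pow_mult. replace ((-1) ^ 2) with 1 by ring. apply pow1.
  - right. destruct (Nat.Even_or_Odd k) as [H|[l ->]].
    + apply Nat.even_spec in H. congruence.
    + exists l. repeat split; auto.
      * unfold cz. rewrite E. auto.
      * unfold sg. rewrite pow_add, pow_mult. replace ((-1) ^ 2) with 1 by ring. rewrite pow1. ring.
Qed.

Lemma cz_ge (k : nat) : (2 * k <= cz k <= 2 * k + 1)%nat.
Proof. unfold cz. destruct (Nat.even k); lia. Qed.

Lemma sg_sq (k : nat) : sg k * sg k = 1.
Proof. destruct (even_cases k) as [[l [_ [_ ->]]]|[l [_ [_ ->]]]]; ring. Qed.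

Lemma sg_cases (k : nat) : sg k = 1 \/ sg k = -1.
Proof. destruct (even_cases k) as [[l [_ [_ ->]]]|[l [_ [_ ->]]]]; auto. Qed.

(** The half of [St] by which it differs from theta, as seen from zone [k]. Its positivity for
    [x >= 1] makes [w] negative wherever the normalised [St] is not positive. *)
Definition gz (v : R) (k : nat) (x : R) : R := th v (sg k / x) / x.

Lemma w_split (v : R) (k : nat) (x : R) : 0 < x -> w v k x = sg k * St v (sg k * x) - gz v k x.
Proof.
  intros Hx. unfold w, gz, St. destruct (sg_cases k) as [-> | ->].
  - replace (1 * x) with x by ring. replace (1 / x) with (/ x) by (field; lra). ring.
  - replace (-1 * x) with (- x) by ring. replace (/ - x) with (-1 / x) by (field; lra). field. lra.
Qed.

Lemma gz_pos (v : R) (k : nat) (x : R) : 0 < v < 1 -> 1 <= x -> 0 < gz v k x.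
Proof.
  intros Hv Hx. unfold gz. apply Rdiv_lt_0_compat; [|lra]. apply th_pos_unit; auto.
  assert (0 < / x <= 1) by (split; [apply Rinv_0_lt_compat; lra | rewrite <- Rinv_1; apply Rinv_le_contravar; lra]).
  unfold Rdiv. destruct (sg_cases k) as [-> | ->]; lra.
Qed.

(** Functional equations change [St] by explicit monomials, so every zone is moved to the same
    interval of the variable [t = v ^ cz k * x]; for odd [k] one application of [St_neg] first
    changes the sign of the argument. The bound on [A] expresses that [St] grows super-geometrically
    from zone to zone, which [w_pos_inner] exploits. *)
Lemma St_sign_scale (v : R) (k : nat) (x : R) : 0 < v < 1 -> (1 <= k)%nat -> 0 < x ->
  exists A, 0 < A /\ sg k * St v (sg k * x) = A * St v (v ^ cz k * x) /\
    (v <= v ^ cz k * x -> / v ^ (k * (k - 1)) <= A).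
Proof.
  intros Hv Hk Hx.
  assert (Hp : forall n, 0 < v ^ n) by (intros; apply pow_lt; lra).
  assert (Ht : 0 < v ^ cz k * x) by (apply Rmult_lt_0_compat; auto).
  set (t := v ^ cz k * x) in *.
  assert (Hlow : forall a b, (a + k * (k - 1) <= b)%nat -> v <= t -> / v ^ (k * (k - 1)) <= t ^ a / v ^ b).
  { intros a b Hab Hvt. apply Rle_trans with (v ^ a / v ^ b).
    - replace b with (a + k * (k - 1) + (b - a - k * (k - 1)))%nat by lia. rewrite !pow_add.
      replace (v ^ a / (v ^ a * v ^ (k * (k - 1)) * v ^ (b - a - k * (k - 1))))
        with (/ (v ^ (k * (k - 1)) * v ^ (b - a - k * (k - 1)))) by (field; repeat split; apply Rgt_not_eq, Hp).
      apply Rinv_le_contravar; [apply Rmult_lt_0_compat; apply Hp|].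
      rewrite <- (Rmult_1_r (v ^ (k * (k - 1)))) at 2. apply Rmult_le_compat_l; [apply Rlt_le, Hp|].
      apply pow_le_one; lra.
    - apply Rmult_le_compat_r; [apply Rlt_le, Rinv_0_lt_compat, Hp|]. apply pow_incr. lra. }
  destruct (even_cases k) as [[l [-> [Ec ->]]]|[l [-> [Ec ->]]]].
  - exists (t ^ (2 * (2 * l)) / v ^ (2 * l * (2 * (2 * l) - 1))). split; [|split].
    + apply Rdiv_lt_0_compat; auto. apply pow_lt; auto.
    + replace (1 * x) with (t / v ^ (2 * (2 * l))).
      2: { unfold t. rewrite Ec. field. apply Rgt_not_eq, Hp. }
      rewrite St_scale; [|auto|lra].
      replace ((-1) ^ (2 * l)) with 1; [ring|].
      rewrite pow_mult. replace ((-1) ^ 2) with 1 by ring. now rewrite pow1.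
    + intros Hvt. apply Hlow; auto. nia.
  - exists (t ^ S (2 * (2 * l + 1)) / v ^ (2 * (2 * l + 1) + (2 * l + 1) * (2 * (2 * l + 1) - 1))). split; [|split].
    + apply Rdiv_lt_0_compat; auto. apply pow_lt; auto.
    + replace (2 * (2 * l + 1) + 1)%nat with (S (2 * (2 * l + 1))) in Ec by lia.
      assert (Et : t = v * v ^ (2 * (2 * l + 1)) * x) by (unfold t; rewrite Ec; reflexivity).
      assert (Hn : v ^ (2 * (2 * l + 1)) <> 0) by apply Rgt_not_eq, Hp.
      replace (-1 * x) with (- x) by ring. rewrite St_neg by lra.
      replace (St v (v * x)) with (St v (t / v ^ (2 * (2 * l + 1)))).
      2: { f_equal. rewrite Et. field. auto. }
      rewrite St_scale; [|auto|lra].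
      replace ((-1) ^ (2 * l + 1)) with (-1).
      2: { rewrite pow_add, pow_mult. replace ((-1) ^ 2) with 1 by ring. rewrite pow1. ring. }
      rewrite pow_add, <- tech_pow_Rmult.
      generalize (t ^ (2 * (2 * l + 1))) (St v t). intros p r. rewrite Et. field.
      split; auto. apply Rgt_not_eq, Hp.
    + intros Hvt. apply Hlow; auto.
      replace (2 * l + 1 - 1)%nat with (2 * l)%nat by lia. nia.
Qed.

Lemma St_nonneg_mid (v t : R) : 0 < v < 1 -> v <= t <= / v -> 0 <= St v t.
Proof.
  intros Hv Ht. destruct (St_lower v Hv) as [c [Hc H]]. specialize (H t Ht).
  assert (0 <= c * ((1 - v * t) * (1 - v / t))); [|lra].
  apply Rmult_le_pos; [lra|]. apply Rmult_le_pos.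
  - assert (v * t <= v * / v) by (apply Rmult_le_compat_l; lra). rewrite Rinv_r in H0 by lra. lra.
  - assert (v / t <= 1); [|lra]. apply Rmult_le_reg_r with t; [lra|]. unfold Rdiv.
    rewrite Rmult_assoc, Rinv_l by lra. lra.
Qed.

(** One use of [St_fe2] relates these neighbouring intervals to the middle one, where [St] is
    nonnegative, and its factor [- v ^ 3 * y ^ 2] reverses the sign. The term [- gz] makes the
    inequality strict also at the ends, where [St] vanishes. *)
Lemma w_neg_outside (v : R) (k : nat) (x : R) : 0 < v < 1 -> (1 <= k)%nat -> 1 <= x ->
  v ^ 3 <= v ^ cz k * x <= v \/ / v <= v ^ cz k * x <= / v ^ 3 -> w v k x < 0.
Proof.
  intros Hv Hk Hx Ht. rewrite w_split by lra.
  assert (G := gz_pos v k x Hv Hx).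
  destruct (St_sign_scale v k x Hv Hk ltac:(lra)) as [A [HA [E _]]]. rewrite E.
  assert (Hp : forall n, 0 < v ^ n) by (intros; apply pow_lt; lra).
  set (t := v ^ cz k * x) in *.
  assert (Ht0 : 0 < t) by (unfold t; apply Rmult_lt_0_compat; [auto | lra]).
  enough (St v t <= 0) by nra.
  destruct Ht as [Ht|Ht].
  - set (u := t / v ^ 2).
    assert (Et : t = v ^ 2 * u) by (unfold u; field; lra).
    assert (Hu : v <= u <= / v).
    { unfold u. split.
      - apply Rmult_le_reg_r with (v ^ 2); [auto|]. unfold Rdiv. rewrite Rmult_assoc, Rinv_l by (apply Rgt_not_eq, Hp).
        replace (v * v ^ 2) with (v ^ 3) by ring. lra.
      - apply Rmult_le_reg_r with (v ^ 2); [auto|]. unfold Rdiv. rewrite Rmult_assoc, Rinv_l by (apply Rgt_not_eq, Hp).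
        replace (/ v * v ^ 2) with v by (field; lra). lra. }
    assert (S0 := St_nonneg_mid v u Hv Hu). rewrite St_fe2 in S0 by lra. rewrite <- Et in S0.
    assert (0 < v ^ 3 * u ^ 2) by (apply Rmult_lt_0_compat; apply pow_lt; lra). nra.
  - rewrite St_fe2 by lra.
    assert (S0 := St_nonneg_mid v (v ^ 2 * t) Hv).
    assert (0 <= St v (v ^ 2 * t)).
    { apply S0. split.
      - replace v with (v ^ 2 * / v) at 1 by (field; lra). apply Rmult_le_compat_l; [apply Rlt_le, Hp | lra].
      - replace (/ v) with (v ^ 2 * / v ^ 3) by (field; lra). apply Rmult_le_compat_l; [apply Rlt_le, Hp | lra]. }
    assert (0 < v ^ 3 * t ^ 2) by (apply Rmult_lt_0_compat; apply pow_lt; lra). nra.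
Qed.

Lemma inz_ge (v : R) (k : nat) (x : R) : 0 < v < 1 -> (1 <= k)%nat -> v <= v ^ cz k * x -> / v <= x.
Proof.
  intros Hv Hk Hx. pose proof (cz_ge k).
  assert (Hp : 0 < v ^ cz k) by (apply pow_lt; lra).
  assert (v ^ cz k <= v ^ 2) by (apply pow_le_anti; [lra|lia]).
  assert (0 < x) by (apply Rmult_lt_reg_l with (v ^ cz k); lra).
  assert (v <= v ^ 2 * x) by (apply Rle_trans with (v ^ cz k * x); auto; apply Rmult_le_compat_r; lra).
  apply Rmult_le_reg_l with (v ^ 2); [apply pow_lt; lra|].
  replace (v ^ 2 * / v) with v by (field; lra). auto.
Qed.

Lemma level_exists (v y : R) : 0 < v < 1 -> 1 <= y -> exists n, 1 <= v ^ n * y /\ v ^ S n * y < 1.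
Proof.
  intros Hv Hy.
  destruct (pow_small v (/ y)) as [N HN]; [lra | apply Rinv_0_lt_compat; lra |].
  assert (H : exists n, v ^ S n * y < 1).
  { exists N. specialize (HN (S N) ltac:(lia)). apply Rmult_lt_compat_r with (r := y) in HN; [|lra].
    rewrite Rinv_l in HN by lra. auto. }
  destruct H as [n Hn]. induction n as [|n IH].
  - exists O. simpl in *. lra.
  - destruct (Rle_lt_dec 1 (v ^ S n * y)) as [H|H]; [exists (S n); auto | auto].
Qed.

(** On each half-line the intervals [v ^ 3 <= v ^ cz k * x <= / v ^ 3] cover everything beyond the
    first zero's range, and outside the zone itself [w_neg_outside] excludes zeros there. *)
Lemma zero_location (v y : R) : 0 < v < 1 -> th v y = 0 ->
  1 < y < / v \/ exists k x, (1 <= k)%nat /\ y = sg k * x /\ inz v k x.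
Proof.
  intros Hv Hy.
  assert (Hp : forall n, 0 < v ^ n) by (intros; apply pow_lt; lra).
  pose proof (inv_v_gt1 v Hv) as Hi.
  assert (Key : forall k x, (1 <= k)%nat -> 1 <= x -> y = sg k * x -> v ^ 3 <= v ^ cz k * x <= / v ^ 3 ->
     1 < y < / v \/ exists k x, (1 <= k)%nat /\ y = sg k * x /\ inz v k x).
  { intros k x Hk Hx Ey Ht. right. exists k, x. repeat split; auto.
    - destruct (Rle_lt_dec (v ^ cz k * x) v) as [H|H]; auto. exfalso.
      assert (W := w_neg_outside v k x Hv Hk Hx ltac:(left; lra)). unfold w in W. rewrite <- Ey, Hy in W. lra.
    - destruct (Rle_lt_dec (/ v) (v ^ cz k * x)) as [H|H]; auto. exfalso.
      assert (W := w_neg_outside v k x Hv Hk Hx ltac:(right; lra)). unfold w in W. rewrite <- Ey, Hy in W. lra. }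
  assert (Hb : Rabs y > 1).
  { destruct (Rle_lt_dec (Rabs y) 1) as [H|H]; auto. apply Rabs_le_between in H.
    pose proof (th_pos_unit v y Hv H). lra. }
  destruct (level_exists v (Rabs y) Hv ltac:(lra)) as [n [Hn1 Hn2]].
  set (x := Rabs y) in *.
  (* A zone can serve if its exponent [cz k] lies between [n - 1] and [n + 3]. The exponents are
     [4 l] on the positive half-line and [4 l + 3] on the negative one, so rounding [n] modulo 4
     always finds one. *)
  assert (Hrange : forall c, (n - 1 <= c)%nat -> (c <= n + 3)%nat -> v ^ 3 <= v ^ c * x <= / v ^ 3).
  { intros c Hc1 Hc2. split.
    - apply Rle_trans with (v ^ (n + 3) * x).
      + rewrite pow_add, (Rmult_comm (v ^ n)), Rmult_assoc. rewrite <- (Rmult_1_r (v ^ 3)) at 1.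
        apply Rmult_le_compat_l; auto. apply Rlt_le, Hp.
      + apply Rmult_le_compat_r; [lra|]. apply pow_le_anti; [lra|lia].
    - apply Rle_trans with (v ^ (n - 1) * x).
      + apply Rmult_le_compat_r; [lra|]. apply pow_le_anti; [lra|lia].
      + apply Rmult_le_reg_l with (v ^ 3); auto. rewrite Rinv_r by (apply Rgt_not_eq, Hp).
        apply Rle_trans with (v ^ S n * x); [|lra].
        rewrite <- Rmult_assoc, <- pow_add. apply Rmult_le_compat_r; [lra|].
        apply pow_le_anti; [lra|lia]. }
  destruct (Rle_lt_dec 0 y) as [Hy0|Hy0].
  - assert (Ey : y = x) by (unfold x; rewrite Rabs_pos_eq; auto).
    destruct (Rlt_le_dec y (/ v)) as [Hlt|Hge]; [left; lra|].
    assert (Hn0 : (1 <= n)%nat).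
    { destruct n as [|n]; [|lia]. exfalso.
      assert (1 <= v ^ 1 * x); [|lra]. rewrite pow_1, <- Ey. replace 1 with (v * / v) at 1 by (field; lra).
      apply Rmult_le_compat_l; lra. }
    set (l := ((n + 2) / 4)%nat).
    assert (Hl : (n + 2 = 4 * l + (n + 2) mod 4)%nat) by (apply Nat.div_mod; lia).
    assert (Hm : ((n + 2) mod 4 < 4)%nat) by (apply Nat.mod_upper_bound; lia).
    destruct (le_lt_dec 3 ((n + 2) mod 4)) as [H3|H3].
    + destruct (even_cases (2 * (l + 1))) as [[l' [E1 [E2 E3]]]|[l' [E1 _]]]; [|lia].
      apply (Key (2 * (l + 1))%nat x); auto; try lia; try lra; [rewrite E3; lra|].
      apply Hrange; lia.
    + destruct (even_cases (2 * l)) as [[l' [E1 [E2 E3]]]|[l' [E1 _]]]; [|lia].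
      apply (Key (2 * l)%nat x); auto; try lia; try lra; [rewrite E3; lra|].
      apply Hrange; lia.
  - assert (Ey : y = - x) by (unfold x; rewrite Rabs_left; lra).
    set (l := (n / 4)%nat).
    assert (Hl : (n = 4 * l + n mod 4)%nat) by (apply Nat.div_mod; lia).
    assert (Hm : (n mod 4 < 4)%nat) by (apply Nat.mod_upper_bound; lia).
    destruct (even_cases (2 * l + 1)) as [[l' [E1 _]]|[l' [E1 [E2 E3]]]]; [lia|].
    apply (Key (2 * l + 1)%nat x); auto; try lia; try lra; [rewrite E3; lra|].
    apply Hrange; lia.
Qed.

(** * Existence of a zone forces the next one *)

(** Multiplying by [v ^ 6] and using [v ^ 3 * x >= 1] gives [1 - v ^ 4 <= v ^ 9], which fails for
    [v <= 0.89]. Moreover [x ^ 2 <= x + 1], so [x] is at most the golden ratio; the last inequality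
    is this bound for [/ x]. *)
Lemma sq_le_golden (v x : R) : 0 < v < 1 -> / v ^ 3 <= x -> x ^ 2 <= v * x + v ^ 3 ->
  0.89 < v /\ 1 < x /\ 1 <= / x + (/ x) ^ 2.
Proof.
  intros Hv Hx H.
  assert (P3 : 0 < v ^ 3) by (apply pow_lt; lra).
  assert (X1 : 1 < x).
  { apply Rlt_le_trans with (/ v ^ 3); auto. rewrite <- Rinv_1. apply Rinv_lt_contravar; [lra|].
    apply pow_lt_1_compat; [lra|lia]. }
  assert (Hx3 : 1 <= v ^ 3 * x).
  { apply Rmult_le_reg_l with (/ v ^ 3); [apply Rinv_0_lt_compat; auto|].
    rewrite <- Rmult_assoc, Rinv_l, Rmult_1_r, Rmult_1_l by lra. auto. }
  split; [|split; auto].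
  - destruct (Rlt_le_dec 0.89 v) as [|Hc]; auto. exfalso.
    assert (H9 : 1 - v ^ 4 <= v ^ 9).
    { assert (v ^ 3 * x * (v ^ 3 * x - v ^ 4) <= v ^ 9).
      { replace (v ^ 9) with (v ^ 6 * v ^ 3) by ring.
        replace (v ^ 3 * x * (v ^ 3 * x - v ^ 4)) with (v ^ 6 * (x ^ 2 - v * x)) by ring.
        apply Rmult_le_compat_l; [apply pow_le|]; lra. }
      assert (0 < v ^ 4 <= 1) by (split; [apply pow_lt; lra | apply pow_le_one; lra]). nra. }
    assert (v ^ 4 <= 0.89 ^ 4) by (apply pow_incr; lra).
    assert (v ^ 9 <= 0.89 ^ 9) by (apply pow_incr; lra). lra.
  - assert (0 < / x) by (apply Rinv_0_lt_compat; lra).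
    assert (v ^ 3 <= 1) by (apply pow_le_one; lra).
    apply Rmult_le_reg_l with (x ^ 2); [apply pow_lt; lra|].
    replace (x ^ 2 * (/ x + (/ x) ^ 2)) with (x + 1) by (field; lra). nra.
Qed.

(** Two consecutive factors of the triple product at [x], for [d = x - / (v x)] and [a = v ^ (2 i + 2)]. *)
Definition Fp (v d a : R) : R :=
  (1 - a) * (1 + v * a) * ((1 + a * d - a ^ 2 / v) * (1 - v * a * d - v * a ^ 2)).

Lemma tf_pair (v x d : R) (i : nat) : 0 < v < 1 -> 0 < x -> d = x - / (v * x) ->
  tf v x (2 * i + 1) * tf v x (2 * i + 2) = Fp v d (v ^ (2 * i + 2)).
Proof.
  intros Hv Hx ->. unfold tf, Fp.
  set (a := v ^ (2 * i)). assert (E : (- v) ^ (2 * i) = a) by (unfold a; rewrite !pow_mult; f_equal; ring).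
  replace (S (2 * i + 1)) with (2 * i + 2)%nat by lia.
  replace (S (2 * i + 2)) with (2 * i + 3)%nat by lia.
  rewrite !pow_add, E. fold a. field. lra.
Qed.

(** In the estimate by 1 the prefactor is at most [1 - a * (1 - v)], while the other two factors
    together are at most [1 + a * (1 - v)]. If the last factor [C] is negative, then
    [- C <= 2 * a - 1] and [B <= 5 / 4], and the product is below one half in any case. The bound
    0.627 is 0.89 to the fourth power, rounded down. *)
Lemma Fp_bounds (v d a : R) : 0 < v < 1 -> 0 < d <= v -> 0 < a <= v ^ 2 ->
  Rabs (Fp v d a) <= 1 /\ (0.627 <= a -> 0.89 <= v -> Rabs (Fp v d a) <= 1 / 2).
Proof.
  intros Hv Hd Ha. pose proof (pow2_unit v Hv) as V2.
  assert (Ha1 : a < 1) by lra.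
  assert (Hav : a / v <= v).
  { apply Rmult_le_reg_r with v; [lra|]. unfold Rdiv. rewrite Rmult_assoc, Rinv_l by lra.
    replace (v * v) with (v ^ 2) by ring. lra. }
  assert (Hav2 : a <= a / v).
  { apply Rmult_le_reg_r with v; [lra|]. unfold Rdiv. rewrite Rmult_assoc, Rinv_l by lra. nra. }
  replace (Fp v d a) with ((1 - a) * (1 + v * a) * ((1 + a * d - a * (a / v)) * (1 - v * a * d - v * a ^ 2)))
    by (unfold Fp; field; lra).
  set (u := a / v) in *.
  set (A := (1 - a) * (1 + v * a)). set (B := 1 + a * d - a * u). set (C := 1 - v * a * d - v * a ^ 2).
  assert (Hva : 0 < v * a < a) by (split; nra).
  assert (Haa : 0 < a ^ 2) by (apply pow_lt; lra).
  assert (Hva2 : 0 < v * a ^ 2) by (apply Rmult_lt_0_compat; lra).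
  assert (Had : 0 < a * d <= a) by (split; nra).
  assert (Hau : a ^ 2 <= a * u <= a * v) by (split; [replace (a ^ 2) with (a * a) by ring|]; apply Rmult_le_compat_l; lra).
  assert (Hvad : 0 < v * a * d) by (apply Rmult_lt_0_compat; lra).
  assert (HA : 0 < A <= 1 - a * (1 - v)).
  { unfold A. split; [apply Rmult_lt_0_compat; lra|].
    replace ((1 - a) * (1 + v * a)) with (1 - a * (1 - v) - v * a ^ 2) by ring. lra. }
  assert (HA2 : A <= 1 - a ^ 2).
  { unfold A. replace (1 - a ^ 2) with ((1 - a) * (1 + a)) by ring. apply Rmult_le_compat_l; lra. }
  assert (HB : 0 < B) by (unfold B; lra).
  assert (HB1 : B <= 1 + a * d) by (unfold B; lra).
  assert (HB2 : B <= 1 + a - a ^ 2) by (unfold B; lra).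
  rewrite Rabs_mult, Rabs_mult, (Rabs_pos_eq A), (Rabs_pos_eq B) by lra.
  destruct (Rle_lt_dec 0 C) as [HC|HC].
  - rewrite Rabs_pos_eq by auto.
    assert (HC1 : C <= 1 - v * a * d) by (unfold C; lra).
    assert (HC2 : C <= 1 - v * a ^ 2) by (unfold C; lra).
    split.
    + assert (K1 : B * C <= 1 + a * d * (1 - v)).
      { apply Rle_trans with ((1 + a * d) * (1 - v * a * d)); [apply Rmult_le_compat; lra|].
        assert (0 <= v * (a * d) ^ 2) by (apply Rmult_le_pos; [lra | apply pow2_ge_0]). lra. }
      assert (K2 : B * C <= 1 + a * (1 - v)).
      { assert (a * d * (1 - v) <= a * (1 - v)) by (apply Rmult_le_compat_r; lra). lra. }
      assert (0 <= B * C) by (apply Rmult_le_pos; lra).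
      apply Rle_trans with ((1 - a * (1 - v)) * (1 + a * (1 - v))).
      * apply Rmult_le_compat; lra.
      * assert (0 <= (a * (1 - v)) ^ 2) by apply pow2_ge_0. lra.
    + intros Ha2 Hv2.
      assert (A2 : 0.627 ^ 2 <= a ^ 2) by (apply pow_incr; lra).
      (* The numbers 0.607, 1.234 and 0.6503 are, rounded up, [1 - a ^ 2], [1 + a - a ^ 2] and
         [1 - v * a ^ 2] at [a = 0.627], with [v = 0.89] and [a ^ 2] replaced by 0.393; their
         product is about 0.487. *)
      assert (A <= 0.607) by lra.
      assert (0 <= (a - 0.627) * (a - 0.373)) by (apply Rmult_le_pos; lra).
      assert (B <= 1.234) by lra.
      assert (0.89 * 0.393 <= v * a ^ 2) by (apply Rmult_le_compat; lra).
      assert (C <= 0.6503) by lra.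
      assert (B * C <= 1.234 * 0.6503) by (apply Rmult_le_compat; lra).
      apply Rle_trans with (0.607 * (1.234 * 0.6503)); [|lra].
      apply Rmult_le_compat; try lra. apply Rmult_le_pos; lra.
  - rewrite Rabs_left by auto.
    assert (v * a * d <= a) by (assert (v * a * d <= v * a) by nra; lra).
    assert (v * a ^ 2 <= a) by (replace (v * a ^ 2) with (v * a * a) by ring; nra).
    assert (HC1 : - C <= 2 * a - 1) by (unfold C; lra).
    assert (0 <= (a - 1 / 2) ^ 2) by apply pow2_ge_0.
    assert (B <= 5 / 4) by lra.
    assert (A * (B * - C) <= 1 / 2).
    { assert (K : B * - C <= 5 / 4 * (2 * a - 1)) by (apply Rmult_le_compat; lra).
      assert (0 <= B * - C) by (apply Rmult_le_pos; lra).
      apply Rle_trans with ((1 - a ^ 2) * (5 / 4 * (2 * a - 1))); [apply Rmult_le_compat; lra|].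
      assert (1 / 2 < a) by lra.
      assert (0 <= (a - 3 / 4) ^ 2) by apply pow2_ge_0.
      assert ((1 - a) * (2 * a - 1) <= 1 / 8) by lra.
      replace ((1 - a ^ 2) * (5 / 4 * (2 * a - 1))) with ((1 + a) * (5 / 4) * ((1 - a) * (2 * a - 1))) by ring.
      assert (0 <= (1 - a) * (2 * a - 1)) by (apply Rmult_le_pos; lra).
      apply Rle_trans with (2 * (5 / 4) * (1 / 8)); [|lra]. apply Rmult_le_compat; lra. }
    split; intros; lra.
Qed.

(** One step of [th_fe2], with the remaining value of theta estimated by [th_upper] and the
    denominator cleared. *)
Lemma th_lower (v s : R) : 0 < v < 1 -> 0 <= s <= 1 ->
  1 - v * s - v ^ 3 * s ^ 2 * (1 - v ^ 4) + v ^ 6 * s ^ 3 * (1 - v ^ 2) <= th v s * (1 + v ^ 7 * s ^ 2).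
Proof.
  intros Hv Hs. pose proof (pow2_unit v Hv) as V2.
  rewrite th_fe2 by (rewrite Rabs_pos_eq; lra).
  assert (H := th_upper v (v ^ 2 * s) Hv ltac:(split; nra)).
  set (D := 1 + v ^ 7 * s ^ 2).
  assert (HD : 0 < D).
  { unfold D. assert (0 <= v ^ 7 * s ^ 2) by (apply Rmult_le_pos; apply pow_le; lra). lra. }
  replace (v ^ 3 * (v ^ 2 * s) ^ 2) with (v ^ 7 * s ^ 2) in H by ring. fold D in H.
  apply Rmult_le_compat_r with (r := D) in H; [|lra].
  unfold Rdiv in H. rewrite Rmult_assoc, Rinv_l, Rmult_1_r in H by lra.
  assert (P : 0 <= v ^ 3 * s ^ 2) by (apply Rmult_le_pos; apply pow_le; lra).
  apply Rmult_le_compat_l with (r := v ^ 3 * s ^ 2) in H; auto.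
  replace ((1 - v * s - v ^ 3 * s ^ 2 * th v (v ^ 2 * s)) * D)
    with ((1 - v * s) * D - v ^ 3 * s ^ 2 * (th v (v ^ 2 * s) * D)) by ring.
  unfold D in *.
  replace (1 - v * s - v ^ 3 * s ^ 2 * (1 - v ^ 4) + v ^ 6 * s ^ 3 * (1 - v ^ 2))
    with ((1 - v * s) * (1 + v ^ 7 * s ^ 2) - v ^ 3 * s ^ 2 * (1 - v * (v ^ 2 * s))) by ring. lra.
Qed.

(** Otherwise [St v x <= d / 8 < th v (/ x) / x] with [d = x - / (v x)], that is, [th v x < 0]. *)
Lemma golden (v x : R) : 0 < v < 1 -> / v ^ 3 <= x -> 0 <= th v x -> v * x + v ^ 3 < x ^ 2.
Proof.
  intros Hv Hx Hth.
  destruct (Rlt_le_dec (v * x + v ^ 3) (x ^ 2)) as [|H]; auto. exfalso.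
  destruct (sq_le_golden v x Hv Hx H) as [V89 [X1 Hs1]].
  pose proof (pow2_unit v Hv) as V2.
  assert (P3 : 0 < v ^ 3 < 1) by (split; [apply pow_lt; lra | apply pow_lt_1_compat; [lra|lia]]).
  assert (Hx3 : 1 <= v ^ 3 * x).
  { apply Rmult_le_reg_l with (/ v ^ 3); [apply Rinv_0_lt_compat; lra|].
    rewrite <- Rmult_assoc, Rinv_l, Rmult_1_r, Rmult_1_l by lra. auto. }
  assert (Hvx : 1 < v * x) by (assert (v ^ 3 < v) by nra; nra).
  set (d := x - / (v * x)).
  assert (Ed : d * (v * x) = v * x ^ 2 - 1) by (unfold d; field; lra).
  assert (Hdv : d <= v).
  { apply Rmult_le_reg_r with (v * x); [lra|]. rewrite Ed.
    assert (v ^ 4 <= 1) by (apply pow_le_one; lra).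
    assert (v * x ^ 2 <= v * (v * x + v ^ 3)) by (apply Rmult_le_compat_l; lra).
    replace (v * (v * x + v ^ 3)) with (v * (v * x) + v ^ 4) in H1 by ring. lra. }
  assert (Hd5 : 1 - v ^ 5 <= v ^ 3 * d).
  { assert (v * / (v * x) <= v * v ^ 2); [|unfold d; nra].
    apply Rmult_le_compat_l; [lra|].
    apply Rmult_le_reg_r with (v * x); [lra|]. rewrite Rinv_l by lra.
    replace (v ^ 2 * (v * x)) with (v ^ 3 * x) by ring. auto. }
  assert (P5 : 0 < v ^ 5 < 1) by (split; [apply pow_lt; lra | apply pow_lt_1_compat; [lra|lia]]).
  assert (P4 : 0 < v ^ 4 < 1) by (split; [apply pow_lt; lra | apply pow_lt_1_compat; [lra|lia]]).
  assert (Hd0 : 0 < d) by (apply Rmult_lt_reg_l with (v ^ 3); lra).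
  assert (A4 : 0.627 <= v ^ 4).
  { apply Rle_trans with (0.89 ^ 4); [lra | apply pow_incr; lra]. }
  (* The factor of index 0 is at most [2 * d] in absolute value. The others are taken in pairs: the
     pair with [a = v ^ 2] is at most 1/8, the one with [a = v ^ 4] at most 1/2, and the remaining
     ones at most 1. *)
  assert (Hst : St v x <= d / 8).
  { assert (L : is_lim_seq (fun m => prodf (tf v x) (S (2 * m))) (St v x)).
    { apply (is_lim_seq_comp (prodf (tf v x)) (fun m => S (2 * m))).
      - apply triple_product; auto. lra.
      - intros N. exists N. intros; lia. }
    assert (K := is_lim_seq_le_loc (fun m => prodf (tf v x) (S (2 * m))) (fun _ => d / 8) (St v x) (d / 8)).
    apply K; auto; [|apply is_lim_seq_const]. exists 2%nat. intros m Hm.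
    rewrite prodf_front, prodf_pairs.
    rewrite (prodf_ext _ (fun i => Fp v d (v ^ (2 * i + 2)))).
    2: { intros i _. replace (S (2 * i)) with (2 * i + 1)%nat by lia.
         replace (S (2 * i + 1)) with (2 * i + 2)%nat by lia. apply tf_pair; auto; lra. }
    destruct m as [|[|m]]; [lia|lia|]. rewrite prodf_front, prodf_front.
    set (rest := prodf _ m).
    assert (Hrest : Rabs rest <= 1).
    { unfold rest. rewrite prodf_abs. rewrite <- (pow1 m), <- prodf_const.
      apply prodf_le. intros i _. split; [apply Rabs_pos|].
      apply Fp_bounds; auto. split; [apply pow_lt; lra|]. apply pow_le_anti; [lra|lia]. }
    assert (H1 : Rabs (Fp v d (v ^ (2 * 1 + 2))) <= 1 / 2).
    { replace (2 * 1 + 2)%nat with 4%nat by lia. apply Fp_bounds; auto; try lra.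
      split; [lra|]. apply pow_le_anti; [lra|lia]. }
    assert (H0 : Rabs (tf v x 0) <= 2 * d).
    { replace (tf v x 0) with ((1 + v) * (1 - v * d - v)) by (unfold tf, d; simpl; field; lra).
      rewrite Rabs_mult, (Rabs_pos_eq (1 + v)) by lra.
      assert (Rabs (1 - v * d - v) <= d) by (apply Rabs_le; split; nra).
      pose proof (Rabs_pos (1 - v * d - v)). apply Rmult_le_compat; lra. }
    assert (H2 : Rabs (Fp v d (v ^ (2 * 0 + 2))) <= 1 / 8).
    { replace (2 * 0 + 2)%nat with 2%nat by lia.
      replace (Fp v d (v ^ 2)) with (- ((1 - v ^ 2) * (1 + v ^ 3) * ((1 + v ^ 2 * d - v ^ 3) * (v ^ 3 * d + v ^ 5 - 1))))
        by (unfold Fp; field; lra).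
      assert (v ^ 3 <= v ^ 2) by (apply pow_le_anti; [lra|lia]).
      assert (v ^ 5 <= v ^ 4) by (apply pow_le_anti; [lra|lia]).
      assert (K1 : 0 <= (1 - v ^ 2) * (1 + v ^ 3) <= 1 - v ^ 4).
      { split; [apply Rmult_le_pos; lra|]. replace (1 - v ^ 4) with ((1 - v ^ 2) * (1 + v ^ 2)) by ring.
        apply Rmult_le_compat_l; lra. }
      assert (K2 : 0 <= 1 + v ^ 2 * d - v ^ 3 <= 1) by (replace (v ^ 3) with (v ^ 2 * v) by ring; nra).
      assert (K3 : 0 <= v ^ 3 * d + v ^ 5 - 1 <= 2 * v ^ 4 - 1).
      { split; [lra|]. assert (H7 : v ^ 3 * d <= v ^ 3 * v) by (apply Rmult_le_compat_l; lra).
        replace (v ^ 3 * v) with (v ^ 4) in H7 by ring. lra. }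
      rewrite Rabs_Ropp, Rabs_pos_eq.
      2: { apply Rmult_le_pos; [lra|]. apply Rmult_le_pos; lra. }
      apply Rle_trans with ((1 - v ^ 4) * (1 * (2 * v ^ 4 - 1))).
      - apply Rmult_le_compat; try lra; [apply Rmult_le_pos; lra|]. apply Rmult_le_compat; lra.
      - set (y := v ^ 4). assert (0 <= (y - 3 / 4) ^ 2) by apply pow2_ge_0. nra. }
    eapply Rle_trans; [apply Rle_abs|]. rewrite !Rabs_mult.
    pose proof (Rabs_pos (tf v x 0)). pose proof (Rabs_pos rest).
    pose proof (Rabs_pos (Fp v d (v ^ (2 * 1 + 2)))). pose proof (Rabs_pos (Fp v d (v ^ (2 * 0 + 2)))).
    apply Rle_trans with (2 * d * (1 / 8 * (1 / 2 * 1))); [|lra].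
    apply Rmult_le_compat; auto; [apply Rmult_le_pos; auto; apply Rmult_le_pos; auto|].
    apply Rmult_le_compat; auto; [apply Rmult_le_pos; auto|]. apply Rmult_le_compat; auto. }
  (* With [s = / x] one has [d <= (1 - s ^ 2) / s], and theta at [s] is at least
     [(1 - s) * (1 - s / 3) / (1 + s ^ 2)]. What is left is a polynomial inequality in [s], valid
     for [s > 0.6]; that range comes from [s + s ^ 2 >= 1]. *)
  assert (Hg : d / 8 < th v (/ x) / x).
  { set (s := / x) in *. assert (Hs0 : 0 < s) by (apply Rinv_0_lt_compat; lra).
    assert (Hss : s <= v ^ 3).
    { apply Rmult_le_reg_r with x; [lra|]. unfold s. rewrite Rinv_l by lra. auto. }
    assert (Hlo := th_lower v s Hv ltac:(lra)).
    (* All deviations from [v = 1] are compared with [D = 1 - v ^ 4]. The resulting coefficient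
       [1 / 4 - z + z ^ 2 / 2] of [s * D] is at least -1/4, and [D <= 4 / 3 * (1 - s)] because
       [s <= v ^ 3]; this costs the factor [1 - s / 3]. *)
    assert (N : (1 - s) * (1 - s / 3) <=
      1 - v * s - v ^ 3 * s ^ 2 * (1 - v ^ 4) + v ^ 6 * s ^ 3 * (1 - v ^ 2)).
    { assert (Q1 : 1 - v ^ 4 <= 4 * (1 - v)) by (assert (B := bernoulli v 4 ltac:(lra)); simpl in B; simpl; lra).
      assert (Q2 : 1 - v ^ 4 <= 2 * (1 - v ^ 2)) by (replace (v ^ 4) with (v ^ 2 * v ^ 2) by ring; nra).
      assert (Q3 : 3 * (1 - v ^ 4) <= 4 * (1 - v ^ 3)).
      { assert (0 <= (1 - v) ^ 2 * (1 + 2 * v + 3 * v ^ 2)) by (apply Rmult_le_pos; [apply pow2_ge_0|lra]).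
        replace ((1 - v) ^ 2 * (1 + 2 * v + 3 * v ^ 2)) with (1 - 4 * v ^ 3 + 3 * v ^ 4) in H0 by ring. lra. }
      set (D := 1 - v ^ 4) in *. assert (0 < D) by (unfold D; lra).
      set (z := v ^ 3 * s). assert (Hz : 0 < z < 1) by (unfold z; nra).
      replace (v ^ 3 * s ^ 2 * D) with (s * z * D) by (unfold z; ring).
      replace (v ^ 6 * s ^ 3 * (1 - v ^ 2)) with (s * z ^ 2 * (1 - v ^ 2)) by (unfold z; ring).
      assert (s * z ^ 2 * (D / 2) <= s * z ^ 2 * (1 - v ^ 2)).
      { apply Rmult_le_compat_l; [|lra]. apply Rmult_le_pos; [lra | apply pow2_ge_0]. }
      assert (s * (D / 4) <= s * (1 - v)) by (apply Rmult_le_compat_l; lra).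
      assert (0 <= s * D * ((1 - z) ^ 2 / 2)) by (apply Rmult_le_pos; [nra | pose proof (pow2_ge_0 (1 - z)); lra]).
      assert (s * D <= s * (4 / 3 * (1 - s))) by (apply Rmult_le_compat_l; lra). nra. }
    assert (Hv7 : v ^ 7 <= 1) by (apply pow_le_one; lra).
    assert (Hs2 : 0 < s ^ 2 < 1) by (split; nra).
    assert (T : th v s * (1 + v ^ 7 * s ^ 2) <= th v s * (1 + s ^ 2)).
    { apply Rmult_le_compat_l; [apply Rlt_le, th_pos_unit; auto; lra|]. nra. }
    assert (Q : (1 - s ^ 2) * (1 + s ^ 2) < 8 * s ^ 2 * ((1 - s) * (1 - s / 3))).
    { assert (0.6 < s) by nra.
      assert (0 < -1 - s + 7 * s ^ 2 - 11 / 3 * s ^ 3).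
      { assert (0 <= (s - 0.6) * ((1 - s) * (11 / 3 * s - 17 / 15))) by (repeat apply Rmult_le_pos; lra).
        lra. }
      assert (0 < (1 - s) * (-1 - s + 7 * s ^ 2 - 11 / 3 * s ^ 3)) by (apply Rmult_lt_0_compat; lra).
      lra. }
    assert (Hds : d <= (1 - s ^ 2) / s).
    { unfold d. fold s. replace (/ (v * x)) with (s / v) by (unfold s; field; lra).
      replace x with (/ s) by (unfold s; rewrite Rinv_inv; auto).
      assert (s <= s / v).
      { apply Rmult_le_reg_r with v; [lra|]. unfold Rdiv. rewrite Rmult_assoc, Rinv_l by lra.
        assert (s * v <= s * 1) by (apply Rmult_le_compat_l; lra). lra. }
      replace ((1 - s ^ 2) / s) with (/ s - s) by (field; lra). lra. }
    unfold Rdiv at 2. fold s.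
    assert (F : (1 - s ^ 2) / s / 8 < th v s * s); [|lra].
    apply Rmult_lt_reg_r with (8 * s * (1 + s ^ 2)); [apply Rmult_lt_0_compat; lra|].
    replace ((1 - s ^ 2) / s / 8 * (8 * s * (1 + s ^ 2))) with ((1 - s ^ 2) * (1 + s ^ 2)) by (field; lra).
    replace (th v s * s * (8 * s * (1 + s ^ 2))) with (8 * s ^ 2 * (th v s * (1 + s ^ 2))) by ring.
    apply Rlt_le_trans with (1 := Q). apply Rmult_le_compat_l; lra. }
  unfold St in Hst. lra.
Qed.

(** The witness has the same scaled position in the next zone. From odd to even it is [x / v], where
    one step of the functional equation gives [1 + x * w v k x]. From even to odd it is [x / v ^ 3],
    where three steps give a nonnegative multiple of [w v k x] plus
    [(x ^ 2 - v * x - v ^ 3) / v ^ 3], positive by [golden]. *)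
Lemma chain (v : R) (k : nat) (x : R) : 0 < v < 1 -> (1 <= k)%nat -> inz v k x -> 0 <= w v k x ->
  exists x', inz v (S k) x' /\ 0 < w v (S k) x'.
Proof.
  intros Hv Hk [Hz1 Hz2] Hw.
  assert (Hx : / v <= x) by (apply (inz_ge v k x); auto; lra).
  pose proof (inv_v_gt1 v Hv).
  destruct (even_cases k) as [[l [-> [Ec Es]]]|[l [-> [Ec Es]]]].
  - destruct (even_cases (S (2 * l))) as [[l' [E _]]|[l' [E [Ec' Es']]]]; [lia|].
    assert (l' = l) by lia. subst l'.
    unfold w in Hw. rewrite Es in Hw. replace (1 * x) with x in Hw by ring.
    assert (Hx3 : / v ^ 3 <= x).
    { assert (v ^ (2 * (2 * l)) <= v ^ 4) by (apply pow_le_anti; [lra|lia]).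
      assert (v <= v ^ 4 * x).
      { rewrite Ec in Hz1. apply Rle_trans with (v ^ (2 * (2 * l)) * x); [lra|].
        apply Rmult_le_compat_r; lra. }
      apply Rmult_le_reg_l with (v ^ 4); [apply pow_lt; lra|].
      replace (v ^ 4 * / v ^ 3) with v by (field; lra). auto. }
    assert (Gd := golden v x Hv Hx3 ltac:(lra)).
    exists (x / v ^ 3). unfold inz, w. rewrite Ec', Es'. rewrite Ec in *.
    replace (2 * (2 * l + 1) + 1)%nat with (2 * (2 * l) + 3)%nat by lia. rewrite pow_add.
    replace (v ^ (2 * (2 * l)) * v ^ 3 * (x / v ^ 3)) with (v ^ (2 * (2 * l)) * x)
      by (field; lra).
    split; [lra|].
    rewrite th_fe by (rewrite Rabs_pos_eq; lra).
    replace (- v * (-1 * (x / v ^ 3))) with (x / v ^ 2) by (field; lra).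
    rewrite (th_fe2 v (x / v ^ 2)) by (rewrite Rabs_pos_eq; lra).
    replace (v ^ 2 * (x / v ^ 2)) with x by (field; lra).
    replace (-1 * (1 - v * (-1 * (x / v ^ 3)) * (1 - v * (x / v ^ 2) - v ^ 3 * (x / v ^ 2) ^ 2 * th v x)))
      with ((x ^ 2 - v * x - v ^ 3) / v ^ 3 + x ^ 3 / v ^ 3 * th v x) by (field; lra).
    assert (0 < / v ^ 3) by (apply Rinv_0_lt_compat, pow_lt; lra).
    assert (0 < (x ^ 2 - v * x - v ^ 3) / v ^ 3) by (apply Rmult_lt_0_compat; lra).
    assert (0 <= x ^ 3 / v ^ 3 * th v x).
    { apply Rmult_le_pos; [|lra]. apply Rmult_le_pos; [apply pow_le|]; lra. }
    lra.
  - destruct (even_cases (S (2 * l + 1))) as [[l' [E [Ec' Es']]]|[l' [E _]]]; [|lia].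
    assert (l' = S l) by lia. subst l'.
    unfold w in Hw. rewrite Es in Hw. rewrite Ec in *.
    exists (x / v). unfold inz, w. rewrite Ec', Es'.
    replace (2 * (2 * S l))%nat with (2 * (2 * l + 1) + 1 + 1)%nat by lia.
    rewrite (pow_add v (2 * (2 * l + 1) + 1) 1), pow_1.
    replace (v ^ (2 * (2 * l + 1) + 1) * v * (x / v)) with (v ^ (2 * (2 * l + 1) + 1) * x) by (field; lra).
    split; [lra|].
    rewrite th_fe by (rewrite Rabs_pos_eq; lra).
    replace (- v * (1 * (x / v))) with (-1 * x) by (field; lra).
    replace (1 * (1 - v * (1 * (x / v)) * th v (-1 * x))) with (1 + x * (-1 * th v (-1 * x))) by (field; lra).
    assert (0 <= x * (-1 * th v (-1 * x))) by (apply Rmult_le_pos; lra). lra.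
Qed.

(** * Windows around a zone *)

(** The normalising signs are put into the weights, so that [w v k] is itself a series [U] and the
    heat equation and the maximum principle apply to it directly. *)
Definition wk (k j : nat) : R := sg k * sg k ^ j.

Lemma geom_bounded_wk (k : nat) : geom_bounded (wk k).
Proof.
  exists 1, 1. repeat split; try lra. intros j. unfold wk.
  rewrite Rabs_mult, <- RPow_abs. replace (Rabs (sg k)) with 1; [rewrite pow1; lra|].
  destruct (sg_cases k) as [-> | ->]; [rewrite Rabs_R1 | rewrite Rabs_left]; lra.
Qed.

Lemma w_U (v : R) (k : nat) (x : R) : w v k x = U (wk k) v x.
Proof.
  unfold w, th, U. rewrite <- Series_scal_l. apply Series_ext. intros j.
  unfold one_w, wk. rewrite Rpow_mult_distr. ring.
Qed.

Lemma w_x (v : R) (k : nat) (x : R) : Ux (wk k) v x = Ux one_w v (sg k * x).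
Proof.
  unfold Ux. f_equal. unfold U. apply Series_ext. intros j.
  unfold shift_w, wk, one_w. replace (- v * (sg k * x)) with (sg k * (- v * x)) by ring.
  rewrite (Rpow_mult_distr (sg k)). simpl (sg k ^ S j).
  replace (sg k * (sg k * sg k ^ j)) with (sg k ^ j) by (rewrite <- Rmult_assoc, sg_sq; ring). ring.
Qed.

Lemma w_xx (v : R) (k : nat) (x : R) : Uxx (wk k) v x = sg k * Uxx one_w v (sg k * x).
Proof.
  unfold Uxx. rewrite <- Rmult_assoc, (Rmult_comm (sg k)), Rmult_assoc. f_equal. unfold U.
  rewrite <- Series_scal_l. apply Series_ext. intros j.
  unfold shift_w, wk, one_w. replace (v ^ 2 * (sg k * x)) with (sg k * (v ^ 2 * x)) by ring.
  rewrite (Rpow_mult_distr (sg k)). simpl (sg k ^ S (S j)).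
  replace (sg k * (sg k * (sg k * sg k ^ j))) with (sg k * sg k ^ j)
    by (rewrite <- (Rmult_assoc (sg k) (sg k)), sg_sq; ring). ring.
Qed.

Definition Lz (v : R) (k : nat) : R := v / v ^ cz k.
Definition Rz (v : R) (k : nat) : R := / v / v ^ cz k.

Lemma zone_scale (v : R) (k : nat) (x z : R) : 0 < v -> (x <= z / v ^ cz k <-> v ^ cz k * x <= z) /\
  (z / v ^ cz k <= x <-> z <= v ^ cz k * x) /\
  (x < z / v ^ cz k <-> v ^ cz k * x < z) /\ (z / v ^ cz k < x <-> z < v ^ cz k * x).
Proof.
  intros Hv. assert (Hp : 0 < v ^ cz k) by (apply pow_lt; auto).
  assert (E : z = v ^ cz k * (z / v ^ cz k)) by (field; lra).
  set (u := z / v ^ cz k) in *. rewrite E.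
  repeat split; intros H.
  all: try (apply Rmult_le_compat_l; lra).
  all: try (apply Rmult_lt_compat_l; lra).
  all: try (apply Rmult_le_reg_l with (v ^ cz k); lra).
  all: apply Rmult_lt_reg_l with (v ^ cz k); lra.
Qed.

Lemma inz_LR (v : R) (k : nat) (x : R) : 0 < v -> (inz v k x <-> Lz v k < x < Rz v k).
Proof.
  intros Hv. unfold inz, Lz, Rz.
  destruct (zone_scale v k x v Hv) as [_ [_ [_ H1]]].
  destruct (zone_scale v k x (/ v) Hv) as [_ [_ [H2 _]]]. tauto.
Qed.

Lemma Lz_ge1 (v : R) (k : nat) : 0 < v < 1 -> (1 <= k)%nat -> / v <= Lz v k.
Proof.
  intros Hv Hk. apply (inz_ge v k); auto. unfold Lz. right. field.
  apply pow_nonzero; lra.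
Qed.

Lemma inz_gt (v : R) (k : nat) (x : R) : 0 < v < 1 -> (1 <= k)%nat -> inz v k x -> / v < x.
Proof. intros Hv Hk Hz. apply inz_LR in Hz; [|lra]. pose proof (Lz_ge1 v k Hv Hk). lra. Qed.

Lemma Lz_lt_Rz (v : R) (k : nat) : 0 < v < 1 -> Lz v k < Rz v k.
Proof.
  intros Hv. unfold Lz, Rz. pose proof (inv_v_gt1 v Hv).
  apply Rmult_lt_compat_r; [apply Rinv_0_lt_compat, pow_lt|]; lra.
Qed.

Lemma w_neg_left (v : R) (k : nat) (x : R) : 0 < v < 1 -> (1 <= k)%nat ->
  1 <= x -> v ^ 3 <= v ^ cz k * x -> x <= Lz v k -> w v k x < 0.
Proof.
  intros Hv Hk H1 H3 HL. apply w_neg_outside; auto. left. split; auto.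
  apply (zone_scale v k x v); auto. lra.
Qed.

Lemma w_neg_right (v : R) (k : nat) (x : R) : 0 < v < 1 -> (1 <= k)%nat ->
  v ^ cz k * x <= / v ^ 3 -> Rz v k <= x -> w v k x < 0.
Proof.
  intros Hv Hk H3 HL. apply w_neg_outside; auto.
  - pose proof (Lz_ge1 v k Hv Hk). pose proof (Lz_lt_Rz v k Hv). pose proof (inv_v_gt1 v Hv). lra.
  - right. split; auto. apply (zone_scale v k x (/ v)); auto. lra.
Qed.

Lemma w_zero_inz (v : R) (k : nat) (x : R) : 0 < v < 1 -> (1 <= k)%nat -> 1 <= x ->
  v ^ 3 <= v ^ cz k * x <= / v ^ 3 -> 0 <= w v k x -> inz v k x.
Proof.
  intros Hv Hk H1 H3 H0. split.
  - destruct (Rlt_le_dec v (v ^ cz k * x)) as [|H]; auto. exfalso.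
    assert (w v k x < 0); [apply w_neg_outside; auto; lra | lra].
  - destruct (Rlt_le_dec (v ^ cz k * x) (/ v)) as [|H]; auto. exfalso.
    assert (w v k x < 0); [apply w_neg_outside; auto; lra | lra].
Qed.

Lemma pow_cont (n : nat) (s eps : R) : 0 < eps ->
  exists d, 0 < d /\ forall v, Rabs (v - s) < d -> Rabs (v ^ n - s ^ n) < eps.
Proof.
  intros Heps.
  assert (C : continuity_pt (fun v => v ^ n) s) by (apply derivable_continuous_pt, derivable_pt_pow).
  destruct (C eps Heps) as [d [Hd H]]. exists d. split; auto. intros v Hv.
  destruct (Req_dec v s) as [->|Hne]; [rewrite Rminus_diag, Rabs_R0; auto|].
  apply H. split; [split; [exact I | auto] | exact Hv].
Qed.

(** The ends of a zone move with [v], whereas the maximum principle needs a fixed rectangle. For [v]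
    near [s] the fixed numbers [al] and [be] lie outside the zone, yet close enough for [w] to be
    negative between them and the zone. *)
Lemma window (k : nat) (s : R) : (1 <= k)%nat -> 0 < s < 1 -> exists d al be, 0 < d /\
  forall v, s - d < v < s + d -> 0 < v < 1 /\ al < Lz v k /\ Rz v k < be /\
    (forall x, al <= x <= Lz v k -> w v k x < 0) /\ (forall x, Rz v k <= x <= be -> w v k x < 0).
Proof.
  intros Hk Hs.
  pose proof (cz_ge k).
  pose proof (inv_v_gt1 s Hs) as Hi.
  set (c := cz k) in *. set (m := (c - 1)%nat). set (n := (c + 1)%nat).
  assert (Hsm : 0 < s ^ m) by (apply pow_lt; lra). assert (Hsn : 0 < s ^ n) by (apply pow_lt; lra).
  set (r := (1 + s) / 2). assert (Hr : s < r < 1) by (unfold r; lra).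
  (* keep v^m/s^m and v^n/s^n within a factor strictly between 1 and 1/r *)
  set (q := (1 + / r) / 2).
  assert (Hir : 1 < / r) by (rewrite <- Rinv_1; apply Rinv_lt_contravar; lra).
  assert (Hq : 1 < q < / r) by (unfold q; lra).
  assert (Hqi : / q < 1) by (rewrite <- Rinv_1; apply Rinv_lt_contravar; lra).
  assert (Hq0 : 0 < / q) by (apply Rinv_0_lt_compat; lra).
  destruct (pow_cont m s (s ^ m * Rmin (1 - / q) (q - 1))) as [d1 [Hd1 H1]].
  { apply Rmult_lt_0_compat; auto. apply Rmin_pos; lra. }
  destruct (pow_cont n s (s ^ n * Rmin (1 - / q) (q - 1))) as [d2 [Hd2 H2]].
  { apply Rmult_lt_0_compat; auto. apply Rmin_pos; lra. }
  set (d := Rmin (Rmin d1 d2) (Rmin s (r - s))).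
  assert (Hd : 0 < d) by (unfold d; repeat apply Rmin_pos; lra).
  assert (D1 : d <= d1) by (unfold d; eapply Rle_trans; [apply Rmin_l | apply Rmin_l]).
  assert (D2 : d <= d2) by (unfold d; eapply Rle_trans; [apply Rmin_l | apply Rmin_r]).
  assert (D3 : d <= s) by (unfold d; eapply Rle_trans; [apply Rmin_r | apply Rmin_l]).
  assert (D4 : d <= r - s) by (unfold d; eapply Rle_trans; [apply Rmin_r | apply Rmin_r]).
  exists d, (Rmax 1 (/ (q * s ^ m))), (q / s ^ n). split; auto. intros v Hv.
  assert (Hv1 : 0 < v < 1) by lra. assert (Hvr : v < r) by lra.
  assert (Hir2 : / r < / v) by (apply Rinv_lt_contravar; nra).
  assert (Hvm : 0 < v ^ m) by (apply pow_lt; lra). assert (Hvn : 0 < v ^ n) by (apply pow_lt; lra).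
  assert (Em : v ^ c = v * v ^ m) by (replace c with (S m) by (unfold m; lia); reflexivity).
  assert (En : v ^ n = v * v ^ c) by (unfold n; rewrite Nat.add_1_r; reflexivity).
  assert (EL : Lz v k = / v ^ m) by (unfold Lz; fold c; rewrite Em; field; lra).
  assert (ER : Rz v k = / v ^ n).
  { unfold Rz; fold c; rewrite En; field. split; [rewrite Em; nra | lra]. }
  assert (B1 : / q * s ^ m < v ^ m < q * s ^ m).
  { specialize (H1 v ltac:(apply Rabs_def1; lra)). apply Rabs_def2 in H1.
    pose proof (Rmin_l (1 - / q) (q - 1)). pose proof (Rmin_r (1 - / q) (q - 1)). nra. }
  assert (B2 : / q * s ^ n < v ^ n < q * s ^ n).
  { specialize (H2 v ltac:(apply Rabs_def1; lra)). apply Rabs_def2 in H2.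
    pose proof (Rmin_l (1 - / q) (q - 1)). pose proof (Rmin_r (1 - / q) (q - 1)). nra. }
  split; auto. split; [|split; [|split]].
  - apply Rmax_lub_lt; [pose proof (Lz_ge1 v k Hv1 Hk); pose proof (inv_v_gt1 v Hv1); lra|].
    rewrite EL. apply Rinv_lt_contravar; nra.
  - rewrite ER. replace (q / s ^ n) with (/ (/ q * s ^ n)) by (field; lra).
    apply Rinv_lt_contravar; [|lra]. apply Rmult_lt_0_compat; auto. apply Rmult_lt_0_compat; auto.
  - intros x [Hx1 Hx2]. apply w_neg_left; auto.
    + eapply Rle_trans; [apply Rmax_l | apply Hx1].
    + assert (Hx3 : / (q * s ^ m) <= x) by (eapply Rle_trans; [apply Rmax_r | apply Hx1]).
      apply Rle_trans with (v ^ c * / (q * s ^ m)).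
      2: { apply Rmult_le_compat_l; auto. apply pow_le; lra. }
      rewrite Em. replace (v ^ 3) with (v * v * v) by ring. rewrite !Rmult_assoc.
      apply Rmult_le_compat_l; [lra|].
      assert (s ^ m < q * v ^ m).
      { apply Rmult_lt_reg_l with (/ q); auto. rewrite <- Rmult_assoc, (Rinv_l q) by lra. lra. }
      assert (v * q <= 1).
      { apply Rmult_le_reg_r with (/ v); [lra|].
        replace (v * q * / v) with q by (field; lra). lra. }
      apply Rmult_le_reg_r with (q * s ^ m); [nra|]. rewrite (Rmult_assoc _ (/ _)), Rinv_l by nra.
      assert (v * q * (v * s ^ m) <= 1 * (v * s ^ m)) by (apply Rmult_le_compat_r; nra).
      assert (v * s ^ m <= v * (q * v ^ m)) by (apply Rmult_le_compat_l; lra).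
      assert (v * q * v ^ m <= 1 * v ^ m) by (apply Rmult_le_compat_r; lra). lra.
  - intros x [Hx1 Hx2]. apply w_neg_right; auto. fold c.
    apply Rle_trans with (v ^ c * (q / s ^ n)).
    { apply Rmult_le_compat_l; auto. apply pow_le; lra. }
    apply Rmult_le_reg_l with (v ^ 3); [apply pow_lt; lra|].
    rewrite Rinv_r by (apply pow_nonzero; lra).
    replace (v ^ 3 * (v ^ c * (q / s ^ n))) with ((v * q) * (v * v ^ n / s ^ n)) by (rewrite En; field; lra).
    assert (v * q <= 1).
    { apply Rmult_le_reg_r with (/ v); [lra|].
      replace (v * q * / v) with q by (field; lra). lra. }
    assert (0 < v * v ^ n / s ^ n) by (apply Rdiv_lt_0_compat; nra).
    assert (v * v ^ n / s ^ n <= 1).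
    { apply Rmult_le_reg_r with (s ^ n); auto. unfold Rdiv. rewrite Rmult_assoc, Rinv_l by lra.
      assert (v * v ^ n <= v * (q * s ^ n)) by (apply Rmult_le_compat_l; lra).
      assert (v * q * s ^ n <= 1 * s ^ n) by (apply Rmult_le_compat_r; lra). lra. }
    nra.
Qed.

(** * Following the zeros of a zone *)

Lemma max_principle_pos (c : nat -> R) (a b al be : R) : geom_bounded c -> 0 < a -> a <= b < 1 -> al <= be ->
  (forall x, al <= x <= be -> 0 < U c a x) ->
  (forall v, a <= v <= b -> 0 < U c v al) ->
  (forall v, a <= v <= b -> 0 < U c v be) ->
  forall v x, a <= v <= b -> al <= x <= be -> 0 < U c v x.
Proof.
  intros Hc Ha Hb Hal H0 H1 H2 v x Hv Hx.
  assert (H := max_principle (fun j => -1 * c j) a b al be (geom_bounded_scal c (-1) Hc) Ha Hb Hal).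
  enough (U (fun j => -1 * c j) v x < 0) by (rewrite U_scal in H3; lra).
  apply H; auto; intros; rewrite U_scal.
  - specialize (H0 x0 H3). lra.
  - specialize (H1 v0 H3). lra.
  - specialize (H2 v0 H3). lra.
Qed.

Lemma Ux_scal (c : nat -> R) (k v x : R) : Ux (fun j => k * c j) v x = k * Ux c v x.
Proof.
  unfold Ux. transitivity (- v * U (fun j => k * shift_w c j) v (- v * x)).
  - f_equal. unfold U. apply Series_ext. intros j. unfold shift_w. ring.
  - rewrite U_scal. ring.
Qed.

Lemma Ux_pos_near (c : nat -> R) (v0 x0 : R) : geom_bounded c -> 0 < v0 < 1 -> 0 < Ux c v0 x0 ->
  exists d, 0 < d /\ forall v x, Rabs (v - v0) < d -> Rabs (x - x0) < d -> 0 < Ux c v x.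
Proof.
  intros Hc Hv0 H. unfold Ux in H.
  destruct (U_neg_near (shift_w c) v0 (- v0 * x0) (geom_bounded_shift c Hc) Hv0) as [e [He H1]]; [nra|].
  pose proof (Rabs_pos x0).
  set (d := Rmin (Rmin e v0) (Rmin 1 (e / (Rabs x0 + 2)))).
  assert (Hd : 0 < d).
  { unfold d. repeat apply Rmin_pos; try lra. apply Rdiv_lt_0_compat; lra. }
  assert (D1 : d <= e) by (unfold d; eapply Rle_trans; [apply Rmin_l | apply Rmin_l]).
  assert (D2 : d <= v0) by (unfold d; eapply Rle_trans; [apply Rmin_l | apply Rmin_r]).
  assert (D3 : d <= 1) by (unfold d; eapply Rle_trans; [apply Rmin_r | apply Rmin_l]).
  assert (D4 : d * (Rabs x0 + 2) <= e).
  { assert (d <= e / (Rabs x0 + 2)) by (unfold d; eapply Rle_trans; [apply Rmin_r | apply Rmin_r]).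
    apply Rmult_le_reg_r with (/ (Rabs x0 + 2)); [apply Rinv_0_lt_compat; lra|].
    rewrite Rmult_assoc, Rinv_r by lra. lra. }
  exists d. split; auto. intros v x Hv Hx. unfold Ux.
  assert (Hlt : U (shift_w c) v (- v * x) < 0).
  { apply H1; [lra|]. replace (- v * x - - v0 * x0) with (- ((v - v0) * x + v0 * (x - x0))) by ring.
    rewrite Rabs_Ropp. eapply Rle_lt_trans; [apply Rabs_triang|]. rewrite !Rabs_mult, (Rabs_pos_eq v0) by lra.
    assert (Rabs x <= Rabs x0 + 1).
    { replace x with (x0 + (x - x0)) by ring. eapply Rle_trans; [apply Rabs_triang|]. lra. }
    pose proof (Rabs_pos (v - v0)). pose proof (Rabs_pos (x - x0)). pose proof (Rabs_pos x).
    assert (Rabs (v - v0) * Rabs x <= d * (Rabs x0 + 1)) by (apply Rmult_le_compat; lra).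
    assert (v0 * Rabs (x - x0) <= 1 * Rabs (x - x0)) by (apply Rmult_le_compat_r; lra). lra. }
  apply Rabs_def2 in Hv. nra.
Qed.

Lemma Ux_neg_near (c : nat -> R) (v0 x0 : R) : geom_bounded c -> 0 < v0 < 1 -> Ux c v0 x0 < 0 ->
  exists d, 0 < d /\ forall v x, Rabs (v - v0) < d -> Rabs (x - x0) < d -> Ux c v x < 0.
Proof.
  intros Hc Hv0 H.
  destruct (Ux_pos_near (fun j => -1 * c j) v0 x0 (geom_bounded_scal c (-1) Hc) Hv0) as [d [Hd H1]].
  { rewrite Ux_scal. lra. }
  exists d. split; auto. intros v x Hv Hx. specialize (H1 v x Hv Hx). rewrite Ux_scal in H1. lra.
Qed.

Lemma incr_of_Ux (c : nat -> R) (v a b : R) : geom_bounded c -> 0 < v < 1 -> a < b ->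
  (forall x, a <= x <= b -> 0 < Ux c v x) -> U c v a < U c v b.
Proof.
  intros Hc Hv Hab H.
  destruct (MVT_cor2 (U c v) (Ux c v) a b Hab) as [t [E Ht]].
  - intros x _. apply is_derive_Reals, is_derive_U_x; auto. rewrite Rabs_pos_eq; lra.
  - specialize (H t ltac:(lra)). nra.
Qed.

Lemma decr_of_Ux (c : nat -> R) (v a b : R) : geom_bounded c -> 0 < v < 1 -> a < b ->
  (forall x, a <= x <= b -> Ux c v x < 0) -> U c v b < U c v a.
Proof.
  intros Hc Hv Hab H.
  destruct (MVT_cor2 (U c v) (Ux c v) a b Hab) as [t [E Ht]].
  - intros x _. apply is_derive_Reals, is_derive_U_x; auto. rewrite Rabs_pos_eq; lra.
  - specialize (H t ltac:(lra)). nra.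
Qed.

Lemma cont_near (F : R -> R) (s h : R) : continuity_pt F s -> 0 < h ->
  exists d, 0 < d /\ forall v, Rabs (v - s) < d -> Rabs (F v - F s) < h.
Proof.
  intros C Hh. destruct (C h Hh) as [d [Hd H]]. exists d. split; auto. intros v Hv.
  destruct (Req_dec v s) as [->|Hne]; [rewrite Rminus_diag, Rabs_R0; auto|].
  apply H. split; [split; [exact I | auto] | exact Hv].
Qed.

Definition pattern (k : nat) (v f g : R) : Prop := forall x, Lz v k <= x <= Rz v k ->
  (x < f -> w v k x < 0) /\ (f < x < g -> 0 < w v k x) /\ (g < x -> w v k x < 0).

Lemma pattern_left (k : nat) (v f g x : R) : pattern k v f g -> Lz v k <= x <= Rz v k -> x < f -> w v k x < 0.
Proof. intros HP Hx. apply (HP x Hx). Qed.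

Lemma pattern_mid (k : nat) (v f g x : R) : pattern k v f g -> Lz v k <= x <= Rz v k -> f < x < g -> 0 < w v k x.
Proof. intros HP Hx. apply (HP x Hx). Qed.

Lemma pattern_right (k : nat) (v f g x : R) : pattern k v f g -> Lz v k <= x <= Rz v k -> g < x -> w v k x < 0.
Proof. intros HP Hx. destruct (HP x Hx) as [_ [_ H]]. exact H. Qed.

Definition zone_branches (k : nat) (vb : R) (F G : R -> R) : Prop := forall v, 0 < v < vb ->
  continuity_pt F v /\ continuity_pt G v /\ inz v k (F v) /\ inz v k (G v) /\ F v < G v /\
  w v k (F v) = 0 /\ w v k (G v) = 0 /\ Ux (wk k) v (F v) <> 0 /\ Ux (wk k) v (G v) <> 0.

Lemma pattern_slopes (k : nat) (v f g : R) : 0 < v < 1 -> inz v k f -> inz v k g -> f < g ->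
  w v k f = 0 -> w v k g = 0 -> pattern k v f g -> 0 <= Ux (wk k) v f /\ Ux (wk k) v g <= 0.
Proof.
  intros Hv Hf Hg Hfg Zf Zg HP. apply inz_LR in Hf; [|lra]. apply inz_LR in Hg; [|lra].
  rewrite w_U in Zf, Zg. split.
  - apply (is_derive_nonneg_left (U (wk k) v) f _ (f - Lz v k)); [lra| |].
    + apply is_derive_U_x; [apply geom_bounded_wk | rewrite Rabs_pos_eq; lra].
    + intros u Hu. rewrite Zf, <- w_U. destruct (HP u ltac:(lra)) as [H _]. left. apply H. lra.
  - assert (0 <= Ux (fun j => -1 * wk k j) v g); [|rewrite Ux_scal in H; lra].
    apply (is_derive_nonneg_left (U (fun j => -1 * wk k j) v) g _ (g - f)); [lra| |].
    + apply is_derive_U_x; [apply geom_bounded_scal, geom_bounded_wk | rewrite Rabs_pos_eq; lra].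
    + intros u Hu. rewrite !U_scal, Zg, <- w_U. destruct (HP u ltac:(lra)) as [_ [H _]].
      specialize (H ltac:(lra)). lra.
Qed.

(** Close to a branch the slope in [x] keeps a sign, since the zero is simple, and this settles the
    signs within distance [h] of [F s] and [G s]. The three remaining pieces have boundary values of
    known sign for all parameters between [v] and [v'], so the maximum principle, for [w] or for
    [- w], transports the sign forward. The pattern at [v] decides which sign each slope has. *)
Lemma pattern_step (k : nat) (vb : R) (F G : R -> R) (s : R) : (1 <= k)%nat -> vb < 1 ->
  zone_branches k vb F G -> 0 < s < vb ->
  exists d, 0 < d /\ forall v v', s - d < v -> v <= v' -> v' < s + d ->
    pattern k v (F v) (G v) -> pattern k v' (F v') (G v').
Proof.
  intros Hk Hvb HB Hs.
  destruct (HB s Hs) as [CF [CG [ZF [ZG [HFG [_ [_ [SF SG]]]]]]]].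
  apply inz_LR in ZF; [|lra]. apply inz_LR in ZG; [|lra].
  assert (Hs1 : 0 < s < 1) by lra.
  destruct (window k s Hk Hs1) as [d0 [al [be [Hd0 Hwin]]]].
  pose proof (geom_bounded_wk k) as Hc.
  assert (Hslope : forall p, Ux (wk k) s p <> 0 -> exists e, 0 < e /\
    ((forall v x, Rabs (v - s) < e -> Rabs (x - p) < e -> 0 < Ux (wk k) v x) \/
     (forall v x, Rabs (v - s) < e -> Rabs (x - p) < e -> Ux (wk k) v x < 0))).
  { intros p Hp. destruct (Rtotal_order (Ux (wk k) s p) 0) as [H|[H|H]]; [|lra|].
    - destruct (Ux_neg_near (wk k) s p Hc Hs1 H) as [e [He He']]. exists e. auto.
    - destruct (Ux_pos_near (wk k) s p Hc Hs1 H) as [e [He He']]. exists e. auto. }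
  destruct (Hslope _ SF) as [e1 [He1 HF1]]. destruct (Hslope _ SG) as [e2 [He2 HG1]].
  set (f := F s) in *. set (g := G s) in *.
  set (h := Rmin (Rmin ((g - f) / 3) (Rmin (f - Lz s k) (Rz s k - g))) (Rmin (e1 / 2) (e2 / 2))).
  assert (Hh : 0 < h) by (unfold h; repeat apply Rmin_pos; lra).
  assert (h1 : h <= (g - f) / 3) by (unfold h; eapply Rle_trans; [apply Rmin_l | apply Rmin_l]).
  assert (h2 : h <= f - Lz s k).
  { unfold h; eapply Rle_trans; [apply Rmin_l |]. eapply Rle_trans; [apply Rmin_r | apply Rmin_l]. }
  assert (h3 : h <= Rz s k - g).
  { unfold h; eapply Rle_trans; [apply Rmin_l |]. eapply Rle_trans; [apply Rmin_r | apply Rmin_r]. }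
  assert (h4 : h <= e1 / 2) by (unfold h; eapply Rle_trans; [apply Rmin_r | apply Rmin_l]).
  assert (h5 : h <= e2 / 2) by (unfold h; eapply Rle_trans; [apply Rmin_r | apply Rmin_r]).
  destruct (cont_near F s h CF Hh) as [e3 [He3 HF3]]. destruct (cont_near G s h CG Hh) as [e4 [He4 HG3]].
  fold f in HF3. fold g in HG3.
  set (d := Rmin (Rmin (Rmin d0 e1) (Rmin e2 e3)) (Rmin e4 (Rmin s (vb - s)))).
  assert (Hd : 0 < d) by (unfold d; repeat apply Rmin_pos; lra).
  assert (D0 : d <= Rmin d0 e1 /\ d <= Rmin e2 e3 /\ d <= e4 /\ d <= Rmin s (vb - s)).
  { unfold d. repeat split.
    - eapply Rle_trans; [apply Rmin_l | apply Rmin_l].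
    - eapply Rle_trans; [apply Rmin_l | apply Rmin_r].
    - eapply Rle_trans; [apply Rmin_r | apply Rmin_l].
    - eapply Rle_trans; [apply Rmin_r | apply Rmin_r]. }
  destruct D0 as [D1 [D2 [D3 D4]]].
  assert (D5 : d <= d0) by (eapply Rle_trans; [apply D1 | apply Rmin_l]).
  assert (D6 : d <= e1) by (eapply Rle_trans; [apply D1 | apply Rmin_r]).
  assert (D7 : d <= e2) by (eapply Rle_trans; [apply D2 | apply Rmin_l]).
  assert (D8 : d <= e3) by (eapply Rle_trans; [apply D2 | apply Rmin_r]).
  assert (D9 : d <= s) by (eapply Rle_trans; [apply D4 | apply Rmin_l]).
  assert (D10 : d <= vb - s) by (eapply Rle_trans; [apply D4 | apply Rmin_r]).
  exists d. split; auto. intros v v' Hv Hvv Hv' HP.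
  assert (Near : forall u, v <= u <= v' -> Rabs (u - s) < d /\ 0 < u < vb /\
     f - h < F u < f + h /\ g - h < G u < g + h /\ inz u k (F u) /\ inz u k (G u) /\
     U (wk k) u (F u) = 0 /\ U (wk k) u (G u) = 0).
  { intros u Hu. assert (Hus : Rabs (u - s) < d) by (apply Rabs_def1; lra).
    assert (Hu2 : 0 < u < vb) by lra.
    destruct (HB u Hu2) as [_ [_ [ZFu [ZGu [_ [WF [WG _]]]]]]]. rewrite w_U in WF, WG.
    specialize (HF3 u ltac:(lra)). specialize (HG3 u ltac:(lra)).
    apply Rabs_def2 in HF3. apply Rabs_def2 in HG3.
    split; [auto|]. split; [auto|]. split; [lra|]. split; [lra|]. auto. }
  assert (Hvr : v <= v <= v') by lra. assert (Hv'r : v <= v' <= v') by lra.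
  destruct (Near v Hvr) as [Nv1 [Nv2 [Nv3 [Nv4 [Nv5 [Nv6 [Nv7 Nv8]]]]]]].
  destruct (HB v Nv2) as [_ [_ [_ [_ [HFGv [WFv [WGv [SFv SGv]]]]]]]].
  destruct (pattern_slopes k v (F v) (G v) ltac:(lra) Nv5 Nv6 HFGv WFv WGv HP) as [S1 S2].
  destruct HF1 as [HF1|HF1].
  2: { exfalso. specialize (HF1 v (F v) ltac:(lra) ltac:(apply Rabs_def1; lra)). lra. }
  destruct HG1 as [HG1|HG1].
  { exfalso. specialize (HG1 v (G v) ltac:(lra) ltac:(apply Rabs_def1; lra)). lra. }
  assert (MF : forall u, v <= u <= v' -> (forall x, f - h <= x < F u -> U (wk k) u x < 0) /\
     (forall x, F u < x <= f + h -> 0 < U (wk k) u x)).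
  { intros u Hu. destruct (Near u Hu) as [N1 [N2 [N3 [N4 [N5 [N6 [N7 N8]]]]]]].
    split; intros x Hx.
    - rewrite <- N7. apply incr_of_Ux; auto; try lra.
      intros z Hz. apply HF1; [lra | apply Rabs_def1; lra].
    - rewrite <- N7. apply incr_of_Ux; auto; try lra.
      intros z Hz. apply HF1; [lra | apply Rabs_def1; lra]. }
  assert (MG : forall u, v <= u <= v' -> (forall x, g - h <= x < G u -> 0 < U (wk k) u x) /\
     (forall x, G u < x <= g + h -> U (wk k) u x < 0)).
  { intros u Hu. destruct (Near u Hu) as [N1 [N2 [N3 [N4 [N5 [N6 [N7 N8]]]]]]].
    split; intros x Hx.
    - rewrite <- N8. apply decr_of_Ux; auto; try lra.
      intros z Hz. apply HG1; [lra | apply Rabs_def1; lra].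
    - rewrite <- N8. apply decr_of_Ux; auto; try lra.
      intros z Hz. apply HG1; [lra | apply Rabs_def1; lra]. }
  destruct (Hwin s ltac:(lra)) as [_ [Wal [Wbe _]]].
  assert (PL : forall x, al <= x <= f - h -> U (wk k) v' x < 0).
  { intros x Hx. apply (max_principle (wk k) v v' al (f - h)); auto; try lra.
    - intros y Hy. rewrite <- w_U. destruct (Hwin v ltac:(lra)) as [_ [_ [_ [HL _]]]].
      destruct (Rle_lt_dec y (Lz v k)) as [H|H]; [apply HL; lra|].
      apply inz_LR in Nv5; [|lra]. apply (pattern_left _ _ _ _ _ HP); lra.
    - intros u Hu. rewrite <- w_U. destruct (Near u Hu) as [N1 [N2 _]]. apply Rabs_def2 in N1.
      destruct (Hwin u ltac:(lra)) as [_ [? [_ [HL _]]]]. apply HL. lra.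
    - intros u Hu. destruct (Near u Hu) as [N1 [N2 [N3 _]]]. apply MF; auto. lra. }
  assert (PR : forall x, g + h <= x <= be -> U (wk k) v' x < 0).
  { intros x Hx. apply (max_principle (wk k) v v' (g + h) be); auto; try lra.
    - intros y Hy. rewrite <- w_U. destruct (Hwin v ltac:(lra)) as [_ [_ [_ [_ HR]]]].
      destruct (Rle_lt_dec (Rz v k) y) as [H|H]; [apply HR; lra|].
      apply inz_LR in Nv6; [|lra]. apply (pattern_right _ _ _ _ _ HP); lra.
    - intros u Hu. destruct (Near u Hu) as [N1 [N2 [N3 [N4 _]]]]. apply MG; auto. lra.
    - intros u Hu. rewrite <- w_U. destruct (Near u Hu) as [N1 [N2 _]]. apply Rabs_def2 in N1.
      destruct (Hwin u ltac:(lra)) as [_ [_ [? [_ HR]]]]. apply HR. lra. }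
  assert (PM : forall x, f + h <= x <= g - h -> 0 < U (wk k) v' x).
  { intros x Hx. apply (max_principle_pos (wk k) v v' (f + h) (g - h)); auto; try lra.
    - intros y Hy. rewrite <- w_U. apply inz_LR in Nv5; [|lra]. apply inz_LR in Nv6; [|lra]. apply (pattern_mid _ _ _ _ _ HP); lra.
    - intros u Hu. destruct (Near u Hu) as [N1 [N2 [N3 _]]]. apply MF; auto. lra.
    - intros u Hu. destruct (Near u Hu) as [N1 [N2 [N3 [N4 _]]]]. apply MG; auto. lra. }
  destruct (Near v' Hv'r) as [N1 [N2 [N3 [N4 [N5 [N6 _]]]]]].
  destruct (Hwin v' ltac:(lra)) as [_ [Wal' [Wbe' _]]].
  intros x Hx. rewrite w_U. repeat split.
  - intros H. destruct (Rle_lt_dec x (f - h)); [apply PL; lra | apply MF; lra].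
  - intros H. destruct (Rle_lt_dec x (f + h)); [apply MF; lra|].
    destruct (Rle_lt_dec x (g - h)); [apply PM; lra | apply MG; lra].
  - intros H. destruct (Rle_lt_dec x (g + h)); [apply MG; lra | apply PR; lra].
Qed.

Lemma pattern_propagates (k : nat) (vb : R) (F G : R -> R) (v0 v : R) : (1 <= k)%nat -> vb < 1 ->
  zone_branches k vb F G -> 0 < v0 -> v0 <= v < vb ->
  pattern k v0 (F v0) (G v0) -> pattern k v (F v) (G v).
Proof.
  intros Hk Hvb HB Hv0 Hv HP.
  apply (local_propagation (fun v => pattern k v (F v) (G v)) v0 v); auto; [lra|].
  intros s Hs. destruct (pattern_step k vb F G s Hk Hvb HB ltac:(lra)) as [d [Hd H]].
  exists d. split; auto. intros. apply (H v1 v'); auto.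
Qed.

Lemma strict_min (f f' : R -> R) (y l : R) : (forall x, is_derive f x (f' x)) ->
  is_derive f' y l -> f' y = 0 -> 0 < l ->
  exists h, 0 < h /\ forall x, Rabs (x - y) < h -> x <> y -> f y < f x.
Proof.
  intros Hf Hf' H0 Hl. apply is_derive_Reals in Hf'.
  destruct (Hf' (l / 2) ltac:(lra)) as [d Hd]. pose proof (cond_pos d).
  assert (Hs : forall u, u <> 0 -> Rabs u < d -> 0 < f' (y + u) / u).
  { intros u Hu Hud. specialize (Hd u Hu Hud). rewrite H0, Rminus_0_r in Hd. apply Rabs_def2 in Hd. lra. }
  exists d. split; auto. intros x Hx Hne.
  destruct (Rtotal_order x y) as [H1|[H1|H1]]; [| lra |].
  - destruct (MVT_cor2 f f' x y H1) as [t [E Ht]]; [intros; apply is_derive_Reals, Hf|].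
    assert (K := Hs (t - y) ltac:(lra)). apply Rabs_def2 in Hx.
    specialize (K ltac:(apply Rabs_def1; lra)). replace (y + (t - y)) with t in K by ring.
    assert (f' t < 0).
    { assert (Ei : f' t = f' t / (t - y) * (t - y)) by (field; lra). nra. }
    nra.
  - destruct (MVT_cor2 f f' y x H1) as [t [E Ht]]; [intros; apply is_derive_Reals, Hf|].
    assert (K := Hs (t - y) ltac:(lra)). apply Rabs_def2 in Hx.
    specialize (K ltac:(apply Rabs_def1; lra)). replace (y + (t - y)) with t in K by ring.
    assert (0 < f' t).
    { assert (Ei : f' t = f' t / (t - y) * (t - y)) by (field; lra). nra. }
    nra.
Qed.

Definition merging (k : nat) (vb : R) (F G : R -> R) (y : R) : Prop :=
  inz vb k y /\ w vb k y = 0 /\ Ux (wk k) vb y = 0 /\ Uxx (wk k) vb y <> 0 /\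
  forall h, 0 < h -> exists d, 0 < d /\ forall v, vb - d < v < vb -> Rabs (F v - y) < h /\ Rabs (G v - y) < h.

(** If [Uxx] were positive, [w] would be positive at some point to the right of [y] in the zone. But
    for parameters just below [vb] this point lies to the right of both branches, where the pattern
    makes [w] negative, and a limit of negative values is not positive. *)
Lemma merging_max (k : nat) (vb : R) (F G : R -> R) (v0 y : R) : (1 <= k)%nat -> 0 < vb < 1 ->
  zone_branches k vb F G -> 0 < v0 < vb -> pattern k v0 (F v0) (G v0) -> merging k vb F G y ->
  Uxx (wk k) vb y < 0 /\ exists h, 0 < h /\ forall x, Rabs (x - y) < h -> x <> y -> w vb k x < 0.
Proof.
  intros Hk Hvb HB Hv0 HP [Hz [W0 [W1 [W2 Hm]]]].
  pose proof (geom_bounded_wk k) as Hc. assert (Hab : Rabs vb < 1) by (rewrite Rabs_pos_eq; lra).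
  apply inz_LR in Hz; [|lra]. rewrite w_U in W0.
  assert (Hneg : Uxx (wk k) vb y < 0).
  { destruct (Rtotal_order (Uxx (wk k) vb y) 0) as [H|[H|H]]; [auto | lra |]. exfalso.
    destruct (strict_min (U (wk k) vb) (Ux (wk k) vb) y (Uxx (wk k) vb y)) as [h [Hh Hmin]]; auto.
    { intros x. apply is_derive_U_x; auto. }
    { apply is_derive_Ux_x; auto. }
    destruct (window k vb Hk Hvb) as [d0 [al [be [Hd0 Hwin]]]].
    set (x := y + Rmin (h / 2) (Rz vb k - y)).
    assert (Hx0 : 0 < Rmin (h / 2) (Rz vb k - y)) by (apply Rmin_pos; lra).
    assert (Hx1 : Rmin (h / 2) (Rz vb k - y) <= h / 2) by apply Rmin_l.
    assert (Hx2 : Rmin (h / 2) (Rz vb k - y) <= Rz vb k - y) by apply Rmin_r.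
    assert (Hpos := Hmin x ltac:(unfold x; apply Rabs_def1; lra) ltac:(unfold x; lra)). rewrite W0 in Hpos.
    destruct (Hm (x - y) ltac:(unfold x; lra)) as [d1 [Hd1 HG]].
    assert (Hle : U (wk k) vb x <= 0); [|lra].
    apply (continuity_pt_le_left (fun v => U (wk k) v x) vb (Rmin (Rmin d0 d1) (vb - v0)) 0).
    - repeat apply Rmin_pos; lra.
    - eapply ex_derive_cont, is_derive_U_v; auto.
    - intros u Hu. pose proof (Rmin_l (Rmin d0 d1) (vb - v0)). pose proof (Rmin_r (Rmin d0 d1) (vb - v0)).
      pose proof (Rmin_l d0 d1). pose proof (Rmin_r d0 d1).
      destruct (Hwin u ltac:(lra)) as [Hu1 [Hal [Hbe [_ HR]]]].
      destruct (Hwin vb ltac:(lra)) as [_ [_ [Hbe0 _]]].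
      destruct (HG u ltac:(lra)) as [_ HGu]. apply Rabs_def2 in HGu.
      destruct (HB u ltac:(lra)) as [_ [_ [_ [ZG _]]]]. apply inz_LR in ZG; [|lra].
      rewrite <- w_U. left. destruct (Rle_lt_dec (Rz u k) x) as [Hxr|Hxr]; [apply HR; unfold x in *; lra|].
      apply (pattern_right _ _ _ _ _ (pattern_propagates k vb F G v0 u Hk ltac:(lra) HB ltac:(lra) ltac:(lra) HP)); lra. }
  split; auto.
  destruct (strict_min (U (fun j => -1 * wk k j) vb) (Ux (fun j => -1 * wk k j) vb) y
    (Uxx (fun j => -1 * wk k j) vb y)) as [h [Hh Hmin]].
  - intros x. apply is_derive_U_x; auto. apply geom_bounded_scal; auto.
  - apply is_derive_Ux_x; auto. apply geom_bounded_scal; auto.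
  - rewrite Ux_scal. lra.
  - assert (E : Uxx (fun j => -1 * wk k j) vb y = -1 * Uxx (wk k) vb y); [|lra].
    rewrite <- (is_derive_unique _ _ _ (is_derive_Ux_x (fun j => -1 * wk k j) vb y (geom_bounded_scal _ (-1) Hc) Hab)).
    rewrite (Derive_ext _ (fun x => -1 * Ux (wk k) vb x)) by (intros; apply Ux_scal).
    apply is_derive_unique, (is_derive_scal (Ux (wk k) vb) y (-1)), is_derive_Ux_x; auto.
  - exists h. split; auto. intros x Hx Hne. specialize (Hmin x Hx Hne). rewrite !U_scal, W0 in Hmin.
    rewrite w_U. lra.
Qed.

(** Near [y] this is the strict local maximum. For a point farther away, say to the left, the
    maximum principle is applied on [[al, y - h / 2]] from a parameter slightly below [vb]: the side
    [y - h / 2] is already known to be negative, and both branches are to the right of it. *)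
Lemma merging_unique (k : nat) (vb : R) (F G : R -> R) (v0 y : R) : (1 <= k)%nat -> 0 < vb < 1 ->
  zone_branches k vb F G -> 0 < v0 < vb -> pattern k v0 (F v0) (G v0) -> merging k vb F G y ->
  forall x, Lz vb k <= x <= Rz vb k -> x <> y -> w vb k x < 0.
Proof.
  intros Hk Hvb HB Hv0 HP HM x Hx Hne.
  destruct (merging_max k vb F G v0 y Hk Hvb HB Hv0 HP HM) as [_ [h [Hh Hloc]]].
  destruct HM as [Hz [W0 [W1 [W2 Hm]]]]. apply inz_LR in Hz; [|lra].
  pose proof (geom_bounded_wk k) as Hc.
  destruct (Rlt_le_dec (Rabs (x - y)) h) as [Hxy|Hxy]; [auto|].
  destruct (window k vb Hk Hvb) as [d0 [al [be [Hd0 Hwin]]]].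
  destruct (Hwin vb ltac:(lra)) as [_ [Hal [Hbe _]]].
  assert (Hside : forall p, Rabs (p - y) < h -> p <> y ->
    exists e, 0 < e /\ forall u, vb - e < u <= vb -> U (wk k) u p < 0).
  { intros p Hp1 Hp2. specialize (Hloc p Hp1 Hp2). rewrite w_U in Hloc.
    destruct (U_neg_near (wk k) vb p Hc Hvb Hloc) as [e [He H]].
    exists e. split; auto. intros u Hu. apply H; [apply Rabs_def1; lra | rewrite Rminus_diag, Rabs_R0; auto]. }
  rewrite w_U.
  assert (Hdir : x <= y - h \/ y + h <= x).
  { destruct (Rle_lt_dec x y); [left | right].
    - rewrite Rabs_left in Hxy by lra. lra.
    - rewrite Rabs_pos_eq in Hxy by lra. lra. }
  destruct Hdir as [Hdir|Hdir].
  - set (p := y - h / 2).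
    destruct (Hside p) as [e [He Hp]]; [unfold p; apply Rabs_def1; lra | unfold p; lra |].
    destruct (Hm (h / 2) ltac:(lra)) as [d1 [Hd1 HF]].
    set (d := Rmin (Rmin d0 e) (Rmin d1 (vb - v0))).
    assert (Hd : 0 < d) by (unfold d; repeat apply Rmin_pos; lra).
    assert (D1 : d <= d0) by (unfold d; eapply Rle_trans; [apply Rmin_l | apply Rmin_l]).
    assert (D2 : d <= e) by (unfold d; eapply Rle_trans; [apply Rmin_l | apply Rmin_r]).
    assert (D3 : d <= d1) by (unfold d; eapply Rle_trans; [apply Rmin_r | apply Rmin_l]).
    assert (D4 : d <= vb - v0) by (unfold d; eapply Rle_trans; [apply Rmin_r | apply Rmin_r]).
    set (v := vb - d / 2). assert (Hv : vb - d < v < vb) by (unfold v; lra).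
    apply (max_principle (wk k) v vb al p); auto; try (unfold p; lra).
    + intros z Hz2. rewrite <- w_U. destruct (Hwin v ltac:(lra)) as [Hv1 [Hal' [Hbe' [HL _]]]].
      destruct (Rle_lt_dec z (Lz v k)) as [Hzl|Hzl]; [apply HL; lra|].
      destruct (HF v ltac:(lra)) as [HFv _]. apply Rabs_def2 in HFv.
      destruct (HB v ltac:(lra)) as [_ [_ [ZF _]]]. apply inz_LR in ZF; [|lra].
      apply (pattern_left _ _ _ _ _ (pattern_propagates k vb F G v0 v Hk ltac:(lra) HB ltac:(lra) ltac:(lra) HP)); unfold p in *; lra.
    + intros u Hu. rewrite <- w_U. destruct (Hwin u ltac:(lra)) as [_ [Hal' [_ [HL _]]]]. apply HL. lra.
    + intros u Hu. apply Hp. lra.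
  - set (p := y + h / 2).
    destruct (Hside p) as [e [He Hp]]; [unfold p; apply Rabs_def1; lra | unfold p; lra |].
    destruct (Hm (h / 2) ltac:(lra)) as [d1 [Hd1 HF]].
    set (d := Rmin (Rmin d0 e) (Rmin d1 (vb - v0))).
    assert (Hd : 0 < d) by (unfold d; repeat apply Rmin_pos; lra).
    assert (D1 : d <= d0) by (unfold d; eapply Rle_trans; [apply Rmin_l | apply Rmin_l]).
    assert (D2 : d <= e) by (unfold d; eapply Rle_trans; [apply Rmin_l | apply Rmin_r]).
    assert (D3 : d <= d1) by (unfold d; eapply Rle_trans; [apply Rmin_r | apply Rmin_l]).
    assert (D4 : d <= vb - v0) by (unfold d; eapply Rle_trans; [apply Rmin_r | apply Rmin_r]).
    set (v := vb - d / 2). assert (Hv : vb - d < v < vb) by (unfold v; lra).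
    apply (max_principle (wk k) v vb p be); auto; try (unfold p; lra).
    + intros z Hz2. rewrite <- w_U. destruct (Hwin v ltac:(lra)) as [Hv1 [Hal' [Hbe' [_ HR]]]].
      destruct (Rle_lt_dec (Rz v k) z) as [Hzl|Hzl]; [apply HR; lra|].
      destruct (HF v ltac:(lra)) as [_ HFv]. apply Rabs_def2 in HFv.
      destruct (HB v ltac:(lra)) as [_ [_ [_ [ZF _]]]]. apply inz_LR in ZF; [|lra].
      apply (pattern_right _ _ _ _ _ (pattern_propagates k vb F G v0 v Hk ltac:(lra) HB ltac:(lra) ltac:(lra) HP)); unfold p in *; lra.
    + intros u Hu. apply Hp. lra.
    + intros u Hu. rewrite <- w_U. destruct (Hwin u ltac:(lra)) as [_ [_ [Hbe' [_ HR]]]]. apply HR. lra.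
Qed.

Definition zone_neg (k : nat) (v : R) : Prop := forall x, Lz v k <= x <= Rz v k -> w v k x < 0.

Lemma zone_neg_step (k : nat) (s : R) : (1 <= k)%nat -> 0 < s < 1 ->
  exists d, 0 < d /\ forall v v', s - d < v -> v <= v' -> v' < s + d -> zone_neg k v -> zone_neg k v'.
Proof.
  intros Hk Hs. destruct (window k s Hk Hs) as [d [al [be [Hd Hwin]]]].
  exists d. split; auto. intros v v' Hv Hvv Hv' HN x Hx. rewrite w_U.
  destruct (Hwin v ltac:(lra)) as [Hv1 [Hal [Hbe [HL HR]]]].
  destruct (Hwin v' ltac:(lra)) as [Hv1' [Hal' [Hbe' _]]].
  pose proof (Lz_lt_Rz v k Hv1).
  apply (max_principle (wk k) v v' al be); auto using geom_bounded_wk; try lra.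
  - intros y Hy. rewrite <- w_U. destruct (Rle_lt_dec y (Lz v k)); [apply HL; lra|].
    destruct (Rle_lt_dec (Rz v k) y); [apply HR; lra | apply HN; lra].
  - intros u Hu. rewrite <- w_U. destruct (Hwin u ltac:(lra)) as [_ [Ha [_ [HLu _]]]]. apply HLu. lra.
  - intros u Hu. rewrite <- w_U. destruct (Hwin u ltac:(lra)) as [_ [_ [Ha [_ HRu]]]]. apply HRu. lra.
Qed.

(** The merged maximum sinks below zero because [2 v w_v = x^2 w_xx < 0] there. *)
Lemma zone_neg_after (k : nat) (vb : R) (F G : R -> R) (v0 y v : R) : (1 <= k)%nat -> 0 < vb < 1 ->
  zone_branches k vb F G -> 0 < v0 < vb -> pattern k v0 (F v0) (G v0) -> merging k vb F G y ->
  vb < v < 1 -> zone_neg k v.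
Proof.
  intros Hk Hvb HB Hv0 HP HM Hv.
  assert (HU := merging_unique k vb F G v0 y Hk Hvb HB Hv0 HP HM).
  destruct (merging_max k vb F G v0 y Hk Hvb HB Hv0 HP HM) as [Hxx _].
  destruct HM as [Hz [W0 [W1 [W2 _]]]]. apply inz_LR in Hz; [|lra].
  pose proof (geom_bounded_wk k) as Hc. pose proof (Lz_ge1 vb k Hvb Hk). pose proof (inv_v_gt1 vb Hvb).
  assert (Ht : U (tri_w (wk k)) vb y < 0).
  { assert (Hh := U_heat (wk k) vb y Hc ltac:(rewrite Rabs_pos_eq; lra)). rewrite W1 in Hh.
    assert (0 < y ^ 2) by (apply pow_lt; lra). nra. }
  destruct (U_neg_near _ vb y (geom_bounded_tri _ Hc) Hvb Ht) as [h [Hh Hloc]].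
  destruct (window k vb Hk Hvb) as [d0 [al [be [Hd0 Hwin]]]].
  destruct (Hwin vb ltac:(lra)) as [_ [Hal [Hbe [HL HR]]]].
  assert (Hout : forall x, al <= x <= be -> x <> y -> U (wk k) vb x < 0).
  { intros x Hx Hne. rewrite <- w_U. destruct (Rle_lt_dec x (Lz vb k)); [apply HL; lra|].
    destruct (Rle_lt_dec (Rz vb k) x); [apply HR; lra | apply HU; auto; lra]. }
  set (X := Rmax (Rabs al) (Rabs be)).
  assert (HX : forall x, al <= x <= be -> Rabs x <= X) by (intros; apply RmaxAbs; lra).
  set (b := (vb + 1) / 2). assert (Hb : vb < b < 1) by (unfold b; lra).
  destruct (U_lip_v (wk k) vb b X Hc ltac:(lra) ltac:(lra)) as [C [HC Hlip]].
  { eapply Rle_trans; [apply Rabs_pos | apply Rmax_l]. }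
  (* Away from [y] there is a uniform negative margin at [vb], which survives for a short time.
     Within [h / 2] of [y], where the margin is lost, the negative [v]-derivative provides the
     sign. *)
  assert (Far : forall p q, al <= p -> p <= q -> q <= be -> (q < y \/ y < p) ->
     exists e, 0 < e /\ forall u x, vb < u < vb + e -> u <= b -> p <= x <= q -> U (wk k) u x < 0).
  { intros p q Hp Hpq Hq Hy.
    destruct (interval_max_neg (U (wk k) vb) p q Hpq) as [m [Hm Him]].
    - intros x _. apply U_cont_x; auto. rewrite Rabs_pos_eq; lra.
    - intros x Hx. apply Hout; lra.
    - exists (m / C). split; [apply Rdiv_lt_0_compat; auto|]. intros u x Hu Hub Hx.
      specialize (Him x Hx). specialize (Hlip u vb x ltac:(lra) ltac:(lra) (HX x ltac:(lra))).
      apply Rabs_le_between in Hlip. rewrite Rabs_pos_eq in Hlip by lra.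
      assert (C * (u - vb) < m); [|lra].
      apply Rmult_lt_reg_r with (/ C); [apply Rinv_0_lt_compat; auto|].
      replace (C * (u - vb) * / C) with (u - vb) by (field; lra). unfold Rdiv in Hu. lra. }
  set (p := Rmax al (y - h / 2)). set (q := Rmin be (y + h / 2)).
  assert (Hp1 : al <= p) by apply Rmax_l. assert (Hp2 : y - h / 2 <= p) by apply Rmax_r.
  assert (Hp3 : p < y) by (apply Rmax_lub_lt; lra).
  assert (Hq1 : q <= be) by apply Rmin_l. assert (Hq2 : q <= y + h / 2) by apply Rmin_r.
  assert (Hq3 : y < q) by (apply Rmin_glb_lt; lra).
  destruct (Far al p ltac:(lra) Hp1 ltac:(lra) ltac:(left; auto)) as [e1 [He1 F1]].
  destruct (Far q be ltac:(lra) Hq1 ltac:(lra) ltac:(right; auto)) as [e2 [He2 F2]].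
  set (e := Rmin (Rmin e1 e2) (Rmin (Rmin h d0) (Rmin (b - vb) (v - vb)))).
  assert (He : 0 < e) by (unfold e; repeat apply Rmin_pos; lra).
  assert (E1 : e <= e1) by (unfold e; eapply Rle_trans; [apply Rmin_l | apply Rmin_l]).
  assert (E2 : e <= e2) by (unfold e; eapply Rle_trans; [apply Rmin_l | apply Rmin_r]).
  assert (E3 : e <= Rmin h d0) by (unfold e; eapply Rle_trans; [apply Rmin_r | apply Rmin_l]).
  assert (E4 : e <= Rmin (b - vb) (v - vb)) by (unfold e; eapply Rle_trans; [apply Rmin_r | apply Rmin_r]).
  assert (E5 : e <= h) by (eapply Rle_trans; [apply E3 | apply Rmin_l]).
  assert (E6 : e <= d0) by (eapply Rle_trans; [apply E3 | apply Rmin_r]).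
  assert (E7 : e <= b - vb) by (eapply Rle_trans; [apply E4 | apply Rmin_l]).
  assert (E8 : e <= v - vb) by (eapply Rle_trans; [apply E4 | apply Rmin_r]).
  set (u := vb + e / 2).
  assert (HNu : zone_neg k u).
  { intros x Hx. destruct (Hwin u ltac:(unfold u; lra)) as [Hu1 [Hal' [Hbe' _]]]. rewrite w_U.
    destruct (Rle_lt_dec x p); [apply F1; unfold u; lra|].
    destruct (Rle_lt_dec q x); [apply F2; unfold u; lra|].
    assert (Hle : U (wk k) vb x <= 0).
    { destruct (Req_dec x y) as [->|]; [rewrite <- w_U; lra|]. left. apply Hout; lra. }
    destruct (MVT_cor2 (fun v => U (wk k) v x) (fun v => U (tri_w (wk k)) v x / v) vb u ltac:(unfold u; lra)) as [t [E Ht']].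
    { intros z Hz2. apply is_derive_Reals, is_derive_U_v; auto. unfold u in Hz2; lra. }
    assert (U (tri_w (wk k)) t x < 0) by (apply Hloc; apply Rabs_def1; unfold u in *; lra).
    assert (0 < / t) by (apply Rinv_0_lt_compat; lra).
    assert (U (tri_w (wk k)) t x / t < 0) by (unfold Rdiv; nra).
    assert (0 < u - vb) by (unfold u; lra). nra. }
  apply (local_propagation (zone_neg k) u v); auto; [unfold u; lra|].
  intros s Hs. destruct (zone_neg_step k s Hk ltac:(unfold u in Hs; lra)) as [d [Hd Hst]].
  exists d. split; auto. intros. apply (Hst v1 v'); auto.
Qed.

(** * From the coalescence data to zones *)

Lemma Derive_theta (v x : R) : 0 < v < 1 -> Derive (theta (- v)) x = Ux one_w v x.
Proof.
  intros Hv. rewrite (Derive_ext _ (th v)) by (intros; apply theta_U).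
  apply is_derive_unique, is_derive_th; auto.
Qed.

Lemma Derive2_theta (v x : R) : 0 < v < 1 -> Derive_n (theta (- v)) 2 x = Uxx one_w v x.
Proof.
  intros Hv. simpl. rewrite (Derive_ext _ (Ux one_w v)).
  - apply is_derive_unique, is_derive_Ux_x; [apply geom_bounded_one | rewrite Rabs_pos_eq; lra].
  - intros t. rewrite <- Derive_theta by auto. apply Derive_ext. auto.
Qed.

Lemma w_sg (v : R) (k : nat) (x : R) : w v k (sg k * x) = sg k * theta (- v) x.
Proof.
  unfold w. rewrite <- Rmult_assoc, sg_sq, Rmult_1_l, theta_U. reflexivity.
Qed.

Lemma simple_zero_w (v : R) (k : nat) (x : R) : 0 < v < 1 -> zero_of_order (theta (- v)) x 1 ->
  w v k (sg k * x) = 0 /\ Ux (wk k) v (sg k * x) <> 0.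
Proof.
  intros Hv [H0 H1]. specialize (H0 O ltac:(lia)). simpl in H0, H1. split.
  - rewrite w_sg, H0. ring.
  - rewrite w_x, <- Rmult_assoc, sg_sq, Rmult_1_l, <- Derive_theta by auto. exact H1.
Qed.

Lemma double_zero_w (v : R) (k : nat) (x : R) : 0 < v < 1 -> zero_of_order (theta (- v)) x 2 ->
  w v k (sg k * x) = 0 /\ Ux (wk k) v (sg k * x) = 0 /\ Uxx (wk k) v (sg k * x) <> 0.
Proof.
  intros Hv [H0 H1]. assert (H00 := H0 O ltac:(lia)). assert (H01 := H0 1%nat ltac:(lia)).
  simpl in H00, H01. split; [|split].
  - rewrite w_sg, H00. ring.
  - rewrite w_x, <- Rmult_assoc, sg_sq, Rmult_1_l, <- Derive_theta by auto. exact H01.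
  - rewrite w_xx, <- (Rmult_assoc _ _ x), sg_sq, Rmult_1_l, <- Derive2_theta by auto.
    destruct (sg_cases k) as [-> | ->]; lra.
Qed.

(** The zeros of zone [k] have the indices [cz k - 1] and [cz k + 1]; with this parity the
    normalisation [- / q ^ j] has the sign [sg k] of the half-line of the zone. *)
Lemma cz_parity (k j : nat) : (1 <= k)%nat -> j = (cz k - 1)%nat \/ j = (cz k + 1)%nat -> (-1) ^ j = - sg k.
Proof.
  intros Hk Hj. destruct (even_cases k) as [[l [-> [Ec ->]]]|[l [-> [Ec ->]]]]; rewrite Ec in Hj.
  - assert (E : exists m, j = (2 * m + 1)%nat).
    { destruct Hj as [-> | ->]; [exists (2 * l - 1)%nat | exists (2 * l)%nat]; lia. }
    destruct E as [m ->]. rewrite pow_add, pow_mult. replace ((-1) ^ 2) with 1 by ring. rewrite pow1. ring.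
  - assert (E : exists m, j = (2 * m)%nat).
    { destruct Hj as [-> | ->]; [exists (2 * l + 1)%nat | exists (2 * l + 2)%nat]; lia. }
    destruct E as [m ->]. rewrite pow_mult. replace ((-1) ^ 2) with 1 by ring. rewrite pow1. ring.
Qed.

Lemma branch_asymptotic (k j : nat) (a : R) (f : R -> R) (eps : R) : (1 <= k)%nat ->
  j = (cz k - 1)%nat \/ j = (cz k + 1)%nat -> zero_branch j a f -> 0 < eps ->
  exists d, 0 < d /\ forall v, 0 < v < d -> Rabs (sg k * f (- v) * v ^ j - 1) < eps.
Proof.
  intros Hk Hj [_ Hlim] Heps.
  assert (HP : locally 1 (fun z => Rabs (z - 1) < eps)).
  { exists (mkposreal eps Heps). intros z Hz. exact Hz. }
  destruct (Hlim _ HP) as [d Hd].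
  exists d. split; [apply cond_pos|]. intros v Hv.
  assert (Hb : ball 0 d (- v)).
  { unfold ball; simpl. unfold AbsRing_ball, abs, minus, plus, opp; simpl.
    replace (- v + - 0) with (- v) by ring. rewrite Rabs_Ropp, Rabs_pos_eq; lra. }
  specialize (Hd (- v) Hb ltac:(lra)). simpl in Hd.
  replace (sg k * f (- v) * v ^ j) with (f (- v) / - / (- v) ^ j); auto.
  replace ((- v) ^ j) with ((-1) ^ j * v ^ j) by (rewrite <- Rpow_mult_distr; f_equal; ring).
  rewrite (cz_parity k j Hk Hj). assert (v ^ j <> 0) by (apply pow_nonzero; lra).
  destruct (sg_cases k) as [-> | ->]; field; auto.
Qed.

Lemma continuous_opp_arg (f : R -> R) (s v : R) : continuous f (- v) -> continuity_pt (fun v => s * f (- v)) v.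
Proof.
  intros H. apply continuity_pt_scal.
  apply (continuity_pt_comp (fun v => - v) f).
  - apply continuity_pt_opp, derivable_continuous_pt, derivable_pt_id.
  - apply continuity_pt_filterlim. exact H.
Qed.

Lemma cont_pt_vpow_mult (F : R -> R) (n : nat) (v : R) : continuity_pt F v ->
  continuity_pt (fun v => v ^ n * F v) v.
Proof.
  intros H. apply continuity_pt_mult; auto. apply derivable_continuous_pt, derivable_pt_pow.
Qed.

Lemma limit_le_left (f g : R -> R) (s d : R) : 0 < d -> continuity_pt f s -> continuity_pt g s ->
  (forall u, s - d < u < s -> f u <= g u) -> f s <= g s.
Proof.
  intros Hd Hf Hg H.
  assert (f s - g s <= 0); [|lra].
  apply (continuity_pt_le_left (fun u => f u - g u) s d 0); auto.
  - apply continuity_pt_minus; auto.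
  - intros u Hu. specialize (H u Hu). lra.
Qed.

(** For small [v] the asymptotics place the branch in the wider interval of [w_neg_outside], and a
    zero there must lie in the zone. Later the branch cannot leave the zone: a limit of points of
    the zone is in its closure, and [w] is negative at the ends. *)
Lemma branch_inz (k j : nat) (vb : R) (f : R -> R) : (1 <= k)%nat -> 0 < vb < 1 ->
  j = (cz k - 1)%nat \/ j = (cz k + 1)%nat -> zero_branch j (- vb) f ->
  forall v, 0 < v < vb -> inz v k (sg k * f (- v)).
Proof.
  intros Hk Hvb Hj HB v Hv.
  set (F := fun v => sg k * f (- v)). change (inz v k (F v)).
  pose proof (cz_ge k).
  assert (HF : forall u, 0 < u < vb -> continuity_pt F u /\ w u k (F u) = 0).
  { intros u Hu. destruct HB as [HB _]. destruct (HB (- u) ltac:(lra)) as [C Z]. split.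
    - apply continuous_opp_arg; auto.
    - apply (simple_zero_w u k _ ltac:(lra) Z). }
  destruct (branch_asymptotic k j (- vb) f (1 / 2) Hk Hj HB ltac:(lra)) as [d [Hd Has]].
  assert (Hsmall : forall u, 0 < u < Rmin (Rmin d vb) (1 / 2) -> inz u k (F u)).
  { intros u Hu. pose proof (Rmin_l (Rmin d vb) (1 / 2)). pose proof (Rmin_r (Rmin d vb) (1 / 2)).
    pose proof (Rmin_l d vb). pose proof (Rmin_r d vb).
    assert (Hu1 : 0 < u < 1) by lra.
    specialize (Has u ltac:(lra)). fold (F u) in Has. apply Rabs_def2 in Has.
    assert (Hp : forall n, 0 < u ^ n) by (intros; apply pow_lt; lra).
    assert (Ej : (u ^ cz k * F u = u * (F u * u ^ j)) \/ u * (u ^ cz k * F u) = F u * u ^ j).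
    { destruct Hj as [-> | ->]; [left | right].
      - replace (cz k) with (S (cz k - 1)) at 1 by lia. simpl. ring.
      - rewrite Nat.add_1_r. simpl. ring. }
    assert (Hx1 : 1 <= F u).
    { assert (1 <= j)%nat by lia. destruct j as [|j']; [lia|]. pose proof (pow_S_bounds u j' Hu1).
      destruct (Rle_lt_dec 1 (F u)) as [|Hlt]; auto. exfalso.
      assert (F u * u ^ S j' <= 1 * u) by (destruct (Rle_lt_dec 0 (F u)); nra). lra. }
    assert (Hu3 : u ^ 3 <= u * (1 / 4)) by (replace (u ^ 3) with (u * (u * u)) by ring; apply Rmult_le_compat_l; nra).
    assert (Hi3 : 4 * / u <= / u ^ 3).
    { replace (/ u ^ 3) with (/ u * (/ u * / u)) by (field; lra).
      assert (2 <= / u) by (replace 2 with (/ (1 / 2)) by field; apply Rinv_le_contravar; lra). nra. }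
    assert (Hi : 1 < / u) by (apply inv_v_gt1; auto).
    apply w_zero_inz; auto.
    - destruct Ej as [-> | Ej].
      + split; nra.
      + assert (E2 : u ^ cz k * F u = / u * (F u * u ^ j)) by (rewrite <- Ej; field; lra).
        rewrite E2. split; nra.
    - destruct (HF u ltac:(lra)) as [_ ->]. lra. }
  set (a := Rmin (Rmin (Rmin d vb) (1 / 2)) v / 2).
  assert (Ha : 0 < Rmin (Rmin (Rmin d vb) (1 / 2)) v) by (repeat apply Rmin_pos; lra).
  pose proof (Rmin_l (Rmin (Rmin d vb) (1 / 2)) v). pose proof (Rmin_r (Rmin (Rmin d vb) (1 / 2)) v).
  apply (real_induction (fun u => inz u k (F u)) a v); try (unfold a; lra).
  - apply Hsmall. unfold a. lra.
  - intros s Hs [P1 P2]. destruct (HF s ltac:(unfold a in Hs; lra)) as [C _].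
    assert (C1 := cont_pt_vpow_mult F (cz k) s C).
    assert (Hs1 : 0 < s < 1) by (unfold a in Hs; lra).
    assert (Ci : continuity_pt (fun u => / u) s).
    { apply (continuity_pt_inv (fun u => u)); [apply derivable_continuous_pt, derivable_pt_id | lra]. }
    set (m := Rmin (s ^ cz k * F s - s) (/ s - s ^ cz k * F s) / 2).
    assert (Hm : 0 < Rmin (s ^ cz k * F s - s) (/ s - s ^ cz k * F s)) by (apply Rmin_pos; lra).
    pose proof (Rmin_l (s ^ cz k * F s - s) (/ s - s ^ cz k * F s)).
    pose proof (Rmin_r (s ^ cz k * F s - s) (/ s - s ^ cz k * F s)).
    destruct (cont_near _ s m C1 ltac:(unfold m; lra)) as [d1 [Hd1 H1']].
    destruct (cont_near _ s m Ci ltac:(unfold m; lra)) as [d2 [Hd2 H2']].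
    exists (Rmin (Rmin d1 d2) m). split; [repeat apply Rmin_pos; unfold m; lra|].
    intros u Hu _. pose proof (Rmin_l (Rmin d1 d2) m). pose proof (Rmin_r (Rmin d1 d2) m).
    pose proof (Rmin_l d1 d2). pose proof (Rmin_r d1 d2).
    specialize (H1' u ltac:(apply Rabs_def1; lra)). specialize (H2' u ltac:(apply Rabs_def1; lra)).
    apply Rabs_def2 in H1'. apply Rabs_def2 in H2'. unfold inz, m in *. lra.
  - intros s Hs Hlt. destruct (HF s ltac:(unfold a in Hs; lra)) as [C W].
    assert (C1 := cont_pt_vpow_mult F (cz k) s C).
    assert (Hs1 : 0 < s < 1) by (unfold a in Hs; lra).
    assert (Ci : continuity_pt (fun u => / u) s).
    { apply (continuity_pt_inv (fun u => u)); [apply derivable_continuous_pt, derivable_pt_id | lra]. }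
    assert (L1 : s <= s ^ cz k * F s).
    { apply (limit_le_left (fun u => u) (fun u => u ^ cz k * F u) s (s - a)); auto; [lra| |].
      - apply derivable_continuous_pt, derivable_pt_id.
      - intros u Hu. destruct (Hlt u ltac:(lra)) as [? _]. lra. }
    assert (L2 : s ^ cz k * F s <= / s).
    { apply (limit_le_left (fun u => u ^ cz k * F u) (fun u => / u) s (s - a)); auto; [lra|].
      intros u Hu. destruct (Hlt u ltac:(lra)) as [_ ?]. lra. }
    pose proof (inv_v_gt1 s Hs1). pose proof (inz_ge s k (F s) Hs1 Hk L1).
    apply w_zero_inz; auto; try lra.
    split; [apply Rle_trans with s; auto; pose proof (pow_le_anti s 1 3 ltac:(lra) ltac:(lia)); lra|].
    apply Rle_trans with (/ s); auto. apply Rinv_le_contravar; [apply pow_lt; lra|].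
    pose proof (pow_le_anti s 1 3 ltac:(lra) ltac:(lia)). lra.
Qed.

(** Translates the coalescence of two zeros into the language of zones. Besides the location of the
    branches, the point is their order: it holds for small [v] by the asymptotics and persists
    because the zeros are simple. *)
Lemma coalesce_zone (k : nat) (a y : R) : (1 <= k)%nat -> coalesce (cz k - 1) (cz k + 1) a y ->
  0 < - a < 1 /\ exists F G, zone_branches k (- a) F G /\ merging k (- a) F G (sg k * y).
Proof.
  intros Hk [Ha [Hy [f [g [Bf [Bg [Lf Lg]]]]]]].
  split; [lra|]. set (vb := - a). replace a with (- vb) in * by (unfold vb; ring).
  assert (Hvb : 0 < vb < 1) by lra. clearbody vb. clear a.
  set (F := fun v => sg k * f (- v)). set (G := fun v => sg k * g (- v)).
  exists F, G.
  assert (IF := branch_inz k _ vb f Hk Hvb (or_introl eq_refl) Bf).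
  assert (IG := branch_inz k _ vb g Hk Hvb (or_intror eq_refl) Bg).
  fold (F) in IF.
  assert (HFG0 : forall v, 0 < v < vb -> continuity_pt F v /\ continuity_pt G v /\
    w v k (F v) = 0 /\ w v k (G v) = 0 /\ Ux (wk k) v (F v) <> 0 /\ Ux (wk k) v (G v) <> 0).
  { intros v Hv. destruct Bf as [Bf _], Bg as [Bg _].
    destruct (Bf (- v) ltac:(lra)) as [Cf Zf]. destruct (Bg (- v) ltac:(lra)) as [Cg Zg].
    destruct (simple_zero_w v k _ ltac:(lra) Zf). destruct (simple_zero_w v k _ ltac:(lra) Zg).
    repeat split; auto; apply continuous_opp_arg; auto. }
  destruct (branch_asymptotic k _ (- vb) f (1 / 2) Hk (or_introl eq_refl) Bf ltac:(lra)) as [d1 [Hd1 A1]].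
  destruct (branch_asymptotic k _ (- vb) g (1 / 2) Hk (or_intror eq_refl) Bg ltac:(lra)) as [d2 [Hd2 A2]].
  pose proof (cz_ge k) as Hcz. pose proof (geom_bounded_wk k) as Hc.
  assert (HFG : forall v, 0 < v < vb -> F v < G v).
  { intros v Hv.
    set (r := Rmin (Rmin d1 d2) (Rmin v (1 / 2))).
    assert (Hr : 0 < r) by (unfold r; repeat apply Rmin_pos; lra).
    assert (r <= d1) by (unfold r; eapply Rle_trans; [apply Rmin_l | apply Rmin_l]).
    assert (r <= d2) by (unfold r; eapply Rle_trans; [apply Rmin_l | apply Rmin_r]).
    assert (r <= v) by (unfold r; eapply Rle_trans; [apply Rmin_r | apply Rmin_l]).
    assert (r <= 1 / 2) by (unfold r; eapply Rle_trans; [apply Rmin_r | apply Rmin_r]).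
    apply (real_induction (fun u => F u < G u) (r / 2) v); try lra.
    - set (u := r / 2). assert (Hu : 0 < u < r) by (unfold u; lra).
      specialize (A1 u ltac:(lra)). specialize (A2 u ltac:(lra)).
      fold (F u) in A1. fold (G u) in A2. apply Rabs_def2 in A1. apply Rabs_def2 in A2.
      assert (Hp : 0 < u ^ (cz k + 1)) by (apply pow_lt; lra).
      apply Rmult_lt_reg_r with (u ^ (cz k + 1)); auto.
      replace (u ^ (cz k + 1)) with (u ^ (cz k - 1) * u ^ 2) at 1 by (rewrite <- pow_add; f_equal; lia).
      assert (u ^ 2 <= 1 / 4) by (replace (u ^ 2) with (u * u) by ring; nra).
      assert (0 < u ^ 2) by (apply pow_lt; lra).
      assert (F u * u ^ (cz k - 1) * u ^ 2 <= 3 / 2 * (1 / 4)) by (apply Rmult_le_compat; lra).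
      lra.
    - intros s Hs P. destruct (HFG0 s ltac:(lra)) as [CF [CG _]].
      destruct (cont_near F s ((G s - F s) / 2) CF ltac:(lra)) as [e1 [He1 E1]].
      destruct (cont_near G s ((G s - F s) / 2) CG ltac:(lra)) as [e2 [He2 E2]].
      exists (Rmin e1 e2). split; [apply Rmin_pos; auto|]. intros u Hu _.
      pose proof (Rmin_l e1 e2). pose proof (Rmin_r e1 e2).
      specialize (E1 u ltac:(apply Rabs_def1; lra)). specialize (E2 u ltac:(apply Rabs_def1; lra)).
      apply Rabs_def2 in E1. apply Rabs_def2 in E2. lra.
    (* If the branches met at [s] before merging, Rolle's theorem just before [s] would produce a
       zero of [Ux] arbitrarily close to the meeting point, where [Ux] is nonzero. *)
    - intros s Hs Hlt. destruct (HFG0 s ltac:(lra)) as [CF [CG [_ [_ [SF _]]]]].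
      assert (Hle : F s <= G s).
      { apply (limit_le_left F G s (s - r / 2)); auto; [lra|]. intros u Hu. left. apply Hlt. lra. }
      destruct Hle as [|Heq]; auto. exfalso.
      assert (Hs1 : 0 < s < 1) by lra.
      assert (Hnz : exists e, 0 < e /\ forall u x, Rabs (u - s) < e -> Rabs (x - F s) < e -> Ux (wk k) u x <> 0).
      { destruct (Rtotal_order (Ux (wk k) s (F s)) 0) as [Hn|[Hn|Hn]]; [|lra|].
        - destruct (Ux_neg_near (wk k) s (F s) Hc Hs1 Hn) as [e [He H']]. exists e. split; auto.
          intros u x Hu Hx. specialize (H' u x Hu Hx). lra.
        - destruct (Ux_pos_near (wk k) s (F s) Hc Hs1 Hn) as [e [He H']]. exists e. split; auto.
          intros u x Hu Hx. specialize (H' u x Hu Hx). lra. }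
      destruct Hnz as [e [He Hnz]].
      destruct (cont_near F s e CF He) as [e1 [He1 E1]]. destruct (cont_near G s e CG He) as [e2 [He2 E2]].
      set (u := s - Rmin (Rmin e (s - r / 2)) (Rmin e1 e2) / 2).
      assert (Hm : 0 < Rmin (Rmin e (s - r / 2)) (Rmin e1 e2)) by (repeat apply Rmin_pos; lra).
      assert (Rmin (Rmin e (s - r / 2)) (Rmin e1 e2) <= e) by (eapply Rle_trans; [apply Rmin_l | apply Rmin_l]).
      assert (Rmin (Rmin e (s - r / 2)) (Rmin e1 e2) <= s - r / 2) by (eapply Rle_trans; [apply Rmin_l | apply Rmin_r]).
      assert (Rmin (Rmin e (s - r / 2)) (Rmin e1 e2) <= e1) by (eapply Rle_trans; [apply Rmin_r | apply Rmin_l]).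
      assert (Rmin (Rmin e (s - r / 2)) (Rmin e1 e2) <= e2) by (eapply Rle_trans; [apply Rmin_r | apply Rmin_r]).
      assert (Hus : s - r / 2 > 0) by lra.
      assert (Hu : r / 2 <= u < s) by (unfold u; lra).
      specialize (E1 u ltac:(unfold u; apply Rabs_def1; lra)). specialize (E2 u ltac:(unfold u; apply Rabs_def1; lra)).
      rewrite <- Heq in E2. apply Rabs_def2 in E1. apply Rabs_def2 in E2.
      destruct (HFG0 u ltac:(lra)) as [_ [_ [W1 [W2 _]]]]. rewrite w_U in W1, W2.
      destruct (MVT_cor2 (U (wk k) u) (Ux (wk k) u) (F u) (G u)) as [t [E Ht]]; [apply Hlt; lra| |].
      { intros z _. apply is_derive_Reals, is_derive_U_x; auto. rewrite Rabs_pos_eq; lra. }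
      apply (Hnz u t); [unfold u; apply Rabs_def1; lra | apply Rabs_def1; lra |].
      specialize (Hlt u ltac:(lra)). rewrite W1, W2 in E.
      apply Rmult_eq_reg_r with (G u - F u); lra. }
  split.
  - intros v Hv. destruct (HFG0 v Hv) as [? [? [? [? [? ?]]]]].
    specialize (IF v Hv). specialize (IG v Hv). specialize (HFG v Hv). repeat split; auto; try apply IF; apply IG.
  - assert (Hm : forall h, 0 < h -> exists d, 0 < d /\ forall v, vb - d < v < vb ->
      Rabs (F v - sg k * y) < h /\ Rabs (G v - sg k * y) < h).
    { intros h Hh.
      assert (HP : locally y (fun z => Rabs (z - y) < h)).
      { exists (mkposreal h Hh). intros z Hz. exact Hz. }
      destruct (Lf _ HP) as [e1 He1]. destruct (Lg _ HP) as [e2 He2].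
      pose proof (cond_pos e1). pose proof (cond_pos e2).
      exists (Rmin e1 e2). split; [apply Rmin_pos; auto|]. intros v Hv.
      pose proof (Rmin_l e1 e2). pose proof (Rmin_r e1 e2).
      assert (Hb : forall e, vb - v < e -> ball (- vb) e (- v)).
      { intros e He. unfold ball; simpl. unfold AbsRing_ball, abs, minus, plus, opp; simpl.
        replace (- v + - - vb) with (vb - v) by ring. rewrite Rabs_pos_eq; lra. }
      specialize (He1 (- v) (Hb e1 ltac:(lra)) ltac:(lra)).
      specialize (He2 (- v) (Hb e2 ltac:(lra)) ltac:(lra)).
      unfold F, G. rewrite <- !Rmult_minus_distr_l, !Rabs_mult.
      replace (Rabs (sg k)) with 1; [rewrite !Rmult_1_l; auto|].
      destruct (sg_cases k) as [-> | ->]; [rewrite Rabs_R1 | rewrite Rabs_left]; lra. }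
    destruct (double_zero_w vb k y Hvb Hy) as [W0 [W1 W2]].
    split; [|auto].
    set (Y := sg k * y) in *.
    (* At [vb] itself the value of [F] is arbitrary. Extending [F] by its limit [Y] lets the closed
       inequalities of the zone pass to the limit, and [w_zero_inz] makes them strict. *)
    set (F' := fun v => if Rlt_dec v vb then F v else Y).
    assert (CF' : continuity_pt F' vb).
    { intros eps Heps. destruct (Hm eps Heps) as [d [Hd H']]. exists (Rmin d vb).
      split; [apply Rmin_pos; lra|]. intros x [_ Hx]. simpl in *. unfold R_dist in *.
      pose proof (Rmin_l d vb). apply Rabs_def2 in Hx. unfold F'.
      destruct (Rlt_dec vb vb); [lra|]. destruct (Rlt_dec x vb).
      - apply H'. lra.
      - rewrite Rminus_diag, Rabs_R0. auto. }
    assert (C1 := cont_pt_vpow_mult F' (cz k) vb CF').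
    assert (EF' : F' vb = Y) by (unfold F'; destruct (Rlt_dec vb vb); [lra | auto]).
    assert (Ci : continuity_pt (fun u => / u) vb).
    { apply (continuity_pt_inv (fun u => u)); [apply derivable_continuous_pt, derivable_pt_id | lra]. }
    assert (Hin : forall u, 0 < u < vb -> inz u k (F' u)).
    { intros u Hu. unfold F'. destruct (Rlt_dec u vb); [apply IF; auto | lra]. }
    assert (L1 : vb <= vb ^ cz k * F' vb).
    { apply (limit_le_left (fun u => u) (fun u => u ^ cz k * F' u) vb vb); auto; [lra| |].
      - apply derivable_continuous_pt, derivable_pt_id.
      - intros u Hu. destruct (Hin u ltac:(lra)) as [? _]. lra. }
    assert (L2 : vb ^ cz k * F' vb <= / vb).
    { apply (limit_le_left (fun u => u ^ cz k * F' u) (fun u => / u) vb vb); auto; [lra|].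
      intros u Hu. destruct (Hin u ltac:(lra)) as [_ ?]. lra. }
    rewrite EF' in *. pose proof (inv_v_gt1 vb Hvb). pose proof (inz_ge vb k Y Hvb Hk L1).
    apply w_zero_inz; auto; try lra.
    split; [apply Rle_trans with vb; auto; pose proof (pow_le_anti vb 1 3 ltac:(lra) ltac:(lia)); lra|].
    apply Rle_trans with (/ vb); auto. apply Rinv_le_contravar; [apply pow_lt; lra|].
    pose proof (pow_le_anti vb 1 3 ltac:(lra) ltac:(lia)). lra.
Qed.

(** * Entire power series over the complex numbers *)

Lemma C_ext (z z' : C) : Re z = Re z' -> Im z = Im z' -> z = z'.
Proof. destruct z, z'. simpl. intros -> ->. reflexivity. Qed.

Lemma Im_RtoC (r : R) : Im (RtoC r) = 0. Proof. reflexivity. Qed.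

Lemma im_le_Cmod (z : C) : Rabs (Im z) <= Cmod z.
Proof. eapply Rle_trans; [apply Rmax_r | apply (Rmax_Cmod z)]. Qed.

Definition clim (u : nat -> C) (l : C) : Prop :=
  is_lim_seq (fun n => Re (u n)) (Re l) /\ is_lim_seq (fun n => Im (u n)) (Im l).

Lemma clim_unique (u : nat -> C) (l l' : C) : clim u l -> clim u l' -> l = l'.
Proof.
  intros [H1 H2] [H3 H4]. apply is_lim_seq_unique in H1, H2, H3, H4.
  apply C_ext; [assert (E : Finite (Re l) = Finite (Re l')) by congruence
               | assert (E : Finite (Im l) = Finite (Im l')) by congruence]; now injection E.
Qed.

Lemma clim_ext (u u' : nat -> C) (l : C) : (forall n, u n = u' n) -> clim u l -> clim u' l.
Proof.
  intros E [H1 H2]. split.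
  - apply (is_lim_seq_ext (fun n => Re (u n))); auto. intros n. now rewrite E.
  - apply (is_lim_seq_ext (fun n => Im (u n))); auto. intros n. now rewrite E.
Qed.

Lemma clim_const (l : C) : clim (fun _ => l) l.
Proof. split; apply is_lim_seq_const. Qed.

Lemma clim_plus (u u' : nat -> C) (l l' : C) : clim u l -> clim u' l' -> clim (fun n => u n + u' n)%C (l + l')%C.
Proof. intros [H1 H2] [H3 H4]. split; simpl; apply is_lim_seq_plus'; auto. Qed.

Lemma clim_mult (u u' : nat -> C) (l l' : C) : clim u l -> clim u' l' -> clim (fun n => u n * u' n)%C (l * l')%C.
Proof.
  intros [H1 H2] [H3 H4]. split; simpl.
  - apply is_lim_seq_minus'; apply is_lim_seq_mult'; auto.
  - apply is_lim_seq_plus'; apply is_lim_seq_mult'; auto.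
Qed.

Lemma clim_S (u : nat -> C) (l : C) : clim u l -> clim (fun n => u (S n)) l.
Proof.
  intros [H1 H2]. split.
  - apply (is_lim_seq_incr_1 (fun n => Re (u n))); auto.
  - apply (is_lim_seq_incr_1 (fun n => Im (u n))); auto.
Qed.

Lemma clim_Cmod (u : nat -> C) (l : C) : clim u l -> is_lim_seq (fun n => Cmod (u n)) (Cmod l).
Proof.
  intros [H1 H2]. unfold Cmod.
  apply (is_lim_seq_continuous sqrt).
  - apply continuity_pt_sqrt. assert (0 <= fst l ^ 2) by apply pow2_ge_0. assert (0 <= snd l ^ 2) by apply pow2_ge_0. lra.
  - simpl. apply is_lim_seq_plus'.
    + apply is_lim_seq_mult'; auto. apply is_lim_seq_mult'; auto. apply is_lim_seq_const.
    + apply is_lim_seq_mult'; auto. apply is_lim_seq_mult'; auto. apply is_lim_seq_const.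
Qed.

Lemma clim_Cmod_le (u : nat -> C) (l : C) (B : R) (N : nat) : clim u l ->
  (forall n, (N <= n)%nat -> Cmod (u n) <= B) -> Cmod l <= B.
Proof.
  intros H HB. assert (K := is_lim_seq_le_loc (fun n => Cmod (u n)) (fun _ => B) (Cmod l) B).
  apply K; [exists N; auto | apply clim_Cmod; auto | apply is_lim_seq_const].
Qed.

Lemma clim_Cmod_ge (u : nat -> C) (l : C) (B : R) (N : nat) : clim u l ->
  (forall n, (N <= n)%nat -> B <= Cmod (u n)) -> B <= Cmod l.
Proof.
  intros H HB. assert (K := is_lim_seq_le_loc (fun _ => B) (fun n => Cmod (u n)) B (Cmod l)).
  apply K; [exists N; auto | apply is_lim_seq_const | apply clim_Cmod; auto].
Qed.

Fixpoint csumf (f : nat -> C) (n : nat) : C :=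
  match n with O => RtoC 0 | S n => (csumf f n + f n)%C end.

Lemma csumf_Re (f : nat -> C) (n : nat) : Re (csumf f n) = sumf (fun i => Re (f i)) n.
Proof. induction n as [|n IH]; simpl; auto. rewrite <- IH. reflexivity. Qed.

Lemma csumf_Im (f : nat -> C) (n : nat) : Im (csumf f n) = sumf (fun i => Im (f i)) n.
Proof. induction n as [|n IH]; simpl; auto. rewrite <- IH. reflexivity. Qed.

Lemma csumf_ext (f g : nat -> C) (n : nat) : (forall i, (i < n)%nat -> f i = g i) -> csumf f n = csumf g n.
Proof. induction n as [|n IH]; intros H; simpl; auto. rewrite IH by auto. now rewrite H by lia. Qed.

Lemma csumf_plus (f g : nat -> C) (n : nat) : csumf (fun i => f i + g i)%C n = (csumf f n + csumf g n)%C.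
Proof. induction n as [|n IH]; simpl; [ring|]. rewrite IH. ring. Qed.

Lemma csumf_scal (k : C) (f : nat -> C) (n : nat) : csumf (fun i => k * f i)%C n = (k * csumf f n)%C.
Proof. induction n as [|n IH]; simpl; [ring|]. rewrite IH. ring. Qed.

Lemma csumf_Cmod (f : nat -> C) (n : nat) : Cmod (csumf f n) <= sumf (fun i => Cmod (f i)) n.
Proof.
  induction n as [|n IH]; simpl; [rewrite Cmod_0; lra|].
  eapply Rle_trans; [apply Cmod_triangle|]. lra.
Qed.

Lemma csumf_swap (f : nat -> nat -> C) (n m : nat) :
  csumf (fun i => csumf (f i) m) n = csumf (fun j => csumf (fun i => f i j) n) m.
Proof.
  induction n as [|n IH]; simpl.
  - induction m as [|m IHm]; simpl; auto. rewrite <- IHm. ring.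
  - rewrite IH. rewrite <- csumf_plus. reflexivity.
Qed.

(** Written in the same form as [Ctheta], so that [CSum (cs (theta_coeff q))] and [Ctheta q] are
    convertible. *)
Definition CSum (a : nat -> C) (z : C) : C :=
  (Series (fun j => Re (a j * z ^ j)%C), Series (fun j => Im (a j * z ^ j)%C)).

Definition centire (a : nat -> C) : Prop := forall r, 0 < r -> exists M, forall n, Cmod (a n) * r ^ n <= M.

Lemma bound_geom (M r : R) (a : nat -> R) : 0 <= r -> (forall n, 0 <= a n) ->
  (forall n, a n * (2 * r + 1) ^ n <= M) -> forall n, a n * r ^ n <= M * (/ 2) ^ n.
Proof.
  intros Hr Ha H n. apply Rmult_le_reg_r with (2 ^ n); [apply pow_lt; lra|].
  rewrite pow_inv, (Rmult_assoc M), Rinv_l, Rmult_1_r by (apply pow_nonzero; lra).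
  eapply Rle_trans; [|apply H]. rewrite Rmult_assoc, <- Rpow_mult_distr.
  apply Rmult_le_compat_l; auto. apply pow_incr. lra.
Qed.

Lemma centire_majorant (a : nat -> C) (r : R) : centire a -> 0 <= r ->
  exists M, forall n, Cmod (a n) * r ^ n <= M * (/ 2) ^ n.
Proof.
  intros Ha Hr. destruct (Ha (2 * r + 1) ltac:(lra)) as [M HM].
  exists M. apply bound_geom; auto. intros; apply Cmod_ge_0.
Qed.

Lemma CSum_clim (a : nat -> C) (z : C) : centire a -> clim (csumf (fun j => a j * z ^ j)%C) (CSum a z).
Proof.
  intros Ha. destruct (centire_majorant a (Cmod z) Ha (Cmod_ge_0 z)) as [M HM].
  assert (HB : forall j, Cmod (a j * z ^ j)%C <= M * (/ 2) ^ j).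
  { intros j. rewrite Cmod_mult, Cmod_pow. apply HM. }
  split.
  - change (Re (CSum a z)) with (Series (fun j => Re (a j * z ^ j)%C)).
    apply (is_lim_seq_ext (sumf (fun j => Re (a j * z ^ j)%C))).
    + intros n. symmetry. apply csumf_Re.
    + apply sumf_lim, ex_series_Rabs, (ex_series_abs_le _ (fun j => M * (/ 2) ^ j)); [apply ex_series_half|].
      intros j. eapply Rle_trans; [apply re_le_Cmod | auto].
  - change (Im (CSum a z)) with (Series (fun j => Im (a j * z ^ j)%C)).
    apply (is_lim_seq_ext (sumf (fun j => Im (a j * z ^ j)%C))).
    + intros n. symmetry. apply csumf_Im.
    + apply sumf_lim, ex_series_Rabs, (ex_series_abs_le _ (fun j => M * (/ 2) ^ j)); [apply ex_series_half|].
      intros j. eapply Rle_trans; [apply im_le_Cmod | auto].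
Qed.

Lemma CSum_bound (a : nat -> C) (z : C) (M : nat -> R) : centire a -> ex_series M ->
  (forall n, Cmod (a n) * Cmod z ^ n <= M n) -> Cmod (CSum a z) <= Series M.
Proof.
  intros Ha HM H. apply (clim_Cmod_le _ _ _ O (CSum_clim a z Ha)). intros n _.
  eapply Rle_trans; [apply csumf_Cmod|].
  apply Rle_trans with (sumf M n).
  - apply sumf_le. intros i _. rewrite Cmod_mult, Cmod_pow. apply H.
  - apply sumf_le_series; auto. intros i. eapply Rle_trans; [|apply H].
    apply Rmult_le_pos; [apply Cmod_ge_0 | apply pow_le, Cmod_ge_0].
Qed.

Lemma CSum_ext (a b : nat -> C) (z : C) : (forall n, a n = b n) -> CSum a z = CSum b z.
Proof. intros E. unfold CSum. f_equal; apply Series_ext; intros n; now rewrite E. Qed.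

Definition cmul1 (xi : C) (a : nat -> C) (n : nat) : C :=
  match n with O => a O | S m => (a (S m) - xi * a m)%C end.

Lemma centire_mul1 (xi : C) (a : nat -> C) : centire a -> centire (cmul1 xi a).
Proof.
  intros Ha r Hr. destruct (Ha r Hr) as [M HM].
  assert (HM0 : 0 <= M) by (eapply Rle_trans; [|apply (HM O)]; apply Rmult_le_pos; [apply Cmod_ge_0 | simpl; lra]).
  pose proof (Cmod_ge_0 xi).
  exists (M + Cmod xi * r * M). intros [|n]; simpl cmul1.
  - specialize (HM O). assert (0 <= Cmod xi * r * M) by (repeat apply Rmult_le_pos; lra). lra.
  - apply Rle_trans with ((Cmod (a (S n)) + Cmod xi * Cmod (a n)) * r ^ S n).
    + apply Rmult_le_compat_r; [apply pow_le; lra|]. unfold Cminus.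
      eapply Rle_trans; [apply Cmod_triangle|]. rewrite Cmod_opp, Cmod_mult. lra.
    + rewrite Rmult_plus_distr_r. apply Rplus_le_compat; [apply HM|].
      simpl. replace (Cmod xi * Cmod (a n) * (r * r ^ n)) with (Cmod xi * r * (Cmod (a n) * r ^ n)) by ring.
      apply Rmult_le_compat_l; [apply Rmult_le_pos; lra | apply HM].
Qed.

Lemma CSum_mul1 (xi : C) (a : nat -> C) (z : C) : centire a ->
  CSum (cmul1 xi a) z = ((1 - xi * z) * CSum a z)%C.
Proof.
  intros Ha. apply (clim_unique (fun n => csumf (fun j => cmul1 xi a j * z ^ j)%C (S n))).
  - apply clim_S. apply CSum_clim, centire_mul1, Ha.
  - apply (clim_ext (fun n => csumf (fun j => a j * z ^ j)%C (S n) + - xi * z * csumf (fun j => a j * z ^ j)%C n)%C).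
    + intros n. induction n as [|n IH]; [simpl; ring|].
      change (csumf (fun j => cmul1 xi a j * z ^ j)%C (S (S n)))
        with (csumf (fun j => cmul1 xi a j * z ^ j)%C (S n) + cmul1 xi a (S n) * z ^ S n)%C.
      rewrite <- IH. simpl. ring.
    + replace ((1 - xi * z) * CSum a z)%C with (CSum a z + - xi * z * CSum a z)%C by ring.
      apply clim_plus; [apply clim_S, CSum_clim; auto|].
      apply clim_mult; [apply clim_const | apply CSum_clim; auto].
Qed.

(** ** Cauchy's estimate, by averaging over roots of unity *)

Definition root1 (N : nat) : C := (cos (2 * PI / INR N), sin (2 * PI / INR N)).

Lemma root1_pow (N k : nat) :
  (root1 N ^ k)%C = (cos (INR k * (2 * PI / INR N)), sin (INR k * (2 * PI / INR N))).
Proof.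
  induction k as [|k IH].
  - simpl. rewrite Rmult_0_l, cos_0, sin_0. reflexivity.
  - rewrite Cpow_S, IH, S_INR, Rmult_plus_distr_r, Rmult_1_l, Rplus_comm.
    rewrite cos_plus, sin_plus. apply C_ext; simpl; ring.
Qed.

Lemma root1_N (N : nat) : (0 < N)%nat -> (root1 N ^ N)%C = RtoC 1.
Proof.
  intros HN. rewrite root1_pow.
  assert (INR N <> 0) by (apply not_0_INR; lia).
  replace (INR N * (2 * PI / INR N)) with (2 * PI) by (field; auto).
  rewrite cos_2PI, sin_2PI. reflexivity.
Qed.

Lemma root1_neq1 (N d : nat) : (0 < d < N)%nat -> (root1 N ^ d)%C <> RtoC 1.
Proof.
  intros Hd E. rewrite root1_pow in E. apply (f_equal Re) in E. simpl in E.
  set (t := INR d * (2 * PI / INR N)) in *.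
  assert (HN : 0 < INR N) by (apply lt_0_INR; lia).
  assert (Hd0 : 0 < INR d) by (apply lt_0_INR; lia).
  assert (Hlt : INR d < INR N) by (apply lt_INR; lia).
  pose proof PI_RGT_0.
  assert (Ht : 0 < t / 2 < PI).
  { unfold t. replace (INR d * (2 * PI / INR N) / 2) with (PI * (INR d / INR N)) by (field; lra).
    assert (0 < INR d / INR N < 1).
    { split; [apply Rdiv_lt_0_compat; auto|]. apply Rmult_lt_reg_r with (INR N); auto.
      unfold Rdiv. rewrite Rmult_assoc, Rinv_l by lra. lra. }
    nra. }
  assert (S := sin_gt_0 (t / 2) ltac:(lra) ltac:(lra)).
  replace t with (2 * (t / 2)) in E by field. rewrite cos_2a_sin in E. nra.
Qed.

Lemma geom_root (x : C) (N : nat) : x <> RtoC 1 -> (x ^ N)%C = RtoC 1 -> csumf (fun k => x ^ k)%C N = RtoC 0.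
Proof.
  intros Hx HN.
  assert (E : ((1 - x) * csumf (fun k => x ^ k)%C N)%C = (1 - x ^ N)%C).
  { clear HN. induction N as [|N IH]; [simpl; ring|].
    change (csumf (fun k => x ^ k)%C (S N)) with (csumf (fun k => x ^ k)%C N + x ^ N)%C.
    rewrite Cmult_plus_distr_l, IH, Cpow_S. ring. }
  rewrite HN in E.
  assert (Hne : (1 - x)%C <> RtoC 0).
  { intros H0. apply Hx. replace x with (1 - (1 - x))%C by ring. rewrite H0. ring. }
  replace (csumf (fun k => x ^ k)%C N) with (/ (1 - x) * ((1 - x) * csumf (fun k => x ^ k)%C N))%C
    by (field; auto).
  rewrite E. replace (1 - 1)%C with (RtoC 0) by ring. ring.
Qed.

Lemma Cmod_root1 (N : nat) : Cmod (root1 N) = 1.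
Proof.
  unfold root1, Cmod. simpl fst. simpl snd.
  replace (cos (2 * PI / INR N) ^ 2 + sin (2 * PI / INR N) ^ 2) with 1.
  - apply sqrt_1.
  - set (t := 2 * PI / INR N). pose proof (sin2_cos2 t). unfold Rsqr in H. simpl. lra.
Qed.

Lemma root_sum (N e : nat) : (0 < N)%nat -> (0 < e < 2 * N)%nat -> e <> N ->
  csumf (fun k => (root1 N ^ e) ^ k)%C N = RtoC 0.
Proof.
  intros HN He Hne. apply geom_root.
  - destruct (le_lt_dec N e) as [H|H].
    + replace e with (N + (e - N))%nat by lia. rewrite Cpow_add_r, root1_N by auto.
      rewrite Cmult_1_l. apply root1_neq1. lia.
    + apply root1_neq1. lia.
  - rewrite <- Cpow_mult_r, Nat.mul_comm, Cpow_mult_r, root1_N by auto. apply Cpow_1_l.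
Qed.

Lemma csumf_single (f : nat -> C) (n N : nat) : (n < N)%nat -> (forall i, (i < N)%nat -> i <> n -> f i = RtoC 0) ->
  csumf f N = f n.
Proof.
  induction N as [|N IH]; intros Hn H; [lia|]. simpl.
  destruct (Nat.eq_dec n N) as [->|Hne].
  - replace (csumf f N) with (RtoC 0); [ring|]. clear IH.
    assert (G : forall m, (m <= N)%nat -> csumf f m = RtoC 0).
    { induction m as [|m IHm]; intros Hm; simpl; auto. rewrite IHm by lia. rewrite H by lia. ring. }
    rewrite G; auto.
  - rewrite IH by (auto; lia). rewrite (H N) by lia. ring.
Qed.

Lemma csumf_const (k : C) (N : nat) : csumf (fun _ => k) N = (RtoC (INR N) * k)%C.
Proof.
  induction N as [|N IH]; [simpl; ring|]. simpl csumf. rewrite IH, S_INR, RtoC_plus. ring.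
Qed.

(** For a polynomial of degree below [N] the average of its values at the points [r * w ^ k],
    weighted with [w ^ ((N - n) * k)], is exactly the term of index [n]: all other powers of the
    root of unity [w] sum to zero. The exponent [N - n] replaces [- n]. *)
Lemma cauchy_finite (a : nat -> C) (r B : R) (n N : nat) : 0 <= r -> (n < N)%nat ->
  (forall z, Cmod z = r -> Cmod (csumf (fun j => a j * z ^ j)%C N) <= B) ->
  Cmod (a n) * r ^ n <= B.
Proof.
  intros Hr Hn HB. set (w := root1 N).
  assert (HN : 0 < INR N) by (apply lt_0_INR; lia).
  assert (E : csumf (fun k => csumf (fun j => a j * (RtoC r * w ^ k) ^ j)%C N * (w ^ (N - n)) ^ k)%C N
    = (RtoC (INR N) * (a n * RtoC r ^ n))%C).
  { transitivity (csumf (fun k => csumf (fun j => a j * RtoC r ^ j * (w ^ (j + (N - n))) ^ k)%C N) N).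
    { apply csumf_ext. intros k _. rewrite Cmult_comm, <- csumf_scal. apply csumf_ext. intros j _.
      rewrite Cpow_mult_l, Cpow_add_r, Cpow_mult_l.
      replace ((w ^ k) ^ j)%C with ((w ^ j) ^ k)%C by (rewrite <- !Cpow_mult_r, Nat.mul_comm; auto). ring. }
    rewrite csumf_swap. rewrite (csumf_single _ n N Hn).
    - rewrite (csumf_ext _ (fun _ => a n * RtoC r ^ n)%C); [apply csumf_const|].
      intros k _. replace (n + (N - n))%nat with N by lia. unfold w. rewrite root1_N, Cpow_1_l by lia. ring.
    - intros j Hj Hne. rewrite csumf_scal. unfold w. rewrite root_sum by lia. ring. }
  assert (L : Cmod (RtoC (INR N) * (a n * RtoC r ^ n))%C <= INR N * B).
  { rewrite <- E. eapply Rle_trans; [apply csumf_Cmod|].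
    apply Rle_trans with (sumf (fun _ => B * 1) N).
    - apply sumf_le. intros k _. rewrite Cmod_mult, !Cmod_pow. unfold w. rewrite Cmod_root1, !pow1, Rmult_1_r, Rmult_1_r.
      apply HB. rewrite Cmod_mult, Cmod_pow. fold w. unfold w. rewrite Cmod_root1, pow1, Cmod_R, Rabs_pos_eq; lra.
    - rewrite sumf_scal. right. clear. induction N as [|N IH]; [simpl; ring|]. simpl sumf. rewrite S_INR. lra. }
  rewrite !Cmod_mult, Cmod_R, Cmod_pow, Cmod_R, !Rabs_pos_eq in L by (auto; lra).
  apply Rmult_le_reg_l with (INR N); auto.
Qed.

Lemma CSum_tail (a : nat -> C) (z : C) (M : R) (N : nat) : centire a ->
  (forall n, Cmod (a n) * Cmod z ^ n <= M * (/ 2) ^ n) ->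
  Cmod (csumf (fun j => a j * z ^ j)%C N - CSum a z)%C <= 2 * M * (/ 2) ^ N.
Proof.
  intros Ha HM.
  assert (HM0 : 0 <= M).
  { specialize (HM O). simpl in HM. pose proof (Cmod_ge_0 (a O)). lra. }
  assert (C1 : clim (fun n => csumf (fun j => a j * z ^ j)%C N + - 1 * csumf (fun j => a j * z ^ j)%C n)%C
     (csumf (fun j => a j * z ^ j)%C N + - 1 * CSum a z)%C).
  { apply clim_plus; [apply clim_const|]. apply clim_mult; [apply clim_const | apply CSum_clim; auto]. }
  replace (csumf (fun j => a j * z ^ j)%C N - CSum a z)%C
    with (csumf (fun j => a j * z ^ j)%C N + - 1 * CSum a z)%C by ring.
  apply (clim_Cmod_le _ _ _ N C1). intros n Hn.
  replace n with (N + (n - N))%nat by lia. generalize (n - N)%nat. intros m.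
  apply Rle_trans with (2 * M * ((/ 2) ^ N - (/ 2) ^ (N + m))).
  - induction m as [|m IH].
    + rewrite Nat.add_0_r. replace (csumf (fun j => a j * z ^ j)%C N + - 1 * csumf (fun j => a j * z ^ j)%C N)%C
        with (RtoC 0) by ring. rewrite Cmod_0. lra.
    + rewrite Nat.add_succ_r.
      change (csumf (fun j => a j * z ^ j)%C (S (N + m)))
        with (csumf (fun j => a j * z ^ j)%C (N + m) + a (N + m)%nat * z ^ (N + m))%C.
      replace (csumf (fun j => a j * z ^ j)%C N + - 1 * (csumf (fun j => a j * z ^ j)%C (N + m) + a (N + m)%nat * z ^ (N + m)))%C
        with ((csumf (fun j => a j * z ^ j)%C N + - 1 * csumf (fun j => a j * z ^ j)%C (N + m)) + - (a (N + m)%nat * z ^ (N + m)))%C by ring.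
      eapply Rle_trans; [apply Cmod_triangle|]. rewrite Cmod_opp, Cmod_mult, Cmod_pow.
      specialize (HM (N + m)%nat). simpl pow at 3. lra.
  - assert (0 <= (/ 2) ^ (N + m)) by (apply pow_le; lra). nra.
Qed.

(** If the estimate failed, the gap would exceed the tail of the series from some index on, and
    [cauchy_finite] for the partial sum would be violated. *)
Lemma cauchy_estimate (a : nat -> C) (r B : R) (n : nat) : centire a -> 0 <= r ->
  (forall z, Cmod z = r -> Cmod (CSum a z) <= B) -> Cmod (a n) * r ^ n <= B.
Proof.
  intros Ha Hr HB. destruct (centire_majorant a r Ha Hr) as [M HM].
  assert (HM0 : 0 <= M).
  { specialize (HM O). simpl in HM. pose proof (Cmod_ge_0 (a O)). lra. }
  apply Rnot_lt_le. intros Hlt.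
  destruct (pow_small (/ 2) ((Cmod (a n) * r ^ n - B) / (2 * M + 1))) as [N HN]; [lra | apply Rdiv_lt_0_compat; lra |].
  set (N' := Nat.max N (S n)). specialize (HN N' ltac:(unfold N'; lia)).
  assert (K : Cmod (a n) * r ^ n <= B + 2 * M * (/ 2) ^ N').
  { apply (cauchy_finite a r _ n N'); auto; [unfold N'; lia|]. intros z Hz.
    replace (csumf (fun j => a j * z ^ j)%C N') with (CSum a z + (csumf (fun j => a j * z ^ j)%C N' - CSum a z))%C by ring.
    eapply Rle_trans; [apply Cmod_triangle|]. apply Rplus_le_compat; [auto|].
    apply CSum_tail; auto. rewrite Hz. auto. }
  assert (0 < (/ 2) ^ N') by (apply pow_lt; lra).
  assert ((2 * M + 1) * (/ 2) ^ N' < Cmod (a n) * r ^ n - B).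
  { apply Rmult_lt_reg_l with (/ (2 * M + 1)); [apply Rinv_0_lt_compat; lra|].
    rewrite <- Rmult_assoc, Rinv_l by lra. unfold Rdiv in HN. lra. }
  lra.
Qed.

(** * Splitting off the known zeros *)

Definition cs (a : nat -> R) (n : nat) : C := RtoC (a n).
Definition rentire (a : nat -> R) : Prop := forall r, 0 < r -> exists M, forall n, Rabs (a n) * r ^ n <= M.

Lemma rentire_cs (a : nat -> R) : rentire a -> centire (cs a).
Proof. intros H r Hr. destruct (H r Hr) as [M HM]. exists M. intros n. unfold cs. rewrite Cmod_R. auto. Qed.

Definition rmul1 (xi : R) (a : nat -> R) (n : nat) : R :=
  match n with O => a O | S m => a (S m) - xi * a m end.

Fixpoint rdiv1 (xi : R) (a : nat -> R) (n : nat) : R :=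
  match n with O => a O | S m => a (S m) + xi * rdiv1 xi a m end.

Lemma rmul1_rdiv1 (xi : R) (a : nat -> R) (n : nat) : rmul1 xi (rdiv1 xi a) n = a n.
Proof. destruct n; simpl; auto. ring. Qed.

Lemma cs_rmul1 (xi : R) (a : nat -> R) (n : nat) : cs (rmul1 xi a) n = cmul1 (RtoC xi) (cs a) n.
Proof. unfold cs. destruct n; simpl; auto. rewrite RtoC_minus, RtoC_mult. reflexivity. Qed.

Definition conv (p c : nat -> R) (n : nat) : R := sumf (fun i => p i * c (n - i)%nat) (S n).

Lemma conv_rmul1_l (xi : R) (p c : nat -> R) (n : nat) :
  conv (rmul1 xi p) c (S n) = conv p c (S n) - xi * conv p c n.
Proof.
  unfold conv. rewrite (sumf_front _ (S n)), (sumf_front (fun i => p i * c (S n - i)%nat) (S n)).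
  rewrite <- sumf_scal.
  rewrite (sumf_ext (fun i => rmul1 xi p (S i) * c (S n - S i)%nat)
    (fun i => p (S i) * c (S n - S i)%nat + -1 * (xi * (p i * c (n - i)%nat)))).
  - rewrite sumf_plus, sumf_scal. simpl rmul1. ring.
  - intros i _. simpl. ring.
Qed.

Lemma conv_rmul1_r (xi : R) (p c : nat -> R) (n : nat) :
  conv p (rmul1 xi c) (S n) = conv p c (S n) - xi * conv p c n.
Proof.
  unfold conv. change (sumf (fun i => p i * rmul1 xi c (S n - i)%nat) (S (S n)))
    with (sumf (fun i => p i * rmul1 xi c (S n - i)%nat) (S n) + p (S n) * rmul1 xi c (S n - S n)%nat).
  change (sumf (fun i => p i * c (S n - i)%nat) (S (S n)))
    with (sumf (fun i => p i * c (S n - i)%nat) (S n) + p (S n) * c (S n - S n)%nat).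
  rewrite Nat.sub_diag. rewrite <- sumf_scal.
  rewrite (sumf_ext (fun i => p i * rmul1 xi c (S n - i)%nat)
    (fun i => p i * c (S n - i)%nat + -1 * (xi * (p i * c (n - i)%nat)))).
  - rewrite sumf_plus, sumf_scal. simpl rmul1. ring.
  - intros i Hi. replace (S n - i)%nat with (S (n - i)) by lia. simpl. ring.
Qed.

Lemma conv_mul_div (xi : R) (p b : nat -> R) (n : nat) : conv (rmul1 xi p) (rdiv1 xi b) n = conv p b n.
Proof.
  assert (E : forall n, conv p (rmul1 xi (rdiv1 xi b)) n = conv p b n).
  { intros m. unfold conv. apply sumf_ext. intros i _. now rewrite rmul1_rdiv1. }
  rewrite <- E. destruct n as [|n]; [reflexivity|].
  rewrite conv_rmul1_l, conv_rmul1_r. reflexivity.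
Qed.

(** Dividing out a zero [x = 1/xi] leaves an entire series:
    [b_n = xi^n sum_(i <= n) a_i x^i = - xi^n sum_(i > n) a_i x^i]. *)
Lemma rdiv1_entire (xi : R) (a : nat -> R) : xi <> 0 -> rentire a ->
  CSum (cs a) (RtoC (/ xi)) = RtoC 0 -> rentire (rdiv1 xi a).
Proof.
  intros Hxi Ha Hz r Hr.
  set (x := / xi) in *. assert (Hx : x <> 0) by (apply Rinv_neq_0_compat; auto).
  assert (Hax : 0 < Rabs x) by (apply Rabs_pos_lt; auto).
  assert (E : forall n, rdiv1 xi a n * x ^ n = sumf (fun i => a i * x ^ i) (S n)).
  { induction n as [|n IH]; [simpl; ring|].
    change (sumf (fun i => a i * x ^ i) (S (S n))) with (sumf (fun i => a i * x ^ i) (S n) + a (S n) * x ^ S n).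
    rewrite <- IH. simpl. unfold x. field. auto. }
  set (R0 := 2 * Rabs x + r). assert (HR : 0 < R0) by (unfold R0; lra).
  destruct (Ha R0 HR) as [M HM]. exists M. intros n.
  assert (HM0 : 0 <= M) by (eapply Rle_trans; [|apply (HM O)]; apply Rmult_le_pos; [apply Rabs_pos | simpl; lra]).
  set (t := Rabs x / R0).
  assert (Ht : 0 < t <= / 2).
  { unfold t. split; [apply Rdiv_lt_0_compat; auto|]. apply Rmult_le_reg_r with R0; auto.
    unfold Rdiv. rewrite Rmult_assoc, Rinv_l by lra. unfold R0. lra. }
  assert (Hterm : forall i, Rabs (a i * x ^ i) <= M * t ^ i).
  { intros i. rewrite Rabs_mult, <- RPow_abs. unfold t, Rdiv. rewrite Rpow_mult_distr, pow_inv.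
    apply Rmult_le_reg_r with (R0 ^ i); [apply pow_lt; auto|].
    replace (M * (Rabs x ^ i * / R0 ^ i) * R0 ^ i) with (M * Rabs x ^ i) by (field; apply pow_nonzero; lra).
    specialize (HM i). pose proof (pow_le (Rabs x) i (Rabs_pos x)). nra. }
  assert (L : is_lim_seq (sumf (fun i => a i * x ^ i)) 0).
  { destruct (CSum_clim (cs a) (RtoC x) (rentire_cs a Ha)) as [H1 _]. rewrite Hz in H1.
    apply (is_lim_seq_ext (fun n => Re (csumf (fun j => cs a j * RtoC x ^ j)%C n))); auto.
    intros m. rewrite csumf_Re. apply sumf_ext. intros i _. unfold cs.
    rewrite <- RtoC_pow, <- RtoC_mult. apply re_RtoC. }
  assert (B : Rabs (sumf (fun i => a i * x ^ i) (S n)) <= M * t ^ n).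
  { set (s := sumf (fun i => a i * x ^ i)) in *.
    assert (K := is_lim_seq_le_loc (fun N => Rabs (s (S n) - s N)) (fun _ => M * t ^ n) (Rabs (s (S n) - 0)) (M * t ^ n)).
    rewrite <- (Rminus_0_r (s (S n))). apply K; clear K.
    2: { apply (is_lim_seq_abs (fun N => s (S n) - s N) (s (S n) - 0)).
         apply is_lim_seq_minus'; [apply is_lim_seq_const | auto]. }
    2: apply is_lim_seq_const.
    exists (S n). intros N HN. replace N with (S n + (N - S n))%nat by lia. generalize (N - S n)%nat. intros j.
    apply Rle_trans with (M * t ^ n * (1 - (/ 2) ^ j)).
    - induction j as [|j IH].
      + rewrite Nat.add_0_r, Rminus_diag, Rabs_R0. simpl. lra.
      + rewrite Nat.add_succ_r. change (s (S (S n + j))) with (s (S n + j)%nat + a (S n + j)%nat * x ^ (S n + j)).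
        replace (s (S n) - (s (S n + j)%nat + a (S n + j)%nat * x ^ (S n + j)))
          with ((s (S n) - s (S n + j)%nat) + - (a (S n + j)%nat * x ^ (S n + j))) by ring.
        eapply Rle_trans; [apply Rabs_triang|]. rewrite Rabs_Ropp. specialize (Hterm (S n + j)%nat).
        assert (t ^ (S n + j) <= t ^ n * (/ 2) ^ S j).
        { replace (S n + j)%nat with (n + S j)%nat by lia. rewrite pow_add. apply Rmult_le_compat_l; [apply pow_le; lra|].
          apply pow_incr. lra. }
        assert (M * t ^ (S n + j) <= M * (t ^ n * (/ 2) ^ S j)) by (apply Rmult_le_compat_l; auto).
        simpl ((/ 2) ^ S j) in *. lra.
    - assert (0 <= (/ 2) ^ j) by (apply pow_le; lra). assert (0 <= t ^ n) by (apply pow_le; lra).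
      assert (0 <= M * t ^ n) by (apply Rmult_le_pos; auto). nra. }
  rewrite <- E, Rabs_mult, <- RPow_abs in B. unfold t, Rdiv in B. rewrite Rpow_mult_distr, pow_inv in B.
  assert (B2 : Rabs (rdiv1 xi a n) * R0 ^ n <= M).
  { apply Rmult_le_reg_r with (Rabs x ^ n * / R0 ^ n).
    - apply Rmult_lt_0_compat; [apply pow_lt; auto | apply Rinv_0_lt_compat, pow_lt; auto].
    - replace (Rabs (rdiv1 xi a n) * R0 ^ n * (Rabs x ^ n * / R0 ^ n))
        with (Rabs (rdiv1 xi a n) * Rabs x ^ n) by (field; apply pow_nonzero; lra). auto. }
  eapply Rle_trans; [|apply B2]. apply Rmult_le_compat_l; [apply Rabs_pos|]. apply pow_incr. unfold R0. lra.
Qed.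

Lemma lim_bounded (u : nat -> R) (l : R) : is_lim_seq u l -> exists B, 0 < B /\ forall n, Rabs (u n) <= B.
Proof.
  intros H. apply is_lim_seq_Reals in H. destruct (maj_by_pos u) as [B [HB HBn]]; [exists l; auto|].
  exists B. auto.
Qed.

(** A canonical product of genus 0. It is parametrised by the reciprocals [xi i] of its zeros, whose
    absolute summability is the condition for convergence. *)
Fixpoint Pz (xi : nat -> R) (m : nat) (z : C) : C :=
  match m with O => RtoC 1 | S m => (Pz xi m z * (1 - RtoC (xi m) * z))%C end.

Fixpoint pseq (xi : nat -> R) (m : nat) : nat -> R :=
  match m with O => fun n => match n with O => 1 | _ => 0 end | S m => rmul1 (xi m) (pseq xi m) end.

Fixpoint qseq (xi : nat -> R) (a : nat -> R) (m : nat) : nat -> R :=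
  match m with O => a | S m => rdiv1 (xi m) (qseq xi a m) end.

Lemma conv_pq (xi a : nat -> R) (m n : nat) : conv (pseq xi m) (qseq xi a m) n = a n.
Proof.
  induction m as [|m IH].
  - unfold conv. rewrite sumf_front. simpl pseq. rewrite (sumf_ext _ (fun _ => 0 * 0)) by (intros; simpl; ring).
    rewrite sumf_scal, Nat.sub_0_r. simpl. ring.
  - simpl pseq. simpl qseq. rewrite conv_mul_div. auto.
Qed.

Section Splitting.

Variables (xi a : nat -> R) (S0 : R).
Hypothesis xi_nz : forall i, xi i <> 0.
Hypothesis xi_inj : forall i j, i <> j -> xi i <> xi j.
Hypothesis xi_sum : ex_series (fun i => Rabs (xi i)).
Hypothesis xi_S0 : forall n, sumf (fun i => Rabs (xi i)) n <= S0.
Hypothesis a_ent : rentire a.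
Hypothesis a_zero : forall i, CSum (cs a) (RtoC (/ xi i)) = RtoC 0.

(** Each division leaves an entire series because the next point is still a zero of the current
    quotient: the zeros are distinct, so the factors divided out so far do not vanish there. *)
Lemma qseq_props (m : nat) : rentire (qseq xi a m) /\
  (forall z, CSum (cs a) z = (Pz xi m z * CSum (cs (qseq xi a m)) z)%C) /\
  (forall j, (m <= j)%nat -> CSum (cs (qseq xi a m)) (RtoC (/ xi j)) = RtoC 0).
Proof.
  induction m as [|m [IH1 [IH2 IH3]]].
  - simpl. split; [auto|]. split; [intros; ring | auto].
  - assert (E : rentire (rdiv1 (xi m) (qseq xi a m))) by (apply rdiv1_entire; auto).
    assert (F : forall z, CSum (cs (qseq xi a m)) z
      = ((1 - RtoC (xi m) * z) * CSum (cs (rdiv1 (xi m) (qseq xi a m))) z)%C).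
    { intros z. rewrite <- CSum_mul1 by (apply rentire_cs; auto). apply CSum_ext. intros n.
      rewrite <- cs_rmul1. unfold cs. now rewrite rmul1_rdiv1. }
    simpl qseq. split; [auto|]. split.
    + intros z. rewrite IH2, F. simpl. ring.
    + intros j Hj. specialize (IH3 j ltac:(lia)). rewrite F in IH3.
      assert (Hne : (1 - RtoC (xi m) * RtoC (/ xi j))%C <> RtoC 0).
      { rewrite <- RtoC_mult, <- RtoC_minus. intros H. apply (f_equal Re) in H. simpl in H.
        apply (xi_inj m j ltac:(lia)). apply Rmult_eq_reg_r with (/ xi j); [|apply Rinv_neq_0_compat; auto].
        rewrite Rinv_r by auto. lra. }
      set (X := CSum (cs (rdiv1 (xi m) (qseq xi a m))) (RtoC (/ xi j))) in *.
      replace X with (/ (1 - RtoC (xi m) * RtoC (/ xi j)) * ((1 - RtoC (xi m) * RtoC (/ xi j)) * X))%C by (field; auto).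
      rewrite IH3. ring.
Qed.

Lemma pseq_sum_bound (r : R) (m N : nat) : 0 <= r ->
  sumf (fun n => Rabs (pseq xi m n) * r ^ n) N <= prodf (fun i => 1 + Rabs (xi i) * r) m.
Proof.
  intros Hr. revert N. induction m as [|m IH]; intros N.
  - simpl prodf. destruct N as [|N]; [simpl; lra|]. rewrite sumf_front.
    rewrite (sumf_ext _ (fun _ => 0 * 0)).
    + rewrite sumf_scal. simpl. rewrite Rabs_R1. lra.
    + intros i _. simpl. rewrite Rabs_R0. ring.
  - simpl prodf. set (p := pseq xi m) in *.
    assert (Hp : 0 <= prodf (fun i => 1 + Rabs (xi i) * r) m).
    { apply prodf_nonneg. intros i _. pose proof (Rabs_pos (xi i)). nra. }
    destruct N as [|N].
    { simpl. apply Rmult_le_pos; auto. pose proof (Rabs_pos (xi m)). nra. }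
    apply Rle_trans with (sumf (fun n => Rabs (p n) * r ^ n) (S N) + Rabs (xi m) * r * sumf (fun n => Rabs (p n) * r ^ n) N).
    + rewrite !(sumf_front _ N). rewrite <- sumf_scal, Rplus_assoc, <- sumf_plus.
      apply Rplus_le_compat; [simpl; fold p; lra|]. apply sumf_le. intros i _. simpl pseq. fold p. simpl rmul1.
      replace (Rabs (p (S i)) * r ^ S i + Rabs (xi m) * r * (Rabs (p i) * r ^ i))
        with ((Rabs (p (S i)) + Rabs (xi m) * Rabs (p i)) * r ^ S i) by (simpl; ring).
      apply Rmult_le_compat_r; [apply pow_le; auto|]. unfold Rminus.
      eapply Rle_trans; [apply Rabs_triang|]. rewrite Rabs_Ropp, Rabs_mult. lra.
    + assert (I1 := IH (S N)). assert (I2 := IH N).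
      assert (0 <= Rabs (xi m) * r) by (apply Rmult_le_pos; [apply Rabs_pos | auto]). nra.
Qed.

Lemma pseq_bound (r : R) (m n : nat) : 0 <= r -> Rabs (pseq xi m n) * r ^ n <= exp (S0 * r).
Proof.
  intros Hr. apply Rle_trans with (sumf (fun n => Rabs (pseq xi m n) * r ^ n) (S n)).
  - simpl sumf. assert (0 <= sumf (fun n => Rabs (pseq xi m n) * r ^ n) n); [|lra].
    apply sumf_nonneg. intros i _. apply Rmult_le_pos; [apply Rabs_pos | apply pow_le; auto].
  - eapply Rle_trans; [apply pseq_sum_bound; auto|].
    apply prodf_one_plus.
    + intros i _. apply Rmult_le_pos; [apply Rabs_pos | auto].
    + rewrite (sumf_ext _ (fun i => r * Rabs (xi i))) by (intros; ring). rewrite sumf_scal, Rmult_comm.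
      apply Rmult_le_compat_r; auto.
Qed.

Lemma pseq_lim (n : nat) : exists l : R, is_lim_seq (fun m => pseq xi m n) l.
Proof.
  destruct n as [|n].
  - exists 1. apply (is_lim_seq_ext (fun _ => 1)); [|apply is_lim_seq_const].
    intros m. induction m as [|m IH]; auto.
  - apply (seq_cv_of_summable _ (fun m => Rabs (xi m) * exp (S0 * 1))).
    + apply (ex_series_scal_r (exp (S0 * 1)) (fun m => Rabs (xi m))). auto.
    + intros m. simpl pseq. simpl rmul1.
      replace (pseq xi m (S n) - xi m * pseq xi m n - pseq xi m (S n)) with (- (xi m * pseq xi m n)) by ring.
      rewrite Rabs_Ropp, Rabs_mult. apply Rmult_le_compat_l; [apply Rabs_pos|].
      assert (B := pseq_bound 1 m n ltac:(lra)). rewrite pow1 in B. lra.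
Qed.

(** By induction on the index of the coefficient. Dividing by one more factor changes the
    coefficient [S n] by [xi m] times the coefficient [n] of the next quotient, which is bounded
    since it converges; the increments are therefore summable. *)
Lemma qseq_lim (n : nat) : exists l : R, is_lim_seq (fun m => qseq xi a m n) l.
Proof.
  induction n as [|n [l IH]].
  - exists (a O). apply (is_lim_seq_ext (fun _ => a O)); [|apply is_lim_seq_const].
    intros m. induction m as [|m IHm]; auto.
  - destruct (lim_bounded _ _ IH) as [B [HB HBn]].
    apply (seq_cv_of_summable _ (fun m => Rabs (xi m) * B)).
    + apply (ex_series_scal_r B (fun m => Rabs (xi m))). auto.
    + intros m. simpl qseq. simpl rdiv1.
      replace (qseq xi a m (S n) + xi m * rdiv1 (xi m) (qseq xi a m) n - qseq xi a m (S n))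
        with (xi m * qseq xi a (S m) n) by (simpl; ring).
      rewrite Rabs_mult. apply Rmult_le_compat_l; [apply Rabs_pos | apply HBn].
Qed.

Lemma CSum_pseq (m : nat) (z : C) : CSum (cs (pseq xi m)) z = Pz xi m z.
Proof.
  induction m as [|m IH].
  - apply (clim_unique (fun n => csumf (fun j => cs (pseq xi 0) j * z ^ j)%C n)).
    + apply CSum_clim, rentire_cs. intros r Hr. exists 1. intros [|n]; simpl.
      * rewrite Rabs_R1. lra.
      * rewrite Rabs_R0. lra.
    + assert (E : forall n, csumf (fun j => cs (pseq xi 0) j * z ^ j)%C (S n) = RtoC 1).
      { induction n as [|n IHn]; [simpl; unfold cs; simpl; ring|].
        change (csumf (fun j => cs (pseq xi 0) j * z ^ j)%C (S (S n)))
          with (csumf (fun j => cs (pseq xi 0) j * z ^ j)%C (S n) + cs (pseq xi 0) (S n) * z ^ S n)%C.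
        rewrite IHn. unfold cs. simpl. ring. }
      simpl Pz. split; apply is_lim_seq_incr_1.
      * apply (is_lim_seq_ext (fun _ => Re (RtoC 1))); [|apply is_lim_seq_const]. intros n. now rewrite E.
      * apply (is_lim_seq_ext (fun _ => Im (RtoC 1))); [|apply is_lim_seq_const]. intros n. now rewrite E.
  - simpl pseq. simpl Pz. rewrite (CSum_ext _ (cmul1 (RtoC (xi m)) (cs (pseq xi m)))) by (intros; apply cs_rmul1).
    rewrite CSum_mul1, IH; [ring|]. apply rentire_cs. intros r Hr. exists (exp (S0 * r)).
    intros n. apply pseq_bound. lra.
Qed.

(** Coefficients of the full canonical product and of the quotient by it. Convergence is so far
    known only coefficient by coefficient, and nothing is claimed about the growth of [Qlim]. *)
Definition Hlim (n : nat) : R := real (Lim_seq (fun m => pseq xi m n)).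
Definition Qlim (n : nat) : R := real (Lim_seq (fun m => qseq xi a m n)).

Lemma Hlim_lim (n : nat) : is_lim_seq (fun m => pseq xi m n) (Hlim n).
Proof. destruct (pseq_lim n) as [l Hl]. unfold Hlim. rewrite (is_lim_seq_unique _ _ Hl). auto. Qed.

Lemma Qlim_lim (n : nat) : is_lim_seq (fun m => qseq xi a m n) (Qlim n).
Proof. destruct (qseq_lim n) as [l Hl]. unfold Qlim. rewrite (is_lim_seq_unique _ _ Hl). auto. Qed.

Lemma Hlim_bound (r : R) (n : nat) : 0 <= r -> Rabs (Hlim n) * r ^ n <= exp (S0 * r).
Proof.
  intros Hr.
  assert (K := is_lim_seq_le (fun m => Rabs (pseq xi m n) * r ^ n) (fun _ => exp (S0 * r)) (Rabs (Hlim n) * r ^ n) (exp (S0 * r))).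
  apply K.
  - intros m. apply pseq_bound; auto.
  - apply is_lim_seq_mult'; [|apply is_lim_seq_const].
    apply (is_lim_seq_abs (fun m => pseq xi m n) (Hlim n)), Hlim_lim.
  - apply is_lim_seq_const.
Qed.

Lemma Hlim_entire : rentire Hlim.
Proof. intros r Hr. exists (exp (S0 * r)). intros n. apply Hlim_bound. lra. Qed.

(** A coefficient of a Cauchy product is a finite sum, so the identity passes to the limit without
    any estimate for [Qlim]. *)
Lemma conv_lim (n : nat) : a n = conv Hlim Qlim n.
Proof.
  assert (L : is_lim_seq (fun m => conv (pseq xi m) (qseq xi a m) n) (conv Hlim Qlim n)).
  { unfold conv. generalize (S n) as N. intros N.
    assert (G : forall K, is_lim_seq (fun m => sumf (fun i => pseq xi m i * qseq xi a m (n - i)%nat) K)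
      (sumf (fun i => Hlim i * Qlim (n - i)%nat) K)).
    { induction K as [|K IH]; simpl; [apply is_lim_seq_const|].
      apply is_lim_seq_plus'; auto. apply is_lim_seq_mult'; [apply Hlim_lim | apply Qlim_lim]. }
    apply G. }
  apply (is_lim_seq_ext _ (fun _ => a n)) in L; [|intros m; apply conv_pq].
  apply is_lim_seq_unique in L. rewrite Lim_seq_const in L. now injection L.
Qed.

Lemma Hlim_clim (z : C) : clim (fun m => Pz xi m z) (CSum (cs Hlim) z).
Proof.
  set (M := exp (S0 * (2 * Cmod z + 1))).
  pose proof (Cmod_ge_0 z) as Hz.
  assert (Hb : forall m n, Cmod (cs (pseq xi m) n * z ^ n)%C <= M * (/ 2) ^ n).
  { intros m n. unfold cs. rewrite Cmod_mult, Cmod_R, Cmod_pow.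
    apply (bound_geom M (Cmod z) (fun n => Rabs (pseq xi m n))); auto.
    - intros; apply Rabs_pos.
    - intros k. apply pseq_bound. lra. }
  split.
  - apply (is_lim_seq_ext (fun m => Series (fun n => Re (cs (pseq xi m) n * z ^ n)%C))).
    + intros m. rewrite <- CSum_pseq. reflexivity.
    + apply (tannery (fun m n => Re (cs (pseq xi m) n * z ^ n)%C) (fun n => Re (cs Hlim n * z ^ n)%C) (fun n => M * (/ 2) ^ n)).
      * apply ex_series_half.
      * intros m n. eapply Rle_trans; [apply re_le_Cmod | apply Hb].
      * intros n. unfold cs. rewrite re_scal_l.
        apply (is_lim_seq_ext (fun m => pseq xi m n * Re (z ^ n)%C)); [intros m; now rewrite re_scal_l|].
        apply is_lim_seq_mult'; [apply Hlim_lim | apply is_lim_seq_const].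
  - apply (is_lim_seq_ext (fun m => Series (fun n => Im (cs (pseq xi m) n * z ^ n)%C))).
    + intros m. rewrite <- CSum_pseq. reflexivity.
    + apply (tannery (fun m n => Im (cs (pseq xi m) n * z ^ n)%C) (fun n => Im (cs Hlim n * z ^ n)%C) (fun n => M * (/ 2) ^ n)).
      * apply ex_series_half.
      * intros m n. eapply Rle_trans; [apply im_le_Cmod | apply Hb].
      * intros n. unfold cs. rewrite im_mult, Im_RtoC, Rmult_0_l, Rplus_0_r, re_RtoC.
        apply (is_lim_seq_ext (fun m => pseq xi m n * Im (z ^ n)%C)).
        { intros m. rewrite im_mult, Im_RtoC, Rmult_0_l, Rplus_0_r, re_RtoC. auto. }
        apply is_lim_seq_mult'; [apply Hlim_lim | apply is_lim_seq_const].
Qed.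

Lemma Pz_zero (i m : nat) : (i < m)%nat -> Pz xi m (RtoC (/ xi i)) = RtoC 0.
Proof.
  induction m as [|m IH]; intros Him; [lia|]. simpl.
  destruct (Nat.eq_dec i m) as [->|Hne].
  - rewrite <- RtoC_mult, Rinv_r by auto. ring.
  - rewrite IH by lia. ring.
Qed.

Lemma Hlim_zero (i : nat) : CSum (cs Hlim) (RtoC (/ xi i)) = RtoC 0.
Proof.
  apply Cmod_eq_0. apply Rle_antisym; [|apply Cmod_ge_0].
  apply (clim_Cmod_le _ _ 0 (S i) (Hlim_clim _)). intros n Hn. rewrite Pz_zero by lia. rewrite Cmod_0. lra.
Qed.

Lemma Pz_split (m n : nat) (z : C) : Pz xi (m + n) z = (Pz xi m z * Pz (fun i => xi (m + i)%nat) n z)%C.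
Proof.
  induction n as [|n IH]; [rewrite Nat.add_0_r; simpl; ring|].
  rewrite Nat.add_succ_r. simpl. rewrite IH. ring.
Qed.

Lemma Pz_nz (m : nat) (z : C) : (forall i, z <> RtoC (/ xi i)) -> Pz xi m z <> RtoC 0.
Proof.
  intros Hz. induction m as [|m IH]; simpl.
  - intros H. apply (f_equal Re) in H. simpl in H. lra.
  - apply Cmult_neq_0; auto. intros H. apply (Hz m).
    assert (Hne : RtoC (xi m) <> RtoC 0) by (intros E; apply (xi_nz m); now injection E).
    rewrite RtoC_inv by auto. replace z with (/ RtoC (xi m) * (RtoC (xi m) * z))%C by (field; auto).
    replace (RtoC (xi m) * z)%C with (1 - (1 - RtoC (xi m) * z))%C by ring. rewrite H. ring.
Qed.

(** Finitely many factors are nonzero at [z]; from the index [M] on [Rabs (xi i) * Cmod z] is at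
    most one half, and the product of these factors is bounded below by an exponential. *)
Lemma Hlim_nz (z : C) : (forall i, z <> RtoC (/ xi i)) -> CSum (cs Hlim) z <> RtoC 0.
Proof.
  intros Hz. pose proof (Cmod_ge_0 z) as Hz0.
  assert (Hx0 : is_lim_seq (fun i => Rabs (xi i)) 0).
  { exact (ex_series_lim_0 (fun i => Rabs (xi i)) xi_sum). }
  apply is_lim_seq_spec in Hx0.
  assert (He : 0 < / (2 * (Cmod z + 1))) by (apply Rinv_0_lt_compat; lra).
  destruct (Hx0 (mkposreal _ He)) as [M HM]. simpl in HM.
  assert (Hsm : forall i, (M <= i)%nat -> 0 <= Rabs (xi i) * Cmod z <= / 2).
  { intros i Hi. specialize (HM i Hi). rewrite Rminus_0_r, Rabs_Rabsolu in HM. pose proof (Rabs_pos (xi i)).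
    split; [apply Rmult_le_pos; auto|].
    apply Rle_trans with (/ (2 * (Cmod z + 1)) * (Cmod z + 1)); [apply Rmult_le_compat; lra|].
    right. field. lra. }
  set (c := Cmod (Pz xi M z) * exp (- (S0 * Cmod z / (1 - / 2)))).
  assert (Hc : 0 < c).
  { apply Rmult_lt_0_compat; [apply Cmod_gt_0, Pz_nz; auto | apply exp_pos]. }
  assert (c <= Cmod (CSum (cs Hlim) z)).
  { apply (clim_Cmod_ge _ _ c M (Hlim_clim z)). intros n Hn.
    replace n with (M + (n - M))%nat by lia. rewrite Pz_split, Cmod_mult. unfold c.
    apply Rmult_le_compat_l; [apply Cmod_ge_0|].
    apply Rle_trans with (prodf (fun i => 1 - Rabs (xi (M + i)%nat) * Cmod z) (n - M)).
    - apply prodf_one_minus; [lra | intros i _; apply Hsm; lia |].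
      rewrite (sumf_ext _ (fun i => Cmod z * Rabs (xi (M + i)%nat))) by (intros; ring).
      rewrite sumf_scal, Rmult_comm. apply Rmult_le_compat_r; auto.
      specialize (xi_S0 (M + (n - M))%nat). rewrite sumf_split in xi_S0.
      assert (0 <= sumf (fun i => Rabs (xi i)) M) by (apply sumf_nonneg; intros; apply Rabs_pos). lra.
    - generalize (n - M)%nat. intros k. induction k as [|k IH]; simpl; [rewrite Cmod_1; lra|].
      rewrite Cmod_mult. apply Rmult_le_compat; auto.
      + apply prodf_nonneg. intros i _. specialize (Hsm (M + i)%nat ltac:(lia)). lra.
      + specialize (Hsm (M + k)%nat ltac:(lia)). lra.
      + assert (T := Cmod_triangle (1 - RtoC (xi (M + k)%nat) * z) (RtoC (xi (M + k)%nat) * z)).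
        replace (1 - RtoC (xi (M + k)%nat) * z + RtoC (xi (M + k)%nat) * z)%C with (RtoC 1) in T by ring.
        rewrite Cmod_1, Cmod_mult, Cmod_R in T. lra. }
  apply Cmod_gt_0. lra.
Qed.

Variables (r : nat -> R) (d : nat) (K : R).
Hypothesis r_pos : forall l, 0 < r l.
Hypothesis r_unbounded : forall B, exists l, B <= r l.
Hypothesis growth : forall l, exists N, forall m z, (N <= m)%nat -> Cmod z = r l ->
  Pz xi (S (2 * m)) z <> RtoC 0 /\ Cmod (CSum (cs a) z) <= K * r l ^ d * Cmod (Pz xi (S (2 * m)) z).

(** Every finite quotient is entire, so Cauchy's estimate on the circle of radius [r l] bounds its
    coefficient [n] by [K * r l ^ d / r l ^ n], uniformly in [m]. The bound is inherited by the
    limit, and it tends to 0 along the unbounded radii. Only products with [S (2 * m)] factors are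
    used: in the application these are [x1] and [m] complete pairs. *)
Lemma Qlim_vanish (n : nat) : (d < n)%nat -> Qlim n = 0.
Proof.
  intros Hn.
  assert (Hb : forall l, Rabs (Qlim n) * r l ^ n <= K * r l ^ d).
  { intros l. destruct (growth l) as [N HN].
    assert (L := is_lim_seq_le_loc (fun m => Rabs (qseq xi a (S (2 * m)) n) * r l ^ n) (fun _ => K * r l ^ d)
      (Rabs (Qlim n) * r l ^ n) (K * r l ^ d)).
    apply L.
    - exists N. intros m Hm. destruct (qseq_props (S (2 * m))) as [E1 [E2 _]].
      rewrite <- Cmod_R. apply (cauchy_estimate (cs (qseq xi a (S (2 * m)))) (r l) (K * r l ^ d) n).
      + apply rentire_cs; auto.
      + specialize (r_pos l). lra.
      + intros z Hz. destruct (HN m z Hm Hz) as [Hne Hle]. rewrite E2, Cmod_mult in Hle.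
        assert (0 < Cmod (Pz xi (S (2 * m)) z)) by (apply Cmod_gt_0; auto).
        apply Rmult_le_reg_l with (Cmod (Pz xi (S (2 * m)) z)); auto. lra.
    - apply is_lim_seq_mult'; [|apply is_lim_seq_const].
      apply (is_lim_seq_abs (fun m => qseq xi a (S (2 * m)) n) (Qlim n)).
      apply (is_lim_seq_comp (fun m => qseq xi a m n) (fun m => S (2 * m))); [apply Qlim_lim|].
      intros N0. exists N0. intros; lia.
    - apply is_lim_seq_const. }
  destruct (Req_dec (Qlim n) 0) as [|Hne]; auto. exfalso.
  assert (Hq : 0 < Rabs (Qlim n)) by (apply Rabs_pos_lt; auto).
  destruct (r_unbounded (Rmax 1 (K / Rabs (Qlim n) + 1))) as [l Hl].
  assert (H1 : 1 <= r l) by (eapply Rle_trans; [apply Rmax_l | apply Hl]).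
  assert (H2 : K / Rabs (Qlim n) + 1 <= r l) by (eapply Rle_trans; [apply Rmax_r | apply Hl]).
  specialize (Hb l). replace n with (d + S (n - S d))%nat in Hb at 2 by lia. rewrite pow_add in Hb.
  assert (Hd : 0 < r l ^ d) by (apply pow_lt; lra).
  assert (Hp : r l <= r l ^ S (n - S d)).
  { simpl. assert (1 <= r l ^ (n - S d)) by (apply pow_R1_Rle; lra). nra. }
  assert (Rabs (Qlim n) * r l <= K).
  { apply Rmult_le_reg_r with (r l ^ d); auto.
    apply Rle_trans with (Rabs (Qlim n) * (r l ^ d * r l ^ S (n - S d))); [|auto].
    replace (Rabs (Qlim n) * r l * r l ^ d) with (Rabs (Qlim n) * (r l ^ d * r l)) by ring.
    apply Rmult_le_compat_l; [lra|]. apply Rmult_le_compat_l; lra. }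
  assert (Rabs (Qlim n) * (K / Rabs (Qlim n) + 1) <= K).
  { eapply Rle_trans; [apply Rmult_le_compat_l; [|apply H2]; lra | auto]. }
  replace (Rabs (Qlim n) * (K / Rabs (Qlim n) + 1)) with (K + Rabs (Qlim n)) in H0 by (field; lra). lra.
Qed.

End Splitting.

(** * Locating two zeros in every zone that is not empty *)

Definition zone_occ (v : R) (k : nat) : Prop := exists x, inz v k x /\ 0 < w v k x.

Lemma gz_le2 (v : R) (k : nat) (x : R) : 0 < v < 1 -> 1 <= x -> gz v k x <= 2.
Proof.
  intros Hv Hx. unfold gz.
  assert (Hi : 0 < / x <= 1) by (split; [apply Rinv_0_lt_compat; lra | rewrite <- Rinv_1; apply Rinv_le_contravar; lra]).
  assert (Hs : -1 <= sg k / x <= 1) by (unfold Rdiv; destruct (sg_cases k) as [-> | ->]; lra).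
  assert (H0 := th_pos_unit v _ Hv Hs).
  assert (H1 : th v (sg k / x) <= 2).
  { assert (U1 : forall y, 0 <= y <= 1 -> 0 < th v y <= 1).
    { intros y Hy. split; [apply th_pos_unit; auto; lra|].
      rewrite <- (th_0 v) by (rewrite Rabs_pos_eq; lra). apply th_nonincr; lra. }
    destruct (Rle_lt_dec 0 (sg k / x)) as [H|H]; [apply Rle_trans with 1; [apply U1; lra | lra]|].
    rewrite th_fe by (rewrite Rabs_pos_eq; lra).
    destruct (U1 (- v * (sg k / x)) ltac:(nra)) as [T1 T2].
    assert (0 <= - v * (sg k / x) <= 1) by nra. nra. }
  unfold Rdiv at 1. nra.
Qed.

(** At relative distance [v ^ i] from the ends of a zone, [St] is still at least a constant times
    [v ^ i], while [St_sign_scale] magnifies it by [v] to the power [- i (i - 1)] and [gz] is at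
    most 2. Hence for large [i] the outer zeros of a zone lie within [v ^ i] of its ends, which
    makes the products of zeros converge. *)
Lemma w_pos_inner (v : R) : 0 < v < 1 -> exists i0, (1 <= i0)%nat /\ forall i, (i0 <= i)%nat ->
  v * (1 + v ^ i) < / v * (1 - v ^ i) /\
  forall x, v ^ cz i * x = v * (1 + v ^ i) \/ v ^ cz i * x = / v * (1 - v ^ i) -> 0 < w v i x.
Proof.
  intros Hv. destruct (St_lower v Hv) as [c [Hc HS]]. pose proof (pow2_unit v Hv) as V2.
  pose proof (inv_v_gt1 v Hv) as Hi1.
  set (g := 1 - v ^ 2) in *. assert (Hg : 0 < g < 1) by (unfold g; lra).
  destruct (pow_small v (Rmin (g / 8) (c * g / 16))) as [N HN]; [lra | apply Rmin_pos; nra |].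
  exists (N + 3)%nat. split; [lia|]. intros i Hi.
  assert (HNi : forall j, (N <= j)%nat -> v ^ j < g / 8 /\ v ^ j < c * g / 16).
  { intros j Hj. specialize (HN j Hj). split; eapply Rlt_le_trans; [apply HN | apply Rmin_l | apply HN | apply Rmin_r]. }
  set (e := v ^ i) in *. destruct (HNi i ltac:(lia)) as [He1 _]. fold e in He1.
  assert (He0 : 0 < e) by (apply pow_lt; lra).
  split.
  - apply Rlt_le_trans with 1.
    + assert (v < 1 - g / 2) by (unfold g; nra). nra.
    + assert (1 + g / 2 <= / v).
      { apply Rmult_le_reg_l with v; [lra|]. rewrite Rinv_r by lra. unfold g. nra. }
      nra.
  - intros x Hx.
    set (t := v ^ cz i * x) in *.
    assert (Ht : v <= t <= / v).
    { destruct Hx as [-> | ->]; split; try nra.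
      - assert (v * (1 + e) <= 1 * / v); [|lra]. assert (v < 1 - g / 2) by (unfold g; nra). nra.
      - apply Rle_trans with (/ v * (1 - g)); [|nra]. unfold g. right. field. lra. }
    assert (Hx1 : 1 <= x) by (pose proof (inz_ge v i x Hv ltac:(lia) ltac:(fold t; lra)); lra).
    rewrite w_split by lra.
    destruct (St_sign_scale v i x Hv ltac:(lia) ltac:(lra)) as [A [HA [E HAl]]]. rewrite E. fold t. fold t in HAl.
    specialize (HAl ltac:(lra)). pose proof (gz_le2 v i x Hv Hx1). specialize (HS t Ht).
    assert (HSt : c * (g / 2 * (e / 2)) <= St v t).
    { eapply Rle_trans; [|apply HS]. apply Rmult_le_compat_l; [lra|].
      destruct Hx as [-> | ->].
      - apply Rmult_le_compat; try lra.
        + unfold g in *. nra.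
        + replace (1 - v / (v * (1 + e))) with (e / (1 + e)) by (field; lra).
          apply Rmult_le_compat_l; [lra|]. apply Rinv_le_contravar; lra.
      - rewrite Rmult_comm. apply Rmult_le_compat; try lra.
        + replace (1 - v * (/ v * (1 - e))) with e by (field; lra). lra.
        + replace (v / (/ v * (1 - e))) with (v ^ 2 / (1 - e)) by (field; lra).
          apply Rmult_le_reg_r with (1 - e); [lra|].
          replace ((1 - v ^ 2 / (1 - e)) * (1 - e)) with (1 - e - v ^ 2) by (field; lra).
          fold g. unfold g in *. nra. }
    (* e / v^(i(i-1)) >= 1 / v^(i(i-2)) > 8/(c g) *)
    assert (HAe : 16 / (c * g) < A * e).
    { apply Rlt_le_trans with (/ v ^ (i * (i - 1)) * e); [|apply Rmult_le_compat_r; lra].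
      replace (i * (i - 1))%nat with (i + i * (i - 2))%nat by nia. rewrite pow_add. fold e.
      destruct (HNi (i * (i - 2))%nat ltac:(nia)) as [_ H2].
      set (p := v ^ (i * (i - 2))) in *. assert (Hp : 0 < p) by (apply pow_lt; lra).
      replace (/ (e * p) * e) with (/ p) by (field; lra).
      replace (16 / (c * g)) with (/ (c * g / 16)) by (field; lra).
      apply Rinv_lt_contravar; auto. apply Rmult_lt_0_compat; auto. nra. }
    assert (4 < A * (c * (g / 2 * (e / 2)))).
    { replace (A * (c * (g / 2 * (e / 2)))) with (A * e * (c * g / 4)) by field.
      apply Rle_lt_trans with (16 / (c * g) * (c * g / 4)); [right; field; lra|].
      apply Rmult_lt_compat_r; nra. }
    assert (A * (c * (g / 2 * (e / 2))) <= A * St v t) by (apply Rmult_le_compat_l; lra).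
    lra.
Qed.

Lemma w_cont (v : R) (k : nat) : 0 < v < 1 -> continuity (w v k).
Proof.
  intros Hv x. apply (continuity_pt_ext (U (wk k) v)).
  - intros y. symmetry. apply w_U.
  - apply U_cont_x; [apply geom_bounded_wk | rewrite Rabs_pos_eq; lra].
Qed.

Lemma w_neg_Lz (v : R) (k : nat) : 0 < v < 1 -> (1 <= k)%nat -> w v k (Lz v k) < 0.
Proof.
  intros Hv Hk. pose proof (Lz_ge1 v k Hv Hk). pose proof (inv_v_gt1 v Hv).
  assert (Hc : v ^ cz k <> 0) by (apply pow_nonzero; lra).
  apply w_neg_left; auto; try lra.
  unfold Lz. replace (v ^ cz k * (v / v ^ cz k)) with (v ^ 1) by (field; auto). apply pow_le_anti; [lra|lia].
Qed.

Lemma w_neg_Rz (v : R) (k : nat) : 0 < v < 1 -> (1 <= k)%nat -> w v k (Rz v k) < 0.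
Proof.
  intros Hv Hk. assert (Hc : v ^ cz k <> 0) by (apply pow_nonzero; lra).
  apply w_neg_right; auto; try lra. unfold Rz.
  replace (v ^ cz k * (/ v / v ^ cz k)) with (/ v ^ 1) by (field; repeat split; auto; apply Rgt_not_eq; lra).
  apply Rinv_le_contravar; [apply pow_lt; lra | apply pow_le_anti; [lra|lia]].
Qed.

Lemma two_zeros (v : R) (k : nat) (p1 p2 : R) : 0 < v < 1 -> (1 <= k)%nat ->
  inz v k p1 -> inz v k p2 -> p1 <= p2 -> 0 < w v k p1 -> 0 < w v k p2 ->
  exists a b, Lz v k < a < p1 /\ p2 < b < Rz v k /\ w v k a = 0 /\ w v k b = 0.
Proof.
  intros Hv Hk H1 H2 H12 W1 W2. apply inz_LR in H1; [|lra]. apply inz_LR in H2; [|lra].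
  pose proof (w_neg_Lz v k Hv Hk). pose proof (w_neg_Rz v k Hv Hk).
  destruct (IVT (w v k) (Lz v k) p1) as [a [Ha Wa]]; try lra; [apply w_cont; auto|].
  destruct (IVT (fun x => - w v k x) p2 (Rz v k)) as [b [Hb Wb]]; try lra.
  { apply (continuity_opp (w v k)). apply w_cont; auto. }
  assert (Wb' : w v k b = 0) by lra.
  assert (a <> Lz v k) by (intros ->; lra). assert (a <> p1) by (intros ->; lra).
  assert (b <> Rz v k) by (intros ->; lra). assert (b <> p2) by (intros ->; lra).
  exists a, b. repeat split; auto; lra.
Qed.

Lemma zone_zeros (v : R) (k : nat) : 0 < v < 1 -> (forall i, (k < i)%nat -> zone_occ v i) ->
  exists (a b : nat -> R) (i0 : nat), (k < i0)%nat /\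
    (forall i, (k < i)%nat -> inz v i (a i) /\ inz v i (b i) /\ a i < b i /\ w v i (a i) = 0 /\ w v i (b i) = 0) /\
    (forall i, (i0 <= i)%nat -> v ^ cz i * a i <= v * (1 + v ^ i) /\ / v * (1 - v ^ i) <= v ^ cz i * b i).
Proof.
  intros Hv Hocc. destruct (w_pos_inner v Hv) as [i1 [Hi1 Hin]].
  (* The condition [k < i] stands inside the relation so that it is total, as the axiom of choice
     requires; zones up to [k] receive a dummy pair. *)
  set (P := fun i (ab : R * R) => (k < i)%nat -> inz v i (fst ab) /\ inz v i (snd ab) /\ fst ab < snd ab /\
    w v i (fst ab) = 0 /\ w v i (snd ab) = 0 /\
    ((i1 <= i)%nat -> v ^ cz i * fst ab <= v * (1 + v ^ i) /\ / v * (1 - v ^ i) <= v ^ cz i * snd ab)).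
  assert (HP : forall i, exists ab, P i ab).
  { intros i. destruct (le_lt_dec i k) as [H|H]; [exists (0, 0); intros ?; lia|].
    assert (Hinz : forall x, Lz v i < x < Rz v i -> inz v i x) by (intros; apply inz_LR; auto; lra).
    destruct (le_lt_dec i1 i) as [H1|H1].
    - destruct (Hin i H1) as [Hlt Hw].
      assert (Hc : 0 < v ^ cz i) by (apply pow_lt; lra).
      assert (He : 0 < v ^ i < 1) by (split; [apply pow_lt; lra | apply pow_lt_1_compat; [lra|lia]]).
      pose proof (inv_v_gt1 v Hv).
      set (p1 := v * (1 + v ^ i) / v ^ cz i). set (p2 := / v * (1 - v ^ i) / v ^ cz i).
      assert (E1 : v ^ cz i * p1 = v * (1 + v ^ i)) by (unfold p1; field; lra).
      assert (E2 : v ^ cz i * p2 = / v * (1 - v ^ i)) by (unfold p2; field; split; lra).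
      assert (Z1 : inz v i p1) by (unfold inz; rewrite E1; split; nra).
      assert (Z2 : inz v i p2) by (unfold inz; rewrite E2; split; nra).
      assert (H12 : p1 <= p2) by (apply Rmult_le_reg_l with (v ^ cz i); lra).
      destruct (two_zeros v i p1 p2 Hv ltac:(lia) Z1 Z2 H12 (Hw p1 (or_introl E1)) (Hw p2 (or_intror E2)))
        as [a [b [Ha [Hb [Wa Wb]]]]].
      exists (a, b). intros _. simpl. apply inz_LR in Z1; [|lra]. apply inz_LR in Z2; [|lra].
      split; [apply Hinz; lra|]. split; [apply Hinz; lra|]. split; [lra|]. split; [auto|]. split; [auto|].
      intros _. rewrite <- E1, <- E2. split; apply Rmult_le_compat_l; lra.
    - destruct (Hocc i H) as [p [Zp Wp]].
      destruct (two_zeros v i p p Hv ltac:(lia) Zp Zp ltac:(lra) Wp Wp) as [a [b [Ha [Hb [Wa Wb]]]]].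
      exists (a, b). intros _. simpl. apply inz_LR in Zp; [|lra].
      split; [apply Hinz; lra|]. split; [apply Hinz; lra|]. split; [lra|]. split; [auto|]. split; [auto|].
      intros; lia. }
  destruct (functional_choice P HP) as [f Hf].
  exists (fun i => fst (f i)), (fun i => snd (f i)), (Nat.max i1 (S k)). split; [lia|]. split.
  - intros i Hi. destruct (Hf i Hi) as [? [? [? [? [? _]]]]]. auto.
  - intros i Hi. destruct (Hf i ltac:(lia)) as [_ [_ [_ [_ [_ H]]]]]. apply H. lia.
Qed.

(** * Growth of theta on circles *)

Lemma theta_coeff_abs (v : R) (n : nat) : 0 < v -> Rabs (theta_coeff (- v) n) = v ^ tri n.
Proof.
  intros Hv. unfold theta_coeff. fold (tri n). rewrite <- RPow_abs, Rabs_Ropp, Rabs_pos_eq; lra.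
Qed.

Lemma theta_rentire (v : R) : 0 < v < 1 -> rentire (theta_coeff (- v)).
Proof.
  intros Hv r Hr. destruct (tri_pow_bounded v r) as [M [HM H]]; [lra|lra|].
  exists M. intros n. rewrite theta_coeff_abs by lra. auto.
Qed.

(** On the circle of radius [kap / v ^ N] the term of index [N] serves as reference for theta.
    Relative to it the term [i] steps further carries the factor [v ^ tri i * kap ^ i], and
    [theta_terms_down] gives the analogue for smaller indices; both are summable uniformly in
    [N]. *)
Lemma theta_terms_up (v kap : R) (N i : nat) : 0 < v -> 0 < kap ->
  v ^ tri (N + i) * (kap / v ^ N) ^ (N + i) = v ^ tri N * (kap / v ^ N) ^ N * (v ^ tri i * kap ^ i).
Proof.
  intros Hv Hk. rewrite tri_add, !pow_add.
  assert (E : v ^ (N * i) * (kap / v ^ N) ^ i = kap ^ i).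
  { rewrite pow_mult, <- Rpow_mult_distr. f_equal. field. apply pow_nonzero; lra. }
  rewrite <- E. ring.
Qed.

Lemma theta_terms_down (v kap : R) (j i : nat) : 0 < v -> 0 < kap ->
  v ^ tri j * (kap / v ^ (j + S i)) ^ j =
  v ^ tri (j + S i) * (kap / v ^ (j + S i)) ^ (j + S i) * (v ^ tri i * / kap ^ S i).
Proof.
  intros Hv Hk. set (N := (j + S i)%nat). set (r := kap / v ^ N).
  assert (HvN : v ^ N <> 0) by (apply pow_nonzero; lra).
  assert (Hr : v ^ N * r = kap) by (unfold r; field; auto).
  assert (Hri : v ^ (N * S i) * r ^ S i = kap ^ S i) by (rewrite pow_mult, <- Rpow_mult_distr, Hr; auto).
  assert (Hk2 : kap ^ S i <> 0) by (apply pow_nonzero; lra).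
  assert (Hv2 : v ^ (N * S i) <> 0) by (apply pow_nonzero; lra).
  assert (Et : (tri N + tri i = tri j + N * S i)%nat).
  { unfold N. rewrite tri_add. rewrite tri_S. pose proof (tri_double i). nia. }
  replace (r ^ N) with (r ^ j * r ^ S i) by (unfold N; rewrite <- pow_add; auto).
  rewrite <- Hri.
  assert (Hp : v ^ tri N * v ^ tri i = v ^ tri j * v ^ (N * S i)) by (rewrite <- !pow_add; f_equal; auto).
  assert (Hr0 : r ^ S i <> 0).
  { intros H0. rewrite H0, Rmult_0_r in Hri. auto. }
  replace (v ^ tri N * (r ^ j * r ^ S i) * (v ^ tri i * / (v ^ (N * S i) * r ^ S i)))
    with (v ^ tri N * v ^ tri i * (r ^ j * r ^ S i) / (v ^ (N * S i) * r ^ S i)) by (field; auto).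
  rewrite Hp. field. auto.
Qed.

Lemma theta_circle_upper (v kap : R) : 0 < v < 1 -> 1 <= kap -> exists C0, 0 < C0 /\
  forall N z, Cmod z = kap / v ^ N ->
    Cmod (CSum (cs (theta_coeff (- v))) z) <= C0 * (v ^ tri N * (kap / v ^ N) ^ N).
Proof.
  intros Hv Hk. set (s := Series (fun i => v ^ tri i * kap ^ i)).
  assert (Hex : ex_series (fun i => v ^ tri i * kap ^ i)) by (apply ex_series_tri; lra).
  assert (Hnn : forall i, 0 <= v ^ tri i * kap ^ i) by (intros; apply Rmult_le_pos; apply pow_le; lra).
  assert (Hs : 0 <= s).
  { apply Rle_trans with (sumf (fun i => v ^ tri i * kap ^ i) 0); [simpl; lra | apply sumf_le_series; auto]. }
  exists (2 * s + 1). split; [lra|]. intros N z Hz.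
  set (r := kap / v ^ N) in *. set (T := v ^ tri N * r ^ N).
  assert (Hr : 0 < r) by (apply Rdiv_lt_0_compat; [lra | apply pow_lt; lra]).
  assert (HT : 0 < T) by (apply Rmult_lt_0_compat; apply pow_lt; lra).
  assert (Hex2 : ex_series (fun n => v ^ tri n * r ^ n)) by (apply ex_series_tri; lra).
  apply Rle_trans with (Series (fun n => v ^ tri n * r ^ n)).
  { apply CSum_bound; auto; [apply rentire_cs, theta_rentire; auto|].
    intros n. unfold cs. rewrite Cmod_R, theta_coeff_abs by lra. rewrite Hz. lra. }
  assert (Hfin : forall M, sumf (fun n => v ^ tri n * r ^ n) (N + M) <= (2 * s + 1) * T).
  { intros M. rewrite sumf_split, sumf_rev.
    assert (B1 : sumf (fun i => v ^ tri (N - 1 - i) * r ^ (N - 1 - i)) N <= T * s).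
    { apply Rle_trans with (T * sumf (fun i => v ^ tri i * kap ^ i) N).
      - rewrite <- sumf_scal. apply sumf_le. intros i Hi.
        assert (E := theta_terms_down v kap (N - 1 - i) i ltac:(lra) ltac:(lra)).
        replace (N - 1 - i + S i)%nat with N in E by lia. fold r in E. fold T in E. rewrite E.
        apply Rmult_le_compat_l; [lra|]. apply Rmult_le_compat_l; [apply pow_le; lra|].
        assert (H1 : 1 <= kap ^ i) by (apply pow_R1_Rle; lra).
        assert (H2 : 1 <= kap ^ S i) by (apply pow_R1_Rle; lra).
        apply Rle_trans with 1; auto. rewrite <- Rinv_1. apply Rinv_le_contravar; lra.
      - apply Rmult_le_compat_l; [lra | apply sumf_le_series; auto]. }
    assert (B2 : sumf (fun i => v ^ tri (N + i) * r ^ (N + i)) M <= T * s).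
    { apply Rle_trans with (T * sumf (fun i => v ^ tri i * kap ^ i) M).
      - rewrite <- sumf_scal. apply sumf_le. intros i _. right.
        unfold r. rewrite theta_terms_up by lra. reflexivity.
      - apply Rmult_le_compat_l; [lra | apply sumf_le_series; auto]. }
    nra. }
  assert (K := is_lim_seq_le_loc (sumf (fun n => v ^ tri n * r ^ n)) (fun _ => (2 * s + 1) * T)
    (Series (fun n => v ^ tri n * r ^ n)) ((2 * s + 1) * T)).
  apply K; [|apply sumf_lim; auto | apply is_lim_seq_const].
  exists N. intros n Hn. replace n with (N + (n - N))%nat by lia. apply Hfin.
Qed.

Lemma Ci_even_pow (r : R) (s : nat) : ((Ci * RtoC r) ^ (2 * s))%C = RtoC ((-1) ^ s * r ^ (2 * s)).
Proof.
  rewrite Cpow_mult_r. replace ((Ci * RtoC r) ^ 2)%C with (RtoC (-1 * r ^ 2)).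
  - rewrite <- RtoC_pow. f_equal. rewrite Rpow_mult_distr, pow_mult. reflexivity.
  - apply C_ext; simpl; ring.
Qed.

Lemma tri_even_sign (s : nat) : (-1) ^ tri (2 * s) = (-1) ^ s.
Proof.
  replace (tri (2 * s)) with (s * 2 * s + s)%nat.
  - rewrite pow_add, pow_mult, Nat.mul_comm, pow_mult. replace ((-1) ^ 2) with 1 by ring. rewrite !pow1. ring.
  - replace (2 * s)%nat with (s + s)%nat by lia. rewrite tri_add. pose proof (tri_double s). nia.
Qed.

(** On the imaginary axis the even-indexed terms of theta are all positive. *)
Lemma theta_imag_lower (v r : R) (l : nat) : 0 < v < 1 -> 0 < r ->
  v ^ tri (4 * l) * r ^ (4 * l) <= Cmod (CSum (cs (theta_coeff (- v))) (Ci * RtoC r)%C).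
Proof.
  intros Hv Hr.
  assert (Hterm : forall n, 0 <= Re (cs (theta_coeff (- v)) n * (Ci * RtoC r) ^ n)%C /\
     (forall s, n = (2 * s)%nat -> Re (cs (theta_coeff (- v)) n * (Ci * RtoC r) ^ n)%C = v ^ tri n * r ^ n)).
  { assert (Hev : forall s, Re (cs (theta_coeff (- v)) (2 * s) * (Ci * RtoC r) ^ (2 * s))%C = v ^ tri (2 * s) * r ^ (2 * s)).
    { intros s. rewrite Ci_even_pow. unfold cs, theta_coeff. fold (tri (2 * s)).
      rewrite <- RtoC_mult, re_RtoC. replace (- v) with (-1 * v) by ring.
      rewrite Rpow_mult_distr, tri_even_sign.
      replace ((-1) ^ s * v ^ tri (2 * s) * ((-1) ^ s * r ^ (2 * s)))
        with ((-1) ^ s * (-1) ^ s * (v ^ tri (2 * s) * r ^ (2 * s))) by ring.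
      rewrite <- Rpow_mult_distr. replace (-1 * -1) with 1 by ring. rewrite pow1. ring. }
    intros n. split.
    - destruct (Nat.Even_or_Odd n) as [[s ->]|[s ->]].
      + rewrite Hev. apply Rmult_le_pos; apply pow_le; lra.
      + right. rewrite Cpow_add_r, Ci_even_pow, Cpow_1_r. unfold cs. simpl. ring.
    - intros s ->. apply Hev. }
  eapply Rle_trans; [|apply re_le_Cmod]. eapply Rle_trans; [|apply Rle_abs].
  destruct (CSum_clim (cs (theta_coeff (- v))) (Ci * RtoC r)%C) as [L _]; [apply rentire_cs, theta_rentire; auto|].
  assert (K := is_lim_seq_le_loc (fun _ => v ^ tri (4 * l) * r ^ (4 * l))
    (fun n => Re (csumf (fun j => cs (theta_coeff (- v)) j * (Ci * RtoC r) ^ j)%C n))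
    (v ^ tri (4 * l) * r ^ (4 * l)) (Re (CSum (cs (theta_coeff (- v))) (Ci * RtoC r)%C))).
  apply K; auto; [|apply is_lim_seq_const].
  exists (S (4 * l)). intros n Hn. rewrite csumf_Re. replace n with (S (4 * l) + (n - S (4 * l)))%nat by lia.
  set (F := fun i => Re (cs (theta_coeff (- v)) i * (Ci * RtoC r) ^ i)%C) in *.
  rewrite sumf_split.
  assert (ES : sumf F (S (4 * l)) = sumf F (4 * l) + F (4 * l)%nat) by reflexivity. rewrite ES.
  destruct (Hterm (4 * l)%nat) as [_ E]. specialize (E (2 * l)%nat ltac:(lia)). fold (F (4 * l)%nat) in E. rewrite E.
  assert (0 <= sumf F (4 * l)) by (apply sumf_nonneg; intros; apply Hterm).
  assert (0 <= sumf (fun i => F (S (4 * l) + i)%nat) (n - S (4 * l)))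
    by (apply sumf_nonneg; intros; apply Hterm).
  lra.
Qed.

(** * The product over the zeros of the occupied zones *)

Lemma zone_unique (v : R) (i i' : nat) (x : R) : 0 < v < 1 -> sg i = sg i' -> inz v i x -> inz v i' x -> i = i'.
Proof.
  intros Hv.
  assert (G : forall i i', (i < i')%nat -> sg i = sg i' -> inz v i x -> inz v i' x -> False).
  { clear i i'. intros i i' Hlt Hs [H1 H2] [H3 H4].
    assert (Hc : (cz i + 2 <= cz i')%nat).
    { destruct (even_cases i) as [[l [E1 [E2 E3]]]|[l [E1 [E2 E3]]]];
      destruct (even_cases i') as [[l' [E1' [E2' E3']]]|[l' [E1' [E2' E3']]]]; try lia; exfalso; lra. }
    replace (cz i') with (cz i + (cz i' - cz i))%nat in H3 by lia. rewrite pow_add in H3.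
    assert (Hp : v ^ (cz i' - cz i) <= v ^ 2) by (apply pow_le_anti; [lra|lia]).
    assert (Hp0 : 0 < v ^ (cz i' - cz i)) by (apply pow_lt; lra).
    set (p := v ^ (cz i' - cz i)) in *. set (y := v ^ cz i * x).
    replace (v ^ cz i * p * x) with (p * y) in H3 by (unfold y; ring). fold y in H1, H2.
    assert (p * y < p * / v) by (apply Rmult_lt_compat_l; auto).
    assert (p * / v <= v ^ 2 * / v) by (apply Rmult_le_compat_r; [pose proof (inv_v_gt1 v Hv)|]; lra).
    replace (v ^ 2 * / v) with v in * by (field; lra). lra. }
  intros Hs H1 H2. destruct (lt_eq_lt_dec i i') as [[H|H]|H]; auto; exfalso.
  - apply (G i i'); auto.
  - apply (G i' i); auto.
Qed.

Lemma CSum_real (c : nat -> R) (x : R) : CSum (cs c) (RtoC x) = RtoC (PSeries c x).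
Proof.
  apply C_ext.
  - change (Series (fun j => Re (RtoC (c j) * RtoC x ^ j)%C) = Series (fun k => c k * x ^ k)).
    apply Series_ext. intros n. rewrite <- RtoC_pow, <- RtoC_mult. reflexivity.
  - change (Series (fun j => Im (RtoC (c j) * RtoC x ^ j)%C) = 0).
    rewrite (Series_ext _ (fun _ => 0 * 0)); [rewrite Series_scal_l; ring|].
    intros n. rewrite <- RtoC_pow, <- RtoC_mult. simpl. ring.
Qed.

Lemma CSum_theta (v y : R) : CSum (cs (theta_coeff (- v))) (RtoC y) = RtoC (th v y).
Proof. rewrite CSum_real. f_equal. apply theta_U. Qed.

Lemma factor_inside (xi A r t : R) (z : C) : 0 < A -> 0 < r -> Rabs xi = / A -> Cmod z = r -> A <= t * r ->
  r / A * (1 - t) <= Cmod (1 - RtoC xi * z)%C <= r / A * (1 + t).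
Proof.
  intros HA Hr Hxi Hz Ht.
  assert (E : Cmod (RtoC xi * z)%C = r / A) by (rewrite Cmod_mult, Cmod_R, Hxi, Hz; field; lra).
  assert (H1 : 1 <= r / A * t).
  { apply Rmult_le_reg_r with A; auto. replace (r / A * t * A) with (t * r) by (field; lra). lra. }
  pose proof (Cmod_triangle 1 (- (RtoC xi * z))%C) as T1. rewrite Cmod_opp, E, Cmod_1 in T1.
  pose proof (Cmod_triangle (1 - RtoC xi * z)%C (- RtoC 1)%C) as T2. rewrite Cmod_opp, Cmod_1 in T2.
  replace (1 - RtoC xi * z + - RtoC 1)%C with (- (RtoC xi * z))%C in T2 by ring. rewrite Cmod_opp, E in T2.
  unfold Cminus in *. lra.
Qed.

Lemma factor_outside (xi A r t : R) (z : C) : 0 < A -> 0 < r -> Rabs xi = / A -> Cmod z = r -> r <= t * A ->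
  1 - t <= Cmod (1 - RtoC xi * z)%C <= 1 + t.
Proof.
  intros HA Hr Hxi Hz Ht.
  assert (E : Cmod (RtoC xi * z)%C = r / A) by (rewrite Cmod_mult, Cmod_R, Hxi, Hz; field; lra).
  assert (H1 : r / A <= t).
  { apply Rmult_le_reg_r with A; auto. replace (r / A * A) with r by (field; lra). lra. }
  pose proof (Cmod_triangle 1 (- (RtoC xi * z))%C) as T1. rewrite Cmod_opp, E, Cmod_1 in T1.
  pose proof (Cmod_triangle (1 - RtoC xi * z)%C (RtoC xi * z)%C) as T2.
  replace (1 - RtoC xi * z + RtoC xi * z)%C with (RtoC 1) in T2 by ring. rewrite E, Cmod_1 in T2.
  unfold Cminus in *. lra.
Qed.

Lemma Pz_pairs (xi : nat -> R) (m : nat) (z : C) :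
  Cmod (Pz xi (S (2 * m)) z) = Cmod (1 - RtoC (xi 0%nat) * z)%C *
    prodf (fun j => Cmod (1 - RtoC (xi (S (2 * j))) * z)%C * Cmod (1 - RtoC (xi (S (S (2 * j)))) * z)%C) m.
Proof.
  set (f := fun j => Cmod (1 - RtoC (xi (S (2 * j))) * z)%C * Cmod (1 - RtoC (xi (S (S (2 * j)))) * z)%C).
  induction m as [|m IH].
  - change (Cmod (1 * (1 - RtoC (xi O) * z))%C = Cmod (1 - RtoC (xi O) * z)%C * 1).
    rewrite Cmod_mult, Cmod_1. ring.
  - replace (S (2 * S m)) with (S (S (S (2 * m)))) by lia.
    change (Pz xi (S (S (S (2 * m)))) z) with
      ((Pz xi (S (2 * m)) z * (1 - RtoC (xi (S (2 * m))) * z)) * (1 - RtoC (xi (S (S (2 * m)))) * z))%C.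
    rewrite !Cmod_mult, IH. change (prodf f (S m)) with (prodf f m * f m). unfold f at 3. ring.
Qed.

(** A single enumeration of the chosen zeros, with the two zeros of a zone adjacent, so that partial
    products ending after a complete pair have odd length. *)
Definition merge_seq (k : nat) (x1 : R) (a b : nat -> R) (n : nat) : R :=
  match n with
  | O => x1
  | S n => let i := (k + 1 + Nat.div2 n)%nat in if Nat.even n then sg i * a i else sg i * b i
  end.

Lemma merge_seq_a (k : nat) (x1 : R) (a b : nat -> R) (j : nat) :
  merge_seq k x1 a b (S (2 * j)) = sg (k + 1 + j) * a (k + 1 + j)%nat.
Proof.
  unfold merge_seq. rewrite Nat.div2_double.
  replace (Nat.even (2 * j)) with true; auto. symmetry. apply Nat.even_spec. exists j. auto.
Qed.

Lemma merge_seq_b (k : nat) (x1 : R) (a b : nat -> R) (j : nat) :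
  merge_seq k x1 a b (S (S (2 * j))) = sg (k + 1 + j) * b (k + 1 + j)%nat.
Proof.
  unfold merge_seq. rewrite Nat.div2_succ_double.
  replace (Nat.even (S (2 * j))) with false; auto. rewrite Nat.even_succ.
  replace (Nat.odd (2 * j)) with false; auto. symmetry. rewrite <- Nat.negb_even.
  replace (Nat.even (2 * j)) with true; auto. symmetry. apply Nat.even_spec. exists j. auto.
Qed.

Lemma pair_index (n : nat) : n = O \/ (exists j, n = S (2 * j)) \/ (exists j, n = S (S (2 * j))).
Proof.
  destruct n as [|n]; auto. right. destruct (Nat.Even_or_Odd n) as [[j ->]|[j ->]].
  - left. exists j. auto.
  - right. exists j. f_equal. lia.
Qed.

Lemma prod_geom_lower (v rho : R) (n : nat) : 0 < v < 1 -> 0 < rho < 1 ->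
  exp (- (rho / (1 - v) / (1 - rho))) <= prodf (fun s => 1 - rho * v ^ s) n.
Proof.
  intros Hv Hr. apply (prodf_one_minus (fun s => rho * v ^ s) rho); [lra| |].
  - intros i _. pose proof (pow_le_one v i ltac:(lra)). assert (0 <= v ^ i) by (apply pow_le; lra). split; nra.
  - rewrite sumf_scal. apply Rmult_le_compat_l; [lra | apply sumf_geom; lra].
Qed.

Lemma prod_geom_upper (v rho : R) (n : nat) : 0 < v < 1 -> 0 < rho ->
  prodf (fun s => 1 + rho * v ^ s) n <= exp (rho / (1 - v)).
Proof.
  intros Hv Hr. apply (prodf_one_plus (fun s => rho * v ^ s)).
  - intros i _. apply Rmult_le_pos; [lra | apply pow_le; lra].
  - rewrite sumf_scal. apply Rmult_le_compat_l; [lra | apply sumf_geom; lra].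
Qed.

(** Of the zeros [/ xi n], the one with [n = 0] and the first [J] of the following pairs lie inside
    the circle [Cmod z = r], the others outside; [rho v ^ s] measures their distance to it. *)
Lemma Pz_bounds (xi A B : nat -> R) (x1 v rho r : R) (J m : nat) (z : C) :
  0 < v < 1 -> 0 < rho < 1 -> 0 < r -> 0 < x1 -> (J <= m)%nat -> Cmod z = r ->
  (forall j, 0 < A j /\ 0 < B j /\ Rabs (xi (S (2 * j))) = / A j /\ Rabs (xi (S (S (2 * j)))) = / B j) ->
  Rabs (xi O) = / x1 -> x1 <= rho * r ->
  (forall j, (j < J)%nat -> A j <= rho * v ^ (J - 1 - j) * r /\ B j <= rho * v ^ (J - 1 - j) * r) ->
  (forall s, r <= rho * v ^ s * A (J + s)%nat /\ r <= rho * v ^ s * B (J + s)%nat) ->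
  let D := r / x1 * prodf (fun j => r / A j * (r / B j)) J in
  let e := exp (- (rho / (1 - v) / (1 - rho))) in let E := exp (rho / (1 - v)) in
  D * ((1 - rho) * (e * e * (e * e))) <= Cmod (Pz xi (S (2 * m)) z) <= D * (2 * (E * E * (E * E))).
Proof.
  intros Hv Hrho Hr Hx1 HJ Hz HAB H0 Hx1r Hin Hout D e E.
  assert (He : 0 < e) by apply exp_pos. assert (HE : 0 < E) by apply exp_pos.
  rewrite Pz_pairs. replace m with (J + (m - J))%nat by lia. rewrite prodf_split.
  set (P1 := prodf _ J). set (P2 := prodf _ (m - J)).
  set (DJ := prodf (fun j => r / A j * (r / B j)) J) in *.
  assert (Hpw : forall s, 0 < v ^ s <= 1) by (intros; split; [apply pow_lt; lra | apply pow_le_one; lra]).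
  assert (Hrs : forall s, 0 < rho * v ^ s <= rho) by (intros s; specialize (Hpw s); split; nra).
  assert (HDJ : 0 < DJ).
  { apply prodf_pos. intros j _. destruct (HAB j) as [? [? _]]. apply Rmult_lt_0_compat; apply Rdiv_lt_0_compat; auto. }
  assert (Hx : 0 < r / x1) by (apply Rdiv_lt_0_compat; auto).
  destruct (factor_inside (xi O) x1 r rho z Hx1 Hr H0 Hz Hx1r) as [F1 F2].
  set (f0 := Cmod (1 - RtoC (xi O) * z)%C) in *.
  assert (Hf0l : r / x1 * (1 - rho) <= f0) by auto.
  assert (Hf0u : f0 <= r / x1 * 2) by (eapply Rle_trans; [apply F2 | apply Rmult_le_compat_l; lra]).
  assert (Plow : forall n, e <= prodf (fun s => 1 - rho * v ^ s) n) by (intros; apply prod_geom_lower; auto).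
  assert (Pup : forall n, prodf (fun s => 1 + rho * v ^ s) n <= E) by (intros; apply prod_geom_upper; auto; lra).
  assert (Pupnn : forall n, 0 <= prodf (fun s => 1 + rho * v ^ s) n).
  { intros; apply prodf_nonneg. intros i _. specialize (Hrs i). lra. }
  assert (HP1 : DJ * (e * e) <= P1 <= DJ * (E * E)).
  { assert (Hj : forall j, (j < J)%nat ->
      r / A j * (r / B j) * ((1 - rho * v ^ (J - 1 - j)) * (1 - rho * v ^ (J - 1 - j))) <=
      Cmod (1 - RtoC (xi (S (2 * j))) * z)%C * Cmod (1 - RtoC (xi (S (S (2 * j)))) * z)%C <=
      r / A j * (r / B j) * ((1 + rho * v ^ (J - 1 - j)) * (1 + rho * v ^ (J - 1 - j)))).
    { intros j Hj. destruct (HAB j) as [HA [HB [XA XB]]]. destruct (Hin j Hj) as [IA IB].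
      destruct (factor_inside _ _ _ _ z HA Hr XA Hz IA) as [L1 U1].
      destruct (factor_inside _ _ _ _ z HB Hr XB Hz IB) as [L2 U2].
      specialize (Hrs (J - 1 - j)%nat).
      assert (0 < r / A j) by (apply Rdiv_lt_0_compat; auto). assert (0 < r / B j) by (apply Rdiv_lt_0_compat; auto).
      set (t := rho * v ^ (J - 1 - j)) in *. split.
      - replace (r / A j * (r / B j) * ((1 - t) * (1 - t))) with (r / A j * (1 - t) * (r / B j * (1 - t))) by ring.
        apply Rmult_le_compat; auto; apply Rmult_le_pos; lra.
      - replace (r / A j * (r / B j) * ((1 + t) * (1 + t))) with (r / A j * (1 + t) * (r / B j * (1 + t))) by ring.
        apply Rmult_le_compat; auto; apply Cmod_ge_0. }
    assert (Hnn : forall j, 0 <= r / A j * (r / B j)).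
    { intros j. destruct (HAB j) as [? [? _]]. apply Rlt_le, Rmult_lt_0_compat; apply Rdiv_lt_0_compat; auto. }
    split.
    - apply Rle_trans with (prodf (fun j => r / A j * (r / B j) * ((1 - rho * v ^ (J - 1 - j)) * (1 - rho * v ^ (J - 1 - j)))) J).
      + rewrite (prodf_mult (fun j => r / A j * (r / B j))). fold DJ. apply Rmult_le_compat_l; [lra|].
        rewrite prodf_mult. rewrite <- (prodf_rev (fun s => 1 - rho * v ^ s)).
        apply Rmult_le_compat; auto; lra.
      + apply prodf_le. intros j Hj'. split; [|apply Hj; auto]. apply Rmult_le_pos; auto.
        specialize (Hrs (J - 1 - j)%nat). apply Rmult_le_pos; lra.
    - apply Rle_trans with (prodf (fun j => r / A j * (r / B j) * ((1 + rho * v ^ (J - 1 - j)) * (1 + rho * v ^ (J - 1 - j)))) J).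
      + apply prodf_le. intros j Hj'. split; [apply Rmult_le_pos; apply Cmod_ge_0 | apply Hj; auto].
      + rewrite (prodf_mult (fun j => r / A j * (r / B j))). fold DJ. apply Rmult_le_compat_l; [lra|].
        rewrite prodf_mult. rewrite <- (prodf_rev (fun s => 1 + rho * v ^ s)).
        apply Rmult_le_compat; auto. }
  assert (HP2 : e * e <= P2 <= E * E).
  { assert (Hj : forall s,
      (1 - rho * v ^ s) * (1 - rho * v ^ s) <=
      Cmod (1 - RtoC (xi (S (2 * (J + s)))) * z)%C * Cmod (1 - RtoC (xi (S (S (2 * (J + s))))) * z)%C <=
      (1 + rho * v ^ s) * (1 + rho * v ^ s)).
    { intros s. destruct (HAB (J + s)%nat) as [HA [HB [XA XB]]]. destruct (Hout s) as [IA IB].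
      destruct (factor_outside _ _ _ _ z HA Hr XA Hz IA) as [L1 U1].
      destruct (factor_outside _ _ _ _ z HB Hr XB Hz IB) as [L2 U2].
      specialize (Hrs s). set (t := rho * v ^ s) in *.
      split; apply Rmult_le_compat; auto; try lra; apply Cmod_ge_0. }
    split.
    - apply Rle_trans with (prodf (fun s => (1 - rho * v ^ s) * (1 - rho * v ^ s)) (m - J)).
      + rewrite prodf_mult. apply Rmult_le_compat; auto; lra.
      + apply prodf_le. intros s _. split; [|apply Hj]. specialize (Hrs s). apply Rmult_le_pos; lra.
    - apply Rle_trans with (prodf (fun s => (1 + rho * v ^ s) * (1 + rho * v ^ s)) (m - J)).
      + apply prodf_le. intros s _. split; [apply Rmult_le_pos; apply Cmod_ge_0 | apply Hj].
      + rewrite prodf_mult. apply Rmult_le_compat; auto. }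
  assert (0 < e * e) by (apply Rmult_lt_0_compat; auto). assert (0 < E * E) by (apply Rmult_lt_0_compat; auto).
  assert (0 <= f0) by apply Cmod_ge_0.
  assert (0 < DJ * (e * e)) by (apply Rmult_lt_0_compat; auto).
  assert (0 <= r / x1 * (1 - rho)) by (apply Rmult_le_pos; lra).
  unfold D. split.
  - replace (r / x1 * DJ * ((1 - rho) * (e * e * (e * e)))) with (r / x1 * (1 - rho) * (DJ * (e * e) * (e * e))) by ring.
    apply Rmult_le_compat; auto; [apply Rmult_le_pos; lra|]. apply Rmult_le_compat; lra.
  - replace (r / x1 * DJ * (2 * (E * E * (E * E)))) with (r / x1 * 2 * (DJ * (E * E) * (E * E))) by ring.
    apply Rmult_le_compat; auto; [apply Rmult_le_pos; lra|]. apply Rmult_le_compat; lra.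
Qed.

(** * Polynomial factors of entire series *)

Fixpoint poly_eval (q : nat -> R) (d : nat) (z : C) : C :=
  match d with O => RtoC (q O) | S d => (RtoC (q O) + z * poly_eval (fun n => q (S n)) d z)%C end.

Lemma poly_eval_trunc (d : nat) (q : nat -> R) (z : C) : q (S d) = 0 -> poly_eval q (S d) z = poly_eval q d z.
Proof.
  revert q. induction d as [|d IH]; intros q H.
  - simpl. rewrite H. ring.
  - change (RtoC (q O) + z * poly_eval (fun n => q (S n)) (S d) z = RtoC (q O) + z * poly_eval (fun n => q (S n)) d z)%C.
    rewrite IH; auto.
Qed.

Lemma poly_eval_bound (d : nat) (q : nat -> R) : exists M, forall z, 1 <= Cmod z -> Cmod (poly_eval q d z) <= M * Cmod z ^ d.
Proof.
  revert q. induction d as [|d IH]; intros q.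
  - exists (Rabs (q O)). intros z _. simpl. rewrite Cmod_R. lra.
  - destruct (IH (fun n => q (S n))) as [M HM]. exists (Rabs (q O) + M). intros z Hz.
    simpl poly_eval. eapply Rle_trans; [apply Cmod_triangle|]. rewrite Cmod_R, Cmod_mult. specialize (HM z Hz).
    assert (1 <= Cmod z ^ S d) by (apply pow_R1_Rle; auto). pose proof (Rabs_pos (q O)).
    assert (Cmod z * Cmod (poly_eval (fun n => q (S n)) d z) <= M * Cmod z ^ S d).
    { simpl. replace (M * (Cmod z * Cmod z ^ d)) with (Cmod z * (M * Cmod z ^ d)) by ring.
      apply Rmult_le_compat_l; lra. }
    assert (Rabs (q O) * 1 <= Rabs (q O) * Cmod z ^ S d) by (apply Rmult_le_compat_l; auto). lra.
Qed.

Lemma CSum_shift_add (c u w : nat -> C) (z : C) : centire u -> centire w ->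
  c O = u O -> (forall n, c (S n) = u (S n) + w n)%C ->
  centire c /\ CSum c z = (CSum u z + z * CSum w z)%C.
Proof.
  intros Hu Hw H0 HS.
  assert (Hc : centire c).
  { intros r Hr. destruct (Hu r Hr) as [M1 H1]. destruct (Hw r Hr) as [M2 H2]. exists (M1 + Rabs M2 * r).
    assert (0 <= Rabs M2 * r) by (apply Rmult_le_pos; [apply Rabs_pos | lra]).
    intros [|n]; [rewrite H0; specialize (H1 O); lra|].
    rewrite HS. specialize (H1 (S n)). specialize (H2 n).
    assert (Hp : 0 <= r ^ S n) by (apply pow_le; lra).
    apply Rle_trans with ((Cmod (u (S n)) + Cmod (w n)) * r ^ S n).
    - apply Rmult_le_compat_r; auto. apply Cmod_triangle.
    - rewrite Rmult_plus_distr_r. apply Rplus_le_compat; auto.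
      replace (Cmod (w n) * r ^ S n) with (Cmod (w n) * r ^ n * r) by (simpl; ring).
      apply Rmult_le_compat_r; [lra|]. pose proof (Rle_abs M2). lra. }
  split; auto.
  apply (clim_unique (csumf (fun j => c j * z ^ j)%C)); [apply CSum_clim; auto|].
  assert (L : clim (fun N => csumf (fun j => u j * z ^ j) (S N) + z * csumf (fun j => w j * z ^ j) N)%C
    (CSum u z + z * CSum w z)%C).
  { apply clim_plus; [apply clim_S, CSum_clim; auto|].
    apply clim_mult; [apply clim_const | apply CSum_clim; auto]. }
  assert (L' : clim (fun N => csumf (fun j => c j * z ^ j) (S N))%C (CSum u z + z * CSum w z)%C).
  { eapply clim_ext; [|exact L]. intros N. induction N as [|N IH].
    - simpl. rewrite H0. ring.
    - change (csumf (fun j => c j * z ^ j)%C (S (S N))) with (csumf (fun j => c j * z ^ j) (S N) + c (S N) * z ^ S N)%C.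
      rewrite <- IH, HS.
      change (csumf (fun j => u j * z ^ j)%C (S (S N))) with (csumf (fun j => u j * z ^ j) (S N) + u (S N) * z ^ S N)%C.
      change (csumf (fun j => w j * z ^ j)%C (S N)) with (csumf (fun j => w j * z ^ j) N + w N * z ^ N)%C.
      change (z ^ S N)%C with (z * z ^ N)%C. ring. }
  destruct L' as [L1 L2]. split.
  - apply (is_lim_seq_incr_1 (fun N => Re (csumf (fun j => c j * z ^ j)%C N))); exact L1.
  - apply (is_lim_seq_incr_1 (fun N => Im (csumf (fun j => c j * z ^ j)%C N))); exact L2.
Qed.

Lemma conv_shift (h q : nat -> R) (n : nat) :
  conv h q (S n) = h (S n) * q O + conv h (fun i => q (S i)) n.
Proof.
  unfold conv. change (sumf (fun i => h i * q (S n - i)%nat) (S (S n))) with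
    (sumf (fun i => h i * q (S n - i)%nat) (S n) + h (S n) * q (S n - S n)%nat).
  rewrite Nat.sub_diag, Rplus_comm. f_equal. apply sumf_ext. intros i Hi. do 2 f_equal. lia.
Qed.

Lemma centire_scal (k : C) (a : nat -> C) : centire a -> centire (fun n => k * a n)%C.
Proof.
  intros Ha r Hr. destruct (Ha r Hr) as [M HM]. exists (Cmod k * M). intros n.
  rewrite Cmod_mult, Rmult_assoc. apply Rmult_le_compat_l; auto. apply Cmod_ge_0.
Qed.

Lemma CSum_scal (k : C) (a : nat -> C) (z : C) : centire a -> CSum (fun n => k * a n)%C z = (k * CSum a z)%C.
Proof.
  intros Ha. apply (clim_unique (csumf (fun j => k * a j * z ^ j)%C)); [apply CSum_clim, centire_scal; auto|].
  eapply clim_ext; [|apply clim_mult; [apply (clim_const k) | apply CSum_clim; auto]].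
  intros n. cbv beta. rewrite <- csumf_scal. apply csumf_ext. intros i _. ring.
Qed.

Lemma CSum_conv (h : nat -> R) (d : nat) (q : nat -> R) (z : C) : rentire h ->
  (forall n, (d < n)%nat -> q n = 0) ->
  centire (cs (conv h q)) /\ CSum (cs (conv h q)) z = (poly_eval q d z * CSum (cs h) z)%C.
Proof.
  intros Hh. pose proof (rentire_cs h Hh) as Hc. revert q. induction d as [|d IH]; intros q Hq.
  - assert (E : forall n, cs (conv h q) n = (RtoC (q O) * cs h n)%C).
    { intros n. unfold cs. rewrite <- RtoC_mult. f_equal. unfold conv. simpl sumf. rewrite Nat.sub_diag.
      assert (E : sumf (fun i => h i * q (n - i)%nat) n = sumf (fun _ => 0 * 0) n).
      { apply sumf_ext. intros i Hi. rewrite (Hq (n - i)%nat) by lia. ring. }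
      rewrite E, sumf_scal. ring. }
    split.
    + intros r Hr. destruct (centire_scal (RtoC (q O)) _ Hc r Hr) as [M HM]. exists M. intros n. rewrite E. apply HM.
    + rewrite (CSum_ext _ _ z E), CSum_scal by auto. reflexivity.
  - destruct (IH (fun n => q (S n)) ltac:(intros n Hn; apply Hq; lia)) as [H1 H2].
    destruct (CSum_shift_add (cs (conv h q)) (fun n => RtoC (q O) * cs h n)%C (cs (conv h (fun n => q (S n)))) z) as [H3 H4]; auto.
    + apply centire_scal; auto.
    + unfold cs, conv. simpl sumf. rewrite <- RtoC_mult. f_equal. simpl. ring.
    + intros n. unfold cs. rewrite conv_shift, <- RtoC_mult, <- RtoC_plus. f_equal. ring.
    + split; auto. rewrite H4, H2, CSum_scal by auto. simpl poly_eval. ring.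
Qed.

Fixpoint cz_sum (n : nat) : nat := match n with O => O | S n => (cz_sum n + 2 * cz (S n))%nat end.

(** A circle between the zones [2 L] and [2 L + 1] encloses [x1] and two zeros for each occupied
    zone up to [2 L], whose product is comparable with [v] to the power [- 2 * cz i]. The identity
    matches these exponents with the exponent of [v] in the reference term of index [4 L + 1]; the
    extra 1 is paired with [x1]. *)
Lemma cz_sum_even (L : nat) : tri (4 * L + 1) = S (cz_sum (2 * L)).
Proof.
  induction L as [|L IH]; [reflexivity|].
  replace (2 * S L)%nat with (S (S (2 * L))) by lia.
  change (cz_sum (S (S (2 * L)))) with (cz_sum (2 * L) + 2 * cz (S (2 * L)) + 2 * cz (S (S (2 * L))))%nat.
  destruct (even_cases (S (2 * L))) as [[l [E1 [E2 _]]]|[l [E1 [E2 _]]]]; [lia|].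
  destruct (even_cases (S (S (2 * L)))) as [[l' [E1' [E2' _]]]|[l' [E1' [E2' _]]]]; [|lia].
  pose proof (tri_double (4 * L + 1)). pose proof (tri_double (4 * S L + 1)). nia.
Qed.

Lemma Rabs_sg_mult (i : nat) (x : R) : 0 < x -> Rabs (sg i * x) = x.
Proof.
  intros Hx. destruct (sg_cases i) as [-> | ->].
  - rewrite Rmult_1_l. apply Rabs_pos_eq. lra.
  - replace (-1 * x) with (- x) by ring. rewrite Rabs_Ropp. apply Rabs_pos_eq. lra.
Qed.

Section Occupied.

Variables (v : R) (k : nat) (x1 : R) (a b : nat -> R) (i0 : nat).
Hypothesis Hv : 0 < v < 1.
Hypothesis x1_range : 1 < x1 < / v.
Hypothesis x1_zero : th v x1 = 0.
Hypothesis i0_gt : (k < i0)%nat.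
Hypothesis ab_zeros : forall i, (k < i)%nat ->
  inz v i (a i) /\ inz v i (b i) /\ a i < b i /\ w v i (a i) = 0 /\ w v i (b i) = 0.
Hypothesis ab_ends : forall i, (i0 <= i)%nat ->
  v ^ cz i * a i <= v * (1 + v ^ i) /\ / v * (1 - v ^ i) <= v ^ cz i * b i.

Let X := merge_seq k x1 a b.
Let xi n := / X n.

Lemma ab_gt (i : nat) : (k < i)%nat -> / v < a i /\ / v < b i.
Proof. intros Hi. destruct (ab_zeros i Hi) as [Ha [Hb _]]. split; apply (inz_gt v i); auto; lia. Qed.

Lemma X_cases (n : nat) : X n = x1 \/ exists i, (k < i)%nat /\ (X n = sg i * a i \/ X n = sg i * b i).
Proof.
  destruct (pair_index n) as [->|[[j ->]|[j ->]]]; [left; auto | right | right]; exists (k + 1 + j)%nat; (split; [lia|]); unfold X.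
  - left. apply merge_seq_a.
  - right. apply merge_seq_b.
Qed.

Lemma w_zero_th (i : nat) (x : R) : w v i x = 0 -> th v (sg i * x) = 0.
Proof. unfold w. intros H. destruct (sg_cases i) as [E|E]; rewrite E in *; lra. Qed.

Lemma X_zero (n : nat) : th v (X n) = 0.
Proof.
  destruct (X_cases n) as [->|[i [Hi [-> | ->]]]]; auto; apply w_zero_th; apply ab_zeros; auto.
Qed.

Lemma X_abs_gt (n : nat) : 1 < Rabs (X n).
Proof.
  pose proof (inv_v_gt1 v Hv).
  assert (G : forall i x, / v < x -> 1 < Rabs (sg i * x)).
  { intros i x Hx. rewrite Rabs_sg_mult; lra. }
  destruct (X_cases n) as [-> | [i [Hi [-> | ->]]]].
  - rewrite Rabs_pos_eq; lra.
  - apply G, ab_gt; auto.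
  - apply G, ab_gt; auto.
Qed.

Lemma X_nz (n : nat) : X n <> 0.
Proof. intros E. pose proof (X_abs_gt n). rewrite E, Rabs_R0 in H. lra. Qed.

Lemma xi_nz' (n : nat) : xi n <> 0.
Proof. apply Rinv_neq_0_compat, X_nz. Qed.

Lemma signed_inj (i i' : nat) (x x' : R) : (1 <= i)%nat -> (1 <= i')%nat -> inz v i x -> inz v i' x' ->
  sg i * x = sg i' * x' -> i = i' /\ x = x'.
Proof.
  intros Hi Hi' H H' E. pose proof (inv_v_gt1 v Hv).
  pose proof (inz_gt v i x Hv Hi H). pose proof (inz_gt v i' x' Hv Hi' H').
  assert (Hs : sg i = sg i' /\ x = x').
  { destruct (sg_cases i) as [E1|E1]; destruct (sg_cases i') as [E2|E2]; rewrite E1, E2 in E; rewrite E1, E2; split; lra. }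
  destruct Hs as [Hs <-]. split; auto. apply (zone_unique v i i' x); auto.
Qed.

Lemma x1_not_zone (i : nat) (x : R) : (1 <= i)%nat -> inz v i x -> x1 <> sg i * x.
Proof.
  intros Hi Hz E. pose proof (inz_gt v i x Hv Hi Hz). pose proof (inv_v_gt1 v Hv).
  destruct (sg_cases i) as [E1|E1]; rewrite E1 in E; lra.
Qed.

Lemma X_inj (i j : nat) : X i = X j -> i = j.
Proof.
  assert (Ha : forall j, inz v (k + 1 + j) (a (k + 1 + j)%nat)) by (intros; apply ab_zeros; lia).
  assert (Hb : forall j, inz v (k + 1 + j) (b (k + 1 + j)%nat)) by (intros; apply ab_zeros; lia).
  assert (Hab : forall j, a (k + 1 + j)%nat < b (k + 1 + j)%nat) by (intros; apply ab_zeros; lia).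
  assert (N : forall j x, inz v (k + 1 + j) x -> x1 <> sg (k + 1 + j) * x) by (intros; apply x1_not_zone; auto; lia).
  unfold X. intros E.
  destruct (pair_index i) as [->|[[i' ->]|[i' ->]]]; destruct (pair_index j) as [->|[[j' ->]|[j' ->]]]; auto;
    rewrite ?merge_seq_a, ?merge_seq_b in E; simpl in E.
  - exfalso. apply (N _ _ (Ha j') E).
  - exfalso. apply (N _ _ (Hb j') E).
  - exfalso. apply (N _ _ (Ha i')). auto.
  - destruct (signed_inj (k + 1 + i') (k + 1 + j') _ _ ltac:(lia) ltac:(lia) (Ha i') (Ha j') E). lia.
  - destruct (signed_inj (k + 1 + i') (k + 1 + j') _ _ ltac:(lia) ltac:(lia) (Ha i') (Hb j') E) as [E1 E2].
    rewrite E1 in E2. specialize (Hab j'). lra.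
  - exfalso. apply (N _ _ (Hb i')). auto.
  - destruct (signed_inj (k + 1 + i') (k + 1 + j') _ _ ltac:(lia) ltac:(lia) (Hb i') (Ha j') E) as [E1 E2].
    rewrite E1 in E2. specialize (Hab j'). lra.
  - destruct (signed_inj (k + 1 + i') (k + 1 + j') _ _ ltac:(lia) ltac:(lia) (Hb i') (Hb j') E). lia.
Qed.

Lemma xi_inj' (i j : nat) : i <> j -> xi i <> xi j.
Proof.
  intros Hne E. apply Hne, X_inj. unfold xi in E. rewrite <- (Rinv_inv (X i)), E. apply Rinv_inv.
Qed.

Lemma inz_inv_small (i : nat) (x : R) : (1 <= i)%nat -> inz v i x -> / x <= v ^ i.
Proof.
  intros Hi Hz. pose proof (inz_gt v i x Hv Hi Hz). pose proof (inv_v_gt1 v Hv). destruct Hz as [Hz _].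
  pose proof (cz_ge i).
  apply Rmult_le_reg_r with x; [lra|]. rewrite Rinv_l by lra.
  assert (Hc : v ^ (1 + i) * x >= v ^ cz i * x).
  { apply Rle_ge, Rmult_le_compat_r; [lra|]. apply pow_le_anti; [lra|lia]. }
  simpl in Hc. apply Rmult_le_reg_l with v; [lra|]. lra.
Qed.

Lemma xi_geom (n : nat) : Rabs (xi n) <= sqrt v ^ n.
Proof.
  assert (Hs : 0 < sqrt v < 1).
  { split; [apply sqrt_lt_R0; lra|]. rewrite <- sqrt_1. apply sqrt_lt_1; lra. }
  assert (G : forall i n x, (1 <= i)%nat -> (n <= 2 * i)%nat -> inz v i x -> Rabs (/ (sg i * x)) <= sqrt v ^ n).
  { clear n. intros i n x Hi Hn Hz. pose proof (inz_gt v i x Hv Hi Hz). pose proof (inv_v_gt1 v Hv).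
    assert (E : Rabs (/ (sg i * x)) = / x).
    { rewrite Rabs_inv, Rabs_sg_mult; lra. }
    rewrite E. eapply Rle_trans; [apply inz_inv_small; eauto|].
    replace v with (sqrt v ^ 2) at 1 by (simpl; rewrite Rmult_1_r; apply sqrt_sqrt; lra).
    rewrite <- pow_mult. apply pow_le_anti; [lra|lia]. }
  unfold xi, X. destruct (pair_index n) as [->|[[j ->]|[j ->]]].
  - simpl. rewrite Rabs_pos_eq; [|apply Rlt_le, Rinv_0_lt_compat; lra].
    rewrite <- Rinv_1. apply Rinv_le_contravar; lra.
  - rewrite merge_seq_a. apply G; [lia|lia|]. apply ab_zeros; lia.
  - rewrite merge_seq_b. apply G; [lia|lia|]. apply ab_zeros; lia.
Qed.

Lemma xi_summable : ex_series (fun i => Rabs (xi i)) /\ forall n, sumf (fun i => Rabs (xi i)) n <= / (1 - sqrt v).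
Proof.
  assert (Hs : 0 < sqrt v < 1).
  { split; [apply sqrt_lt_R0; lra|]. rewrite <- sqrt_1. apply sqrt_lt_1; lra. }
  split.
  - apply (ex_series_le (fun i => Rabs (xi i)) (fun i => sqrt v ^ i)).
    + intros n. change (norm (Rabs (xi n))) with (Rabs (Rabs (xi n))). rewrite Rabs_Rabsolu. apply xi_geom.
    + apply ex_series_geom. rewrite Rabs_pos_eq; lra.
  - intros n. eapply Rle_trans; [apply sumf_le; intros; apply xi_geom | apply sumf_geom; lra].
Qed.

(** The circle of radius [rad L] lies strictly between the zones up to [2 L], which end at the
    latest at [v] to the power [- (4 L + 1)], and the zones from [2 L + 1] on, which begin at the
    earliest at [v] to the power [- (4 L + 2)]. Any [kap] strictly between 1 and [/ v] separates
    them, and [rho] records by which ratio. [Dl] is the size of the product on the circle when each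
    inner factor is replaced by its leading term; [tz i] is the scaled product of the two zeros of
    zone [i]. *)
Let kap := (1 + / v) / 2.
Let rho := Rmax (/ kap) (kap * v).
Let rad L := kap / v ^ (4 * L + 1).
Let A j := a (k + 1 + j)%nat.
Let B j := b (k + 1 + j)%nat.
Let Dl J r := r / x1 * prodf (fun j => r / A j * (r / B j)) J.
Let tz i := v ^ cz i * a i * (v ^ cz i * b i).

Lemma kap_range : 1 < kap < / v.
Proof. unfold kap. pose proof (inv_v_gt1 v Hv). lra. Qed.

Lemma rho_range : 0 < rho < 1 /\ / kap <= rho /\ kap * v <= rho.
Proof.
  pose proof kap_range. unfold rho.
  assert (0 < / kap < 1) by (split; [apply Rinv_0_lt_compat; lra | rewrite <- Rinv_1; apply Rinv_lt_contravar; lra]).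
  assert (kap * v < 1) by (replace 1 with (/ v * v) by (field; lra); apply Rmult_lt_compat_r; lra).
  repeat split; [eapply Rlt_le_trans; [|apply Rmax_l]; lra | apply Rmax_lub_lt; lra | apply Rmax_l | apply Rmax_r].
Qed.

Lemma rad_pos (L : nat) : 0 < rad L.
Proof. pose proof kap_range. apply Rdiv_lt_0_compat; [lra | apply pow_lt; lra]. Qed.

Lemma inside_ratio (L i : nat) (x : R) : (i <= 2 * L)%nat -> inz v i x -> x <= rho * v ^ (2 * L - i) * rad L.
Proof.
  intros Hi [_ Hz]. destruct rho_range as [Hr [Hr1 _]]. pose proof kap_range.
  assert (Hc : (cz i + 1 + (2 * L - i) <= 4 * L + 1)%nat).
  { destruct (even_cases i) as [[l [E1 [E2 _]]]|[l [E1 [E2 _]]]]; lia. }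
  assert (Hp : forall n, 0 < v ^ n) by (intros; apply pow_lt; lra).
  apply Rle_trans with (/ v / v ^ cz i).
  - destruct (zone_scale v i x (/ v) ltac:(lra)) as [_ [_ [H3 _]]]. apply Rlt_le, H3. auto.
  - apply Rle_trans with (/ kap * v ^ (2 * L - i) * rad L).
    + unfold rad. replace (/ kap * v ^ (2 * L - i) * (kap / v ^ (4 * L + 1))) with (v ^ (2 * L - i) / v ^ (4 * L + 1))
        by (field; repeat split; apply Rgt_not_eq; first [apply Hp | lra]).
      apply Rmult_le_reg_r with (v ^ (4 * L + 1)); auto. unfold Rdiv at 2. rewrite Rmult_assoc, Rinv_l, Rmult_1_r by (apply Rgt_not_eq, Hp).
      replace (4 * L + 1)%nat with (cz i + 1 + (4 * L + 1 - cz i - 1))%nat by lia. rewrite !pow_add, pow_1.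
      replace (/ v / v ^ cz i * (v ^ cz i * v * v ^ (4 * L + 1 - cz i - 1))) with (v ^ (4 * L + 1 - cz i - 1)).
      2:{ field; repeat split; apply Rgt_not_eq; first [apply Hp | lra]. }
      apply pow_le_anti; [lra|lia].
    + apply Rmult_le_compat_r; [apply Rlt_le, rad_pos|]. apply Rmult_le_compat_r; auto. apply Rlt_le, Hp.
Qed.

Lemma outside_ratio (L s : nat) (x : R) : inz v (2 * L + 1 + s) x -> rad L <= rho * v ^ s * x.
Proof.
  set (i := (2 * L + 1 + s)%nat). intros Hz0. pose proof Hz0 as [Hz _].
  pose proof (inz_gt v i x Hv ltac:(unfold i; lia) Hz0). pose proof (inv_v_gt1 v Hv).
  destruct rho_range as [Hr [_ Hr1]]. pose proof kap_range.
  assert (Hc : (4 * L + 3 + s <= cz i)%nat).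
  { destruct (even_cases i) as [[l [E1 [E2 _]]]|[l [E1 [E2 _]]]]; unfold i in *; lia. }
  assert (Hp : forall n, 0 < v ^ n) by (intros; apply pow_lt; lra).
  apply Rle_trans with (kap * v * v ^ s * x).
  - unfold rad. apply Rmult_le_reg_r with (v ^ (4 * L + 1)); auto.
    replace (kap / v ^ (4 * L + 1) * v ^ (4 * L + 1)) with (kap * 1) by (field; apply Rgt_not_eq, Hp).
    replace (kap * v * v ^ s * x * v ^ (4 * L + 1)) with (kap * (v ^ (4 * L + 1) * v * v ^ s * x)) by ring.
    apply Rmult_le_compat_l; [lra|].
    assert (v ^ cz i * x <= v ^ (4 * L + 3 + s) * x) by (apply Rmult_le_compat_r; [lra | apply pow_le_anti; [lra|lia]]).
    replace (4 * L + 3 + s)%nat with (4 * L + 1 + 1 + s + 1)%nat in H2 by lia. rewrite !pow_add, !pow_1 in H2.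
    rewrite !pow_add in *. rewrite !pow_1 in *. apply Rmult_le_reg_l with v; lra.
  - apply Rmult_le_compat_r; [lra|]. apply Rmult_le_compat_r; auto. apply Rlt_le, Hp.
Qed.

Lemma ab_scaled (i : nat) : (k < i)%nat -> v < v ^ cz i * a i < / v /\ v < v ^ cz i * b i < / v /\ 0 < a i /\ 0 < b i.
Proof.
  intros Hi. destruct (ab_zeros i Hi) as [Ha [Hb _]]. destruct (ab_gt i Hi). pose proof (inv_v_gt1 v Hv).
  unfold inz in *. repeat split; lra.
Qed.

Lemma prod_scaled (J : nat) : v ^ cz_sum (k + J) * prodf (fun j => A j * B j) J =
  v ^ cz_sum k * prodf (fun j => tz (k + 1 + j)) J.
Proof.
  induction J as [|J IH]; [rewrite Nat.add_0_r; simpl; ring|].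
  simpl prodf. rewrite Nat.add_succ_r.
  change (cz_sum (S (k + J))) with (cz_sum (k + J) + 2 * cz (S (k + J)))%nat.
  replace (v ^ cz_sum k * (prodf (fun j => tz (k + 1 + j)) J * tz (k + 1 + J)))
    with (v ^ cz_sum k * prodf (fun j => tz (k + 1 + j)) J * tz (k + 1 + J)) by ring.
  rewrite <- IH. unfold A, B, tz. replace (k + 1 + J)%nat with (S (k + J)) by lia.
  rewrite pow_add. replace (2 * cz (S (k + J)))%nat with (cz (S (k + J)) + cz (S (k + J)))%nat by lia.
  rewrite pow_add. ring.
Qed.

Lemma Dl_pow (J : nat) (r : R) : Dl J r * (x1 * prodf (fun j => A j * B j) J) = r ^ S (2 * J).
Proof.
  unfold Dl. replace (r / x1 * prodf (fun j => r / A j * (r / B j)) J * (x1 * prodf (fun j => A j * B j) J))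
    with (r * (prodf (fun j => r / A j * (r / B j)) J * prodf (fun j => A j * B j) J)) by (field; lra).
  rewrite <- prodf_mult. change (r ^ S (2 * J)) with (r * r ^ (2 * J)). f_equal.
  rewrite pow_mult, <- prodf_const. apply prodf_ext. intros j _.
  destruct (ab_scaled (k + 1 + j) ltac:(lia)) as [_ [_ [? ?]]]. unfold A, B. field. split; lra.
Qed.

Let Al J := v * x1 * v ^ cz_sum k * prodf (fun j => tz (k + 1 + j)) J.

(** The term on the left accounts for all zeros that fit inside the circle, the product [Dl] only
    for [x1] and the zones beyond [k]. The [2 * k] missing zeros show up as [rad L ^ (2 * k)], and
    [Al] stays between positive bounds: this is the origin of the degree [2 * k]. *)
Lemma main_term (L : nat) : (k <= 2 * L)%nat ->
  v ^ tri (4 * L + 1) * rad L ^ (4 * L + 1) = rad L ^ (2 * k) * Dl (2 * L - k) (rad L) * Al (2 * L - k).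
Proof.
  intros HL. set (J := (2 * L - k)%nat). set (r := rad L).
  replace (r ^ (4 * L + 1)) with (r ^ (2 * k) * r ^ S (2 * J)) by (rewrite <- pow_add; f_equal; unfold J; lia).
  rewrite <- (Dl_pow J r), cz_sum_even. replace (2 * L)%nat with (k + J)%nat at 1 by (unfold J; lia).
  change (v ^ S (cz_sum (k + J))) with (v * v ^ cz_sum (k + J)).
  unfold Al.
  replace (v * x1 * v ^ cz_sum k * prodf (fun j => tz (k + 1 + j)) J)
    with (v * x1 * (v ^ cz_sum k * prodf (fun j => tz (k + 1 + j)) J)) by ring.
  rewrite <- prod_scaled. ring.
Qed.

(** From [i0] on the two zeros of a zone lie so close to its two ends that their scaled product
    differs from 1 by at most [v ^ i]. The infinite product of these numbers is therefore bounded
    and bounded away from 0. *)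
Lemma Al_bounds : exists lo hi, 0 < lo /\ forall J, (i0 - k - 1 <= J)%nat -> lo <= Al J <= hi.
Proof.
  set (j0 := (i0 - k - 1)%nat).
  assert (Htz : forall j, 0 < tz (k + 1 + j)).
  { intros j. destruct (ab_scaled (k + 1 + j) ltac:(lia)) as [? [? _]]. unfold tz. apply Rmult_lt_0_compat; lra. }
  set (P0 := v * x1 * v ^ cz_sum k * prodf (fun j => tz (k + 1 + j)) j0).
  assert (HP0 : 0 < P0).
  { unfold P0. apply Rmult_lt_0_compat; [|apply prodf_pos; auto].
    apply Rmult_lt_0_compat; [apply Rmult_lt_0_compat; lra | apply pow_lt; lra]. }
  set (e := exp (- (v / (1 - v) / (1 - v)))). set (E := exp (v / (1 - v))).
  assert (He : 0 < e) by apply exp_pos.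
  exists (P0 * e), (P0 * E). split; [apply Rmult_lt_0_compat; auto|].
  intros J HJ. replace J with (j0 + (J - j0))%nat by lia. unfold Al. rewrite prodf_split.
  set (P1 := prodf _ (J - j0)).
  replace (v * x1 * v ^ cz_sum k * (prodf (fun j => tz (k + 1 + j)) j0 * P1)) with (P0 * P1) by (unfold P0; ring).
  assert (Hb : forall j, 1 - v * v ^ j <= tz (k + 1 + (j0 + j)) <= 1 + v * v ^ j).
  { intros j. set (i := (k + 1 + (j0 + j))%nat).
    destruct (ab_ends i ltac:(unfold i, j0; lia)) as [Ea Eb].
    destruct (ab_scaled i ltac:(unfold i; lia)) as [[Ha _] [[Hb0 Hb] _]].
    assert (Hi : 0 < v ^ i <= v * v ^ j).
    { split; [apply pow_lt; lra|]. change (v * v ^ j) with (v ^ S j). apply pow_le_anti; [lra|unfold i; lia]. }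
    pose proof (inv_v_gt1 v Hv). pose proof (pow_lt_1_compat v i ltac:(lra) ltac:(unfold i; lia)).
    unfold tz. set (p := v ^ cz i * a i) in *. set (q := v ^ cz i * b i) in *. split.
    - apply Rle_trans with (v * (/ v * (1 - v ^ i))).
      + rewrite <- Rmult_assoc, Rinv_r by lra. lra.
      + apply Rmult_le_compat; try lra. apply Rmult_le_pos; lra.
    - apply Rle_trans with (v * (1 + v ^ i) * / v).
      + apply Rmult_le_compat; [lra | lra | exact Ea | lra].
      + replace (v * (1 + v ^ i) * / v) with (1 + v ^ i) by (field; lra). lra. }
  split; apply Rmult_le_compat_l; try lra.
  - eapply Rle_trans; [apply (prod_geom_lower v v (J - j0)); lra|]. apply prodf_le. intros j _. split; [|apply Hb].
    pose proof (pow_le_one v j ltac:(lra)). assert (0 <= v ^ j) by (apply pow_le; lra). nra.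
  - eapply Rle_trans; [|apply (prod_geom_upper v v (J - j0)); lra]. apply prodf_le. intros j _. split; [|apply Hb].
    apply Rlt_le, Htz.
Qed.

Lemma Pz_concrete (L m : nat) (z : C) : (k <= 2 * L)%nat -> (2 * L - k <= m)%nat -> Cmod z = rad L ->
  let e := exp (- (rho / (1 - v) / (1 - rho))) in let E := exp (rho / (1 - v)) in
  Dl (2 * L - k) (rad L) * ((1 - rho) * (e * e * (e * e))) <= Cmod (Pz xi (S (2 * m)) z) <=
  Dl (2 * L - k) (rad L) * (2 * (E * E * (E * E))).
Proof.
  intros HL Hm Hz. pose proof rho_range as [Hr [Hr1 Hr2]]. pose proof kap_range as Hk. pose proof (inv_v_gt1 v Hv).
  apply (Pz_bounds xi A B x1 v rho (rad L)); auto; try lra.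
  - apply rad_pos.
  - intros j. destruct (ab_scaled (k + 1 + j) ltac:(lia)) as [_ [_ [Ha Hb]]]. unfold A, B.
    split; auto. split; auto. unfold xi, X. rewrite merge_seq_a, merge_seq_b, !Rabs_inv, !Rabs_sg_mult; auto.
  - unfold xi, X. simpl. rewrite Rabs_inv, Rabs_pos_eq; lra.
  - apply Rle_trans with (/ v); [lra|]. apply Rle_trans with (rho * (kap / v ^ (4 * L + 1))); [|unfold rad; lra].
    apply Rle_trans with (/ kap * (kap / v)).
    + right. field. lra.
    + apply Rmult_le_compat; try lra.
      * apply Rlt_le, Rinv_0_lt_compat; lra.
      * apply Rlt_le, Rdiv_lt_0_compat; lra.
      * apply Rmult_le_compat_l; [lra|]. apply Rinv_le_contravar; [apply pow_lt; lra|].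
        rewrite <- (pow_1 v) at 2. apply pow_le_anti; [lra|lia].
  - intros j Hj. destruct (ab_zeros (k + 1 + j) ltac:(lia)) as [Za [Zb _]]. unfold A, B.
    replace (2 * L - k - 1 - j)%nat with (2 * L - (k + 1 + j))%nat by lia.
    split; apply inside_ratio; auto; lia.
  - intros s. unfold A, B. replace (k + 1 + (2 * L - k + s))%nat with (2 * L + 1 + s)%nat by lia.
    destruct (ab_zeros (2 * L + 1 + s) ltac:(lia)) as [Za [Zb _]].
    split; apply outside_ratio; auto.
Qed.

Lemma rad_unbounded (l0 : nat) (M : R) : exists l, M <= rad (l0 + l).
Proof.
  destruct (pow_small v (/ (Rabs M + 1))) as [N HN]; [lra | apply Rinv_0_lt_compat; pose proof (Rabs_pos M); lra |].
  exists N. specialize (HN (4 * (l0 + N) + 1)%nat ltac:(lia)).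
  assert (Hp : 0 < v ^ (4 * (l0 + N) + 1)) by (apply pow_lt; lra). pose proof kap_range. pose proof (Rabs_pos M).
  unfold rad. apply Rle_trans with (1 / v ^ (4 * (l0 + N) + 1)).
  - apply Rle_trans with (Rabs M + 1); [pose proof (Rle_abs M); lra|].
    rewrite <- (Rinv_inv (Rabs M + 1)). unfold Rdiv. rewrite Rmult_1_l.
    apply Rinv_le_contravar; lra.
  - apply Rmult_le_compat_r; [apply Rlt_le, Rinv_0_lt_compat|]; lra.
Qed.

Let h := Hlim xi.
Let q := Qlim xi (theta_coeff (- v)).

Lemma theta_at_xi (n : nat) : CSum (cs (theta_coeff (- v))) (RtoC (/ xi n)) = RtoC 0.
Proof. unfold xi. rewrite Rinv_inv, CSum_theta, X_zero. reflexivity. Qed.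

(** On the circles theta is at most a constant times the reference term, and the partial products
    are at least a constant times [Dl]; by [main_term] the quotient is of order at most
    [rad L ^ (2 * k)], as [Qlim_vanish] requires. *)
Lemma q_vanish (n : nat) : (2 * k < n)%nat -> q n = 0.
Proof.
  destruct xi_summable as [Hs1 Hs2]. destruct Al_bounds as [lo [hi [Hlo HAl]]].
  pose proof rho_range as [Hr [Hr1 Hr2]]. pose proof kap_range as Hk.
  destruct (theta_circle_upper v kap Hv ltac:(lra)) as [C0 [HC0 Hup]].
  set (e := exp (- (rho / (1 - v) / (1 - rho)))). assert (He : 0 < e) by apply exp_pos.
  set (c1 := (1 - rho) * (e * e * (e * e))).
  assert (Hc1 : 0 < c1) by (repeat apply Rmult_lt_0_compat; lra).
  apply (Qlim_vanish xi (theta_coeff (- v)) xi_nz' xi_inj' Hs1 (theta_rentire v Hv) theta_at_xi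
    (fun l => rad (i0 + l)) (2 * k) (C0 * hi / c1)).
  - intros l. apply rad_pos.
  - apply rad_unbounded.
  - intros l. exists (2 * (i0 + l) - k)%nat. intros m z Hm Hz.
    set (L := (i0 + l)%nat) in *.
    destruct (Pz_concrete L m z ltac:(unfold L; lia) Hm Hz) as [HP _]. fold e in HP. fold c1 in HP.
    specialize (Hup (4 * L + 1)%nat z Hz). fold (rad L) in Hup.
    rewrite main_term in Hup by (unfold L; lia).
    assert (HD : 0 < Dl (2 * L - k) (rad L)).
    { unfold Dl. pose proof (rad_pos L). apply Rmult_lt_0_compat; [apply Rdiv_lt_0_compat; lra|].
      apply prodf_pos. intros j _. destruct (ab_scaled (k + 1 + j) ltac:(lia)) as [_ [_ [Ha Hb]]].
      apply Rmult_lt_0_compat; apply Rdiv_lt_0_compat; auto. }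
    set (D := Dl (2 * L - k) (rad L)) in *.
    assert (HDc : 0 < D * c1) by (apply Rmult_lt_0_compat; auto).
    split; [intros E; rewrite E, Cmod_0 in HP; lra|].
    destruct (HAl (2 * L - k)%nat ltac:(unfold L; lia)) as [A1 A2].
    set (al := Al (2 * L - k)) in *. set (rk := rad L ^ (2 * k)) in *.
    assert (Hrk : 0 < rk) by (apply pow_lt, rad_pos).
    eapply Rle_trans; [exact Hup|].
    apply Rle_trans with (C0 * hi / c1 * rk * (D * c1)).
    + replace (C0 * hi / c1 * rk * (D * c1)) with (C0 * (rk * D * hi)) by (field; lra).
      apply Rmult_le_compat_l; [lra|]. apply Rmult_le_compat_l; auto. apply Rlt_le, Rmult_lt_0_compat; auto.
    + apply Rmult_le_compat_l; auto. apply Rmult_le_pos; [|lra]. apply Rmult_le_pos; [|apply Rlt_le, Rinv_0_lt_compat; auto].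
      apply Rmult_le_pos; lra.
Qed.

Lemma theta_hq (z : C) : CSum (cs (theta_coeff (- v))) z = (poly_eval q (2 * k) z * CSum (cs h) z)%C.
Proof.
  destruct xi_summable as [Hs1 Hs2].
  rewrite <- (proj2 (CSum_conv h (2 * k) q z (Hlim_entire xi _ Hs1 Hs2) q_vanish)).
  apply CSum_ext. intros n. unfold cs. f_equal. apply (conv_lim xi _ _ Hs1 Hs2).
Qed.

Lemma h_circle_upper (L : nat) (z : C) : (k <= 2 * L)%nat -> Cmod z = rad L ->
  let E := exp (rho / (1 - v)) in
  Cmod (CSum (cs h) z) <= Dl (2 * L - k) (rad L) * (2 * (E * E * (E * E))).
Proof.
  intros HL Hz E. destruct xi_summable as [Hs1 Hs2].
  destruct (Hlim_clim xi _ Hs1 Hs2 z) as [C1 C2].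
  apply (clim_Cmod_le (fun m => Pz xi (S (2 * m)) z) _ _ (2 * L - k)).
  - split; [apply (is_lim_seq_comp (fun m => Re (Pz xi m z)) (fun m => S (2 * m))) |
            apply (is_lim_seq_comp (fun m => Im (Pz xi m z)) (fun m => S (2 * m)))];
      try assumption; intros N; exists N; intros; lia.
  - intros m Hm. apply (Pz_concrete L m z HL Hm Hz).
Qed.

(** At the point of the circle on the imaginary axis theta is at least its term of index [4 L],
    while [h] is at most a constant times [Dl], so the polynomial is there at least a constant times
    [rad L ^ (2 * k)]. With vanishing top coefficient it would be of lower order, or identically 0
    when [k = 0]. *)
Lemma q_top : q (2 * k)%nat <> 0.
Proof.
  intros H0. destruct Al_bounds as [lo [hi [Hlo HAl]]]. pose proof kap_range as Hk.
  set (E := exp (rho / (1 - v))). assert (HE : 0 < E) by apply exp_pos.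
  set (C2 := 2 * (E * E * (E * E))). assert (HC2 : 0 < C2) by (repeat apply Rmult_lt_0_compat; lra).
  assert (Hlow : forall l, let L := (i0 + l)%nat in
    lo / (kap * C2) * rad L ^ (2 * k) <= Cmod (poly_eval q (2 * k) (Ci * RtoC (rad L))%C)).
  { intros l L. pose proof (rad_pos L) as Hr. set (z := (Ci * RtoC (rad L))%C).
    assert (Hz : Cmod z = rad L) by (unfold z; rewrite Cmod_mult, Cmod_Ci, Cmod_R, Rabs_pos_eq; lra).
    pose proof (theta_imag_lower v (rad L) L Hv Hr) as T. fold z in T.
    rewrite theta_hq, Cmod_mult in T.
    pose proof (h_circle_upper L z ltac:(unfold L; lia) Hz) as HU. fold E in HU. fold C2 in HU.
    pose proof (main_term L ltac:(unfold L; lia)) as M.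
    (* The lower bound for theta uses the even index [4 L], the comparison with [Dl] the index
       [4 L + 1]; on this circle the two terms differ exactly by the factor [kap]. *)
    assert (EM : v ^ tri (4 * L + 1) * rad L ^ (4 * L + 1) = kap * (v ^ tri (4 * L) * rad L ^ (4 * L))).
    { replace (4 * L + 1)%nat with (S (4 * L)) by lia. rewrite tri_S, pow_add.
      replace (rad L ^ S (4 * L)) with (rad L * rad L ^ (4 * L)) by reflexivity.
      assert (F : v ^ S (4 * L) * rad L = kap).
      { unfold rad. replace (4 * L + 1)%nat with (S (4 * L)) by lia. field. apply pow_nonzero; lra. }
      rewrite <- F. ring. }
    destruct (HAl (2 * L - k)%nat ltac:(unfold L; lia)) as [A1 _].
    assert (HD : 0 < Dl (2 * L - k) (rad L)).
    { unfold Dl. apply Rmult_lt_0_compat; [apply Rdiv_lt_0_compat; lra|].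
      apply prodf_pos. intros j _. destruct (ab_scaled (k + 1 + j) ltac:(lia)) as [_ [_ [Ha Hb]]].
      apply Rmult_lt_0_compat; apply Rdiv_lt_0_compat; auto. }
    set (D := Dl (2 * L - k) (rad L)) in *. set (al := Al (2 * L - k)) in *.
    set (rk := rad L ^ (2 * k)) in *. assert (Hrk : 0 < rk) by (apply pow_lt; auto).
    set (m := Cmod (poly_eval q (2 * k) z)) in *. assert (Hm : 0 <= m) by apply Cmod_ge_0.
    assert (F1 : rk * D * lo <= kap * (m * (D * C2))).
    { apply Rle_trans with (rk * D * al).
      - apply Rmult_le_compat_l; [apply Rlt_le, Rmult_lt_0_compat|]; auto.
      - rewrite <- M, EM. apply Rmult_le_compat_l; [lra|].
        eapply Rle_trans; [exact T|]. apply Rmult_le_compat_l; auto. }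
    apply Rmult_le_reg_r with (kap * C2 * D); [apply Rmult_lt_0_compat; auto; apply Rmult_lt_0_compat; lra|].
    replace (lo / (kap * C2) * rk * (kap * C2 * D)) with (rk * D * lo) by (field; lra). lra. }
  set (c := lo / (kap * C2)) in *.
  assert (Hc : 0 < c) by (apply Rdiv_lt_0_compat; auto; apply Rmult_lt_0_compat; lra).
  destruct (Nat.eq_dec k 0) as [K0|K0].
  - specialize (Hlow O). cbv zeta in Hlow. rewrite K0 in Hlow, H0. simpl in Hlow, H0.
    rewrite H0, Cmod_0 in Hlow. lra.
  - destruct (poly_eval_bound (2 * k - 1) q) as [M HM].
    destruct (rad_unbounded i0 (Rmax 1 (M / c + 1))) as [l Hl].
    assert (Hl1 : 1 <= rad (i0 + l)) by (eapply Rle_trans; [apply Rmax_l | apply Hl]).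
    assert (Hl2 : M / c + 1 <= rad (i0 + l)) by (eapply Rle_trans; [apply Rmax_r | apply Hl]).
    specialize (Hlow l). cbv zeta in Hlow. set (r := rad (i0 + l)) in *.
    assert (Hz : Cmod (Ci * RtoC r)%C = r) by (rewrite Cmod_mult, Cmod_Ci, Cmod_R, Rabs_pos_eq; lra).
    specialize (HM (Ci * RtoC r)%C ltac:(rewrite Hz; auto)). rewrite Hz in HM.
    replace (2 * k)%nat with (S (2 * k - 1)) in Hlow, H0 by lia. rewrite poly_eval_trunc in Hlow by auto.
    assert (Hp : 0 < r ^ (2 * k - 1)) by (apply pow_lt; lra).
    assert (c * r <= M).
    { apply Rmult_le_reg_r with (r ^ (2 * k - 1)); auto. simpl in Hlow. simpl in HM. simpl. lra. }
    assert (c * (M / c + 1) <= c * r) by (apply Rmult_le_compat_l; lra).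
    replace (c * (M / c + 1)) with (M + c) in H1 by (field; lra). lra.
Qed.

Lemma occupied_factorization : exists h q : nat -> R, rentire h /\
  (forall z, CSum (cs (theta_coeff (- v))) z = (poly_eval q (2 * k) z * CSum (cs h) z)%C) /\ q (2 * k)%nat <> 0 /\
  (forall n, CSum (cs h) (RtoC (X n)) = RtoC 0) /\
  (forall z, (forall n, z <> RtoC (X n)) -> CSum (cs h) z <> RtoC 0).
Proof.
  destruct xi_summable as [Hs1 Hs2]. exists h, q. repeat split.
  - apply (Hlim_entire xi _ Hs1 Hs2).
  - apply theta_hq.
  - apply q_top.
  - intros n. rewrite <- (Rinv_inv (X n)). apply (Hlim_zero xi _ xi_nz' Hs1 Hs2).
  - intros z Hz. apply (Hlim_nz xi _ xi_nz' Hs1 Hs2). intros n. unfold xi. rewrite Rinv_inv. apply Hz.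
Qed.

Lemma X_zone (i n : nat) (x : R) : (1 <= i)%nat -> inz v i x -> X n = sg i * x -> (k < i)%nat /\ (x = a i \/ x = b i).
Proof.
  intros Hi Hz E. destruct (X_cases n) as [E1 | [i' [Hi' [E1 | E1]]]]; rewrite E1 in E.
  - exfalso. apply (x1_not_zone i x Hi Hz E).
  - destruct (ab_zeros i' Hi') as [Za _].
    destruct (signed_inj i' i (a i') x ltac:(lia) Hi Za Hz E) as [-> ->]. auto.
  - destruct (ab_zeros i' Hi') as [_ [Zb _]].
    destruct (signed_inj i' i (b i') x ltac:(lia) Hi Zb Hz E) as [-> ->]. auto.
Qed.

End Occupied.

(** theta is a polynomial of degree [2 k] times the canonical product over [x_1] and two zeros in
    each zone beyond [k]. *)
Lemma zero_count (v : R) (k : nat) : 0 < v < 1 -> (forall i, (k < i)%nat -> zone_occ v i) ->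
  exists (X h q : nat -> R), rentire h /\
  (forall z, CSum (cs (theta_coeff (- v))) z = (poly_eval q (2 * k) z * CSum (cs h) z)%C) /\ q (2 * k)%nat <> 0 /\
  (forall n, CSum (cs h) (RtoC (X n)) = RtoC 0) /\
  (forall z, (forall n, z <> RtoC (X n)) -> CSum (cs h) z <> RtoC 0) /\
  (exists n, 1 < X n < / v /\ th v (X n) = 0) /\
  (forall i, (k < i)%nat -> exists a b n m, inz v i a /\ inz v i b /\ a < b /\ w v i a = 0 /\ w v i b = 0 /\
    X n = sg i * a /\ X m = sg i * b /\
    forall j x, inz v i x -> X j = sg i * x -> x = a \/ x = b).
Proof.
  intros Hv Hocc. destruct (first_zero v Hv) as [x1 [Hx1 [Hx1z _]]].
  destruct (zone_zeros v k Hv Hocc) as [a [b [i0 [Hi0 [Hab Hends]]]]].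
  destruct (occupied_factorization v k x1 a b i0 Hv Hx1 Hx1z Hi0 Hab Hends) as [h [q [F1 [F2 [F3 [F4 F5]]]]]].
  exists (merge_seq k x1 a b), h, q. do 5 (split; auto). split.
  - exists O. auto.
  - intros i Hi. destruct (Hab i Hi) as [Za [Zb [Hlt [Wa Wb]]]].
    exists (a i), (b i), (S (2 * (i - k - 1))), (S (S (2 * (i - k - 1)))).
    rewrite merge_seq_a, merge_seq_b. replace (k + 1 + (i - k - 1))%nat with i by lia. do 7 (split; auto).
    intros j x Hz E. apply (X_zone v k x1 a b i0) with j; auto. lia.
Qed.

(** * Complex derivatives and orders of zeros *)

(** A quadratic error term is more than differentiability demands, but it is preserved by sums and
    products through elementary estimates, and power series satisfy it directly. *)
Definition cder (f : C -> C) (z l : C) : Prop := exists K d, 0 <= K /\ 0 < d <= 1 /\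
  forall h, Cmod h < d -> Cmod (f (z + h) - f z - h * l)%C <= K * Cmod h ^ 2.

Lemma cder_C_derive (f : C -> C) (z l : C) : cder f z l -> C_derive f z = l.
Proof.
  intros [K [d [HK [Hd H]]]]. apply is_C_derive_unique. split; [apply is_linear_scal_l|].
  intros x Hx eps.
  (* The definition of the differential quantifies over all limits of the filter [locally z]; there
     is only [z] itself. *)
  assert (E : x = z) by (symmetry; exact (@is_filter_lim_locally_unique C_AbsRing (AbsRing_NormedModule C_AbsRing) z x Hx)). subst x.
  assert (He : 0 < Rmin d (eps / (K + 1))).
  { apply Rmin_pos; [lra|]. apply Rdiv_lt_0_compat; [apply cond_pos | lra]. }
  assert (Main : forall y : C, Cmod (y - z)%C < Rmin d (eps / (K + 1)) ->
    Cmod (f y - f z - (y - z) * l)%C <= eps * Cmod (y - z)%C); [|exists (mkposreal _ He); exact Main].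
  intros y Hy.
  set (h := (y - z)%C) in *. assert (Hh1 : Cmod h < d) by (eapply Rlt_le_trans; [apply Hy | apply Rmin_l]).
  assert (Hh2 : Cmod h < eps / (K + 1)) by (eapply Rlt_le_trans; [apply Hy | apply Rmin_r]).
  specialize (H h Hh1). replace (z + h)%C with y in H by (unfold h; ring).
  eapply Rle_trans; [exact H|]. pose proof (Cmod_ge_0 h).
  replace (K * Cmod h ^ 2) with (K * Cmod h * Cmod h) by ring. apply Rmult_le_compat_r; auto.
  apply Rle_trans with ((K + 1) * (eps / (K + 1))).
  - apply Rmult_le_compat; lra.
  - right. field. lra.
Qed.

Lemma cder_ext (f g : C -> C) (z l : C) : (forall y, f y = g y) -> cder f z l -> cder g z l.
Proof. intros E [K [d [HK [Hd H]]]]. exists K, d. repeat split; auto; try lra. intros h Hh. rewrite <- !E. auto. Qed.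

Lemma cder_const (c z : C) : cder (fun _ => c) z (RtoC 0).
Proof.
  exists 0, 1. repeat split; try lra. intros h _. replace (c - c - h * 0)%C with (RtoC 0) by ring. rewrite Cmod_0. lra.
Qed.

Lemma cder_sub_const (c z : C) : cder (fun y => y - c)%C z (RtoC 1).
Proof.
  exists 0, 1. repeat split; try lra. intros h _. replace (z + h - c - (z - c) - h * 1)%C with (RtoC 0) by ring.
  rewrite Cmod_0. lra.
Qed.

Lemma cder_plus (f g : C -> C) (z l m : C) : cder f z l -> cder g z m -> cder (fun y => f y + g y)%C z (l + m)%C.
Proof.
  intros [K [d [HK [Hd H]]]] [K' [d' [HK' [Hd' H']]]]. exists (K + K'), (Rmin d d').
  repeat split; [lra | apply Rmin_pos; lra | eapply Rle_trans; [apply Rmin_l | lra] |].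
  intros h Hh. assert (Cmod h < d) by (eapply Rlt_le_trans; [apply Hh | apply Rmin_l]).
  assert (Cmod h < d') by (eapply Rlt_le_trans; [apply Hh | apply Rmin_r]).
  replace (f (z + h) + g (z + h) - (f z + g z) - h * (l + m))%C
    with ((f (z + h) - f z - h * l) + (g (z + h) - g z - h * m))%C by ring.
  eapply Rle_trans; [apply Cmod_triangle|]. specialize (H h H0). specialize (H' h H1). lra.
Qed.

Lemma cder_mult (f g : C -> C) (z l m : C) : cder f z l -> cder g z m ->
  cder (fun y => f y * g y)%C z (l * g z + f z * m)%C.
Proof.
  intros [K [d [HK [Hd H]]]] [K' [d' [HK' [Hd' H']]]].
  pose proof (Cmod_ge_0 (f z)). pose proof (Cmod_ge_0 (g z)). pose proof (Cmod_ge_0 l). pose proof (Cmod_ge_0 m).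
  exists (K * (Cmod (g z) + Cmod m + K') + ((Cmod (f z) + Cmod l) * K' + Cmod l * Cmod m)), (Rmin d d').
  repeat split; [| apply Rmin_pos; lra | eapply Rle_trans; [apply Rmin_l | lra] |].
  { repeat apply Rplus_le_le_0_compat; apply Rmult_le_pos; lra. }
  intros h Hh. assert (Hh1 : Cmod h < d) by (eapply Rlt_le_trans; [apply Hh | apply Rmin_l]).
  assert (Hh2 : Cmod h < d') by (eapply Rlt_le_trans; [apply Hh | apply Rmin_r]).
  specialize (H h Hh1). specialize (H' h Hh2). pose proof (Cmod_ge_0 h) as Hp.
  set (rf := (f (z + h) - f z - h * l)%C) in *. set (rg := (g (z + h) - g z - h * m)%C) in *.
  replace (f (z + h)%C * g (z + h)%C - f z * g z - h * (l * g z + f z * m))%C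
    with (rf * (g z + h * m + rg) + ((f z + h * l) * rg + h * h * (l * m)))%C by (unfold rf, rg; ring).
  set (t := Cmod h) in *. assert (Ht2 : 0 <= t ^ 2 <= 1) by (split; [apply pow_le; auto|]; simpl; rewrite Rmult_1_r; rewrite <- (Rmult_1_r 1); apply Rmult_le_compat; lra).
  assert (B1 : Cmod (g z + h * m + rg)%C <= Cmod (g z) + Cmod m + K').
  { eapply Rle_trans; [apply Cmod_triangle|]. apply Rplus_le_compat.
    - eapply Rle_trans; [apply Cmod_triangle|]. apply Rplus_le_compat_l. rewrite Cmod_mult. fold t.
      rewrite <- (Rmult_1_l (Cmod m)) at 2. apply Rmult_le_compat_r; lra.
    - eapply Rle_trans; [exact H'|]. rewrite <- (Rmult_1_r K') at 2. apply Rmult_le_compat_l; lra. }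
  assert (B2 : Cmod (f z + h * l)%C <= Cmod (f z) + Cmod l).
  { eapply Rle_trans; [apply Cmod_triangle|]. apply Rplus_le_compat_l. rewrite Cmod_mult. fold t.
    rewrite <- (Rmult_1_l (Cmod l)) at 2. apply Rmult_le_compat_r; lra. }
  eapply Rle_trans; [apply Cmod_triangle|]. rewrite !Rmult_plus_distr_r. rewrite <- !Rmult_plus_distr_r, Rmult_plus_distr_r. apply Rplus_le_compat.
  - rewrite Cmod_mult.
    replace (K * (Cmod (g z) + Cmod m + K') * t ^ 2) with (K * t ^ 2 * (Cmod (g z) + Cmod m + K')) by ring.
    apply Rmult_le_compat; auto; apply Cmod_ge_0.
  - eapply Rle_trans; [apply Cmod_triangle|]. rewrite Rmult_plus_distr_r. apply Rplus_le_compat; rewrite !Cmod_mult.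
    + replace ((Cmod (f z) + Cmod l) * K' * t ^ 2) with ((Cmod (f z) + Cmod l) * (K' * t ^ 2)) by ring.
      apply Rmult_le_compat; auto; apply Cmod_ge_0.
    + fold t. right. ring.
Qed.

(** The derivatives are provided as functions on the whole plane, since iterating [C_derive] at one
    point requires the derivative at the points around it. *)
Fixpoint smooth (n : nat) (f : C -> C) : Prop :=
  match n with O => True | S n => exists f', (forall z, cder f z (f' z)) /\ smooth n f' end.

Lemma smooth_S (n : nat) (f : C -> C) : smooth (S n) f -> smooth n f.
Proof. revert f. induction n as [|n IH]; intros f; [simpl; auto|]. intros [f' [H1 H2]]. exists f'. split; auto. Qed.

Lemma smooth_plus (n : nat) (f g : C -> C) : smooth n f -> smooth n g -> smooth n (fun y => f y + g y)%C.
Proof.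
  revert f g. induction n as [|n IH]; intros f g; [simpl; auto|].
  intros [f' [H1 H2]] [g' [H3 H4]]. exists (fun y => f' y + g' y)%C. split; [intros; apply cder_plus; auto | apply IH; auto].
Qed.

Lemma smooth_mult (n : nat) (f g : C -> C) : smooth n f -> smooth n g -> smooth n (fun y => f y * g y)%C.
Proof.
  revert f g. induction n as [|n IH]; intros f g; [simpl; auto|].
  intros Hf Hg. pose proof (smooth_S _ _ Hf). pose proof (smooth_S _ _ Hg).
  destruct Hf as [f' [H1 H2]]. destruct Hg as [g' [H3 H4]].
  exists (fun y => f' y * g y + f y * g' y)%C. split; [intros; apply cder_mult; auto |].
  apply smooth_plus; apply IH; auto.
Qed.

Lemma smooth_const (n : nat) (c : C) : smooth n (fun _ => c).
Proof. revert c. induction n as [|n IH]; intros c; [simpl; auto|]. exists (fun _ => RtoC 0). split; [intros; apply cder_const | apply IH]. Qed.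

Lemma smooth_sub_const (n : nat) (c : C) : smooth n (fun y => y - c)%C.
Proof. destruct n as [|n]; [simpl; auto|]. exists (fun _ => RtoC 1). split; [intros; apply cder_sub_const | apply smooth_const]. Qed.

Lemma cder_pow (m : nat) (z0 z : C) :
  cder (fun y => (y - z0) ^ S m)%C z (RtoC (INR (S m)) * (z - z0) ^ m)%C.
Proof.
  induction m as [|m IHm].
  - apply (cder_ext (fun y => y - z0)%C); [intros; simpl; ring|].
    replace (RtoC (INR 1) * (z - z0) ^ 0)%C with (RtoC 1) by (simpl; ring). apply cder_sub_const.
  - replace (RtoC (INR (S (S m))) * (z - z0) ^ S m)%C
      with (1 * (z - z0) ^ S m + (z - z0) * (RtoC (INR (S m)) * (z - z0) ^ m))%C.
    2:{ rewrite (S_INR (S m)), RtoC_plus. simpl Cpow. ring. }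
    apply (cder_mult (fun y => y - z0)%C (fun y => (y - z0) ^ S m)%C); [apply cder_sub_const | auto].
Qed.

(** By induction on [m]: the derivative of [(z - z0) ^ S m * G] is [(z - z0) ^ m] times a function
    whose value at [z0] is [INR (S m) * G z0], again nonzero. *)
Lemma order_of_factor (m : nat) (z0 : C) (F G : C -> C) : smooth m G -> G z0 <> RtoC 0 ->
  (forall z, F z = (z - z0) ^ m * G z)%C -> C_zero_of_order F z0 m.
Proof.
  revert F G. induction m as [|m IH]; intros F G HG H0 E.
  - split; [intros; lia|]. simpl. rewrite E. simpl. rewrite Cmult_1_l. auto.
  - pose proof (smooth_S _ _ HG) as HG0. destruct HG as [G' [HG1 HG2]].
    assert (ED : forall z, C_derive F z = ((z - z0) ^ m * (RtoC (INR (S m)) * G z + (z - z0) * G' z))%C).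
    { intros z. apply cder_C_derive. apply (cder_ext (fun y => (y - z0) ^ S m * G y)%C); [intros; symmetry; apply E|].
      replace ((z - z0) ^ m * (RtoC (INR (S m)) * G z + (z - z0) * G' z))%C
        with (RtoC (INR (S m)) * (z - z0) ^ m * G z + (z - z0) ^ S m * G' z)%C by (simpl Cpow; ring).
      apply cder_mult; auto. apply cder_pow. }
    destruct (IH (C_derive F) (fun z => RtoC (INR (S m)) * G z + (z - z0) * G' z)%C) as [I1 I2]; auto.
    + apply smooth_plus; apply smooth_mult; auto; [apply smooth_const | apply smooth_sub_const].
    + replace (RtoC (INR (S m)) * G z0 + (z0 - z0) * G' z0)%C with (RtoC (INR (S m)) * G z0)%C by ring.
      apply Cmult_neq_0; auto. intros K. apply RtoC_inj in K. apply (not_0_INR (S m)); auto.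
    + split.
      * intros [|i] Hi; [simpl; rewrite E; simpl; ring|]. rewrite Nat.iter_succ_r. apply I1. lia.
      * rewrite Nat.iter_succ_r. exact I2.
Qed.

Lemma pow_remainder (n : nat) (z h : C) (r : R) : 1 <= r -> Cmod z <= r -> Cmod (z + h)%C <= r ->
  Cmod ((z + h) ^ n - z ^ n - h * (RtoC (INR n) * z ^ pred n))%C <= Cmod h ^ 2 * (4 * r) ^ n.
Proof.
  intros Hr Hz Hzh. pose proof (Cmod_ge_0 h). induction n as [|n IH].
  - simpl. replace (1 - 1 - h * (0 * 1))%C with (RtoC 0) by ring. rewrite Cmod_0. nra.
  - set (e := ((z + h) ^ n - z ^ n - h * (RtoC (INR n) * z ^ pred n))%C) in *.
    assert (E : ((z + h) ^ S n - z ^ S n - h * (RtoC (INR (S n)) * z ^ pred (S n)))%C =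
      ((z + h) * e + h * h * (RtoC (INR n) * z ^ pred n))%C).
    { unfold e. rewrite S_INR, RtoC_plus. destruct n as [|n]; simpl pred; simpl Cpow; [simpl INR; ring|]. ring. }
    rewrite E. eapply Rle_trans; [apply Cmod_triangle|]. rewrite !Cmod_mult, Cmod_R, Cmod_pow.
    assert (Hp : 0 < (4 * r) ^ n) by (apply pow_lt; lra).
    assert (Hn : INR n <= 4 ^ n).
    { clear. induction n as [|n IH]; [simpl; lra|]. rewrite S_INR. simpl. assert (1 <= 4 ^ n) by (apply pow_R1_Rle; lra). lra. }
    assert (H1 : Cmod (z + h)%C * Cmod e <= r * (Cmod h ^ 2 * (4 * r) ^ n)) by (apply Rmult_le_compat; auto; apply Cmod_ge_0).
    assert (H2 : Rabs (INR n) * Cmod z ^ pred n <= (4 * r) ^ n).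
    { rewrite Rabs_pos_eq by apply pos_INR. rewrite Rpow_mult_distr. apply Rmult_le_compat; auto.
      - apply pos_INR.
      - apply pow_le, Cmod_ge_0.
      - apply Rle_trans with (r ^ pred n); [apply pow_incr; split; auto; apply Cmod_ge_0|].
        apply Rle_pow; auto. lia. }
    assert (H3 : Cmod h * Cmod h * (Rabs (INR n) * Cmod z ^ pred n) <= Cmod h ^ 2 * (4 * r) ^ n).
    { replace (Cmod h * Cmod h) with (Cmod h ^ 2) by ring. apply Rmult_le_compat_l; auto. apply pow_le; auto. }
    assert (H4 : 0 <= Cmod h ^ 2 * (4 * r) ^ n) by (apply Rmult_le_pos; [apply pow_le; auto | lra]).
    change ((4 * r) ^ S n) with (4 * r * (4 * r) ^ n).
    replace (Cmod h ^ 2 * (4 * r * (4 * r) ^ n)) with (4 * r * (Cmod h ^ 2 * (4 * r) ^ n)) by ring.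
    nra.
Qed.

Definition cderiv_coeff (a : nat -> C) (n : nat) : C := (RtoC (INR (S n)) * a (S n))%C.

Lemma centire_deriv (a : nat -> C) : centire a -> centire (cderiv_coeff a).
Proof.
  intros Ha r Hr. destruct (Ha (2 * r) ltac:(lra)) as [M HM]. exists (M / r). intros n.
  unfold cderiv_coeff. rewrite Cmod_mult, Cmod_R, Rabs_pos_eq by apply pos_INR.
  apply Rmult_le_reg_r with r; auto. replace (M / r * r) with M by (field; lra).
  eapply Rle_trans; [|apply (HM (S n))]. rewrite Rpow_mult_distr.
  replace (INR (S n) * Cmod (a (S n)) * r ^ n * r) with (INR (S n) * (Cmod (a (S n)) * r ^ S n)) by (simpl; ring).
  replace (Cmod (a (S n)) * (2 ^ S n * r ^ S n)) with (2 ^ S n * (Cmod (a (S n)) * r ^ S n)) by ring.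
  apply Rmult_le_compat_r; [apply Rmult_le_pos; [apply Cmod_ge_0 | apply pow_le; lra]|].
  generalize (S n). clear. induction n as [|n IH]; [simpl; lra|]. rewrite S_INR. simpl.
  assert (1 <= 2 ^ n) by (apply pow_R1_Rle; lra). lra.
Qed.

(** As in the real case, the second-order remainders of the powers are summed; their bound
    [(4 * r) ^ n] is harmless for coefficients of an entire series. *)
Lemma cder_CSum (a : nat -> C) (z : C) : centire a -> cder (CSum a) z (CSum (cderiv_coeff a) z).
Proof.
  intros Ha. set (r := Cmod z + 1). pose proof (Cmod_ge_0 z) as Hz.
  destruct (centire_majorant a (4 * r) Ha ltac:(unfold r; lra)) as [M HM].
  assert (HM0 : 0 <= M).
  { specialize (HM O). simpl in HM. pose proof (Cmod_ge_0 (a O)). lra. }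
  exists (2 * M), 1. repeat split; try lra. intros h Hh.
  set (g := fun n => (a n * ((z + h) ^ n - z ^ n - h * (RtoC (INR n) * z ^ pred n)))%C).
  assert (Hb : forall N, Cmod (csumf g N) <= 2 * M * Cmod h ^ 2).
  { intros N. eapply Rle_trans; [apply csumf_Cmod|].
    apply Rle_trans with (sumf (fun n => M * Cmod h ^ 2 * (/ 2) ^ n) N).
    - apply sumf_le. intros n _. unfold g. rewrite Cmod_mult.
      assert (P := pow_remainder n z h r ltac:(unfold r; lra) ltac:(unfold r; lra)
        ltac:(eapply Rle_trans; [apply Cmod_triangle | unfold r; lra])).
      apply Rle_trans with (Cmod (a n) * (Cmod h ^ 2 * (4 * r) ^ n)); [apply Rmult_le_compat_l; auto; apply Cmod_ge_0|].
      specialize (HM n). assert (0 <= Cmod h ^ 2) by (apply pow_le, Cmod_ge_0).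
      replace (Cmod (a n) * (Cmod h ^ 2 * (4 * r) ^ n)) with (Cmod h ^ 2 * (Cmod (a n) * (4 * r) ^ n)) by ring.
      replace (M * Cmod h ^ 2 * (/ 2) ^ n) with (Cmod h ^ 2 * (M * (/ 2) ^ n)) by ring.
      apply Rmult_le_compat_l; auto.
    - rewrite sumf_scal. assert (S := sumf_geom (/ 2) N ltac:(lra)).
      replace (2 * M * Cmod h ^ 2) with (M * Cmod h ^ 2 * / (1 - / 2)) by field.
      apply Rmult_le_compat_l; auto. apply Rmult_le_pos; auto. apply pow_le, Cmod_ge_0. }
  assert (L : clim (fun N => csumf (fun n => a n * (z + h) ^ n) (S N) - csumf (fun n => a n * z ^ n) (S N)
     - h * csumf (fun n => cderiv_coeff a n * z ^ n) N)%C (CSum a (z + h) - CSum a z - h * CSum (cderiv_coeff a) z)%C).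
  { assert (Lm : forall u u' l l', clim u l -> clim u' l' -> clim (fun n => u n - u' n)%C (l - l')%C).
    { intros u u' l l' Hu Hu'. replace (l - l')%C with (l + RtoC (Ropp 1) * l')%C by (rewrite RtoC_opp; ring).
      eapply clim_ext; [|apply clim_plus; [exact Hu | apply clim_mult; [apply (clim_const (RtoC (Ropp 1))) | exact Hu']]].
      intros n. cbv beta. rewrite RtoC_opp. ring. }
    apply Lm; [apply Lm|].
    - apply clim_S, CSum_clim; auto.
    - apply clim_S, CSum_clim; auto.
    - apply clim_mult; [apply clim_const | apply CSum_clim, centire_deriv; auto]. }
  refine (clim_Cmod_le _ _ _ O L _). intros N _. specialize (Hb (S N)).
  replace (csumf (fun n => a n * (z + h) ^ n) (S N) - csumf (fun n => a n * z ^ n) (S N)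
     - h * csumf (fun n => cderiv_coeff a n * z ^ n) N)%C with (csumf g (S N)); auto.
  clear. induction N as [|N IH].
  - unfold g. simpl. ring.
  - change (csumf g (S (S N))) with (csumf g (S N) + g (S N))%C. rewrite IH. unfold g.
    change (csumf (fun n => a n * (z + h) ^ n)%C (S (S N))) with (csumf (fun n => a n * (z + h) ^ n) (S N) + a (S N) * (z + h) ^ S N)%C.
    change (csumf (fun n => a n * z ^ n)%C (S (S N))) with (csumf (fun n => a n * z ^ n) (S N) + a (S N) * z ^ S N)%C.
    change (csumf (fun n => cderiv_coeff a n * z ^ n)%C (S N))
      with (csumf (fun n => cderiv_coeff a n * z ^ n) N + RtoC (INR (S N)) * a (S N) * z ^ N)%C.
    simpl pred. ring.
Qed.

Lemma smooth_CSum (n : nat) (a : nat -> C) : centire a -> smooth n (CSum a).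
Proof.
  revert a. induction n as [|n IH]; intros a Ha; [simpl; auto|].
  exists (CSum (cderiv_coeff a)). split; [intros; apply cder_CSum; auto | apply IH, centire_deriv; auto].
Qed.

(** * Factorization of real polynomials *)

Lemma csumf_front (f : nat -> C) (n : nat) : csumf f (S n) = (f O + csumf (fun i => f (S i)) n)%C.
Proof.
  induction n as [|n IH]; [simpl; ring|].
  change (csumf f (S (S n))) with (csumf f (S n) + f (S n))%C. rewrite IH. simpl. ring.
Qed.

Lemma poly_eval_csumf (d : nat) (q : nat -> R) (z : C) : poly_eval q d z = csumf (fun i => RtoC (q i) * z ^ i)%C (S d).
Proof.
  revert q. induction d as [|d IH]; intros q; [simpl; ring|].
  rewrite csumf_front. simpl poly_eval. rewrite IH. rewrite <- csumf_scal.
  assert (E : csumf (fun i => z * (RtoC (q (S i)) * z ^ i))%C (S d) = csumf (fun i => RtoC (q (S i)) * z ^ S i)%C (S d)).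
  { apply csumf_ext. intros i _. simpl. ring. }
  rewrite E. simpl Cpow at 2. ring.
Qed.

Module ClosedField.
From mathcomp Require Import all_boot all_algebra complex Rstruct.
Import GRing.Theory.
Local Open Scope ring_scope.

(** The fundamental theorem of algebra, transported from the closed field [R[i]] along the map
    [phi], which respects sums, products and powers. The surrounding module keeps the other
    library's notations and scopes local. *)
Lemma monic_root (n : nat) (P : nat -> C) : lt 0 n ->
  exists z : C, Cpow z n = csumf (fun i => Cmult (P i) (Cpow z i)) n.
Proof.
pose phi (c : R[i]) : C := (complex.Re c, complex.Im c).
have phiM (x y : R[i]) : phi (x * y) = Cmult (phi x) (phi y).
  case: x y => [a b] [c d]. reflexivity.
have phiX (x : R[i]) m : phi (x ^+ m) = Cpow (phi x) m.
  by elim: m => [|m IHm]; rewrite ?expr0 ?exprS ?phiM ?IHm.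
have phiS (p : nat -> R[i]) (x : R[i]) m :
    phi (\sum_(i < m) p i * x ^+ i) = csumf (fun i => Cmult (phi (p i)) (Cpow (phi x) i)) m.
  elim: m => [|m IHm]; first by rewrite big_ord0.
  rewrite big_ord_recr /= -IHm -phiX -phiM.
  by case: (\sum_(i < m) _) => a b; case: (p m * _).
move=> /ltP n0.
pose P' i : R[i] := let: (a, b) := P i in Complex a b.
have [x xn] := @GRing.solve_monicpoly R[i] n P' n0.
exists (phi x); rewrite -phiX xn (phiS P'); apply: csumf_ext => i _.
by rewrite /P'; case: (P i).
Qed.
End ClosedField.

Lemma real_poly_root (d : nat) (q : nat -> R) : (1 <= d)%nat -> q d <> 0 -> exists z, poly_eval q d z = RtoC 0.
Proof.
  intros Hd Hq. destruct (ClosedField.monic_root d (fun i => RtoC (- (q i / q d))) Hd) as [z Hz].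
  exists z. rewrite poly_eval_csumf. simpl csumf. rewrite Hz.
  rewrite <- csumf_scal, <- csumf_plus.
  rewrite (csumf_ext _ (fun _ => RtoC 0)); [rewrite csumf_const; ring|].
  intros i _.
  replace (RtoC (q i) * z ^ i + RtoC (q d) * (RtoC (- (q i / q d)) * z ^ i))%C
    with ((RtoC (q i) + RtoC (q d) * RtoC (- (q i / q d))) * z ^ i)%C by ring.
  rewrite <- RtoC_mult, <- RtoC_plus. replace (q i + q d * - (q i / q d)) with 0 by (field; auto). ring.
Qed.

(** Division by a real quadratic rather than by a linear factor keeps the quotient real when a
    conjugate pair of roots is removed. The Horner form of [poly_eval] makes it a recursion on the
    leading part. *)
Lemma quadratic_division (s t : R) (d : nat) (q : nat -> R) : exists (p : nat -> R) (r0 r1 : R),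
  p d = q (S (S d)) /\
  forall z, poly_eval q (S (S d)) z = ((z * z - RtoC s * z + RtoC t) * poly_eval p d z + RtoC r0 + RtoC r1 * z)%C.
Proof.
  revert q. induction d as [|d IH]; intros q.
  - exists (fun _ => q 2%nat), (q 0%nat - q 2%nat * t), (q 1%nat + q 2%nat * s). split; auto.
    intros z. simpl. rewrite RtoC_minus, RtoC_plus, !RtoC_mult. ring.
  - destruct (IH (fun n => q (S n))) as [p [r0 [r1 [Hp H]]]].
    exists (fun n => match n with O => r1 | S n => p n end), (q 0%nat - r1 * t), (r0 + r1 * s). split; auto.
    intros z. change (poly_eval q (S (S (S d))) z) with (RtoC (q O) + z * poly_eval (fun n => q (S n)) (S (S d)) z)%C.
    change (poly_eval _ (S d) z) with (RtoC r1 + z * poly_eval p d z)%C. rewrite H, RtoC_minus, RtoC_plus, !RtoC_mult. ring.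
Qed.

Lemma poly_eval_conj (d : nat) (q : nat -> R) (z : C) : poly_eval q d (Cconj z) = Cconj (poly_eval q d z).
Proof.
  revert q. assert (Hr : forall x : R, Cconj (RtoC x) = RtoC x) by (intros; apply C_ext; simpl; ring).
  induction d as [|d IH]; intros q; simpl; [rewrite Hr; auto|].
  rewrite IH, Cplus_conj, Cmult_conj, Hr. reflexivity.
Qed.

Fixpoint root_prod (l : list C) (z : C) : C :=
  match l with nil => RtoC 1 | w :: l => ((z - w) * root_prod l z)%C end.

Lemma root_prod_app (l l' : list C) (z : C) : root_prod (l ++ l') z = (root_prod l z * root_prod l' z)%C.
Proof. induction l as [|w l IH]; simpl; [ring|]. rewrite IH. ring. Qed.

(** A root is not real, so it or its conjugate lies in the upper half-plane. The remainder of the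
    division by the quadratic of the pair is real of degree at most 1 and vanishes at a non-real
    point, hence is 0. The quotient has no real roots either, and the induction continues. *)
Lemma conjugate_factorization (k : nat) (q : nat -> R) : q (2 * k)%nat <> 0 ->
  (forall y : R, poly_eval q (2 * k) (RtoC y) <> RtoC 0) ->
  exists zs, length zs = k /\ List.Forall (fun z : C => 0 < Im z) zs /\
    forall z, poly_eval q (2 * k) z = (RtoC (q (2 * k)%nat) * root_prod (zs ++ map Cconj zs) z)%C.
Proof.
  revert q. induction k as [|k IH]; intros q Hq Hy.
  - exists nil. repeat split; auto. intros z. simpl. ring.
  - replace (2 * S k)%nat with (S (S (2 * k))) in * by lia.
    assert (Hw : exists w, poly_eval q (S (S (2 * k))) w = RtoC 0 /\ 0 < Im w).
    { destruct (real_poly_root (S (S (2 * k))) q ltac:(lia) Hq) as [w Hw].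
      destruct (Rtotal_order (Im w) 0) as [H|[H|H]].
      - exists (Cconj w). rewrite poly_eval_conj, Hw, im_conj. split; [apply C_ext; simpl; ring | lra].
      - exfalso. apply (Hy (Re w)). replace (RtoC (Re w)) with w; auto. apply C_ext; auto.
      - exists w. auto. }
    destruct Hw as [w [Hw Hi]].
    destruct (quadratic_division (2 * Re w) (Re w ^ 2 + Im w ^ 2) (2 * k) q) as [p [r0 [r1 [Hp H]]]].
    assert (EQ : forall z, (z * z - RtoC (2 * Re w) * z + RtoC (Re w ^ 2 + Im w ^ 2))%C = ((z - w) * (z - Cconj w))%C).
    { intros z. destruct w as [x y]. unfold Cconj. simpl Re. simpl Im. apply C_ext; simpl; ring. }
    assert (Hr : RtoC r0 = RtoC 0 /\ RtoC r1 = RtoC 0).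
    { rewrite H, EQ in Hw. replace (w - w)%C with (RtoC 0) in Hw by ring.
      replace (0 * (w - Cconj w) * poly_eval p (2 * k) w + r0 + r1 * w)%C with (RtoC r0 + RtoC r1 * w)%C in Hw by ring.
      assert (H1 : Im (RtoC r0 + RtoC r1 * w)%C = 0) by (rewrite Hw; reflexivity).
      assert (H2 : Re (RtoC r0 + RtoC r1 * w)%C = 0) by (rewrite Hw; reflexivity).
      destruct w as [x y]. simpl in H1, H2, Hi.
      assert (r1 * y = 0) by lra. destruct (Rmult_integral _ _ H0); [|lra]. subst r1.
      split; f_equal; lra. }
    destruct Hr as [R0 R1].
    assert (HF : forall z, poly_eval q (S (S (2 * k))) z = ((z - w) * (z - Cconj w) * poly_eval p (2 * k) z)%C).
    { intros z. rewrite H, EQ, R0, R1. ring. }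
    destruct (IH p) as [zs [L [Fz Ez]]].
    + rewrite Hp. auto.
    + intros y E. apply (Hy y). rewrite HF, E. ring.
    + exists (w :: zs). split; [simpl; auto|]. split; [constructor; auto|].
      intros z. rewrite HF, Ez, Hp. rewrite !root_prod_app. simpl. ring.
Qed.

Lemma root_prod_count (l : list C) (z0 : C) : exists l', (forall w, List.In w l' -> w <> z0) /\
  forall z, root_prod l z = ((z - z0) ^ count_occ Ceq_dec l z0 * root_prod l' z)%C.
Proof.
  induction l as [|w l [l' [H1 H2]]].
  - exists nil. split; [intros w []|]. intros z. simpl. ring.
  - simpl count_occ. destruct (Ceq_dec w z0) as [->|Hne].
    + exists l'. split; auto. intros z. simpl. rewrite H2. ring.
    + exists (w :: l'). split; [intros u [<-|Hu]; auto|]. intros z. simpl. rewrite H2. ring.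
Qed.

Lemma root_prod_nz (l : list C) (z : C) : (forall w, List.In w l -> w <> z) -> root_prod l z <> RtoC 0.
Proof.
  induction l as [|w l IH]; intros H; simpl.
  - intros E. apply RtoC_inj in E. lra.
  - apply Cmult_neq_0; [|apply IH; intros u Hu; apply H; right; auto].
    intros E. apply (H w); [left; auto|]. replace w with (z - (z - w))%C by ring. rewrite E. ring.
Qed.

Lemma smooth_root_prod (n : nat) (l : list C) : smooth n (root_prod l).
Proof.
  induction l as [|w l IH]; [exact (smooth_const n (RtoC 1))|].
  apply (smooth_mult n (fun z => z - w)%C (root_prod l)); [apply smooth_sub_const | auto].
Qed.

Lemma pairs_of_factorization (F : C -> C) (k : nat) (h q : nat -> R) : rentire h ->
  q (2 * k)%nat <> 0 -> (forall y : R, poly_eval q (2 * k) (RtoC y) <> RtoC 0) ->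
  (forall z : C, Im z <> 0 -> CSum (cs h) z <> RtoC 0) ->
  (forall z, F z = poly_eval q (2 * k) z * CSum (cs h) z)%C ->
  has_conjugate_zero_pairs F k.
Proof.
  intros Hh Hq Hy Hnz HF.
  destruct (conjugate_factorization k q Hq Hy) as [zs [L [Fz Ez]]].
  exists zs. split; auto. split; auto. intros z0 Hz0.
  destruct (root_prod_count (zs ++ map Cconj zs) z0) as [l' [H1 H2]].
  apply (order_of_factor _ z0 F (fun z => RtoC (q (2 * k)%nat) * root_prod l' z * CSum (cs h) z)%C).
  - apply smooth_mult; [apply smooth_mult; [apply smooth_const | apply smooth_root_prod] | apply smooth_CSum, rentire_cs; auto].
  - apply Cmult_neq_0; [apply Cmult_neq_0|]; auto.
    + intros E. apply RtoC_inj in E. auto.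
    + apply root_prod_nz; auto.
  - intros z. rewrite HF, Ez, H2. ring.
Qed.

(** * Spectral values and zones *)

Lemma sign_right (k : nat) (v x e : R) : 0 < v < 1 -> w v k x = 0 -> 0 < Ux (wk k) v x -> 0 < e ->
  exists t, x < t < x + e /\ 0 < w v k t.
Proof.
  intros Hv W0 HU He. destruct (Ux_pos_near (wk k) v x (geom_bounded_wk k) Hv HU) as [d [Hd H]].
  set (s := Rmin d e / 2). assert (Hs : 0 < Rmin d e) by (apply Rmin_pos; auto).
  pose proof (Rmin_l d e). pose proof (Rmin_r d e).
  exists (x + s). split; [unfold s; lra|]. rewrite w_U in *. rewrite <- W0.
  apply incr_of_Ux; [apply geom_bounded_wk | auto | unfold s; lra |].
  intros t Ht. apply H; [rewrite Rminus_diag, Rabs_R0; lra | apply Rabs_def1; unfold s in *; lra].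
Qed.

Lemma sign_left (k : nat) (v x e : R) : 0 < v < 1 -> w v k x = 0 -> Ux (wk k) v x < 0 -> 0 < e ->
  exists t, x - e < t < x /\ 0 < w v k t.
Proof.
  intros Hv W0 HU He. destruct (Ux_neg_near (wk k) v x (geom_bounded_wk k) Hv HU) as [d [Hd H]].
  set (s := Rmin d e / 2). assert (Hs : 0 < Rmin d e) by (apply Rmin_pos; auto).
  pose proof (Rmin_l d e). pose proof (Rmin_r d e).
  exists (x - s). split; [unfold s; lra|]. rewrite w_U in *. rewrite <- W0.
  apply decr_of_Ux; [apply geom_bounded_wk | auto | unfold s; lra |].
  intros t Ht. apply H; [rewrite Rminus_diag, Rabs_R0; lra | apply Rabs_def1; unfold s in *; lra].
Qed.

Lemma occ_of_simple (v : R) (k : nat) (x : R) : 0 < v < 1 -> inz v k x -> w v k x = 0 -> Ux (wk k) v x <> 0 ->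
  zone_occ v k.
Proof.
  intros Hv Hz W0 HU. apply inz_LR in Hz; [|lra].
  destruct (Rtotal_order (Ux (wk k) v x) 0) as [H|[H|H]]; [| contradiction |].
  - destruct (sign_left k v x (x - Lz v k) Hv W0 H ltac:(lra)) as [t [Ht Wt]].
    exists t. split; auto. apply inz_LR; lra.
  - destruct (sign_right k v x (Rz v k - x) Hv W0 H ltac:(lra)) as [t [Ht Wt]].
    exists t. split; auto. apply inz_LR; lra.
Qed.

Lemma occ_chain (v : R) (k : nat) : 0 < v < 1 -> (1 <= k)%nat -> zone_occ v k ->
  forall i, (k <= i)%nat -> zone_occ v i.
Proof.
  intros Hv Hk H i Hi. replace i with (k + (i - k))%nat by lia. generalize (i - k)%nat. clear i Hi.
  intros n. induction n as [|n [x [Hz Hw]]]; [rewrite Nat.add_0_r; auto|].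
  rewrite Nat.add_succ_r. apply (chain v (k + n) x); auto; [lia | lra].
Qed.

Lemma th_zero_w (v : R) (k : nat) (x : R) : th v (sg k * x) = 0 <-> w v k x = 0.
Proof. unfold w. destruct (sg_cases k) as [-> | ->]; split; lra. Qed.

Lemma w_neg_ends (v : R) (k : nat) (x : R) : 0 < v < 1 -> (1 <= k)%nat -> Lz v k <= x <= Rz v k ->
  0 <= w v k x -> Lz v k < x < Rz v k.
Proof.
  intros Hv Hk Hx Hw. pose proof (w_neg_Lz v k Hv Hk). pose proof (w_neg_Rz v k Hv Hk).
  split.
  - destruct (proj1 Hx) as [|E]; auto. rewrite <- E in Hw. lra.
  - destruct (proj2 Hx) as [|E]; auto. rewrite E in Hw. lra.
Qed.

Lemma pattern_of_two_zeros (v : R) (k : nat) (f g : R) : 0 < v < 1 -> (1 <= k)%nat ->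
  inz v k f -> f < g -> inz v k g -> w v k f = 0 -> w v k g = 0 -> Ux (wk k) v f <> 0 ->
  (forall x, inz v k x -> w v k x = 0 -> x = f \/ x = g) -> pattern k v f g.
Proof.
  intros Hv Hk Hf Hfg Hg Wf Wg Uf Hz. apply inz_LR in Hf; [|lra]. apply inz_LR in Hg; [|lra].
  assert (Hz' : forall x, Lz v k < x < Rz v k -> w v k x = 0 -> x = f \/ x = g).
  { intros x Hx. apply Hz, inz_LR; auto; lra. }
  pose proof (w_neg_Lz v k Hv Hk) as NL. pose proof (w_neg_Rz v k Hv Hk) as NR.
  assert (Left : forall x, Lz v k <= x -> x < f -> w v k x < 0).
  { intros x Hx Hxf. apply Rnot_le_lt. intros H0.
    assert (HI := w_neg_ends v k x Hv Hk ltac:(lra) H0).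
    destruct (IVT_cor (w v k) (Lz v k) x) as [t [Ht Wt]]; [apply w_cont; auto | lra | nra |].
    assert (t <> Lz v k) by (intros ->; lra).
    destruct (Hz' t ltac:(lra) Wt); lra. }
  assert (Right : forall x, x <= Rz v k -> g < x -> w v k x < 0).
  { intros x Hx Hxf. apply Rnot_le_lt. intros H0.
    assert (HI := w_neg_ends v k x Hv Hk ltac:(lra) H0).
    destruct (IVT_cor (w v k) x (Rz v k)) as [t [Ht Wt]]; [apply w_cont; auto | lra | nra |].
    assert (t <> Rz v k) by (intros ->; lra).
    destruct (Hz' t ltac:(lra) Wt); lra. }
  assert (Up : 0 < Ux (wk k) v f).
  { destruct (Rtotal_order (Ux (wk k) v f) 0) as [H|[H|H]]; [| contradiction | auto].
    destruct (sign_left k v f (f - Lz v k) Hv Wf H ltac:(lra)) as [t [Ht Wt]].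
    specialize (Left t ltac:(lra) ltac:(lra)). lra. }
  intros x Hx. split; [apply Left; lra|]. split; [|apply Right; lra].
  intros Hm. apply Rnot_le_lt. intros H0.
  destruct (sign_right k v f (x - f) Hv Wf Up ltac:(lra)) as [t [Ht Wt]].
  destruct (IVT_cor (w v k) t x) as [s [Hs Ws]]; [apply w_cont; auto | lra | nra |].
  destruct (Hz' s ltac:(lra) Ws); lra.
Qed.

(** With [k = 0] in [zero_count] the polynomial factor is a nonzero constant, so the zeros of theta
    are those of the product, two in each zone. The given zeros [f] and [g] must be these two, and
    between and beside them the sign is determined by the ends and the slope at [f]. *)
Lemma pattern_start (v : R) (k : nat) (f g : R) : 0 < v < 1 -> (1 <= k)%nat ->
  (forall i, (1 <= i)%nat -> zone_occ v i) ->
  inz v k f -> f < g -> inz v k g -> w v k f = 0 -> w v k g = 0 -> Ux (wk k) v f <> 0 -> pattern k v f g.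
Proof.
  intros Hv Hk Hocc Hf Hfg Hg Wf Wg Uf. apply pattern_of_two_zeros; auto.
  destruct (zero_count v 0 Hv Hocc) as [X [h [q [_ [HF [Hq [_ [Hnz [_ HZ]]]]]]]]].
  destruct (HZ k ltac:(lia)) as [a [b [_ [_ [_ [_ [_ [_ [_ [_ [_ Hab]]]]]]]]]]].
  assert (G : forall x, inz v k x -> w v k x = 0 -> x = a \/ x = b).
  { intros x Hz Wx. apply NNPP. intros Hne.
    apply (Hnz (RtoC (sg k * x))).
    - intros n E. apply RtoC_inj in E. apply Hne, (Hab n); auto.
    - assert (E : CSum (cs (theta_coeff (- v))) (RtoC (sg k * x)) = RtoC 0).
      { rewrite CSum_theta. f_equal. apply th_zero_w; auto. }
      rewrite HF in E. simpl in E. destruct (Ceq_dec (CSum (cs h) (RtoC (sg k * x))) (RtoC 0)) as [|Hn]; auto.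
      exfalso. apply (Cmult_neq_0 (RtoC (q 0%nat)) _) in Hn; auto. intros E0. apply RtoC_inj in E0. auto. }
  intros x Hz Wx. destruct (G x Hz Wx); destruct (G f Hf Wf); destruct (G g Hg Wg); subst; auto; lra.
Qed.

Lemma zone_order (v : R) (j k : nat) (x y : R) : 0 < v < 1 -> (cz k + 2 <= cz j)%nat ->
  inz v k y -> inz v j x -> 0 < x -> y < x.
Proof.
  intros Hv Hc [_ Hy] [Hx _] Hx0.
  assert (Hp : 0 < v ^ cz k) by (apply pow_lt; lra).
  apply Rmult_lt_reg_l with (v ^ cz k); auto. eapply Rlt_le_trans; [exact Hy|].
  assert (H : v < v ^ (cz k + 2) * x).
  { eapply Rlt_le_trans; [exact Hx|]. apply Rmult_le_compat_r; [lra|]. apply pow_le_anti; [lra|auto]. }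
  rewrite pow_add in H. apply Rmult_le_reg_l with (v ^ 2); [apply pow_lt; lra|].
  replace (v ^ 2 * / v) with v by (field; lra). lra.
Qed.

Lemma smooth_ext (n : nat) (f g : C -> C) : (forall z, f z = g z) -> smooth n f -> smooth n g.
Proof.
  destruct n as [|n]; [simpl; auto|]. intros E [f' [H1 H2]]. exists f'. split; auto.
  intros z. apply (cder_ext f); auto.
Qed.

Lemma smooth_poly_eval (n d : nat) (q : nat -> R) : smooth n (poly_eval q d).
Proof.
  revert q. induction d as [|d IH]; intros q; [apply (smooth_const n (RtoC (q O)))|].
  apply (smooth_ext n (fun z => RtoC (q O) + (z - 0) * poly_eval (fun n => q (S n)) d z)%C).
  - intros z. simpl. ring.
  - apply smooth_plus; [apply smooth_const|]. apply smooth_mult; [apply smooth_sub_const | auto].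
Qed.

(** The product rule gives derivative 0 at a common zero. The quadratic error bound of [cder],
    restricted to real increments, transfers this to the real derivative. *)
Lemma common_zero_multiple (v y : R) (d : nat) (h q : nat -> R) : 0 < v < 1 -> rentire h ->
  (forall z, CSum (cs (theta_coeff (- v))) z = (poly_eval q d z * CSum (cs h) z)%C) ->
  poly_eval q d (RtoC y) = RtoC 0 -> CSum (cs h) (RtoC y) = RtoC 0 -> Ux one_w v y = 0.
Proof.
  intros Hv Hh HF H1 H2.
  destruct (smooth_poly_eval 1 d q) as [f' [Hf _]]. destruct (smooth_CSum 1 (cs h) (rentire_cs h Hh)) as [g' [Hg _]].
  pose proof (cder_mult _ _ _ _ _ (Hf (RtoC y)) (Hg (RtoC y))) as [K [e [HK [He Hd]]]].
  rewrite H1, H2 in Hd.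
  assert (Hth : forall t, Rabs t < e -> Rabs (th v (y + t) - th v y) <= K * Rabs t ^ 2).
  { intros t Ht. specialize (Hd (RtoC t)). rewrite !Cmod_R in Hd. specialize (Hd Ht).
    rewrite <- RtoC_plus, <- HF, CSum_theta in Hd.
    assert (E : th v y = 0) by (apply RtoC_inj; rewrite <- CSum_theta, HF, H1; ring).
    rewrite E. rewrite <- Cmod_R, RtoC_minus.
    replace (RtoC (th v (y + t)) - RtoC 0)%C with (RtoC (th v (y + t)) - 0 * 0 - RtoC t * (f' (RtoC y) * 0 + 0 * g' (RtoC y)))%C by ring.
    exact Hd. }
  assert (D : derivable_pt_lim (th v) y 0).
  { intros eps Heps. assert (Hm : 0 < Rmin e (eps / (K + 1))) by (apply Rmin_pos; [lra | apply Rdiv_lt_0_compat; lra]).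
    exists (mkposreal _ Hm). intros t Ht0 Ht. simpl in Ht.
    assert (T1 : Rabs t < e) by (eapply Rlt_le_trans; [apply Ht | apply Rmin_l]).
    assert (T2 : Rabs t < eps / (K + 1)) by (eapply Rlt_le_trans; [apply Ht | apply Rmin_r]).
    specialize (Hth t T1). pose proof (Rabs_pos_lt t Ht0).
    rewrite Rminus_0_r. unfold Rdiv at 1. rewrite Rabs_mult, Rabs_inv.
    apply Rle_lt_trans with (K * Rabs t).
    - apply Rmult_le_reg_r with (Rabs t); auto. rewrite Rmult_assoc, Rinv_l, Rmult_1_r by lra. nra.
    - apply Rle_lt_trans with ((K + 1) * Rabs t); [nra|].
      replace eps with ((K + 1) * (eps / (K + 1))) by (field; lra). apply Rmult_lt_compat_l; lra. }
  apply is_derive_Reals in D. rewrite <- (is_derive_unique _ _ _ D).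
  symmetry. apply is_derive_unique, is_derive_th; auto.
Qed.

Section Spectrum.

Variables qbar ybar : nat -> R.
Hypothesis Hspec : spectral_data qbar ybar.

Let vb k := - qbar k.
Let Y k := sg k * ybar k.

(** For [k = 2 l] the indices [cz k - 1] and [cz k + 1] are [4 l - 1] and [4 l + 1]; for
    [k = 2 l + 1] they are [4 (l + 1) - 2] and [4 (l + 1)], so the hypothesis is used at [S l]. *)
Lemma spectral_zone (k : nat) : (1 <= k)%nat ->
  0 < vb k < 1 /\ exists F G, zone_branches k (vb k) F G /\ merging k (vb k) F G (Y k).
Proof.
  intros Hk. apply coalesce_zone; auto.
  destruct (even_cases k) as [[l [E1 [E2 _]]]|[l [E1 [E2 _]]]]; rewrite E2, E1.
  - destruct (Hspec l ltac:(lia)) as [_ H].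
    replace (2 * (2 * l) - 1)%nat with (4 * l - 1)%nat by lia.
    replace (2 * (2 * l) + 1)%nat with (4 * l + 1)%nat by lia. exact H.
  - destruct (Hspec (S l) ltac:(lia)) as [H _].
    replace (2 * (2 * l + 1) + 1 - 1)%nat with (4 * S l - 2)%nat by lia.
    replace (2 * (2 * l + 1) + 1 + 1)%nat with (4 * S l)%nat by lia.
    replace (2 * l + 1)%nat with (2 * S l - 1)%nat by lia. exact H.
Qed.

Lemma vb_range (k : nat) : (1 <= k)%nat -> 0 < vb k < 1.
Proof. intros Hk. apply (spectral_zone k Hk). Qed.

(** Before the merging zone [k] contains a simple zero; theta changes sign there, so [w] is positive
    somewhere in the zone, and [chain] passes this on to all later zones. *)
Lemma occ_below (v : R) (k i : nat) : (1 <= k)%nat -> 0 < v < vb k -> (k <= i)%nat -> zone_occ v i.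
Proof.
  intros Hk Hv Hi. destruct (spectral_zone k Hk) as [Hvb [F [G [HB _]]]].
  apply (occ_chain v k); auto; [lra|].
  destruct (HB v Hv) as [_ [_ [ZF [_ [_ [WF [_ [UF _]]]]]]]].
  apply (occ_of_simple v k (F v)); auto. lra.
Qed.

(** Below [vb 1] every zone is occupied, so [pattern_start] applies; from there the pattern is
    carried forward until the two branches merge. *)
Lemma spectral_pattern (k : nat) : (1 <= k)%nat -> exists F G v0,
  zone_branches k (vb k) F G /\ merging k (vb k) F G (Y k) /\ 0 < v0 < vb k /\ pattern k v0 (F v0) (G v0) /\
  forall v, 0 < v < vb k -> pattern k v (F v) (G v).
Proof.
  intros Hk. destruct (spectral_zone k Hk) as [Hvb [F [G [HB HM]]]].
  assert (HP : forall v, 0 < v < vb k -> v < vb 1 -> pattern k v (F v) (G v)).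
  { intros v Hv Hv1. destruct (HB v Hv) as [_ [_ [ZF [ZG [FG [WF [WG [UF _]]]]]]]].
    apply pattern_start; auto; [lra|]. intros i Hi. apply (occ_below v 1); auto. lra. }
  pose proof (vb_range 1 ltac:(lia)).
  (* The minimum is taken because the order of [vb 1] and [vb k] is established only afterwards,
     with the help of this very lemma. *)
  exists F, G, (Rmin (vb 1) (vb k) / 2).
  assert (Hm : 0 < Rmin (vb 1) (vb k)) by (apply Rmin_pos; lra).
  pose proof (Rmin_l (vb 1) (vb k)). pose proof (Rmin_r (vb 1) (vb k)).
  set (m := Rmin (vb 1) (vb k)) in *.
  split; auto. split; auto. split; [lra|]. split; [apply HP; lra|].
  intros v Hv. destruct (Rlt_le_dec v (m / 2)) as [Hlt|Hge]; [apply HP; lra|].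
  apply (pattern_propagates k (vb k) F G (m / 2) v); auto; try lra. apply HP; lra.
Qed.

Lemma zone_empty_after (k : nat) (v : R) : (1 <= k)%nat -> vb k < v < 1 -> zone_neg k v.
Proof.
  intros Hk Hv. destruct (spectral_pattern k Hk) as [F [G [v0 [HB [HM [Hv0 [HP _]]]]]]].
  apply (zone_neg_after k (vb k) F G v0 (Y k) v); auto. apply vb_range; auto.
Qed.

Lemma zone_unique_zero (k : nat) (x : R) : (1 <= k)%nat -> Lz (vb k) k <= x <= Rz (vb k) k -> x <> Y k ->
  w (vb k) k x < 0.
Proof.
  intros Hk Hx Hne. destruct (spectral_pattern k Hk) as [F [G [v0 [HB [HM [Hv0 [HP _]]]]]]].
  apply (merging_unique k (vb k) F G v0 (Y k)); auto. apply vb_range; auto.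
Qed.

Lemma Y_zone (k : nat) : (1 <= k)%nat -> inz (vb k) k (Y k) /\ w (vb k) k (Y k) = 0.
Proof. intros Hk. destruct (spectral_zone k Hk) as [_ [F [G [_ [H1 [H2 _]]]]]]. auto. Qed.

(** At the parameter [vb k] zone [k] still has the zero [Y k], so by [chain] zone [S k] contains a
    point where [w] is strictly positive. If [vb (S k)] were smaller, that zone would be negative
    throughout, and if it were equal, [w] would have maximum 0 there. *)
Lemma vb_lt_S (k : nat) : (1 <= k)%nat -> vb k < vb (S k).
Proof.
  intros Hk. destruct (Y_zone k Hk) as [Z W]. pose proof (vb_range k Hk) as Hv.
  destruct (chain (vb k) k (Y k) Hv Hk Z ltac:(lra)) as [x [Zx Wx]].
  apply Rnot_le_lt. intros Hle. pose proof (proj1 (inz_LR _ _ _ (proj1 Hv)) Zx) as Hx.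
  destruct Hle as [Hlt | E].
  - pose proof (zone_empty_after (S k) (vb k) ltac:(lia) ltac:(lra) x ltac:(lra)). lra.
  - rewrite <- E in *. destruct (Req_dec x (Y (S k))) as [->|Hne].
    + destruct (Y_zone (S k) ltac:(lia)) as [_ W']. lra.
    + pose proof (zone_unique_zero (S k) x ltac:(lia) ltac:(lra) Hne). lra.
Qed.

Lemma vb_mono (j k : nat) : (1 <= j)%nat -> (j < k)%nat -> vb j < vb k.
Proof.
  intros Hj H. replace k with (S j + (k - S j))%nat by lia. generalize (k - S j)%nat. clear k H.
  intros n. induction n as [|n IH]; [rewrite Nat.add_0_r; apply vb_lt_S; auto|].
  rewrite Nat.add_succ_r. eapply Rlt_trans; [apply IH | apply vb_lt_S; lia].
Qed.

Lemma zone_empty (k : nat) (v x : R) : (1 <= k)%nat -> vb k < v < 1 -> inz v k x -> w v k x <> 0.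
Proof.
  intros Hk Hv Hz. pose proof (vb_range k Hk). apply inz_LR in Hz; [|lra].
  pose proof (zone_empty_after k v Hk Hv x ltac:(lra)). lra.
Qed.

Lemma spectral_zero (k : nat) (x : R) : (1 <= k)%nat -> theta (qbar k) x = 0 ->
  1 < x < / vb k \/ x = ybar k \/
  exists j X, (k < j)%nat /\ x = sg j * X /\ inz (vb k) j X.
Proof.
  intros Hk H. pose proof (vb_range k Hk) as Hv. replace (qbar k) with (- vb k) in H by (unfold vb; ring).
  rewrite theta_U in H.
  destruct (zero_location (vb k) x Hv H) as [|[j [X [Hj [Ex Zx]]]]]; auto. right.
  assert (W : w (vb k) j X = 0) by (apply th_zero_w; rewrite <- Ex; auto).
  destruct (lt_eq_lt_dec j k) as [[L|E]|L].
  - exfalso. apply (zone_empty j (vb k) X Hj); auto. split; [apply vb_mono; auto | lra].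
  - subst j. left. apply inz_LR in Zx; [|lra]. destruct (Req_dec X (Y k)) as [E|Hne].
    + rewrite Ex, E. unfold Y. rewrite <- Rmult_assoc, sg_sq. ring.
    + pose proof (zone_unique_zero k X Hk ltac:(lra) Hne). lra.
  - right. exists j, X. auto.
Qed.

Lemma Y_local_max (k : nat) : (1 <= k)%nat -> exists h, 0 < h /\ forall x, Rabs (x - ybar k) < h ->
  sg k * theta (qbar k) x <= 0.
Proof.
  intros Hk. destruct (spectral_pattern k Hk) as [F [G [v0 [HB [HM [Hv0 [HP _]]]]]]].
  destruct (merging_max k (vb k) F G v0 (Y k) Hk (vb_range k Hk) HB Hv0 HP HM) as [_ [h [Hh H]]].
  exists h. split; auto. intros x Hx. replace (qbar k) with (- vb k) by (unfold vb; ring). rewrite <- w_sg.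
  destruct (Req_dec (sg k * x) (Y k)) as [->|Hne].
  - right. apply Y_zone; auto.
  - left. apply H; auto. unfold Y. rewrite <- Rmult_minus_distr_l, Rabs_mult.
    destruct (sg_cases k) as [-> | ->]; rewrite ?Rabs_Ropp, ?Rabs_m1, ?Rabs_R1; lra.
Qed.

Lemma theta_ybar (k : nat) : (1 <= k)%nat -> theta (qbar k) (ybar k) = 0.
Proof.
  intros Hk. destruct (Y_zone k Hk) as [_ W]. unfold Y in W. rewrite w_sg in W.
  replace (- vb k) with (qbar k) in W by (unfold vb; ring).
  destruct (sg_cases k) as [E|E]; rewrite E in W; lra.
Qed.

Lemma parity_gap (j k : nat) : (k < j)%nat -> sg j = sg k -> (cz k + 2 <= cz j)%nat.
Proof.
  intros H E. destruct (even_cases k) as [[l [E1 [E2 E3]]]|[l [E1 [E2 E3]]]];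
    destruct (even_cases j) as [[l' [E1' [E2' E3']]]|[l' [E1' [E2' E3']]]]; try lia; exfalso; lra.
Qed.

(** Zones of smaller index are empty and zones of larger index on the same half-line lie farther
    from 0, so [ybar k] is the negative zero closest to 0. The maximum of [w] is a minimum of theta
    because [sg k = -1]. *)
Lemma odd_part (k : nat) : (1 <= k)%nat -> Nat.Odd k ->
  ybar k < 0 /\ local_min (theta (qbar k)) (ybar k) /\ rightmost_negative_zero (theta (qbar k)) (ybar k).
Proof.
  intros Hk [m Em]. pose proof (vb_range k Hk) as Hv. pose proof (inv_v_gt1 _ Hv).
  assert (Hs : sg k = -1) by (destruct (even_cases k) as [[l [E1 _]]|[l [_ [_ E]]]]; [lia | auto]).
  destruct (Y_zone k Hk) as [Z W]. pose proof (inz_gt _ _ _ Hv Hk Z) as HY. pose proof Z as Z0.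
  unfold Y in HY. rewrite Hs in HY.
  split; [lra|]. split; [|split; [lra|split; [apply theta_ybar; auto|]]].
  - destruct (Y_local_max k Hk) as [h [Hh H0]]. exists (mkposreal h Hh). intros x Hx.
    change (Rabs (x - ybar k) < h) in Hx. specialize (H0 x Hx). rewrite theta_ybar by auto. rewrite Hs in H0. lra.
  - intros x Hx Hx0. destruct (spectral_zero k x Hk Hx0) as [H1|[-> |[j [X [Hj [Ex Zx]]]]]]; [lra | lra |].
    pose proof (inz_gt (vb k) j X Hv ltac:(lia) Zx) as HX.
    assert (Ej : sg j = -1) by (destruct (sg_cases j) as [E|E]; auto; rewrite E in Ex; lra).
    assert (Y k < X) by (apply (zone_order (vb k) j k); auto; [apply parity_gap; auto; congruence | lra]).
    unfold Y in H0. rewrite Hs in H0. rewrite Ej in Ex. lra.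
Qed.

(** As in the odd case, with [sg k = 1]; the only positive zero to the left of [ybar k] is the one
    of [first_zero], which precedes all zones. *)
Lemma even_part (k : nat) : (1 <= k)%nat -> Nat.Even k ->
  0 < ybar k /\ local_max (theta (qbar k)) (ybar k) /\ second_leftmost_positive_zero (theta (qbar k)) (ybar k).
Proof.
  intros Hk [m Em]. pose proof (vb_range k Hk) as Hv. pose proof (inv_v_gt1 _ Hv).
  assert (Hs : sg k = 1) by (destruct (even_cases k) as [[l [_ [_ E]]]|[l [E1 _]]]; [auto | lia]).
  destruct (Y_zone k Hk) as [Z W]. pose proof (inz_gt _ _ _ Hv Hk Z) as HY. pose proof Z as Z0.
  assert (EY : Y k = ybar k) by (unfold Y; rewrite Hs; ring). rewrite EY in *.
  split; [lra|]. split; [|split; [lra|split; [apply theta_ybar; auto|]]].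
  - destruct (Y_local_max k Hk) as [h [Hh H0]]. exists (mkposreal h Hh). intros x Hx.
    change (Rabs (x - ybar k) < h) in Hx. specialize (H0 x Hx). rewrite theta_ybar by auto. rewrite Hs in H0. lra.
  - assert (Eth : forall x, theta (qbar k) x = th (vb k) x).
    { intros x. replace (qbar k) with (- vb k) by (unfold vb; ring). apply theta_U. }
    destruct (first_zero (vb k) Hv) as [x1 [Hx1 [Hx1z [_ [Hpos Hneg]]]]].
    exists x1. split; [split; [lra | rewrite Eth; auto]|].
    intros x [Hx Hx0]. destruct (spectral_zero k x Hk Hx0) as [H1|[-> |[j [X [Hj [Ex Zx]]]]]]; [| lra |].
    + rewrite Eth in Hx0. destruct (Rtotal_order x x1) as [L|[E|L]]; auto; exfalso.
      * pose proof (Hpos x ltac:(lra)). lra.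
      * pose proof (Hneg x ltac:(lra)). lra.
    + exfalso. pose proof (inz_gt (vb k) j X Hv ltac:(lia) Zx) as HX.
      assert (Ej : sg j = 1) by (destruct (sg_cases j) as [E|E]; auto; rewrite E in Ex; lra).
      assert (ybar k < X) by (apply (zone_order (vb k) j k); auto; [apply parity_gap; auto; congruence | lra]).
      rewrite Ej in Ex. lra.
Qed.

(** It has to be excluded that the polynomial of degree [2 * k] has a real root. Such a root is a
    real zero of theta, hence simple and one of the enumerated zeros [X n]: it lies in [(1, 1/v)],
    or in a zone beyond [k], where the pattern leaves just two zeros. Then the canonical product
    vanishes there as well, and the zero would be multiple. *)
Lemma pairs_between (k : nat) (q0 : R) : (1 <= k)%nat -> qbar (S k) < q0 < qbar k ->
  has_conjugate_zero_pairs (Ctheta q0) k.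
Proof.
  intros Hk Hq. set (v := - q0). replace q0 with (- v) by (unfold v; ring).
  assert (Hv1 : vb k < v < vb (S k)) by (unfold vb, v; lra).
  pose proof (vb_range k Hk). pose proof (vb_range (S k) ltac:(lia)). assert (Hv : 0 < v < 1) by lra.
  destruct (zero_count v k Hv) as [X [h [q [Hh [HF [Hqt [HX [Hnz [[n1 [Hn1 Zn1]] HZ]]]]]]]]].
  { intros i Hi. apply (occ_below v (S k)); [lia | lra | lia]. }
  apply (pairs_of_factorization (Ctheta (- v)) k h q Hh Hqt).
  - intros y Hy.
    assert (Hth : th v y = 0).
    { apply RtoC_inj. rewrite <- CSum_theta, HF, Hy. ring. }
    assert (Simple : Ux one_w v y <> 0 /\ exists n, X n = y).
    { destruct (zero_location v y Hv Hth) as [Hy1|[j [x [Hj [Ey Zx]]]]].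
      - destruct (first_zero v Hv) as [x1 [Hx1 [Hx1z [Ux1 [Hpos Hneg]]]]].
        assert (U1 : forall t, 1 < t < / v -> th v t = 0 -> t = x1).
        { intros t Ht Ht0. destruct (Rtotal_order t x1) as [L|[E|L]]; auto; exfalso.
          - pose proof (Hpos t ltac:(lra)). lra.
          - pose proof (Hneg t ltac:(lra)). lra. }
        rewrite (U1 y Hy1 Hth). split; auto. exists n1. apply U1; auto.
      - assert (Wx : w v j x = 0) by (apply th_zero_w; rewrite <- Ey; auto).
        destruct (le_lt_dec j k) as [L|L].
        + exfalso. apply (zone_empty j v x Hj); auto. split; [|lra].
          destruct (Nat.eq_dec j k) as [->|]; [lra|]. pose proof (vb_mono j k Hj ltac:(lia)). lra.
        + assert (Hvj : 0 < v < vb j).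
          { split; [lra|]. destruct (Nat.eq_dec j (S k)) as [->|]; [lra|].
            pose proof (vb_mono (S k) j ltac:(lia) ltac:(lia)). lra. }
          destruct (spectral_pattern j Hj) as [F [G [v0 [HB [_ [_ [_ HP]]]]]]].
          specialize (HP v Hvj). destruct (HB v Hvj) as [_ [_ [ZF [ZG [FG [WF [WG [UF UG]]]]]]]].
          assert (Two : forall t, inz v j t -> w v j t = 0 -> t = F v \/ t = G v).
          { intros t Zt Wt. apply inz_LR in Zt; [|lra].
            destruct (Rtotal_order t (F v)) as [C1|[C1|C1]]; auto.
            - pose proof (pattern_left j v (F v) (G v) t HP ltac:(lra) C1). lra.
            - destruct (Rtotal_order t (G v)) as [C2|[C2|C2]]; auto.
              + pose proof (pattern_mid j v (F v) (G v) t HP ltac:(lra) (conj C1 C2)). lra.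
              + pose proof (pattern_right j v (F v) (G v) t HP ltac:(lra) C2). lra. }
          split.
          * rewrite Ey, <- w_x. destruct (Two x Zx Wx) as [-> | ->]; auto.
          * destruct (HZ j L) as [a [b [n [m [Za [Zb [Hab [Wa [Wb [Xn [Xm _]]]]]]]]]]].
            destruct (Two x Zx Wx) as [Ex|Ex]; destruct (Two a Za Wa) as [Ea|Ea]; destruct (Two b Zb Wb) as [Eb|Eb];
              try (exfalso; lra);
              solve [exists n; rewrite Xn, Ey; f_equal; congruence | exists m; rewrite Xm, Ey; f_equal; congruence]. }
    destruct Simple as [HU [n En]]. apply HU.
    apply (common_zero_multiple v y (2 * k) h q); auto. rewrite <- En. apply HX.
  - intros z Hz. apply Hnz. intros n E. apply Hz. rewrite E. reflexivity.
  - intros z. apply HF.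
Qed.

End Spectrum.

Theorem theorem7 (qbar ybar : nat -> R) (Hspec : spectral_data qbar ybar) :
  (forall k : nat, (1 <= k)%nat ->
     (Nat.Odd k ->
        ybar k < 0 /\
        local_min (theta (qbar k)) (ybar k) /\
        rightmost_negative_zero (theta (qbar k)) (ybar k)) /\
     (Nat.Even k ->
        0 < ybar k /\
        local_max (theta (qbar k)) (ybar k) /\
        second_leftmost_positive_zero (theta (qbar k)) (ybar k))) /\
  (forall k : nat, (1 <= k)%nat ->
     -1 < qbar (S k) /\ qbar (S k) < qbar k /\ qbar k < 0) /\
  (forall (k : nat) (q : R), (1 <= k)%nat -> qbar (S k) < q < qbar k ->
     has_conjugate_zero_pairs (Ctheta q) k).
Proof.
  split; [|split].
  - intros k Hk. split; intros Hp; [apply odd_part | apply even_part]; auto.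
  - intros k Hk. pose proof (vb_lt_S qbar ybar Hspec k Hk).
    pose proof (vb_range qbar ybar Hspec k Hk). pose proof (vb_range qbar ybar Hspec (S k) ltac:(lia)). lra.
  - intros k q Hk Hq. apply (pairs_between qbar ybar Hspec k q); auto.
Qed.
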